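(* Let $n\ge1$ be an integer, let $2<p<\infty$, and let $B,D\in O(n)$. Let $$K_p(B,D)=\left\{(x,y)\in\mathbb{R}^{n}\times\mathbb{R}^n:\ \|Bx\|_p^p+\|Dy\|_p^p\le 1\right\}\subset\mathbb{R}^{2n}.$$ Then $$c_0(p)\le c_{EHZ}(K_p(B,D))=c_Z(K_p(B,D))\le c_0(p)\,n^{1/2-1/p},$$ and equality holds in the upper bound if and only if $BD^T$ is a normalized Hadamard matrix.
   Context: Coordinates on $\mathbb{R}^{2n}$ are ordered $(x_1,\ldots,x_n,y_1,\ldots,y_n)$, with the standard symplectic form $\omega=\sum_j dx_j\wedge dy_j$. $\|\cdot\|_p$ is the $\ell_p$ norm on $\mathbb{R}^n$. $c_0(p)$ denotes the area of $B_p^2=\{(s,t)\in\mathbb{R}^2:|s|^p+|t|^p\le1\}$, which equals $4\Gamma(1+1/p)^2/\Gamma(1+2/p)$. A normalized Hadamard matrix of order $n$ is a matrix $H\in O(n)$ with $|H_{ij}|=n^{-1/2}$ for all $i,j$ (equivalently $H=n^{-1/2}A$ with $A\in\{-1,1\}^{n\times n}$ and $AA^T=nI_n$). The cylindrical capacity $c_Z(K)$ is the infimum of $\pi R^2$ over all $R>0$ such that some open neighborhood of $K$ embeds symplectically into $Z_R=\{(x,y)\in\mathbb{R}^{2n}:x_1^2+y_1^2<R^2\}$. The Ekeland--Hofer--Zehnder capacity $c_{EHZ}(K)$ of a convex body $K$ with sufficiently smooth boundary is the minimum of $\left|\tfrac12\int\omega(\gamma,\dot\gamma)\,dt\right|$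 over all closed characteristics $\gamma$ on $\partial K$, i.e. closed curves in $\partial K$ whose velocity spans, at each point, the kernel line of $\omega$ restricted to the tangent space of $\partial K$. *)

(* Defs.v *)
(* MathComp / MathComp-Analysis *)
From mathcomp Require Export all_boot all_order all_algebra.
From mathcomp Require Export all_classical all_reals all_analysis.
Set Implicit Arguments.
Unset Strict Implicit.
Unset Printing Implicit Defensive.
Export Order.TTheory GRing.Theory Num.Theory.
Export numFieldNormedType.Exports.
Local Open Scope classical_set_scope.
Local Open Scope ring_scope.

(* R^2n with coordinates (x, y), as a normed space. *)
Definition phase_space (R : realType) (n : nat) : normedModType R :=
  ('cV[R]_n * 'cV[R]_n)%type.

(* The standard symplectic form sum_j dx_j /\ dy_j. *)
Definition omega (R : realType) (n : nat) (u v : phase_space R n) : R :=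
  \sum_(j < n) (u.1 j 0 * v.2 j 0 - u.2 j 0 * v.1 j 0).

Definition orthogonal_mx (R : realType) (n : nat) (A : 'M[R]_n) : Prop :=
  A *m A^T = 1%:M.

Definition normalized_hadamard (R : realType) (n : nat) (H : 'M[R]_n) : Prop :=
  orthogonal_mx H /\ forall i j, `|H i j| = n%:R `^ (- 2^-1).

Definition lp_norm (R : realType) (n : nat) (p : R) (x : 'cV[R]_n) : R :=
  (\sum_(i < n) `|x i 0| `^ p) `^ p^-1.

Definition Kp (R : realType) (n : nat) (p : R) (B D : 'M[R]_n) :
    set (phase_space R n) :=
  [set z : phase_space R n |
    lp_norm p (B *m z.1) `^ p + lp_norm p (D *m z.2) `^ p <= 1].

Definition lp_ball2 (R : realType) (p : R) : set (R * R) :=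
  [set u | `|u.1| `^ p + `|u.2| `^ p <= 1].

Definition c0 (R : realType) (p : R) : \bar R :=
  (@lebesgue_measure R \x @lebesgue_measure R)%E (lp_ball2 p).

Definition iter_derive (R : realType) (V W : normedModType R) (vs : seq V)
    (f : V -> W) : V -> W :=
  foldr (fun v g => fun x => 'D_v g x) f vs.

(* C^oo on an open set: all iterated directional derivatives are (Frechet)
   differentiable there, in particular exist and are continuous. *)
Definition smooth_on (R : realType) (V W : normedModType R) (U : set V)
    (f : V -> W) : Prop :=
  forall (vs : seq V) (x : V), U x -> differentiable (iter_derive vs f) x.

(* The third clause says that phi is a homeomorphism from U onto its image
   with the subspace topology; that phi is an immersion follows from the
   fourth. *)
Definition symplectic_embedding (R : realType) (n : nat)
    (U : set (phase_space R n)) (phi : phase_space R n -> phase_space R n) :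
    Prop :=
  [/\ smooth_on U phi,
      set_inj U phi,
      forall V, open V -> V `<=` U ->
        exists2 W, open W & phi @` V = phi @` U `&` W
    & forall z, U z -> forall u v,
        omega ('d phi z u) ('d phi z v) = omega u v].

Definition cylinder (R : realType) (n : nat) (n_gt0 : (0 < n)%N) (r : R) :
    set (phase_space R n) :=
  [set z : phase_space R n | z.1 (Ordinal n_gt0) 0 ^+ 2 + z.2 (Ordinal n_gt0) 0 ^+ 2 < r ^+ 2].

Definition embeds_in_cylinder (R : realType) (n : nat) (n_gt0 : (0 < n)%N)
    (K : set (phase_space R n)) (r : R) : Prop :=
  exists U phi, [/\ open U, K `<=` U, symplectic_embedding U phi
                  & phi @` U `<=` cylinder n_gt0 r].

Definition cZ (R : realType) (n : nat) (n_gt0 : (0 < n)%N)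
    (K : set (phase_space R n)) : \bar R :=
  ereal_inf [set (pi * r ^+ 2)%:E | r in
    [set r : R | 0 < r /\ embeds_in_cylinder n_gt0 K r]].

Definition bdry (T : topologicalType) (K : set T) : set T :=
  closure K `\` interior K.

(* Tangent vectors as velocities of curves in S; this is the usual tangent
   space when S is a C^1 hypersurface. *)
Definition tangent_space (R : realType) (V : normedModType R) (S : set V)
    (z : V) : set V :=
  [set v | exists c : R -> V,
    [/\ c 0 = z, \forall t \near (0 : R), S (c t)
      & is_derive (0 : R) (1 : R) c v]].

Definition omega_kernel (R : realType) (n : nat) (S : set (phase_space R n))
    (z : phase_space R n) : set (phase_space R n) :=
  [set u | tangent_space S z u /\
           forall v, tangent_space S z v -> omega u v = 0].

(* A closed curve is a C^1 map on the line with period T > 0. *)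
Definition closed_characteristic (R : realType) (n : nat)
    (K : set (phase_space R n)) (T : R) (g : R -> phase_space R n) : Prop :=
  [/\ 0 < T /\ (forall t, g (t + T) = g t),
      (forall t, derivable g t 1) /\ continuous (derive1 g),
      forall t, bdry K (g t)
    & forall t, derive1 g t != 0 /\
        omega_kernel (bdry K) (g t) = [set a *: derive1 g t | a in [set: R]]].

Definition action (R : realType) (n : nat) (T : R)
    (g : R -> phase_space R n) : R :=
  `| 2^-1 * \int[@lebesgue_measure R]_(t in `[0, T])
              (omega (g t) (derive1 g t)) |.

Definition actions (R : realType) (n : nat) (K : set (phase_space R n)) :
    set R :=
  [set a | exists T g, closed_characteristic K T g /\ a = action T g].

(* The capacity is a minimum, so the value is required to be attained. *)
Definition is_cEHZ (R : realType) (n : nat) (K : set (phase_space R n))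
    (c : R) : Prop :=
  actions K c /\ lbound (actions K) c.

(* Main.v *)
Require Import Defs.
From mathcomp Require Import ring lra zify.
Set Implicit Arguments.
Unset Strict Implicit.
Unset Printing Implicit Defensive.
Local Open Scope classical_set_scope.
Local Open Scope ring_scope.

(* Let [M] be the norm of [O = B D^T] from l_q to l_p, where 1/p + 1/q = 1, let [a]
   and [b] be extremal, <b, O a> = M, and put [c = c0 p / M], where [c0 p] is four
   times [I], the integral of (1 - s^p)^(1/p) over [0, 1]. Both capacities equal [c].

   Closed characteristics. Parametrized by [w' = X_G (w)], with [G] the defining
   function of [K], a closed characteristic of period [tau] has action [p tau / 2].
   With xi = D x and [mid] the midpoint of its values at the ends of a half-period, the
   integral of <O (xi - mid), |O xi|^(p-2) O xi> is at least [tau / 4] over one of the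
   two half-periods. Hoelder's inequality, the definition of [M] and the sharp
   inequality 4 (2I)^p int |u|^p <= s^2 (int |u'|^q)^(p-1) on [0, s] for functions with
   [u s = - u 0] then bound [tau] below. Equality holds for a curve in the plane
   spanned by D^T a and B^T b.

   Upper bound for c_Z. The functionals s = <B^T b, x> / M and t = <D^T a, y> are
   conjugate and |M s|^p + |t|^p <= 1 on [K]. They are completed to a linear
   symplectic map, and the plane region |t| <= h s, of area [c], is sent into a disc
   by (s, t) |-> (int_0^s H, t / H s), with [H] a smooth function slightly larger than
   [h], followed by action-angle coordinates.

   Lower bound for c_Z (non-squeezing). If a neighbourhood of [K] embeds into a
   cylinder of smaller area, a function of [G] is transplanted to the image and
   extended by a quadratic form whose flow has one frequency above the resonance 2 pi.
   A 1-periodic orbit of positive action exists: for the loops discretized in time it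
   is a critical point obtained by linking (Poincare-Miranda), and the discrete orbits
   converge along an ultrafilter. The orbit lies in the image of [K] and pulls back to
   a closed characteristic of action less than [c].

   Finally n^(1/p - 1/2) <= M <= 1: the upper bound compares l_p norms with the l_2
   norm, and the lower one is the power mean inequality on a column of [O], whose
   equality case says that all entries have the same modulus. Conversely [M] is
   minimal for Hadamard matrices by the Hausdorff-Young inequality, proved by
   induction on the number of doublings of p - 2. *)

(** * The Poincare-Miranda theorem *)

(** The constant is sharp because an antiperiodic function satisfies a one-dimensional Dirichlet
    inequality whose extremals are those of the planar curve; a' b' <= s^2 / 4 then absorbs the
    unknown division of a half-period between the two summands of G. The obstacle in non-squeezing
    is that the action of loops is indefinite, with infinitely many directions of both signs. With
    2M + 1 time steps and positions and momenta on staggered grids it becomes a finite diagonal form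
    with eigenvalues close to 2 pi k, and every bound on critical points is uniform in M. The
    frequency between pi and 2 pi makes a mode with k = 1 the extra linking direction. Gradients are
    only continuous, so the gradient flow is replaced by iterated Euler steps. The transplanted
    Hamiltonian is a function of l^(2/p), the factor by which the level l scales actions: its slope
    is the action of a 1-periodic orbit rescaled to the boundary of K, so a slope below c excludes
    such orbits. *)

Lemma mx_norm_le (R : realType) m n (A : 'M[R]_(m, n)) (e : R) :
  0 <= e -> (forall i j, `|A i j| <= e) -> `|A| <= e.
Proof.
move=> e0 Ae; rewrite [leLHS]/Num.norm/= mx_normrE; apply/bigmax_leP.
by split => //= -[i j] _; exact: Ae.
Qed.

Lemma coord_le_mx_norm (R : realType) m n (A : 'M[R]_(m, n)) i j :
  `|A i j| <= `|A|.
Proof.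
rewrite [leRHS]/Num.norm/= mx_normrE.
exact: (@le_bigmax _ _ _ 0 (fun ij : 'I_m * 'I_n => `|A ij.1 ij.2|) (i, j)).
Qed.

(** * Cubical cochains modulo 2 and the degree of a labelling *)

Section CubicalStokes.
Variables (K : comNzRingType) (addFF : forall a : K, a + a = 0) (d : nat).
Implicit Types (x y : 'I_d -> nat) (B : {set 'I_d}) (j l : 'I_d).

Definition grid_step x j : 'I_d -> nat := fun i => (x i + (i == j))%N.
Definition grid_upd x j (k : nat) : 'I_d -> nat :=
  fun i => if i == j then k else x i.

Lemma grid_stepC x j l :
  grid_step (grid_step x j) l = grid_step (grid_step x l) j.
Proof. by apply/funext => i; rewrite /grid_step addnAC. Qed.

(* The cubical cup product of the coboundaries of the functions [us], modulo
   2, evaluated on the cube with lowest vertex [x] and set of directions [B]. *)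
Fixpoint cup (us : seq (('I_d -> nat) -> K)) x B : K :=
  if us is u :: us' then
    \sum_(j in B) (u (grid_step x j) - u x) * cup us' (grid_step x j) (B :\ j)
  else 1.

Lemma oppF (a : K) : - a = a.
Proof. by apply/eqP; rewrite eq_sym -subr_eq0 opprK addFF. Qed.

Lemma sum_offdiagC B (f : 'I_d -> 'I_d -> K) :
  \sum_(j in B) \sum_(l in B :\ j) f j l =
  \sum_(j in B) \sum_(l in B :\ j) f l j.
Proof.
rewrite (exchange_big_dep (mem B)) /=; last first.
  by move=> i j _; rewrite !inE => /andP[].
apply: eq_bigr => j jB; apply: eq_bigl => l.
by rewrite !inE jB andbT andbC eq_sym.
Qed.

(** Each unordered pair of directions is counted twice, which gives zero modulo 2. *)
Lemma sum_offdiag_sym B (f : 'I_d -> 'I_d -> K) :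
  (forall j l, f j l = f l j) ->
  \sum_(j in B) \sum_(l in B :\ j) f j l = 0.
Proof.
move=> fC.
have split_lt : \sum_(j in B) \sum_(l in B :\ j) f j l =
    \sum_(j in B) \sum_(l in B :\ j | (j < l)%N) f j l +
    \sum_(j in B) \sum_(l in B :\ j | (l < j)%N) f j l.
  rewrite -big_split; apply: eq_bigr => j jB /=.
  rewrite (bigID (fun l : 'I_d => (j < l)%N)) /=; congr (_ + _).
  apply: eq_bigl => l; rewrite !inE -leqNgt leq_eqVlt.
  by rewrite (inj_eq val_inj); case: (l == j); rewrite ?andbF.
rewrite split_lt.
rewrite [X in _ + X](_ : _ =
    \sum_(j in B) \sum_(l in B :\ j | (j < l)%N) f j l) ?addFF//.
rewrite (exchange_big_dep (mem B)) /=; last first.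
  by move=> i j _; rewrite !inE => /andP[/andP[]].
apply: eq_bigr => j jB.
apply: eq_big => [l|l _]; last exact: fC.
by rewrite !inE jB !andbT eq_sym; case: (l == j); rewrite ?andbF.
Qed.

(** Modulo 2 this says that a product of coboundaries is a cocycle: its values on the faces of a
    cube sum to zero. The terms with both directions stepped are symmetric and cancel, and so do
    those with the value of [u] at [x], by the induction hypothesis. *)
Lemma cup_closed us x B :
  \sum_(j in B) cup us (grid_step x j) (B :\ j) =
  \sum_(j in B) cup us x (B :\ j).
Proof.
elim: us x B => [|u us IH] x B //=.
pose W j l a := cup us a (B :\ j :\ l).
have WC j l a : W j l a = W l j a by rewrite /W !finset.setDDl finset.setUC.
transitivity (\sum_(j in B) \sum_(l in B :\ j)
    (u (grid_step (grid_step x j) l) * W j l (grid_step (grid_step x j) l)) -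
  \sum_(j in B) \sum_(l in B :\ j)
    (u (grid_step x j) * W j l (grid_step (grid_step x j) l))).
  rewrite -sumrB; apply: eq_bigr => j _; rewrite -sumrB.
  by apply: eq_bigr => l _; rewrite mulrBl.
rewrite sum_offdiag_sym; last by move=> j l; rewrite grid_stepC WC.
transitivity (\sum_(j in B) \sum_(l in B :\ j)
    (u (grid_step x l) * W j l (grid_step x l)) -
  \sum_(j in B) \sum_(l in B :\ j) (u x * W j l (grid_step x l))); last first.
  rewrite -sumrB; apply: eq_bigr => j _; rewrite -sumrB.
  by apply: eq_bigr => l _; rewrite mulrBl.
rewrite [X in _ = _ - X](_ : _ = 0); last first.
  under eq_bigr => j _ do rewrite -mulr_sumr IH mulr_sumr.
  by rewrite sum_offdiag_sym// => j l; rewrite -/(W j l x) WC.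
rewrite sub0r subr0 oppF [RHS]sum_offdiagC.
apply: eq_bigr => j jB.
by rewrite -!mulr_sumr IH; congr (_ * _); apply: eq_bigr => l _; exact: WC.
Qed.

(** As the product of [us] is closed, [w] can be moved under the coboundary; the summands on the
    right are differences across the cube, which telescope over a box. *)
Lemma cup_coboundary w us x B :
  cup (w :: us) x B = \sum_(j in B) (w (grid_step x j) *
    cup us (grid_step x j) (B :\ j) - w x * cup us x (B :\ j)).
Proof.
rewrite sumrB -[in RHS]mulr_sumr -cup_closed mulr_sumr -sumrB /=.
by apply: eq_bigr => j _; rewrite mulrBl.
Qed.

(** The cube spanned by [B] stays in the hyperplane [y j = x j], where the coboundary of [u]
    vanishes. *)
Lemma cup0 us u x B j (v : K) : u \in us -> j \notin B ->
  (forall y, y j = x j -> u y = v) -> cup us x B = 0.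
Proof.
elim: us x B => [//|w us IH] x B; rewrite inE => + jB uv /=.
have stepj l : l \in B -> grid_step x l j = x j.
  move=> lB; rewrite /grid_step; case: eqP => [jl|_]; last by rewrite addn0.
  by rewrite jl lB in jB.
move=> /predU1P[uw|uus]; apply: big1 => l lB.
  by rewrite -uw !uv ?subrr ?mul0r// stepj.
rewrite IH ?mulr0//; first by rewrite !inE negb_and jB orbT.
by move=> y yj; apply: uv; rewrite yj stepj.
Qed.

Variable N : nat.

Fixpoint box_sum (js : seq 'I_d) (f : ('I_d -> nat) -> K) x : K :=
  if js is j :: js' then \sum_(k < N) box_sum js' f (grid_upd x j k) else f x.

Lemma eq_box_sum js f g x :
  (forall y, (forall i, i \notin js -> y i = x i) -> f y = g y) ->
  box_sum js f x = box_sum js g x.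
Proof.
elim: js x => [|j js IH] x fg /=; first exact: fg.
apply: eq_bigr => k _; apply: IH => y yx; apply: fg => i.
by rewrite inE negb_or => /andP[ij ijs]; rewrite yx// /grid_upd (negPf ij).
Qed.

Lemma box_sumD js f g x :
  box_sum js (fun y => f y + g y) x = box_sum js f x + box_sum js g x.
Proof.
elim: js x => [|j js IH] x //=.
by rewrite -big_split; apply: eq_bigr => k _; exact: IH.
Qed.

Lemma box_sum_sum B js f x :
  box_sum js (fun y => \sum_(j in B) f j y) x =
  \sum_(j in B) box_sum js (f j) x.
Proof.
elim: js x => [|j js IH] x //=.
by rewrite exchange_big; apply: eq_bigr => k _; exact: IH.
Qed.

Lemma box_sum_step js f x j : j \notin js ->
  box_sum js (fun y => f (grid_step y j)) x = box_sum js f (grid_step x j).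
Proof.
elim: js x => [|l js IH] x //=; rewrite inE negb_or => /andP[jl jjs].
apply: eq_bigr => k _; rewrite IH//; congr box_sum.
apply/funext => i; rewrite /grid_step /grid_upd; case: eqP => // ->.
by rewrite eq_sym (negPf jl) addn0.
Qed.

Lemma box_sum_eq0 js f x j : j \notin js ->
  (forall y, y j = x j -> f y = 0) -> box_sum js f x = 0.
Proof.
move=> jjs f0; rewrite (@eq_box_sum _ _ (fun=> 0)); last first.
  by move=> y yx; apply/f0/yx.
by elim: js {jjs f0} x => //= l js IH x; rewrite big1.
Qed.

Lemma box_sum_telescope js f x j : uniq js -> j \in js ->
  (forall y, y j = 0%N -> f y = 0) -> (forall y, y j = N -> f y = 0) ->
  box_sum js (fun y => f (grid_step y j) - f y) x = 0.
Proof.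
elim: js x => [//|l js IH] x /= /andP[ljs ujs]; rewrite inE.
have [->|jl] := eqVneq j l; last first.
  by move=> /= jjs f0 fN; rewrite big1// => k _; exact: IH.
move=> _ f0 fN.
have E k : box_sum js (fun y => f (grid_step y l) - f y) (grid_upd x l k) =
    box_sum js f (grid_upd x l k.+1) - box_sum js f (grid_upd x l k).
  rewrite box_sumD box_sum_step//; congr (box_sum _ _ _ + _).
    apply/funext => i; rewrite /grid_step /grid_upd.
    by case: eqP => // _; rewrite ?addn1 ?addn0.
  rewrite oppF; apply: eq_box_sum => y _; exact: oppF.
under eq_bigr => k _ do rewrite E.
rewrite -(big_mkord xpredT (fun k => box_sum js f (grid_upd x l k.+1) -
  box_sum js f (grid_upd x l k))) telescope_sumr//.
rewrite (@box_sum_eq0 _ _ (grid_upd x l N) l)//; last first.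
  by move=> y yl; apply: fN; rewrite yl /grid_upd eqxx.
rewrite (@box_sum_eq0 _ _ (grid_upd x l 0) l) ?subrr// => y yl.
by apply: f0; rewrite yl /grid_upd eqxx.
Qed.

(** This is the degree modulo 2, computed one dimension at a time. Replacing [u j] by the indicator
    [e] of [0 < y j] changes the integrand by a coboundary that vanishes on the boundary of the box;
    with [e] only the layer [y j = 0] contributes. *)
Lemma box_sum_cup js (u : 'I_d -> ('I_d -> nat) -> K) x :
  (0 < N)%N -> uniq js ->
  (forall j y, y j = 0%N -> u j y = 0) ->
  (forall j y, y j = N -> u j y = 1) ->
  box_sum js (fun y => cup [seq u j | j <- js] y [set j in js]) x = 1.
Proof.
move=> N0 + u0 uN; elim: js x => [//|j js IH] x /= /andP[jjs ujs].
rewrite -/(map u js); set us := map u js.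
set B := [set l in j :: js].
pose e y : K := if (0 < y j)%N then 1 else 0.
pose w y := u j y - e y.
have cupE y : cup (u j :: us) y B = cup (w :: us) y B + cup (e :: us) y B.
  rewrite -big_split; apply: eq_bigr => l _ /=; rewrite -mulrDl; congr (_ * _).
  rewrite /w; ring.
rewrite -[LHS]/(box_sum (j :: js) (fun y => cup (u j :: us) y B) x).
under eq_box_sum => y _ do rewrite cupE.
rewrite box_sumD [X in X + _](_ : _ = 0) ?add0r; last first.
  under eq_box_sum => y _ do rewrite cup_coboundary.
  rewrite (@box_sum_sum B _ (fun l y => w (grid_step y l) *
    cup us (grid_step y l) (B :\ l) - w y * cup us y (B :\ l))).
  apply: big1 => l; rewrite inE => ljs.
  rewrite (@box_sum_telescope _ (fun y => w y * cup us y (B :\ l)))//=.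
  - by rewrite jjs.
  (* On a face in direction [j] the function [w] vanishes; on a face in a direction [l] of [js] the
     product vanishes, as [u l] is constant there. *)
  - move=> y yl; move: ljs; rewrite inE => /predU1P[lj|ljs].
      by rewrite /w /e -lj yl u0 -?lj// ltnn subrr mul0r.
    rewrite (@cup0 us (u l) y _ l 0) ?mulr0 ?inE ?eqxx//.
      by apply: map_f.
    by move=> z; rewrite yl; exact: u0.
  - move=> y yl; move: ljs; rewrite inE => /predU1P[lj|ljs].
      by rewrite /w /e -lj yl uN -?lj// N0 subrr mul0r.
    rewrite (@cup0 us (u l) y _ l 1) ?mulr0 ?inE ?eqxx//.
      by apply: map_f.
    by move=> z; rewrite yl; exact: uN.
have cupe y : cup (e :: us) y B = (if y j == 0%N then
    cup us (grid_step y j) [set l in js] else 0).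
  rewrite /= (bigD1 j) ?inE ?eqxx//= big1 ?addr0; last first.
    move=> l /andP[_ lj]; rewrite /e /grid_step eq_sym (negPf lj) addn0.
    by rewrite subrr mul0r.
  have -> : B :\ j = [set l in js].
    apply/setP => l; rewrite !inE; case: eqP => // ->.
    by rewrite (negPf jjs).
  rewrite /e /grid_step eqxx addn1 /=; case: (y j) => [|k] /=.
    by rewrite subr0 mul1r.
  by rewrite subrr mul0r.
rewrite /=; case: N N0 IH {u0 uN} => // N' _ IH.
rewrite big_ord_recl big1 ?addr0 /=; last first.
  move=> k _; apply: (@box_sum_eq0 _ _ _ j) => // y yj.
  by rewrite -/(cup (e :: us) y B) cupe yj /grid_upd eqxx.
rewrite (@eq_box_sum _ _ (fun y => cup us (grid_step y j) [set l in js])).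
  rewrite (@box_sum_step js (fun y => cup us y [set l in js]))//; exact: IH.
move=> y yj; rewrite -/(cup (e :: us) y B) cupe yj// /grid_upd eqxx.
by rewrite eqxx.
Qed.

Lemma box_sum_neq0 js f x : uniq js -> box_sum js f x != 0 ->
  exists y, [/\ f y != 0, forall i, i \in js -> (y i < N)%N
    & forall i, i \notin js -> y i = x i].
Proof.
elim: js x => [x _ fx|j js IH x /= /andP[jjs ujs]]; first by exists x.
move=> sum_neq0.
have [k /IH[//|y [fy yN yx]]] : exists k : 'I_N,
    box_sum js f (grid_upd x j k) != 0.
  apply/existsP; apply: contraNT sum_neq0; rewrite negb_exists => /forallP f0.
  by rewrite big1// => k _; apply/eqP; move: (f0 k); rewrite negbK.
exists y; split=> // i; rewrite inE.
  move=> /predU1P[->|]; last exact: yN.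
  by rewrite yx// /grid_upd eqxx.
by rewrite negb_or => /andP[ij ijs]; rewrite yx// /grid_upd (negPf ij).
Qed.

Lemma cup_neq0 us u x B : u \in us -> cup us x B != 0 ->
  exists a b, [/\ forall i, (x i <= a i <= (x i).+1)%N,
    forall i, (x i <= b i <= (x i).+1)%N & u a != u b].
Proof.
move=> + cupx.
(* For the induction the two vertices must belong to the cube spanned by [B]. *)
suff main : u \in us -> exists a b,
    [/\ forall i, (x i <= a i <= x i + (i \in B))%N,
    forall i, (x i <= b i <= x i + (i \in B))%N & u a != u b].
  move=> /main[a [b [xa xb uab]]]; exists a, b; split=> // i.
    have /andP[-> /leq_trans->//] := xa i.
    by rewrite -addn1 leq_add2l leq_b1.
  have /andP[-> /leq_trans->//] := xb i.
  by rewrite -addn1 leq_add2l leq_b1.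
elim: us x B cupx => [//|w us IH] x B /= sum_neq0 uus.
have [j jB] : exists2 j, j \in B &
    (w (grid_step x j) - w x) * cup us (grid_step x j) (B :\ j) != 0.
  apply/exists_inP; apply: contraNT sum_neq0.
  rewrite negb_exists_in => /forall_inP f0.
  by rewrite big1// => j jB; apply/eqP; move: (f0 j jB); rewrite negbK.
move=> wcup.
have w_neq : w x != w (grid_step x j).
  by apply: contraNneq wcup => ->; rewrite subrr mul0r.
have cupj : cup us (grid_step x j) (B :\ j) != 0.
  by apply: contraNneq wcup => ->; rewrite mulr0.
move: uus; rewrite inE => /predU1P[->|uus].
  exists x, (grid_step x j); split=> // i.
    by rewrite leqnn leq_addr.
  rewrite /grid_step leq_addr leq_add2l.
  by case: (eqVneq i j) => // ->; rewrite jB.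
have [a [b [xa xb uab]]] := IH _ _ cupj uus.
have step_le (z : 'I_d -> nat) :
    (forall i, (grid_step x j i <= z i <= grid_step x j i + (i \in B :\ j))%N) ->
    forall i, (x i <= z i <= x i + (i \in B))%N.
  move=> xz i; have := xz i; rewrite /grid_step !inE.
  case: (eqVneq i j) => [->|_] /=; first by rewrite jB; lia.
  by rewrite addn0.
by exists a, b; split=> //; exact: step_le.
Qed.

End CubicalStokes.

(** The products over all cubes sum to 1, so one of them is nonzero, and on that cube every label
    takes both values. *)
Lemma Kuhn_lemma (d N : nat) (u : 'I_d -> ('I_d -> nat) -> bool) :
  (0 < N)%N ->
  (forall j x, x j = 0%N -> u j x = false) ->
  (forall j x, x j = N -> u j x = true) ->
  exists2 x : 'I_d -> nat, (forall i, (x i < N)%N) &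
    forall j, exists a b, [/\ forall i, (x i <= a i <= (x i).+1)%N,
      forall i, (x i <= b i <= (x i).+1)%N, u j a = false & u j b = true].
Proof.
move=> N0 u0 uN.
have addFF (a : 'F_2) : a + a = 0 by apply/val_inj; case: a => [[|[|]]].
pose v j x : 'F_2 := if u j x then 1 else 0.
have := @box_sum_cup _ addFF d N (enum 'I_d) v (fun=> 0%N) N0 (enum_uniq _).
set us := map v _ => /(_ _ _)/eqP sum1.
have : box_sum N (enum 'I_d) (fun y => cup us y [set j in enum 'I_d])
    (fun=> 0%N) != 0.
  rewrite (eqP (sum1 _ _)) ?oner_neq0// => j y yj; rewrite /v.
    by rewrite u0.
  by rewrite uN.
move=> /(box_sum_neq0 (enum_uniq _))[x [cupx xN _]].
exists x => [i|j]; first by apply: xN; rewrite mem_enum.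
have vus : v j \in us by apply: map_f; rewrite mem_enum.
have [a [b [xa xb]]] := cup_neq0 vus cupx.
rewrite /v; case ua : (u j a); case ub : (u j b); rewrite ?eqxx// => _.
  by exists b, a.
by exists a, b.
Qed.

Lemma Poincare_Miranda (R : realType) (d : nat) (f : 'I_d -> 'rV[R]_d -> R) :
  (forall j, continuous (f j)) ->
  (forall j (x : 'rV[R]_d), (forall i, 0 <= x 0 i <= 1) -> x 0 j = 0 -> f j x <= 0) ->
  (forall j (x : 'rV[R]_d), (forall i, 0 <= x 0 i <= 1) -> x 0 j = 1 -> 0 <= f j x) ->
  exists2 x : 'rV[R]_d, (forall i, 0 <= x 0 i <= 1) & forall j, f j x = 0.
Proof.
move=> fc f0 f1.
pose cube := [set x : 'rV[R]_d | forall i, 0 <= x 0 i <= 1].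
have cube_compact : compact cube.
  have := @rV_compact R d (fun=> `[0, 1]%classic)
    (fun _ => @segment_compact _ _ _).
  by congr compact; apply/seteqP; split => x /= + i => /(_ i); rewrite /= in_itv.
(* [minn] keeps the points in the unit cube for arbitrary vertices. *)
pose pt N (a : 'I_d -> nat) : 'rV[R]_d := \row_i ((minn (a i) N.+1)%:R / N.+1%:R).
have pt_cube N a i : 0 <= pt N a 0 i <= 1.
  rewrite mxE divr_ge0//= ler_pdivrMr ?ltr0n// mul1r ler_nat; exact: geq_minr.
(* The labels are forced on the two faces in direction [j], where [f j] may vanish and its sign
   would not decide. *)
pose lab N j (a : 'I_d -> nat) :=
  (0 < a j)%N && ((N.+1 <= a j)%N || (0 <= f j (pt N a))).
have approx N : exists x : 'rV[R]_d, cube x /\ forall j, exists a b : 'rV[R]_d,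
    [/\ `|x - a| <= N.+1%:R^-1, `|x - b| <= N.+1%:R^-1, f j a <= 0 & 0 <= f j b].
  have [//|||x xN xab] := @Kuhn_lemma d N.+1 (lab N).
  - by move=> j x xj; rewrite /lab xj.
  - by move=> j x xj; rewrite /lab xj leqnn.
  exists (pt N x); split; first exact: pt_cube.
  have dist a : (forall i, (x i <= a i <= (x i).+1)%N) ->
      `|pt N x - pt N a| <= N.+1%:R^-1.
    move=> xa; apply: mx_norm_le => [|i k]; first by rewrite invr_ge0.
    rewrite !mxE -mulrBl normrM [X in _ * X]ger0_norm//.
    rewrite ler_piMl// distrC -natrB; last first.
      by have := xa k; have := xN k; lia.
    rewrite ger0_norm// lern1; have := xa k; have := xN k; lia.
  move=> j; have [a [b [xa xb la lb]]] := xab j.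
  exists (pt N a), (pt N b); split; [exact: dist|exact: dist| |].
    move: la => /negbT; rewrite negb_and -leqNgt leqn0 => /orP[/eqP a0|].
      by apply: f0 => //; rewrite mxE a0 min0n mul0r.
    by rewrite negb_or -ltNge => /andP[_ /ltW].
  move: lb => /andP[_ /orP[aN|//]].
  by apply: f1 => //; rewrite mxE (minn_idPr aN) divff.
have [u uP] := choice approx.
have [|x [xcube clx]] := cube_compact (u @ \oo).
  by exists 0%N => // N _; have [] := uP N.
exists x => // j; apply/eqP/negPn/negP => fx0.
have [e e0 fe] : exists2 e, 0 < e & forall y, `|x - y| < e ->
    `|f j x - f j y| < `|f j x|.
  have /(@cvgrPdist_lt _ _ _ (nbhs x)) /(_ `|f j x|) := fc j x.
  rewrite normr_gt0 => /(_ fx0) /nbhs_ballP[e /= e0 H].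
  by exists e => // y xy; apply: H; rewrite -ball_normE.
have [M _ Me] : \forall M \near \oo, M.+1%:R^-1 < e / 2.
  have e20 : 0 < e / 2 by rewrite divr_gt0.
  exact: (near_infty_natSinv_lt (PosNum e20)).
have [_ [[N MN <-] xuN]] : [set u N | N in [set N | (M <= N)%N]] `&`
    ball x (e / 2) !=set0.
  apply: clx; last by apply: nbhsx_ballx; rewrite divr_gt0.
  by exists M => // N; exists N.
have [_ /(_ j)[a [b [ua ub fa fb]]]] := uP N.
have near_x y : `|u N - y| <= N.+1%:R^-1 -> `|f j x - f j y| < `|f j x|.
  move=> uy; apply: fe; rewrite -(subrK (u N) x) -addrA.
  rewrite (le_lt_trans (ler_normD _ _))// [ltRHS]splitr ltrD//.
    by move: xuN; rewrite -ball_normE.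
  by rewrite (le_lt_trans uy)//; exact: Me.
(* Both [f j a] and [f j b] must have the strict sign of [f j x], which contradicts one of the two
   weak inequalities. *)
have := near_x _ ua; have := near_x _ ub.
by case: (ltrgt0P (f j x)) fx0 => //; rewrite ?ltr_norml; lra.
Qed.

(** * Continuity and the mean value theorem *)

Lemma scaleRE (R : pzRingType) (a b : R) : a *: (b : R^o) = a * b.
Proof. by []. Qed.

Section ContinuousOps.
Variables (R : realType) (T : topologicalType).
Implicit Types f g : T -> R.

Lemma cont_cst (a : R) : continuous (fun _ : T => a).
Proof. by move=> x; exact: cvg_cst. Qed.

Lemma contD f g : continuous f -> continuous g -> continuous (fun x => f x + g x).
Proof. by move=> fc gc x; apply: cvgD; [exact: fc|exact: gc]. Qed.

Lemma contN f : continuous f -> continuous (fun x => - f x).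
Proof. by move=> fc x; apply: cvgN; exact: fc. Qed.

Lemma contB f g : continuous f -> continuous g -> continuous (fun x => f x - g x).
Proof. by move=> fc gc x; apply: cvgB; [exact: fc|exact: gc]. Qed.

Lemma contM f g : continuous f -> continuous g -> continuous (fun x => f x * g x).
Proof. by move=> fc gc x; apply: cvgM; [exact: fc|exact: gc]. Qed.

Lemma contX f n : continuous f -> continuous (fun x => f x ^+ n).
Proof.
move=> fc; elim: n => [|n IH].
  by under eq_fun do rewrite expr0; exact: cont_cst.
by under eq_fun do rewrite exprS; exact: contM.
Qed.

Lemma cont_max f g : continuous f -> continuous g ->
  continuous (fun x => Order.max (f x) (g x)).
Proof. by move=> fc gc x; apply: continuous_max; [exact: fc|exact: gc]. Qed.

Lemma cont_min f g : continuous f -> continuous g ->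
  continuous (fun x => Order.min (f x) (g x)).
Proof. by move=> fc gc x; apply: continuous_min; [exact: fc|exact: gc]. Qed.

Lemma cont_norm f : continuous f -> continuous (fun x => `|f x|).
Proof. by move=> fc x; apply: cvg_norm; exact: fc. Qed.

Lemma cont_inv f : (forall x, f x != 0) -> continuous f ->
  continuous (fun x => (f x)^-1).
Proof. by move=> f0 fc x; apply: cvgV; [exact: f0|exact: fc]. Qed.

Lemma cont_comp (U V : topologicalType) (h : U -> V) (k : T -> U) :
  continuous k -> continuous h -> continuous (fun x => h (k x)).
Proof. by move=> kc hc x; apply: continuous_comp; [exact: kc|exact: hc]. Qed.

Lemma cont_sum (I : finType) (P : pred I) (F : I -> T -> R) :
  (forall i, continuous (F i)) -> continuous (fun x => \sum_(i | P i) F i x).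
Proof. by move=> Fc; apply: continuous_big => //; exact: add_continuous. Qed.

Lemma cont_mx m n (f : T -> 'M[R]_(m, n)) :
  (forall i j, continuous (fun x => f x i j)) -> continuous f.
Proof.
move=> fc x; apply/cvgrPdist_le => e e0.
have : \forall y \near x, forall ij : 'I_m * 'I_n,
    `|f x ij.1 ij.2 - f y ij.1 ij.2| <= e.
  apply: filter_forall => -[i j] /=.
  by have /cvgrPdist_le/(_ e e0) := fc i j x.
apply: filterS => y fxy; apply: mx_norm_le; first exact: ltW.
by move=> i j; rewrite !mxE; exact: (fxy (i, j)).
Qed.

End ContinuousOps.

Lemma continuous_dist (R : realType) (V W : normedModType R) (f : V -> W) :
  (forall x (e : R), 0 < e -> exists2 d, 0 < d &
    forall y, `|x - y| < d -> `|f x - f y| <= e) <-> continuous f.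
Proof.
split=> [fd x|fc x e e0].
  apply/cvgrPdist_le => e e0; have [d d0 xd] := fd x e e0.
  by apply/nbhs_ballP; exists d => //= y; rewrite -ball_normE; exact: xd.
have /cvgrPdist_le/(_ e e0) := fc x.
move=> /nbhs_ballP[d /= d0 xd]; exists d => // y xy.
by apply: xd; rewrite -ball_normE.
Qed.

Lemma MVT_is_derive (R : realType) (f df : R -> R) (a b : R) : a <= b ->
  (forall x : R, is_derive x (1 : R) f (df x)) ->
  exists2 c, a <= c <= b & f b - f a = df c * (b - a).
Proof.
move=> ab fdf; have [|c cab ->] := @MVT_segment R f df a b ab (fun x _ => fdf x).
  by apply: derivable_within_continuous => x _; have [] := fdf x.
by exists c => //; move: cab; rewrite in_itv.
Qed.

(** * A linking theorem *)

Section Linking.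
Variables (R : realType) (d : nat) (lam : 'I_d -> R) (i0 : 'I_d)
  (G : 'rV[R]_d -> R) (gG : 'I_d -> 'rV[R]_d -> R) (a : 'I_d -> R)
  (C B eta r beta : R) (cs : 'rV[R]_d).
Hypothesis G_derive : forall (c v : 'rV[R]_d) (t : R),
  is_derive t 1 (fun s : R => G (c + s *: v)) (\sum_i gG i (c + t *: v) * v 0 i).
Hypothesis G_continuous : continuous G.
(** Uniform continuity at small distances and a Lipschitz bound at large ones: a continuous gradient
    that is linear up to a bounded error has this property, and an Euler step needs no more. *)
Hypothesis gG_modulus : forall e : R, 0 < e -> exists2 K : R, 0 <= K &
  forall i c c', `|gG i c - gG i c'| <= e + K * `|c - c'|.
Hypothesis gG_infty : forall i (c : 'rV[R]_d), `|gG i c - 2 * a i * c 0 i| <= B.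
Hypothesis nonresonance : forall i, lam i != 2 * a i.
Hypothesis G_ge0 : forall c, 0 <= G c.
Hypothesis G_growth : forall c : 'rV[R]_d, \sum_i a i * c 0 i ^+ 2 - C <= G c.
Hypothesis eta_gt0 : 0 < eta.
Hypothesis a_gt : forall i, lam i <= 0 \/ i = i0 -> eta <= a i - lam i / 2.
Hypothesis lam0_gt0 : 0 < lam i0.
Hypothesis r_gt0 : 0 < r.
Hypothesis beta_gt0 : 0 < beta.

Definition quad_action (c : 'rV[R]_d) := 2^-1 * \sum_i lam i * c 0 i ^+ 2.
Definition linkPsi c := quad_action c - G c.
Definition linkg i (c : 'rV[R]_d) := lam i * c 0 i - gG i c.

(** The linking set: the components in nonpositive directions are frozen at those of [cs], and the
    positive ones lie on an ellipsoid. *)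
Hypothesis Gamma_ge : forall c : 'rV[R]_d,
  (forall i, lam i <= 0 -> c 0 i = cs 0 i) ->
  2^-1 * \sum_(i | 0 < lam i) lam i * c 0 i ^+ 2 = r -> beta <= linkPsi c.

Let coordc i : continuous (fun c : 'rV[R]_d => c 0 i).
Proof. exact: coord_continuous. Qed.

Let gGc i : continuous (gG i).
Proof.
apply/continuous_dist => c e e0.
have e20 : 0 < e / 2 by rewrite divr_gt0.
have [K K0 gK] := gG_modulus e20.
exists (e / 2 / (K + 1)); first by rewrite divr_gt0// ltr_wpDl.
move=> y /ltW cy; apply: (le_trans (gK i _ _)); rewrite [leRHS]splitr lerD2l.
apply: (le_trans (ler_wpM2l K0 cy)).
rewrite mulrA [K * _]mulrC -mulrA; apply: ler_piMr; first exact: ltW.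
by rewrite ler_pdivrMr ?ltr_wpDl// mul1r lerDl.
Qed.

Let linkgc i : continuous (linkg i).
Proof.
by apply: contB; [apply: contM; [exact: cont_cst|exact: coordc]|exact: gGc].
Qed.

Let linkPsic : continuous linkPsi.
Proof.
apply: (@contB R 'rV[R]_d quad_action G); last exact: G_continuous.
apply: contM; first exact: cont_cst.
apply: cont_sum => i; apply: contM; first exact: cont_cst.
by apply: contX; exact: coordc.
Qed.

Let S c := \sum_i linkg i c ^+ 2.

Let Sc : continuous S.
Proof. by apply: cont_sum => i; apply: contX; exact: linkgc. Qed.

Let S_ge i c : linkg i c ^+ 2 <= S c.
Proof.
by rewrite /S (bigD1 i)//= lerDl sumr_ge0// => j _; exact: sqr_ge0.
Qed.

Let S_ge0 c : 0 <= S c. Proof. by apply: sumr_ge0 => i _; exact: sqr_ge0. Qed.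

(** By nonresonance the linear part of the gradient is invertible in each coordinate, and at
    infinity it dominates the bounded remainder. *)
Let S_coercive : exists2 M : R, 0 < M & forall c, M <= `|c| -> 1 <= S c.
Proof.
pose gam i := `|lam i - 2 * a i|.
have gam0 i : 0 < gam i by rewrite normr_gt0 subr_eq0.
pose M := 1 + \sum_i (`|B| + 1) / gam i.
have M0 : 0 < M.
  rewrite ltr_wpDr// sumr_ge0// => i _.
  by rewrite divr_ge0 ?addr_ge0// ltW.
exists M => // c Mc.
(* Otherwise the norm of [c] would be at most the sum of all thresholds, which is less than [M]. *)
have [i ci] : exists i, (`|B| + 1) / gam i <= `|c 0 i|.
  apply/not_existsP => ci.
  have : `|c| <= \sum_i (`|B| + 1) / gam i.
    apply: mx_norm_le => [|k j].
      by apply: sumr_ge0 => i _; rewrite divr_ge0 ?addr_ge0// ltW.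
    rewrite ord1 (bigD1 j)//= ler_wpDr//.
      by apply: sumr_ge0 => i _; rewrite divr_ge0 ?addr_ge0// ltW.
    by rewrite leNgt; apply/negP => /ltW; exact: ci.
  by move=> /(le_trans Mc); rewrite /M; lra.
apply: le_trans (S_ge i c); rewrite -real_normK ?num_real// expr_ge1//.
have : `|B| + 1 <= `|(lam i - 2 * a i) * c 0 i|.
  by rewrite normrM mulrC -ler_pdivrMr ?ci//; exact: gam0.
have := gG_infty i c; have := ler_norm B.
have -> : linkg i c = (lam i - 2 * a i) * c 0 i - (gG i c - 2 * a i * c 0 i).
  by rewrite /linkg; ring.
move=> B1 B2 B3.
have := lerB_dist ((lam i - 2 * a i) * c 0 i) (gG i c - 2 * a i * c 0 i).
lra.
Qed.

Hypothesis no_crit : forall c, beta <= linkPsi c -> exists i, linkg i c != 0.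

(** A form of the Palais-Smale condition. The function [m] is positive by [no_crit], so it has a
    positive minimum on the ball outside of which [S] is at least 1; this leaves room for levels
    slightly below [beta]. *)
Let gap : exists beta' mu, [/\ 0 < beta', beta' < beta, 0 < mu &
  forall c, beta' <= linkPsi c -> mu <= S c].
Proof.
have [M M0 SM] := S_coercive.
pose m c := Order.max (beta - linkPsi c) 0 + S c.
have mc : continuous m.
  apply: contD; last exact: Sc.
  apply: cont_max; last exact: cont_cst.
  by apply: contB; [exact: cont_cst|exact: linkPsic].
have m_gt0 c : 0 < m c.
  rewrite /m; have [lt0|] := ltP 0 (beta - linkPsi c).
    by rewrite (lt_le_trans lt0)// lerDl.
  rewrite subr_le0 => /no_crit[i gi]; rewrite add0r.
  by apply: lt_le_trans (S_ge i c); rewrite exprn_even_gt0.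
have [|||c0 _ c0min] := @EVT_min_rV R d m [set c | `|c| <= M].
- by exists 0; rewrite /= normr0 ltW.
- apply: bounded_closed_compact.
    by exists M; split; [rewrite num_real|move=> x Mx c /= /le_trans->//; exact: ltW].
  have := @closed_closed_ball_ R 'rV[R]_d 0 M.
  by congr closed; apply/seteqP; split => c /=; rewrite /closed_ball_/= sub0r normrN.
- by apply: continuous_subspaceT.
pose mu := Order.min (m c0) 1.
have mu0 : 0 < mu by rewrite lt_min m_gt0 ltr01.
have mu1 : mu <= 1 by rewrite ge_min lexx orbT.
have muM c : mu <= Order.max (beta - linkPsi c) 0 + S c.
  have [cM|/ltW Mc] := leP `|c| M.
    by rewrite ge_min (_ : m c0 <= _)// c0min// inE.
  rewrite (le_trans mu1)// (le_trans (SM c Mc))// lerDr.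
  by rewrite le_max lexx orbT.
pose e := Order.min mu beta / 2.
have e0 : 0 < e by rewrite divr_gt0// lt_min mu0.
have [e1 e2] : e <= mu / 2 /\ e <= beta / 2.
  by split; rewrite ler_pM2r ?invr_gt0// ge_min lexx ?orbT.
exists (beta - e), (mu / 2); split; [lra|lra|lra|].
move=> c Hc; have := muM c.
by case: (leP (beta - linkPsi c) 0) => _; lra.
Qed.

Let grad c : 'rV[R]_d := \row_i linkg i c.

Let Psi_derive (c v : 'rV[R]_d) (t : R) :
  is_derive t 1 (fun s : R => linkPsi (c + s *: v))
    (\sum_i linkg i (c + t *: v) * v 0 i).
Proof.
have quad_derive : is_derive t 1 (fun s : R => quad_action (c + s *: v))
    (\sum_i lam i * (c + t *: v) 0 i * v 0 i).
  have -> : (fun s : R => quad_action (c + s *: v)) = (fun s : R =>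
      2^-1 * (\sum_i lam i * c 0 i ^+ 2) +
      s * (\sum_i lam i * c 0 i * v 0 i) +
      s ^+ 2 * (2^-1 * \sum_i lam i * v 0 i ^+ 2)).
    apply/funext => s; rewrite /quad_action !mulr_sumr -!big_split.
    by apply: eq_bigr => i _ /=; rewrite !mxE; field.
  apply: is_derive_eq.
  have -> : \sum_i lam i * (c + t *: v) 0 i * v 0 i =
      \sum_i lam i * c 0 i * v 0 i + t * \sum_i lam i * v 0 i ^+ 2.
    rewrite mulr_sumr -big_split; apply: eq_bigr => i _; rewrite !mxE /=; ring.
  by rewrite !scaleRE; field.
have := @is_deriveB _ _ _ _ _ _ _ _ _ quad_derive (@G_derive c v t).
move/is_derive_eq; apply; rewrite -sumrB; apply: eq_bigr => i _.
by rewrite /linkg; ring.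
Qed.

(** One Euler step. Its length depends on [mu] only, because the error of the first-order expansion
    is measured against [S c]: [e] and [tau] make each of its two parts at most [S c / 4]. *)
Let descent mu : 0 < mu -> exists2 tau, 0 < tau & forall c s,
  mu <= S c -> 0 <= s <= tau ->
  linkPsi (c - s *: grad c) <= linkPsi c - s * S c / 2.
Proof.
move=> mu0; pose D : R := d%:R.
have D0 : 0 <= D by exact: ler0n.
pose del := Num.sqrt mu.
have del0 : 0 < del by rewrite sqrtr_gt0.
pose e := del / (4 * (D + 1)).
have e0 : 0 < e by rewrite divr_gt0// mulr_gt0// ltr_wpDl.
have [K K0 gK] := gG_modulus e0.
pose L := \sum_i `|lam i|.
have L0 : 0 <= L by apply: sumr_ge0.
pose tau := (4 * (L + D * K + 1))^-1.
have den0 : 0 < 4 * (L + D * K + 1).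
  by rewrite mulr_gt0// ltr_wpDl// addr_ge0// mulr_ge0.
have tau0 : 0 < tau by rewrite invr_gt0.
exists tau => // c s muS /andP[s0 stau].
have := @MVT_is_derive R (fun u : R => linkPsi (c + u *: (- grad c)))
  (fun u => \sum_i linkg i (c + u *: (- grad c)) * (- grad c) 0 i) 0 s s0
  (fun u => Psi_derive c (- grad c) u).
rewrite /= scale0r addr0 scalerN subr0 => -[u /andP[u0 us]].
move=> /eqP; rewrite subr_eq => /eqP ->; rewrite addrC lerD2l.
rewrite -mulrN mulrC -mulrA ler_wpM2l//.
pose n := `|grad c|.
have n0 : 0 <= n by exact: normr_ge0.
have gn i : `|linkg i c| <= n.
  by have := coord_le_mx_norm (grad c) 0 i; rewrite mxE.
have S_sqrt : Num.sqrt (S c) ^+ 2 = S c by rewrite sqr_sqrtr.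
have gS i : `|linkg i c| <= Num.sqrt (S c).
  by rewrite -sqrtr_sqr ler_wsqrtr.
have nS : n <= Num.sqrt (S c).
  by apply: mx_norm_le => // k i; rewrite mxE.
have delS : del <= Num.sqrt (S c) by rewrite ler_wsqrtr.
have change i : `|linkg i (c + u *: (- grad c)) - linkg i c| <=
    `|lam i| * (u * n) + e + K * (u * n).
  have -> : linkg i (c + u *: (- grad c)) - linkg i c =
     - (lam i * (u * linkg i c)) - (gG i (c + u *: (- grad c)) - gG i c).
    by rewrite /linkg !mxE /linkg; ring.
  rewrite -addrA; apply: (le_trans (ler_normB _ _)); apply: lerD.
    by rewrite normrN !normrM (ger0_norm u0) ler_wpM2l// ler_wpM2l.
  apply: (le_trans (gK _ _ _)); rewrite lerD2l ler_wpM2l//.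
  by rewrite addrC addKr normrZ normrN (ger0_norm u0).
have alg (x1 x2 x3 x4 x5 x6 : R) : (x1 * (x2 * x3) + x4 * x5 +
    x4 * (x6 * (x2 * x3))) * x3 =
    (x1 * x2 + x4 * x6 * x2) * x3 ^+ 2 + x4 * x5 * x3 by ring.
have main : \sum_i linkg i (c + u *: (- grad c)) * linkg i c >= S c / 2.
  have -> : \sum_i linkg i (c + u *: (- grad c)) * linkg i c = S c +
      \sum_i (linkg i (c + u *: (- grad c)) - linkg i c) * linkg i c.
    by rewrite /S -big_split; apply: eq_bigr => i _ /=; ring.
  have sum_le : `|\sum_i (linkg i (c + u *: (- grad c)) - linkg i c) * linkg i c|
      <= (L * u + D * K * u) * n ^+ 2 + D * e * n.
    apply: (le_trans (ler_norm_sum _ _ _)).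
    apply: (@le_trans _ _ (\sum_i (`|lam i| * (u * n) + e + K * (u * n)) * n)).
      by apply: ler_sum => i _; rewrite normrM ler_pM.
    rewrite -mulr_suml !big_split/= -mulr_suml !sumr_const card_ord -/L.
    by rewrite -[e *+ d]mulr_natl -[K * _ *+ d]mulr_natl -/D alg.
  have n2 : n ^+ 2 <= S c by rewrite -S_sqrt ler_pXn2r// nnegrE sqrtr_ge0.
  have p1 : (L * u + D * K * u) * n ^+ 2 <= S c / 4.
    rewrite -mulrDl; apply: (@le_trans _ _ ((L + D * K) * tau * S c)).
      apply: ler_pM => //; first by rewrite mulr_ge0// addr_ge0// mulr_ge0.
        by rewrite sqr_ge0.
      by rewrite ler_wpM2l ?addr_ge0 ?mulr_ge0// (le_trans us).
    rewrite [leRHS]mulrC ler_wpM2r//.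
    rewrite /tau invfM mulrCA ler_piMr ?invr_ge0//.
    by rewrite ler_pdivrMr ?mul1r ?lerDl// ltr_wpDl// addr_ge0// mulr_ge0.
  have p2 : D * e * n <= S c / 4.
    apply: (@le_trans _ _ (del / 4 * n)).
      rewrite ler_wpM2r// /e mulrCA ler_wpM2l ?(ltW del0)//.
      by rewrite invfM mulrCA ler_piMr// ler_pdivrMr ?mul1r ?lerDl// ltr_wpDl.
    rewrite mulrAC ler_wpM2r// -S_sqrt expr2 ler_pM// ltW//.
  by move: sum_le; rewrite ler_norml => /andP[]; lra.
have -> : \sum_i linkg i (c + u *: (- grad c)) * (- grad c) 0 i =
   - \sum_i linkg i (c + u *: (- grad c)) * linkg i c.
  by rewrite -sumrN; apply: eq_bigr => i _; rewrite !mxE mulrN.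
by rewrite mulrN lerN2.
Qed.

(** Euler steps, cut off by [chi] below the level [beta'], are iterated. As long as the level is at
    least [beta] a step gains [tau * mu / 2], so finitely many suffice. *)
Let deformation M : exists h : 'rV[R]_d -> 'rV[R]_d,
  [/\ continuous h, forall c, linkPsi c <= 0 -> h c = c
    & forall c, linkPsi c <= M -> linkPsi (h c) < beta].
Proof.
have [beta' [mu [b0 bb mu0 gapS]]] := gap.
have [tau tau0 desc] := descent mu0.
have bb0 : 0 < beta - beta' by rewrite subr_gt0.
pose chi c := Order.max 0 (Order.min 1 ((linkPsi c - beta') / (beta - beta'))).
have chi01 c : 0 <= chi c <= 1.
  by rewrite /chi le_max lexx/= ge_max ler01/= ge_min lexx.
have chic : continuous chi.
  apply: cont_max; first exact: cont_cst.
  apply: cont_min; first exact: cont_cst.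
  apply: contM; last exact: cont_cst.
  by apply: contB; [exact: linkPsic|exact: cont_cst].
have chi0 c : linkPsi c <= beta' -> chi c = 0.
  move=> cb; apply/max_idPl; rewrite ge_min; apply/orP; right.
  by rewrite ler_pdivrMr// mul0r subr_le0.
have chi1 c : beta <= linkPsi c -> chi c = 1.
  move=> cb; rewrite /chi (min_idPl _) ?(max_idPr _)//.
  by rewrite ler_pdivlMr// mul1r lerD2r.
pose step c := c - (tau * chi c) *: grad c.
have step_id c : linkPsi c <= beta' -> step c = c.
  by move=> /chi0 c0; rewrite /step c0 mulr0 scale0r subr0.
have step_le c : linkPsi (step c) <= linkPsi c.
  have [/step_id->//|/ltW/gapS muS] := leP (linkPsi c) beta'.
  have /andP[x0 x1] := chi01 c.
  have := desc c (tau * chi c) muS.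
  rewrite mulr_ge0 ?(ltW tau0)//= ler_piMr ?(ltW tau0)// => /(_ isT) /le_trans.
  apply; rewrite gerBl divr_ge0// mulr_ge0// mulr_ge0// ltW//.
have step_drop c : beta <= linkPsi c ->
    linkPsi (step c) <= linkPsi c - tau * mu / 2.
  move=> cb; have muS : mu <= S c by apply/gapS/(le_trans (ltW bb)).
  have := desc c tau muS; rewrite (ltW tau0) lexx /step chi1// mulr1.
  move=> /(_ isT)/le_trans; apply; rewrite lerD2l lerN2 ler_pM2r ?invr_gt0//.
  by rewrite ler_pM2l.
have stepc : continuous step.
  apply: cont_mx => i j; rewrite ord1 /step.
  under eq_fun => c do rewrite !mxE.
  apply: contB; first exact: coordc.
  apply: contM; last exact: linkgc.
  by apply: contM; [exact: cont_cst|exact: chic].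
have drop0 : 0 < tau * mu / 2 by rewrite divr_gt0// mulr_gt0.
have iter_bound k c : linkPsi c <= M ->
    linkPsi (iter k step c) < beta \/
    linkPsi (iter k step c) <= M - k%:R * (tau * mu / 2).
  move=> cM; elim: k => [|k [lt_b|le_M]]; first by right; rewrite mul0r subr0.
    by left; apply: le_lt_trans lt_b; exact: step_le.
  have [lt_b|/step_drop le_k] := ltP (linkPsi (iter k step c)) beta.
    by left; apply: le_lt_trans lt_b; exact: step_le.
  right; apply: (le_trans le_k).
  by rewrite -[k.+1%:R]natr1 mulrDl mul1r opprD addrA lerB.
have [k kM] : exists k : nat, M - k%:R * (tau * mu / 2) < beta.
  pose t := `|(M - beta) / (tau * mu / 2)|; exists (Num.trunc t).+1.
  have lt_k : (M - beta) / (tau * mu / 2) < (Num.trunc t).+1%:R.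
    exact: le_lt_trans (ler_norm _) (truncnS_gt t).
  by move: lt_k; rewrite ltr_pdivrMr//; lra.
exists (iter k step); split.
- elim: k {kM} => [|k IH] /=; first by move=> c; exact: cvg_id.
  exact: cont_comp.
- move=> c c0; elim: k {kM} => //= k ->; apply: step_id.
  exact: le_trans c0 (ltW b0).
- by move=> c /(iter_bound k)[//|/le_lt_trans]; exact.
Qed.

(** On the boundary of the box of size [tau] in the nonpositive directions times [0, tau] in the
    direction [i0], [linkPsi] is at most 0 and the deformation is the identity. The deformed box
    must therefore still meet the linking set, where [linkPsi] is at least [beta]. *)
Lemma linking_contra : False.
Proof.
(* The summands serve three bounds: [C <= eta * tau ^+ 2], [r <= lam i0 * tau ^+ 2 / 2], and the
   norm of [cs] is at most [tau]. *)
pose tau := 1 + `|C| / eta + r / lam i0 * 2 + `|cs|.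
have q1 : 0 <= `|C| / eta by rewrite divr_ge0// ltW.
have q2 : 0 <= r / lam i0 * 2 by rewrite mulr_ge0// divr_ge0// ltW.
have tau1 : 1 <= tau by rewrite /tau -!addrA lerDl !addr_ge0.
have tau0 : 0 < tau by apply: lt_le_trans tau1.
have tau_sq : tau <= tau ^+ 2 by rewrite expr2 ler_peMl// ltW.
have C_tau : C <= eta * tau ^+ 2.
  rewrite mulrC -ler_pdivrMr//; apply: le_trans tau_sq.
  apply: (@le_trans _ _ (`|C| / eta)).
    by rewrite ler_pM2r ?invr_gt0// ler_norm.
  have := normr_ge0 cs; rewrite /tau; lra.
have r_tau : r <= 2^-1 * (lam i0 * tau ^+ 2).
  have h : r / lam i0 * 2 <= tau ^+ 2.
    by apply: le_trans tau_sq; have := normr_ge0 cs; rewrite /tau; lra.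
  have := ler_wpM2l (ltW lam0_gt0) h.
  have -> : lam i0 * (r / lam i0 * 2) = r * 2 by field; exact: lt0r_neq0.
  lra.
have cs_tau i : `|cs 0 i| <= tau.
  by apply: (le_trans (coord_le_mx_norm _ _ _)); rewrite /tau; lra.
(* The positive directions other than [i0] are dummy variables, so that the domain is the full unit
   cube. *)
pose kap (x : 'rV[R]_d) : 'rV[R]_d := \row_i
  (if i == i0 then tau * x 0 i
   else if lam i <= 0 then tau * (2 * x 0 i - 1) else 0).
have kapc : continuous kap.
  apply: cont_mx => k j; rewrite ord1 /kap.
  under eq_fun => x do rewrite !mxE.
  case: (j == i0); first by apply: contM; [exact: cont_cst|exact: coordc].
  case: (lam j <= 0); last exact: cont_cst.
  apply: contM; first exact: cont_cst.
  apply: contB; last exact: cont_cst.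
  by apply: contM; [exact: cont_cst|exact: coordc].
have kap_gt x i : 0 < lam i -> i != i0 -> kap x 0 i = 0.
  by move=> li ii0; rewrite mxE (negPf ii0) leNgt li.
have kap_le x : linkPsi (kap x) <=
    C - eta * \sum_(i | (lam i <= 0) || (i == i0)) kap x 0 i ^+ 2.
  have := G_growth (kap x); rewrite /linkPsi.
  have -> : quad_action (kap x) = \sum_i 2^-1 * (lam i * kap x 0 i ^+ 2).
    by rewrite /quad_action mulr_sumr.
  have : \sum_i 2^-1 * (lam i * kap x 0 i ^+ 2) -
      \sum_i a i * kap x 0 i ^+ 2 <=
      - (eta * \sum_(i | (lam i <= 0) || (i == i0)) kap x 0 i ^+ 2).
    rewrite -sumrB mulr_sumr -sumrN [leRHS]big_mkcond/=; apply: ler_sum => i _.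
    case: ifPn => [/orP Pi|].
      have := @a_gt i; have := sqr_ge0 (kap x 0 i).
      have Pi' : lam i <= 0 \/ i = i0 by case: Pi => [|/eqP]; [left|right].
      move=> k0 /(_ Pi') ai.
      have := ler_wpM2r k0 ai; lra.
    rewrite negb_or -ltNge => /andP[li ii0].
    by rewrite kap_gt// expr0n /= !mulr0 subrr.
  lra.
have kap_bdry x i : lam i <= 0 \/ i = i0 -> kap x 0 i ^+ 2 = tau ^+ 2 ->
    linkPsi (kap x) <= 0.
  move=> Pi ki; apply: (le_trans (kap_le x)); rewrite subr_le0.
  apply: (le_trans C_tau); rewrite ler_pM2l// (bigD1 i)/=.
    by rewrite ki lerDl sumr_ge0// => j _; exact: sqr_ge0.
  by case: Pi => [->//|->]; rewrite eqxx orbT.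
have kap_bot (x : 'rV[R]_d) : x 0 i0 = 0 -> linkPsi (kap x) <= 0.
  move=> x0; rewrite /linkPsi subr_le0; apply: le_trans (G_ge0 _).
  rewrite /quad_action mulr_ge0_le0 ?invr_ge0// sumr_le0// => i _.
  have [->|ii0] := eqVneq i i0.
    by rewrite mxE eqxx x0 mulr0 expr0n mulr0.
  have [li|li] := leP (lam i) 0; first by rewrite mulr_le0_ge0// sqr_ge0.
  by rewrite kap_gt// expr0n mulr0.
have [h [hc h_id h_lt]] := deformation C.
have kap_lt x : linkPsi (h (kap x)) < beta.
  apply: h_lt; apply: (le_trans (kap_le x)); rewrite gerBl mulr_ge0 ?(ltW eta_gt0)//.
  by apply: sumr_ge0 => i _; exact: sqr_ge0.
(* A common zero is a point whose image lies on the linking set; the dummy variables are set to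
   1/2. *)
pose f i (x : 'rV[R]_d) : R :=
  if i == i0 then
    2^-1 * (\sum_(j | 0 < lam j) lam j * h (kap x) 0 j ^+ 2) - r
  else if lam i <= 0 then h (kap x) 0 i - cs 0 i else x 0 i - 2^-1.
have hkc : continuous (fun x => h (kap x)).
  exact: cont_comp.
have [||| x _ fx] := @Poincare_Miranda R d f.
- move=> i; rewrite /f; case: (i == i0).
    apply: contB; last exact: cont_cst.
    apply: contM; first exact: cont_cst.
    apply: cont_sum => j; apply: contM; first exact: cont_cst.
    by apply: contX; exact: (cont_comp hkc (@coordc j)).
  case: (lam i <= 0); apply: contB; try exact: cont_cst; last exact: coordc.
  exact: (cont_comp hkc (@coordc i)).
- move=> i x xcube xi; rewrite /f; case: ifPn => [/eqP ii0|ii0].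
    rewrite h_id; last by apply: kap_bot; rewrite -ii0.
    rewrite subr_le0 (bigD1 i0)//= [X in _ + X]big1 => [|j /andP[lj ji]].
      by rewrite mxE eqxx -ii0 xi mulr0 expr0n /= mulr0 addr0 mulr0 ltW.
    by rewrite kap_gt// expr0n mulr0.
  case: ifPn => li; last by rewrite xi sub0r oppr_le0 invr_ge0.
  rewrite h_id; last first.
    apply: (@kap_bdry _ i); [by left|].
    by rewrite mxE (negPf ii0) li xi mulr0 sub0r mulrN1 sqrrN.
  rewrite mxE (negPf ii0) li xi mulr0 sub0r mulrN1.
  by have := cs_tau i; rewrite ler_norml => /andP[]; lra.
- move=> i x xcube xi; rewrite /f; case: ifPn => [/eqP ii0|ii0].
    rewrite h_id; last first.
      apply: (@kap_bdry _ i0); [by right|].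
      by rewrite mxE eqxx -ii0 xi mulr1.
    rewrite subr_ge0 (bigD1 i0)//= [X in _ + X]big1 => [|j /andP[lj ji]].
      by rewrite mxE eqxx -ii0 xi mulr1 addr0 ii0.
    by rewrite kap_gt// expr0n mulr0.
  case: ifPn => li; last by rewrite xi; lra.
  have kxi : kap x 0 i = tau.
    by rewrite mxE (negPf ii0) li xi mulr1; ring.
  rewrite h_id; last by apply: (@kap_bdry _ i); [by left|rewrite kxi].
  by rewrite kxi; have := cs_tau i; rewrite ler_norml => /andP[]; lra.
have := kap_lt x; rewrite ltNge => /negP; apply; apply: Gamma_ge.
  move=> i li; have := fx i; rewrite /f li; case: eqP => [ii0|_ /eqP].
    by move: li; rewrite ii0 leNgt lam0_gt0.
  by rewrite subr_eq0 => /eqP.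
by have := fx i0; rewrite /f eqxx => /eqP; rewrite subr_eq0 => /eqP.
Qed.

End Linking.

Lemma linking (R : realType) (d : nat) (lam : 'I_d -> R) (i0 : 'I_d)
    (G : 'rV[R]_d -> R) (gG : 'I_d -> 'rV[R]_d -> R) (a : 'I_d -> R)
    (C B eta r beta : R) (cs : 'rV[R]_d) :
  (forall (c v : 'rV[R]_d) (t : R), is_derive t (1 : R)
    (fun s : R => G (c + s *: v)) (\sum_i gG i (c + t *: v) * v 0 i)) ->
  continuous G ->
  (forall e : R, 0 < e -> exists2 K : R, 0 <= K &
    forall i c c', `|gG i c - gG i c'| <= e + K * `|c - c'|) ->
  (forall i (c : 'rV[R]_d), `|gG i c - 2 * a i * c 0 i| <= B) ->
  (forall i, lam i != 2 * a i) ->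
  (forall c, 0 <= G c) ->
  (forall c : 'rV[R]_d, \sum_i a i * c 0 i ^+ 2 - C <= G c) ->
  0 < eta -> (forall i, lam i <= 0 \/ i = i0 -> eta <= a i - lam i / 2) ->
  0 < lam i0 -> 0 < r -> 0 < beta ->
  (forall c : 'rV[R]_d, (forall i, lam i <= 0 -> c 0 i = cs 0 i) ->
    2^-1 * \sum_(i | 0 < lam i) lam i * c 0 i ^+ 2 = r ->
    beta <= linkPsi lam G c) ->
  exists2 c : 'rV[R]_d, beta <= linkPsi lam G c &
    forall i, lam i * c 0 i = gG i c.
Proof.
move=> h1 h2 h3 h4 h5 h6 h7 h8 h9 h10 h11 h12 h13.
apply: contrapT => no; apply: (linking_contra h1 h2 h3 h4 h5 h6 h7 h8 h9 h10 h11 h12 h13).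
move=> c Hc; apply/not_existsP => gc; apply: no; exists c => // i.
have := gc i; move/negP; rewrite negbK subr_eq0 => /eqP.
exact.
Qed.

(** * Real powers *)

Lemma powR_pos_mono (R : realType) (r x y : R) : 0 <= r -> 0 <= x -> x <= y ->
  x `^ r <= y `^ r.
Proof.
by move=> r0 x0 xy; apply: ge0_ler_powR => //; rewrite nnegrE// (le_trans x0).
Qed.

Lemma powR_pos_ltr (R : realType) (r x y : R) : 0 < r -> 0 <= x -> x < y ->
  x `^ r < y `^ r.
Proof.
by move=> r0 x0 xy; apply: gt0_ltr_powR => //; rewrite nnegrE// (le_trans x0)// ltW.
Qed.

Lemma powRK (R : realType) (r x : R) : r != 0 -> 0 <= x -> (x `^ r) `^ r^-1 = x.
Proof. by move=> r0 x0; rewrite -powRrM mulfV// powRr1. Qed.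

Lemma powRKV (R : realType) (r x : R) : r != 0 -> 0 <= x -> (x `^ r^-1) `^ r = x.
Proof. by move=> r0 x0; rewrite -powRrM mulVf// powRr1. Qed.

Lemma powR_gt0D (R : realType) (x r s : R) : 0 < x ->
  x `^ (r + s) = x `^ r * x `^ s.
Proof. by move=> x0; rewrite powRD// (gt_eqF x0) implybT. Qed.

Lemma cont_powR (R : realType) (r : R) : 0 < r ->
  continuous (fun s : R => `|s| `^ r).
Proof.
move=> r0 x; have [->|x0] := eqVneq x 0.
  rewrite /continuous_at normr0 powR0 ?gt_eqF//.
  apply/cvgrPdist_le => e e0; apply/nbhs_ballP; exists (e `^ r^-1).
    by rewrite /= powR_gt0.
  move=> y /=; rewrite sub0r normrN => ye.
  rewrite sub0r normrN ger0_norm ?powR_ge0// -[leRHS](@powRKV _ r) ?gt_eqF ?ltW//.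
  by apply: powR_pos_ltr.
apply: (@continuous_comp _ _ _ (fun s : R => `|s|) (fun s : R => s `^ r)).
  exact: norm_continuous.
apply: differentiable_continuous; apply/derivable1_diffP.
by apply: derivable_powR; rewrite in_itv/= andbT normr_gt0.
Qed.

(* [spow r s] is the derivative of [|s|^r / r]. *)
Definition spow (R : realType) (r s : R) : R := Num.sg s * `|s| `^ (r - 1).

Section SignedPower.
Variables (R : realType) (r : R).
Hypothesis r_gt1 : 1 < r.
Let r10 : 0 < r - 1. Proof. by rewrite subr_gt0. Qed.
Let r0 : 0 < r. Proof. exact: lt_trans ltr01 r_gt1. Qed.

Lemma spow0 : spow r 0 = 0 :> R.
Proof. by rewrite /spow sgr0 mul0r. Qed.

Lemma norm_spow s : `|spow r s| = `|s| `^ (r - 1).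
Proof.
have [->|s0] := eqVneq s 0; first by rewrite spow0 normr0 powR0// gt_eqF.
by rewrite /spow normrM normr_sg s0 mul1r ger0_norm// powR_ge0.
Qed.

Lemma spowM s t : spow r (s * t) = spow r s * spow r t.
Proof. by rewrite /spow sgrM normrM powRM// mulrACA. Qed.

Lemma spow_pos s : 0 <= s -> spow r s = s `^ (r - 1).
Proof.
rewrite le_eqVlt => /predU1P[<-|s0]; first by rewrite spow0 powR0// gt_eqF.
by rewrite /spow gtr0_sg// mul1r gtr0_norm.
Qed.

Lemma spowN s : spow r (- s) = - spow r s.
Proof. by rewrite /spow sgrN normrN mulNr. Qed.

Lemma mul_spow s : s * spow r s = `|s| `^ r.
Proof.
have [->|s0] := eqVneq s 0; first by rewrite mul0r normr0 powR0// gt_eqF.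
by rewrite /spow mulrA [s * _]mulrC -normrEsg mulr_powRB1.
Qed.

Lemma cont_spow : continuous (spow r).
Proof.
move=> x; have [x0|x0] := eqVneq x 0.
  have := @cont_powR R _ r10 x => /cvgrPdist_le h.
  apply/cvgrPdist_le => e e0; have := h e e0; rewrite x0 spow0 normr0.
  rewrite powR0 ?gt_eqF//; apply: filterS => y; rewrite !sub0r !normrN norm_spow.
  by rewrite ger0_norm// powR_ge0.
have locsg : \forall y \near x, Num.sg x * `|y| `^ (r - 1) = spow r y.
  move: x0; rewrite neq_lt => /orP[x0|x0].
    near=> y; rewrite /spow (ltr0_sg x0) ltr0_sg//; near: y.
    by apply: lt_nbhsl.
  near=> y; rewrite /spow (gtr0_sg x0) gtr0_sg//; near: y.
  by apply: lt_nbhsr.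
apply: (cvg_trans (near_eq_cvg locsg)).
by apply: (@cvgM _ _ _ _ (fun=> Num.sg x)); [exact: cvg_cst|exact: cont_powR].
Unshelve. all: by end_near. Qed.

Lemma is_derive_abs_powR (x : R) :
  is_derive x (1 : R) (fun s : R => `|s| `^ r) (r * spow r x).
Proof.
have pos (y : R) : 0 < y ->
    is_derive y (1 : R) (fun s : R => `|s| `^ r) (r * spow r y).
  move=> y0; apply: (@near_eq_is_derive _ _ _ (fun s : R => s `^ r)).
    near=> z; rewrite ger0_norm//; near: z.
    by apply: filterS (lt_nbhsr y0) => z /ltW.
  rewrite spow_pos ?ltW//; have yin : y \in `]0, +oo[ by rewrite in_itv/= andbT.
  have := @derivable_powR R 1 r y yin => /derivableP.
  by rewrite -derive1E powR_derive1.
have [x0|x0|->] := ltrgtP x 0; last 1 first.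
- rewrite spow0 mulr0.
  have lim0 : h^-1 *: (((fun s : R => `|s| `^ r) \o shift 0) (h *: (1 : R)) -
      (fun s : R => `|s| `^ r) 0) @[h --> 0^'] --> (0 : R).
    have : spow r h @[h --> 0^'] --> (0 : R).
      by rewrite -[X in _ --> X]spow0; apply: cvg_within_filter; exact: cont_spow.
    apply: cvg_trans; apply: near_eq_cvg; near=> h.
    rewrite /= !scaleRE mulr1 addr0 normr0 powR0 ?gt_eqF// subr0 -mul_spow.
    by rewrite mulKf//; near: h; exact: nbhs_dnbhs_neq.
  by apply: DeriveDef; [apply/cvg_ex; exists 0|apply/cvg_lim].
- have := pos (- x); rewrite oppr_gt0 => /(_ x0) dN.
  have -> : (fun s : R => `|s| `^ r) = (fun s : R => `|s| `^ r) \o -%R.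
    by apply/funext => s /=; rewrite normrN.
  have dopp : is_derive x (1 : R) (-%R : R -> R) (-1).
    exact: is_deriveNid.
  have := @is_derive1_comp R _ _ _ _ _ dN dopp.
  by move/is_derive_eq; apply; rewrite spowN; ring.
- exact: pos.
Unshelve. all: by end_near. Qed.

End SignedPower.

Lemma wAMGM (R : realType) (t x y : R) : 0 <= t <= 1 -> 0 <= x -> 0 <= y ->
  x `^ (1 - t) * y `^ t <= (1 - t) * x + t * y.
Proof.
move=> /andP[]; rewrite le_eqVlt => /predU1P[<-|t0].
  by rewrite !subr0 powRr0 mulr1 mul0r addr0 mul1r => *; rewrite powRr1.
rewrite le_eqVlt => /predU1P[->|t1] x0 y0.
  by rewrite subrr powRr0 mul0r !mul1r add0r powRr1.
have t10 : 0 < 1 - t by rewrite subr_gt0.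
have := @conjugate_powR R (x `^ (1 - t)) (y `^ t) (1 - t)^-1 t^-1.
rewrite !powR_ge0 !invr_gt0 !invrK t0 t10 subrK => /(_ isT isT isT isT erefl).
by rewrite !powRK ?gt_eqF// [x * _]mulrC [y * _]mulrC.
Qed.

(** Lyapunov's interpolation between the exponents [s] and [r]: the weighted arithmetic-geometric
    mean inequality is applied termwise to [u i ^ s] and [u i ^ r / B], both of which sum to 1. *)
Lemma sum_powR_interpolation (R : realType) (I : finType) (u : I -> R) (s r t : R) :
  (forall i, 0 <= u i) -> 0 <= t <= 1 -> 0 < s -> 0 < r ->
  \sum_i u i `^ s = 1 ->
  \sum_i u i `^ (s * (1 - t) + r * t) <= (\sum_i u i `^ r) `^ t.
Proof.
move=> u0 t01 s0 r0 sum1; set B := \sum_i u i `^ r.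
have B0 : 0 < B.
  have [i ui] : exists i, u i != 0.
    apply/existsP; apply: contraPT sum1; rewrite negb_exists => /forallP h.
    rewrite big1 => [/esym/eqP|i _]; first by rewrite oner_eq0.
    by have := h i; rewrite negbK => /eqP ->; rewrite powR0// gt_eqF.
  rewrite /B (bigD1 i)//= ltr_wpDr//; first by apply: sumr_ge0 => j _; exact: powR_ge0.
  by rewrite powR_gt0// lt_def ui u0.
have Bt0 : 0 < B `^ t by rewrite powR_gt0.
have termwise i : u i `^ (s * (1 - t) + r * t) <=
    B `^ t * ((1 - t) * u i `^ s + t * (u i `^ r / B)).
  have /andP[t0 t1] := t01; have t10 : 0 <= 1 - t by rewrite subr_ge0.
  have rhs0 : 0 <= B `^ t * ((1 - t) * u i `^ s + t * (u i `^ r / B)).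
    rewrite mulr_ge0 ?addr_ge0 ?mulr_ge0 ?powR_ge0 ?invr_ge0//; exact: ltW.
  have e0 : s * (1 - t) + r * t != 0.
    rewrite gt_eqF//; move: t0; rewrite le_eqVlt => /predU1P[<-|t0].
      by rewrite subr0 mulr1 mulr0 addr0.
    by rewrite ltr_wpDl ?mulr_gt0// mulr_ge0// ltW.
  have := u0 i; rewrite le_eqVlt => /predU1P[ui|ui].
    by rewrite -{1}ui powR0.
  have uB : 0 <= u i `^ r / B by rewrite divr_ge0 ?powR_ge0// ltW.
  have := wAMGM t01 (powR_ge0 (u i) s) uB.
  rewrite -(ler_pM2l Bt0); apply: le_trans; rewrite powR_gt0D// !powRrM.
  rewrite mulrCA ler_wpM2l ?powR_ge0// -powRM ?(ltW B0)//.
  by rewrite mulrC divfK ?gt_eqF.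
apply: (le_trans (ler_sum _ (fun i _ => termwise i))).
rewrite -mulr_sumr big_split/= -!mulr_sumr sum1 -mulr_suml divff ?gt_eqF//.
by rewrite !mulr1 subrK mulr1.
Qed.

(** * The norm of an orthogonal matrix from l_q to l_p *)

Lemma eqle (R : realType) (x y : R) : x = y -> x <= y.
Proof. by move=> ->. Qed.

Lemma powR_inv (R : realType) (x r : R) : 0 <= x -> (x^-1) `^ r = (x `^ r)^-1.
Proof. by move=> x0; rewrite -powR_inv1// -powRrM mulN1r powRN. Qed.

Lemma powR_root_mul (R : realType) (p M s : R) : 0 < p -> 0 <= M ->
  (M `^ p * s `^ (p - 1)) `^ p^-1 = M * s `^ ((p - 1) / p).
Proof.
move=> p0 M0; rewrite powRM ?powR_ge0// powRK ?(lt0r_neq0 p0)//.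
by rewrite powRrM.
Qed.

Section PowerSums.
Variable R : realType.

Fact psum_key : unit. Proof. by []. Qed.
Definition psum n (r : R) (x : 'cV[R]_n) : R :=
  locked_with psum_key (\sum_i `|x i 0| `^ r).

Lemma psumE n (r : R) (x : 'cV[R]_n) : psum r x = \sum_i `|x i 0| `^ r.
Proof. by rewrite /psum unlock. Qed.

Lemma psum_ge0 n r (x : 'cV[R]_n) : 0 <= psum r x.
Proof. by rewrite psumE; apply: sumr_ge0 => i _; exact: powR_ge0. Qed.

Lemma psum_lp_norm n (r : R) (x : 'cV[R]_n) : 0 < r -> lp_norm r x `^ r = psum r x.
Proof. move=> r0; rewrite /lp_norm -psumE powRKV ?(lt0r_neq0 r0)//; exact: psum_ge0. Qed.

Lemma psum_eq0 n (r : R) (x : 'cV[R]_n) : 0 < r -> psum r x = 0 -> x = 0.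
Proof.
move=> r0 /eqP; rewrite psumE psumr_eq0 => [/allP x0|i _]; last exact: powR_ge0.
apply/colP => i; rewrite mxE; apply/eqP.
by have /(_ (mem_index_enum i)) := x0 i; rewrite powR_eq0 normr_eq0 => /andP[].
Qed.

Lemma psum0 n (r : R) : 0 < r -> psum r (0 : 'cV[R]_n) = 0.
Proof.
by move=> r0; rewrite psumE; apply: big1 => i _; rewrite mxE normr0 powR0// gt_eqF.
Qed.

Lemma psum_gt0 n (r : R) (x : 'cV[R]_n) : 0 < r -> x != 0 -> 0 < psum r x.
Proof.
move=> r0 x0; rewrite lt_def psum_ge0 andbT; apply: contra_neq x0.
exact: psum_eq0.
Qed.

Lemma psumZ n (r a : R) (x : 'cV[R]_n) : psum r (a *: x) = `|a| `^ r * psum r x.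
Proof.
rewrite !psumE mulr_sumr; apply: eq_bigr => i _.
by rewrite mxE normrM powRM.
Qed.

Lemma cont_psum n (r : R) : 0 < r -> continuous (@psum n r).
Proof.
move=> r0.
rewrite (_ : psum r = fun x : 'cV[R]_n => \sum_i `|x i 0| `^ r); last first.
  by apply/funext => x; exact: psumE.
apply: cont_sum => i.
apply: (@cont_comp 'cV[R]_n R R (fun s : R => `|s| `^ r) (fun x : 'cV[R]_n => x i 0)).
  exact: coord_continuous.
exact: cont_powR.
Qed.

Lemma coord_le_psum n (r : R) (x : 'cV[R]_n) i : `|x i 0| `^ r <= psum r x.
Proof.
by rewrite psumE (bigD1 i)//= lerDl sumr_ge0// => j _; exact: powR_ge0.
Qed.

Definition dotc n (x y : 'cV[R]_n) : R :=
  locked_with psum_key (\sum_i x i 0 * y i 0).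

Lemma dotc_sum n (x y : 'cV[R]_n) : dotc x y = \sum_i x i 0 * y i 0.
Proof. by rewrite /dotc unlock. Qed.

Lemma dotcC n (x y : 'cV[R]_n) : dotc x y = dotc y x.
Proof. by rewrite !dotc_sum; apply: eq_bigr => i _; rewrite mulrC. Qed.

Lemma dotcE n (x y : 'cV[R]_n) : dotc x y = (x^T *m y) 0 0.
Proof. by rewrite dotc_sum mxE; apply: eq_bigr => i _; rewrite mxE. Qed.

Lemma dotc_mulmx n m (A : 'M[R]_(m, n)) x y : dotc (A *m x) y = dotc x (A^T *m y).
Proof. by rewrite !dotcE trmx_mul mulmxA. Qed.

Lemma psum2 n (x : 'cV[R]_n) : psum 2 x = dotc x x.
Proof.
by rewrite psumE dotc_sum; apply: eq_bigr => i _; rewrite powR_mulrn// real_normK ?num_real// expr2.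
Qed.

End PowerSums.

Section Conjugate.
Variables (R : realType) (p : R).
Hypothesis p_gt1 : 1 < p.
Fact conj_exp_key : unit. Proof. by []. Qed.
Definition conj_exp : R := locked_with conj_exp_key (p / (p - 1)).
Lemma conj_expE : conj_exp = p / (p - 1). Proof. by rewrite /conj_exp unlock. Qed.
Local Notation q := conj_exp.

Lemma p_gt0 : 0 < p. Proof. exact: lt_trans ltr01 p_gt1. Qed.
Lemma p1_gt0 : 0 < p - 1. Proof. by rewrite subr_gt0 p_gt1. Qed.
Lemma q_gt1 : 1 < q.
Proof. by rewrite conj_expE ltr_pdivlMr ?p1_gt0//; lra. Qed.
Lemma q_lt2 : 2 < p -> q < 2.
Proof. by move=> p2; rewrite conj_expE ltr_pdivrMr ?p1_gt0//; lra. Qed.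
Lemma q_gt0 : 0 < q. Proof. by apply: lt_trans q_gt1. Qed.
Lemma q1E : q - 1 = (p - 1)^-1.
Proof. by rewrite conj_expE; field; rewrite gt_eqF// p1_gt0. Qed.
Lemma conjE : p^-1 + q^-1 = 1.
Proof. by rewrite conj_expE invf_div; field; rewrite gt_eqF// p_gt0. Qed.
Lemma p1_div : (p - 1) / p = q^-1.
Proof. by rewrite conj_expE invf_div. Qed.
Lemma divpq : q^-1 * p = p - 1.
Proof. by rewrite conj_expE invf_div divfK// gt_eqF// p_gt0. Qed.
Lemma mul_p1q : (p - 1) * q = p.
Proof. by rewrite conj_expE mulrC divfK// gt_eqF// p1_gt0. Qed.
Lemma mul_q1p : (q - 1) * p = q.
Proof. by rewrite q1E mulrC conj_expE. Qed.

Lemma spowK (s : R) : spow p (spow q s) = s.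
Proof.
have [->|s0] := eqVneq s 0; first by rewrite !spow0// ?p_gt1 ?q_gt1.
rewrite {1}/spow norm_spow ?q_gt1// -powRrM q1E mulVf ?gt_eqF ?p1_gt0//.
rewrite powRr1// /spow sgrM sgr_id.
rewrite (_ : Num.sg (_ `^ _) = 1) ?mulr1 -?numEsg//.
by rewrite gtr0_sg// powR_gt0// normr_gt0.
Qed.

Lemma spowKq (s : R) : spow q (spow p s) = s.
Proof.
have [->|s0] := eqVneq s 0; first by rewrite !spow0// ?p_gt1 ?q_gt1.
rewrite {1}/spow norm_spow ?p_gt1// -powRrM q1E mulfV ?gt_eqF ?p1_gt0//.
rewrite powRr1// /spow sgrM sgr_id.
rewrite (_ : Num.sg (_ `^ _) = 1) ?mulr1 -?numEsg//.
by rewrite gtr0_sg// powR_gt0// normr_gt0.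
Qed.

Lemma norm_spow_q (s : R) : `|spow p s| `^ q = `|s| `^ p.
Proof. by rewrite norm_spow ?p_gt1// -powRrM mul_p1q. Qed.

Lemma norm_spow_p (s : R) : `|spow q s| `^ p = `|s| `^ q.
Proof. by rewrite norm_spow ?q_gt1// -powRrM mul_q1p. Qed.

Definition spowv m (r : R) (x : 'cV[R]_m) : 'cV[R]_m := \col_i spow r (x i 0).

Lemma psum_spow_q m (x : 'cV[R]_m) : psum q (spowv p x) = psum p x.
Proof. by rewrite !psumE; apply: eq_bigr => i _; rewrite mxE norm_spow_q. Qed.

Lemma psum_spow_p m (x : 'cV[R]_m) : psum p (spowv q x) = psum q x.
Proof. by rewrite !psumE; apply: eq_bigr => i _; rewrite mxE norm_spow_p. Qed.

Lemma dotc_spow m (r : R) (x : 'cV[R]_m) : 1 < r -> dotc x (spowv r x) = psum r x.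
Proof. by clear p_gt1; move=> r1; rewrite dotc_sum psumE; apply: eq_bigr => i _; rewrite mxE mul_spow. Qed.

Lemma young (a b : R) : a * b <= `|a| `^ p / p + `|b| `^ q / q.
Proof.
apply: (le_trans (ler_norm _)); rewrite normrM.
by apply: conjugate_powR; rewrite ?p_gt0 ?q_gt0 ?conjE.
Qed.

(* Equality in Young's inequality makes the difference of the two sides, as a
   function of [b], attain its minimum. *)
Lemma young_eq (a b : R) : a * b = `|a| `^ p / p + `|b| `^ q / q -> a = spow q b.
Proof.
move=> eqab.
pose f (s : R) : R := `|s| `^ q * q^-1 + (- a) * s + `|a| `^ p / p.
have f_der (s : R) : is_derive s (1 : R) f (spow q s - a).
  have dq := @is_derive_abs_powR R q q_gt1 s.
  apply: is_derive_eq.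
  rewrite !scaleRE; field; rewrite gt_eqF ?q_gt0//.
have f_ge0 s : 0 <= f s by have := young a s; rewrite /f; lra.
have fb : f b = 0 by rewrite /f; lra.
have [||||d0 f0] := @derive1_at_min R f (b - 1) (b + 1) b.
- lra.
- by move=> t _; have [] := f_der t.
- by rewrite in_itv/=; apply/andP; split; lra.
- by move=> t _; rewrite fb f_ge0.
have [_ fb'] := f_der b.
by move: f0; rewrite fb' => /eqP; rewrite subr_eq0 => /eqP.
Qed.

Lemma hoelder_le1 m (x y : 'cV[R]_m) : psum p x <= 1 -> psum q y <= 1 ->
  dotc x y <= 1.
Proof.
move=> xp yq; apply: (@le_trans _ _ (psum p x / p + psum q y / q)).
  rewrite dotc_sum !psumE !mulr_suml -big_split.
  by apply: ler_sum => i _; exact: young.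
rewrite -conjE -[leRHS]add0r; have := p_gt0; have := q_gt0 => q0 p0.
by rewrite add0r lerD// ler_piMl// invr_ge0 ltW.
Qed.

Lemma powR_normalize (r s : R) : 0 < r -> 0 < s ->
  `|(s `^ r^-1)^-1| `^ r * s = 1.
Proof.
move=> r0 s0; rewrite normfV ger0_norm ?powR_ge0// -powRN -powRrM mulNr.
by rewrite mulVf ?gt_eqF// powRN powRr1 ?ltW// mulVf ?gt_eqF.
Qed.

Lemma hoelder_le m (x y : 'cV[R]_m) :
  dotc x y <= psum p x `^ p^-1 * psum q y `^ q^-1.
Proof.
have p0 := p_gt0; have q0 := q_gt0.
have [->|x0] := eqVneq x 0.
  rewrite dotc_sum big1 ?mulr_ge0 ?powR_ge0// => i _; by rewrite mxE mul0r.
have [->|y0] := eqVneq y 0.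
  rewrite dotc_sum big1 ?mulr_ge0 ?powR_ge0// => i _; by rewrite mxE mulr0.
have X0 : 0 < psum p x `^ p^-1 by rewrite powR_gt0 ?psum_gt0.
have Y0 : 0 < psum q y `^ q^-1 by rewrite powR_gt0 ?psum_gt0.
have Xp : psum p ((psum p x `^ p^-1)^-1 *: x) <= 1.
  by rewrite psumZ (powR_normalize p0 (psum_gt0 p0 x0)).
have Yq : psum q ((psum q y `^ q^-1)^-1 *: y) <= 1.
  by rewrite psumZ (powR_normalize q0 (psum_gt0 q0 y0)).
have := hoelder_le1 Xp Yq.
have -> : dotc ((psum p x `^ p^-1)^-1 *: x) ((psum q y `^ q^-1)^-1 *: y) =
    (psum p x `^ p^-1 * psum q y `^ q^-1)^-1 * dotc x y.
  rewrite !dotc_sum mulr_sumr; apply: eq_bigr => i _; rewrite !mxE invfM.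
  exact: mulrACA.
clear Xp Yq => XY1.
have XY0 := mulr_gt0 X0 Y0.
by move: XY1; rewrite mulrC ler_pdivrMr// mul1r.
Qed.

(** The defects in Young's inequality are nonnegative with sum at most zero, so each of them
    vanishes. *)
Lemma hoelder_eq m (x y : 'cV[R]_m) : psum p x <= 1 -> psum q y <= 1 ->
  dotc x y = 1 -> x = spowv q y.
Proof.
move=> xp yq xy1; have p0 := p_gt0; have q0 := q_gt0.
have le_sum : \sum_i (`|x i 0| `^ p / p + `|y i 0| `^ q / q - x i 0 * y i 0) <= 0.
  rewrite sumrB big_split/= -!mulr_suml -dotc_sum -!psumE xy1 -conjE.
  rewrite subr_le0 lerD// ler_piMl// invr_ge0 ltW//.
have terms_ge0 i : 0 <= `|x i 0| `^ p / p + `|y i 0| `^ q / q - x i 0 * y i 0.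
  by rewrite subr_ge0 young.
have sum0 : \sum_i (`|x i 0| `^ p / p + `|y i 0| `^ q / q - x i 0 * y i 0) = 0.
  by apply/eqP; rewrite eq_le le_sum sumr_ge0.
apply/colP => i; rewrite mxE; apply: young_eq.
move/eqP: sum0; rewrite psumr_eq0// => /allP/(_ i (mem_index_enum i)) /=.
by rewrite subr_eq0 => /eqP.
Qed.

End Conjugate.

(* [extremal p O M a] : the norm of [O] from l_q to l_p is [M], attained at [a]. *)
Definition extremal (R : realType) n (p : R) (O : 'M[R]_n) (M : R) (a : 'cV[R]_n) :=
  [/\ 0 < M, psum (conj_exp p) a = 1, psum p (O *m a) = M `^ p &
    forall x, psum p (O *m x) <= M `^ p * psum (conj_exp p) x `^ (p - 1)].

Section Extremal.
Variables (R : realType) (n : nat) (p : R) (O : 'M[R]_n).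
Hypotheses (p_gt2 : 2 < p) (n_gt0 : (0 < n)%N) (O_orth : orthogonal_mx O).
Local Notation q := (conj_exp p).
Let p1 : 1 < p. Proof. by apply: lt_trans p_gt2; lra. Qed.
Let p0 := p_gt0 p1.
Let q0 := q_gt0 p1.
Let q1 := q_gt1 p1.

Lemma orth_mulT : O^T *m O = 1%:M.
Proof. by apply: mulmx1C; exact: O_orth. Qed.

Lemma dotc_orth (x y : 'cV[R]_n) : dotc (O *m x) (O *m y) = dotc x y.
Proof. by rewrite dotc_mulmx mulmxA orth_mulT mul1mx. Qed.

(** The unit sphere of l_q is compact, and homogeneity handles all other vectors. The maximum is
    positive because [O] is injective. *)
Lemma extremal_exists : exists M a, extremal p O M a.
Proof.
pose S := [set x : 'rV[R]_n | psum q x^T = 1].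
have trc : continuous (fun x : 'rV[R]_n => x^T).
  apply: cont_mx => i j; under eq_fun do rewrite mxE; exact: coord_continuous.
have mulc : continuous (fun x : 'rV[R]_n => O *m x^T).
  apply: cont_mx => i j; under eq_fun do rewrite mxE.
  apply: cont_sum => k; apply: contM; first exact: cont_cst.
  by under eq_fun do rewrite mxE; exact: coord_continuous.
pose i0 := Ordinal n_gt0.
pose e0 : 'cV[R]_n := \col_i (i == i0)%:R.
have psum_e0 r : 0 < r -> psum r e0 = 1.
  move=> r0; rewrite psumE (bigD1 i0)//= mxE eqxx normr1 powR1 big1 ?addr0//.
  by move=> i ii0; rewrite mxE (negPf ii0) normr0 powR0// gt_eqF.
have [||| a' Sa' amax] := @EVT_max_rV R n (fun x => psum p (O *m x^T)) S.
- by exists e0^T; rewrite /S/= trmxK psum_e0.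
- apply: bounded_closed_compact.
    exists 1; split=> [|x x1 v Sv]; first exact: num_real.
    apply: (le_trans _ (ltW x1)); apply: mx_norm_le => // i j.
    rewrite ord1 leNgt; apply/negP => v1.
    have := coord_le_psum q v^T j; rewrite Sv mxE leNgt => /negP; apply.
    by have := powR_pos_ltr q0 ler01 v1; rewrite powR1.
  have -> : S = (fun x : 'rV[R]_n => psum q x^T) @^-1` [set 1] by [].
  apply: closed_comp; last exact: closed_eq.
  by move=> x _; exact: (cont_comp trc (cont_psum q0)).
- apply: continuous_subspaceT; exact: (cont_comp mulc (cont_psum p0)).
set m := psum p (O *m a'^T) in amax.
pose a := a'^T; have Sa : psum q a = 1 by move: Sa'; rewrite inE.
have a_neq0 : a != 0.
  by apply: contra_eq_neq Sa => ->; rewrite psum0// eq_sym oner_neq0.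
have Oa_neq0 : O *m a != 0.
  apply: contra_neq a_neq0 => Oa0.
  by rewrite -[a]mul1mx -orth_mulT -mulmxA Oa0 mulmx0.
have m0 : 0 < m by apply: psum_gt0.
exists (m `^ p^-1), a; split => //.
- by rewrite powR_gt0.
- by rewrite powRKV ?(lt0r_neq0 p0) ?(ltW m0).
move=> x; rewrite powRKV ?(lt0r_neq0 p0) ?(ltW m0)//.
have [->|x_neq0] := eqVneq x 0.
  by rewrite mulmx0 psum0// mulr_ge0 ?powR_ge0// ltW.
have X0 : 0 < psum q x by exact: psum_gt0.
pose c := (psum q x `^ q^-1)^-1.
have cE : c = psum q x `^ (- q^-1) by rewrite powRN.
have c0 : 0 < c by rewrite invr_gt0 powR_gt0.
have /amax : (c *: x)^T \in S.
  by rewrite inE /S/= trmxK psumZ (powR_normalize q0 X0).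
rewrite trmxK -scalemxAr psumZ gtr0_norm// cE -powRrM mulNr powRN.
rewrite ler_pdivrMl ?powR_gt0// mulrC.
by rewrite (divpq p1).
Qed.

Variables (M : R) (a : 'cV[R]_n).
Hypothesis ext : extremal p O M a.
Let M0 : 0 < M. Proof. by case: ext. Qed.

(** The unit vector of l_q on which [O *m a], as a functional, attains its norm. *)
Definition ext_b : 'cV[R]_n := spowv p (M^-1 *: (O *m a)).

Lemma psum_ext_b : psum q ext_b = 1.
Proof.
rewrite psum_spow_q// psumZ gtr0_norm ?invr_gt0//; case: ext => _ _ -> _.
by rewrite -powRM ?invr_ge0 ?ltW// mulVf ?gt_eqF// powR1.
Qed.

Lemma ext_O : O *m a = M *: spowv q ext_b.
Proof.
apply/colP => i; rewrite !mxE spowKq// mulrA mulfV ?mul1r ?gt_eqF//.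
Qed.

Lemma extremal_bilinear (x y : 'cV[R]_n) :
  dotc (O *m x) y <= M * (psum q x `^ q^-1 * psum q y `^ q^-1).
Proof.
have H := hoelder_le p1 (O *m x) y.
apply: (le_trans H); rewrite mulrA; apply: ler_wpM2r; first exact: powR_ge0.
case: ext => _ _ _ /(_ x) Ox.
have pi0 : 0 <= p^-1 by rewrite invr_ge0 ltW.
apply: (le_trans (powR_pos_mono pi0 (psum_ge0 _ _) Ox)).
by rewrite -(p1_div p); apply: eqle; exact: powR_root_mul (ltW M0).
Qed.

(** This is the Euler-Lagrange equation of the extremal problem. The vector [w] has norm at most 1
    in l_p by duality and pairs to 1 with [a], which is equality in Hoelder's inequality. *)
Lemma ext_OT : O^T *m ext_b = M *: spowv q a.
Proof.
have dual x : dotc x (O^T *m ext_b) <= M * psum q x `^ q^-1.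
  rewrite -dotc_mulmx; apply: (le_trans (extremal_bilinear _ _)).
  by rewrite psum_ext_b powR1 mulr1.
pose w := M^-1 *: (O^T *m ext_b).
have wE : w = spowv q a.
  apply: hoelder_eq => //; last first.
  - rewrite dotcC /w; case: (ext) => _ a1 Oa _.
    have : dotc a (O^T *m ext_b) = M.
      rewrite -dotc_mulmx ext_O.
      have -> : dotc (M *: spowv q ext_b) ext_b = M * dotc ext_b (spowv q ext_b).
        by rewrite dotcC !dotc_sum mulr_sumr; apply: eq_bigr => i _; rewrite !mxE; ring.
      by rewrite dotc_spow// psum_ext_b mulr1.
    move=> aOb; rewrite (_ : dotc _ _ = M^-1 * dotc a (O^T *m ext_b)).
      by rewrite aOb mulVf// gt_eqF.
    by rewrite !dotc_sum mulr_sumr; apply: eq_bigr => i _; rewrite !mxE; ring.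
  - by case: ext => _ -> _ _.
  have [->|w0] := eqVneq w 0; first by rewrite psum0.
  (* Duality is tested on the vector that norms [w]. *)
  have := dual (spowv p w).
  have W0 : 0 < psum p w by exact: psum_gt0.
  have -> : O^T *m ext_b = M *: w by rewrite /w scalerA mulfV ?scale1r// gt_eqF.
  have -> : dotc (spowv p w) (M *: w) = M * psum p w.
    rewrite -dotc_spow// dotcC !dotc_sum mulr_sumr.
    by apply: eq_bigr => i _; rewrite [(M *: w) i 0]mxE mulrA.
  rewrite psum_spow_q// ler_pM2l//.
  rewrite {1}(_ : psum p w = psum p w `^ p^-1 * psum p w `^ q^-1); last first.
    by rewrite -powR_gt0D// (conjE p1) powRr1// ltW.
  rewrite -[X in _ <= X]mul1r ler_pM2r ?powR_gt0//.
  move=> W1; rewrite leNgt; apply/negP => W2.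
  have : 1 < psum p w `^ p^-1.
    have pi0 : 0 < p^-1 by rewrite invr_gt0.
    by have := powR_pos_ltr pi0 ler01 W2; rewrite powR1.
  by rewrite ltNge W1.
by rewrite -wE /w scalerA mulfV ?scale1r// gt_eqF.
Qed.

End Extremal.

(** Young's inequality is applied to each entry and to the constant [b], the value of [u ^ (r - 1)]
    at the uniform vector; the equality case is [young_eq]. *)
Lemma power_mean (R : realType) n (r : R) (u : 'cV[R]_n) : (0 < n)%N -> 1 < r ->
  (forall i, 0 <= u i 0) -> \sum_i u i 0 = 1 ->
  n%:R `^ (1 - r) <= psum r u /\
  (psum r u <= n%:R `^ (1 - r) -> forall i, u i 0 = n%:R^-1).
Proof.
move=> n0 r1 u0 sum1; set N : R := n%:R.
have N0 : 0 < N by rewrite ltr0n.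
have r0 := p_gt0 r1; have q0 := q_gt0 r1.
set b := N `^ (1 - r).
have bq : `|b| `^ conj_exp r = N `^ (- r).
  rewrite ger0_norm ?powR_ge0// -powRrM -[1 - r]opprB mulNr.
  by rewrite mul_p1q.
have sum_young : \sum_i (`|u i 0| `^ r / r + `|b| `^ conj_exp r / conj_exp r -
    u i 0 * b) = (psum r u - b) / r.
  rewrite sumrB big_split/= -!mulr_suml -psumE sum1 sumr_const card_ord bq.
  have -> : N `^ (- r) *+ n = b.
    rewrite -mulr_natl -/N /b powR_gt0D// powRr1//; exact: ltW.
  have <- : 1 - r^-1 = (conj_exp r)^-1 by rewrite -(conjE r1) addrAC subrr add0r.
  ring.
have young_ge0 i : 0 <= `|u i 0| `^ r / r + `|b| `^ conj_exp r / conj_exp r -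
    u i 0 * b by rewrite subr_ge0; exact: young.
split.
  have : 0 <= (psum r u - b) / r by rewrite -sum_young; exact: sumr_ge0.
  by rewrite pmulr_lge0 ?invr_gt0// subr_ge0.
move=> psum_le i.
have : \sum_i (`|u i 0| `^ r / r + `|b| `^ conj_exp r / conj_exp r - u i 0 * b) = 0.
  apply/eqP; rewrite eq_le sumr_ge0// andbT sum_young.
  by rewrite pmulr_lle0 ?invr_gt0// subr_le0.
move/eqP; rewrite psumr_eq0 => [/allP/(_ i (mem_index_enum i))|j _]; last exact: young_ge0.
move=> /=; rewrite subr_eq0 => /eqP/esym/(young_eq r1) ->.
rewrite spow_pos ?powR_ge0//; last exact: q_gt1.
have r10 : 0 < r - 1 by rewrite subr_gt0.
by rewrite /b -powRrM (q1E r1) -opprB mulNr mulfV ?(lt0r_neq0 r10)// powRN powRr1 ?(ltW N0).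
Qed.

(** * Bounds for the norm, and the case of Hadamard matrices *)

Section OpNormBounds.
Variables (R : realType) (n : nat) (p : R) (O : 'M[R]_n).
Hypotheses (p_gt2 : 2 < p) (n_gt0 : (0 < n)%N) (O_orth : orthogonal_mx O).
Local Notation q := (conj_exp p).
Let p1 : 1 < p. Proof. by apply: lt_trans p_gt2; lra. Qed.
Let p0 := p_gt0 p1.
Let q0 := q_gt0 p1.
Let N : R := n%:R.
Let N0 : 0 < N. Proof. by rewrite ltr0n. Qed.
Variables (M : R) (a : 'cV[R]_n).
Hypothesis ext : extremal p O M a.
Let M0 : 0 < M. Proof. by case: ext. Qed.

Lemma psum2_orth (x : 'cV[R]_n) : psum 2 (O *m x) = psum 2 x.
Proof. by rewrite !psum2 dotc_orth. Qed.

Lemma le1_psum_mono (r s : R) (x : 'cV[R]_n) : 0 < r -> r <= s ->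
  (forall i, `|x i 0| <= 1) -> psum s x <= psum r x.
Proof.
move=> r0 rs x1; rewrite !psumE; apply: ler_sum => i _.
have [->|xi] := eqVneq (x i 0) 0.
  by rewrite normr0 !powR0// ?gt_eqF// (lt_le_trans r0).
by apply: ger_powR => //; rewrite normr_gt0 xi x1.
Qed.

Lemma psum_le1_coord (r : R) (x : 'cV[R]_n) : 0 < r -> psum r x <= 1 ->
  forall i, `|x i 0| <= 1.
Proof.
move=> r0 x1 i; rewrite leNgt; apply/negP => xi.
have := powR_pos_ltr r0 ler01 xi; rewrite powR1.
by rewrite ltNge (le_trans (coord_le_psum r x i)).
Qed.

Lemma opnorm_le1 : M <= 1.
Proof.
case: ext => _ a1 Oa _.
have a2 : psum 2 a <= 1.
  rewrite -[X in _ <= X]a1; apply: (le1_psum_mono q0 (ltW (q_lt2 p1 p_gt2))).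
  by apply: (psum_le1_coord q0); rewrite a1.
have Oa2 : psum 2 (O *m a) <= 1 by rewrite psum2_orth.
have : M `^ p <= 1.
  rewrite -Oa; apply: (le_trans _ Oa2); apply: le1_psum_mono => //; first exact: ltW.
  by apply: (psum_le1_coord _ Oa2).
move=> Mp; rewrite leNgt; apply/negP => M1.
by have := powR_pos_ltr p0 ler01 M1; rewrite powR1 ltNge Mp.
Qed.

(** The squares in a column form a probability vector, to which the power mean inequality with
    exponent p/2 applies. *)
Let sqcol j : 'cV[R]_n := \col_i (O i j ^+ 2).

Let sqcol_sum j : \sum_i sqcol j i 0 = 1.
Proof.
have : (O^T *m O) j j = 1 by rewrite orth_mulT// mxE eqxx.
by rewrite mxE => <-; apply: eq_bigr => i _; rewrite !mxE expr2.
Qed.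

Let sqcol_psum j : psum (p / 2) (sqcol j) = psum p (O *m delta_mx j 0).
Proof.
rewrite -colE !psumE; apply: eq_bigr => i _; rewrite !mxE.
rewrite normrX -powR_mulrn// -powRrM; congr (_ `^ _).
by rewrite mulrC divfK// pnatr_eq0.
Qed.

Let col_le j : psum p (O *m delta_mx j 0) <= M `^ p.
Proof.
case: ext => _ _ _ /(_ (delta_mx j 0)).
have -> : psum q (delta_mx j 0 : 'cV[R]_n) = 1.
  rewrite psumE (bigD1 j)//= mxE !eqxx normr1 powR1 big1 ?addr0// => i ij.
  by rewrite mxE (negPf ij) normr0 powR0// gt_eqF.
by rewrite powR1 mulr1.
Qed.

Let half_p : 1 < p / 2. Proof. by rewrite ltr_pdivlMr// mul1r. Qed.

Lemma opnorm_ge : N `^ (1 - p / 2) <= M `^ p.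
Proof.
have j := Ordinal n_gt0; apply: le_trans (col_le j); rewrite -sqcol_psum.
have [] // := @power_mean R n (p / 2) (sqcol j) n_gt0 half_p.
by move=> i; rewrite mxE sqr_ge0.
Qed.

Lemma opnorm_min_hadamard : M `^ p <= N `^ (1 - p / 2) -> normalized_hadamard O.
Proof.
move=> Mp; split=> // i j.
have [||_] // := @power_mean R n (p / 2) (sqcol j) n_gt0 half_p.
  by move=> k; rewrite mxE sqr_ge0.
rewrite sqcol_psum (le_trans (col_le j))// => /(_ isT i); rewrite mxE => Oij.
rewrite -sqrtr_sqr Oij -powR12_sqrt ?invr_ge0//.
by rewrite -powR_inv1// -powRrM mulN1r.
Qed.

(** Flatness of the entries bounds the largest entry of [a] through the Euler-Lagrange equation;
    with [psum q a = 1] this bounds [psum 2 a], which is [M ^+ 2 * S] because [O] is orthogonal. The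
    factor [S] then cancels. *)
Lemma opnorm_hadamard3 : 3 <= p -> normalized_hadamard O ->
  M `^ p <= N `^ (1 - p / 2).
Proof.
move=> p3 [_ Oflat].
have a1 : psum q a = 1 by case: ext.
pose bh := M^-1 *: (O *m a); pose S := psum 2 bh.
have bh1 : psum p bh = 1.
  rewrite psumZ gtr0_norm ?invr_gt0//; case: ext => _ _ -> _.
  by rewrite -powRM ?invr_ge0 ?(ltW M0)// mulVf ?(lt0r_neq0 M0)// powR1.
have bh_neq0 : bh != 0.
  by apply: contra_eq_neq bh1 => ->; rewrite psum0// eq_sym oner_neq0.
have S0 : 0 < S by apply: psum_gt0.
have MS : M ^+ 2 * S = psum 2 a.
  rewrite /S psumZ psum2_orth mulrA normfV gtr0_norm//.
  by rewrite powR_mulrn ?invr_ge0 ?(ltW M0)// -exprMn mulfV ?(lt0r_neq0 M0)// expr1n mul1r.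
pose Y := psum (p - 1) bh.
have p20 : 0 < p - 2 by rewrite subr_gt0.
(* The exponent p - 1 is interpolated between p and 2 with weight 1/(p - 2), at most 1 because
   [3 <= p]. *)
have YS : Y <= S `^ (p - 2)^-1.
  have t01 : 0 <= (p - 2)^-1 <= 1.
    rewrite invr_ge0 (ltW p20) invf_le1//=; lra.
  have := @sum_powR_interpolation R _ (fun i => `|bh i 0|) p 2 (p - 2)^-1
    (fun i => normr_ge0 _) t01 p0 (ltr0Sn _ 1).
  rewrite -!psumE => /(_ bh1).
  have -> : p * (1 - (p - 2)^-1) + 2 * (p - 2)^-1 = p - 1.
    by field; rewrite gt_eqF.
  exact.
have N12 : 0 < N `^ (- 2^-1) by rewrite powR_gt0.
pose A := N `^ (- 2^-1) * Y / M.
have A_ge i : `|a i 0| `^ (q - 1) <= A.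
  rewrite -(norm_spow (q_gt1 p1)).
  have := congr1 (fun x : 'cV[R]_n => `|x i 0|) (ext_OT p_gt2 ext).
  rewrite [X in _ = `|X| -> _]mxE [spowv _ _ _ _]mxE normrM (gtr0_norm M0) => eqM.
  rewrite /A ler_pdivlMr// mulrC -eqM mxE.
  apply: (le_trans (ler_norm_sum _ _ _)); rewrite /Y psumE mulr_sumr.
  apply: ler_sum => j _; rewrite mxE normrM Oflat /ext_b mxE norm_spow//.
have A0 : 0 <= A by apply: le_trans (powR_ge0 _ _) (A_ge (Ordinal n_gt0)).
have a2A : psum 2 a <= A `^ (p - 2).
  rewrite -[leRHS]mul1r -[X in _ <= X * _]a1 !psumE mulr_suml.
  apply: ler_sum => i _.
  (* The surplus of the exponent 2 over q is (q - 1)(p - 2), and that power is bounded by [A_ge]. *)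
  rewrite [X in _ `^ X <= _](_ : 2 = q + (q - 1) * (p - 2)); last first.
    by rewrite (q1E p1) conj_expE; field; rewrite gt_eqF// subr_gt0.
  have [->|ai] := eqVneq (a i 0) 0.
    rewrite normr0 powR0 ?mulr_ge0 ?powR_ge0// gt_eqF// addr_gt0// mulr_gt0//.
    by rewrite subr_gt0 q_gt1.
  rewrite powR_gt0D ?normr_gt0// ler_wpM2l ?powR_ge0// powRrM.
  exact: (powR_pos_mono (ltW p20) (powR_ge0 _ _) (A_ge i)).
have AS : A `^ (p - 2) <= N `^ (1 - p / 2) * S / M `^ (p - 2).
  have -> : A `^ (p - 2) = N `^ (1 - p / 2) * Y `^ (p - 2) / M `^ (p - 2).
    rewrite /A powRM ?mulr_ge0 ?invr_ge0 ?(ltW M0) ?(ltW N12) ?psum_ge0//.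
    rewrite powRM ?(ltW N12) ?psum_ge0// -powRrM; congr (_ `^ _ * _ * _).
      by field.
    by rewrite powR_inv// ltW.
  rewrite ler_pM2r ?invr_gt0 ?powR_gt0// ler_pM2l ?powR_gt0//.
  rewrite -[leRHS](@powRKV _ (p - 2)) ?(lt0r_neq0 p20) ?(ltW S0)//.
  exact: (powR_pos_mono (ltW p20) (psum_ge0 _ _) YS).
have main : M ^+ 2 * S <= N `^ (1 - p / 2) * S / M `^ (p - 2).
  rewrite MS; exact: le_trans a2A AS.
clear AS a2A; have Mp0 : 0 < M `^ (p - 2) by exact: powR_gt0.
move: main; rewrite (ler_pdivlMr _ _ Mp0) mulrAC (ler_pM2r S0).
rewrite -powR_mulrn ?(ltW M0)// -powR_gt0D//.
by rewrite addrCA subrr addr0.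
Qed.

(** P = 2/(3 - p) is the exponent whose conjugate is 2/(p - 1), so that the power sum of [ext_b]
    with the conjugate exponent is [S]. The inequality for the transpose at P bounds a power sum of
    [a], and interpolating the exponent 2 between q and P/(p - 1) replaces the bound on the largest
    entry used for [3 <= p]. *)
Lemma opnorm_hadamard_step : p < 3 -> normalized_hadamard O ->
  (forall x : 'cV[R]_n, psum (2 / (3 - p)) (O^T *m x) <=
    N `^ (1 - (2 / (3 - p)) / 2) *
    psum (conj_exp (2 / (3 - p))) x `^ (2 / (3 - p) - 1)) ->
  M `^ p <= N `^ (1 - p / 2).
Proof.
move=> p3 _.
have p30 : 0 < 3 - p by rewrite subr_gt0.
have p10 : 0 < p - 1 by rewrite subr_gt0.
set P := 2 / (3 - p) => IH.
have P1 : 1 < P by rewrite ltr_pdivlMr//; move: p_gt2; lra.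
have P0 : 0 < P by exact: lt_trans P1.
have a1 : psum q a = 1 by case: ext.
pose bh := M^-1 *: (O *m a); pose S := psum 2 bh.
have bh1 : psum p bh = 1.
  rewrite psumZ gtr0_norm ?invr_gt0//; case: ext => _ _ -> _.
  by rewrite -powRM ?invr_ge0 ?(ltW M0)// mulVf ?(lt0r_neq0 M0)// powR1.
have bh_neq0 : bh != 0.
  by apply: contra_eq_neq bh1 => ->; rewrite psum0// eq_sym oner_neq0.
have S0 : 0 < S by apply: psum_gt0.
have MS : M ^+ 2 * S = psum 2 a.
  rewrite /S psumZ psum2_orth mulrA normfV gtr0_norm//.
  by rewrite powR_mulrn ?invr_ge0 ?(ltW M0)// -exprMn mulfV ?(lt0r_neq0 M0)// expr1n mul1r.
pose T := psum (P / (p - 1)) a.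
have := IH (ext_b p O M a); rewrite (ext_OT p_gt2 ext) psumZ gtr0_norm//.
have -> : psum P (spowv q a) = T.
  rewrite /T !psumE; apply: eq_bigr => i _; rewrite mxE (norm_spow (q_gt1 p1)).
  by rewrite -powRrM (q1E p1) mulrC.
have -> : psum (conj_exp P) (ext_b p O M a) = S.
  rewrite /S !psumE; apply: eq_bigr => i _; rewrite mxE norm_spow//.
  rewrite -powRrM; congr (_ `^ _).
  by rewrite conj_expE /P; field; rewrite !gt_eqF//=; move: p_gt2; lra.
move=> TS.
pose x := (3 - p) / (p - 1).
have x01 : 0 <= x <= 1.
  by rewrite divr_ge0 ?(ltW p30) ?(ltW p10)//= ler_pdivrMr// mul1r; move: p_gt2; lra.
have /andP[x0 x1] := x01.
have aT : psum 2 a <= T `^ x.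
  have Pp : 0 < P / (p - 1) by rewrite divr_gt0.
  have := @sum_powR_interpolation R _ (fun i => `|a i 0|) q (P / (p - 1)) x
    (fun i => normr_ge0 _) x01 q0 Pp.
  rewrite -!psumE => /(_ a1).
  have -> : q * (1 - x) + P / (p - 1) * x = 2.
    by rewrite /x /P conj_expE; field; rewrite !gt_eqF.
  exact.
have T_le : T <= N `^ (1 - P / 2) * S `^ (P - 1) / M `^ P.
  have MP0 : 0 < M `^ P by exact: powR_gt0.
  rewrite (ler_pdivlMr _ _ MP0) mulrC; exact: TS.
have Tx : T `^ x <= N `^ ((2 - p) / (p - 1)) * S / M `^ (2 / (p - 1)).
  apply: (le_trans (powR_pos_mono x0 (psum_ge0 _ _) T_le)).
  rewrite powRM ?mulr_ge0 ?powR_ge0 ?invr_ge0 ?powR_ge0//.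
  rewrite powRM ?powR_ge0// powR_inv ?powR_ge0// -!powRrM.
  have -> : (1 - P / 2) * x = (2 - p) / (p - 1).
    by rewrite /x /P; field; rewrite !gt_eqF.
  have -> : (P - 1) * x = 1 by rewrite /x /P; field; rewrite !gt_eqF.
  have -> : P * x = 2 / (p - 1) by rewrite /x /P; field; rewrite !gt_eqF.
  by rewrite powRr1// ltW.
have main : M ^+ 2 * S <= N `^ ((2 - p) / (p - 1)) * S / M `^ (2 / (p - 1)).
  rewrite MS; exact: le_trans aT Tx.
clear Tx T_le aT TS IH; have Mp0 : 0 < M `^ (2 / (p - 1)) by exact: powR_gt0.
move: main; rewrite (ler_pdivlMr _ _ Mp0) mulrAC (ler_pM2r S0).
rewrite -powR_mulrn ?(ltW M0)// -powR_gt0D// => main.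
have h0 : 0 <= (p - 1) / 2 by rewrite divr_ge0// ltW.
have := powR_pos_mono h0 (powR_ge0 _ _) main; rewrite -!powRrM.
have -> : (2 + 2 / (p - 1)) * ((p - 1) / 2) = p by field; rewrite gt_eqF.
have -> : (2 - p) / (p - 1) * ((p - 1) / 2) = 1 - p / 2 by field; rewrite gt_eqF.
exact.
Qed.

End OpNormBounds.

Lemma hadamardT (R : realType) n (O : 'M[R]_n) :
  normalized_hadamard O -> normalized_hadamard O^T.
Proof.
move=> [Oo Of]; split; last by move=> i j; rewrite mxE Of.
by rewrite /orthogonal_mx trmxK; exact: orth_mulT.
Qed.

(* Hausdorff-Young inequality for Hadamard matrices; doubling [p - 2] brings
   [p] above [3]. *)
Lemma hadamard_opnorm (R : realType) n (k : nat) (p : R) (O : 'M[R]_n) :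
  (0 < n)%N -> 2 < p -> 1 <= 2 ^+ k * (p - 2) -> normalized_hadamard O ->
  forall M a, extremal p O M a -> M `^ p <= n%:R `^ (1 - p / 2).
Proof.
move=> n0; elim: k p O => [|k IH] p O p2 pk Oh M a ext.
  by apply: (opnorm_hadamard3 p2 n0 Oh.1 ext) => //; move: pk; rewrite expr0; lra.
have [p3|p3] := leP 3 p; first exact: (opnorm_hadamard3 p2 n0 Oh.1 ext).
apply: (opnorm_hadamard_step p2 Oh.1 ext) => //.
have p30 : 0 < 3 - p by rewrite subr_gt0.
set P := 2 / (3 - p).
have P2 : 2 < P by rewrite ltr_pdivlMr//; lra.
(* As 3 - p < 1, the number P - 2 is at least twice p - 2. *)
have Pk : 1 <= 2 ^+ k * (P - 2).
  apply: (le_trans pk); rewrite exprSr -mulrA ler_wpM2l ?exprn_ge0//.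
  have -> : P - 2 = 2 * (p - 2) / (3 - p) by rewrite /P; field; rewrite gt_eqF.
  by rewrite ler_pdivlMr// ler_piMr ?mulr_ge0//; lra.
have [M' [a' ext']] := extremal_exists P2 n0 (hadamardT Oh).1.
have M'P := IH P O^T P2 Pk (hadamardT Oh) M' a' ext'.
move=> x; case: ext' => _ _ _ /(_ x)/le_trans; apply.
by rewrite ler_wpM2r// powR_ge0.
Qed.

(** * Discrete Fourier modes *)

Section SineBounds.
Variable R : realType.
Implicit Types x : R.

Lemma sin_le_id x : 0 <= x -> sin x <= x.
Proof.
move=> x0; have [c _] := @MVT_is_derive R sin cos 0 x x0 (fun t => is_derive_sin t).
rewrite sin0 !subr0 => ->; rewrite ler_piMl// cos_le1//.
Qed.

Lemma sin_ge_cos x : 0 <= x <= pi -> x * cos x <= sin x.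
Proof.
move=> /andP[x0 xpi].
have [c /andP[c0 cx]] := @MVT_is_derive R sin cos 0 x x0 (fun t => is_derive_sin t).
rewrite sin0 !subr0 => ->; rewrite mulrC ler_wpM2r//.
move: cx; rewrite le_eqVlt => /predU1P[->//|cx]; apply: ltW.
by rewrite ltr_cos// in_itv/= ?c0 ?x0// (le_trans (ltW cx)).
Qed.

Lemma pi_lt4 : (pi : R) < 4.
Proof.
have := pihalf_lt2 R; rewrite ltr_pdivrMr//; lra.
Qed.

(** If the mean slope of the sine on [0, x] were below 1/2, the one on [x, pi/2] would be above 1/2
    because pi < 4, whereas the cosine decreases. *)
Lemma sin_ge_half x : 0 <= x <= pi / 2 -> x / 2 <= sin x.
Proof.
move=> /andP[x0 xpi]; rewrite leNgt; apply/negP => sinx.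
have pi4 := pi_lt4; have pi0 := pi_gt0 R.
have [c /andP[c0 cx]] := @MVT_is_derive R sin cos 0 x x0 (fun t => is_derive_sin t).
have [e /andP[xe epi]] := @MVT_is_derive R sin cos x (pi / 2) xpi (fun t => is_derive_sin t).
rewrite sin0 sin_pihalf !subr0 => eqe eqc.
have x_gt0 : 0 < x.
  by rewrite lt_def x0 andbT; apply: contraTneq sinx => ->; rewrite sin0 mul0r ltxx.
have xpi' : 0 < pi / 2 - x.
  rewrite subr_gt0 lt_def xpi andbT; apply: contraTneq sinx => <-.
  by rewrite sin_pihalf -leNgt; lra.
have cosc : cos c < 2^-1.
  by rewrite -(ltr_pM2r x_gt0) -eqc mulrC.
have cose : 2^-1 < cos e.
  rewrite -(ltr_pM2r xpi') -eqe; lra.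
have : cos e <= cos c.
  have : c <= e by exact: le_trans cx xe.
  rewrite le_eqVlt => /predU1P[->//|ce]; apply: ltW.
  by rewrite ltr_cos// in_itv/= ?c0 ?(le_trans c0 (ltW ce))//=; lra.
lra.
Qed.

Lemma cos_period (j : nat) x : cos (x + 2 * pi * j%:R) = cos x.
Proof.
elim: j => [|j IH]; first by rewrite mulr0 addr0.
have -> : x + 2 * pi * j.+1%:R = (x + 2 * pi * j%:R) + pi *+ 2.
  by rewrite -[j.+1%:R]natr1; ring.
by rewrite cosD2pi.
Qed.

Lemma sin_period (j : nat) x : sin (x + 2 * pi * j%:R) = sin x.
Proof.
elim: j => [|j IH]; first by rewrite mulr0 addr0.
have -> : x + 2 * pi * j.+1%:R = (x + 2 * pi * j%:R) + pi *+ 2.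
  by rewrite -[j.+1%:R]natr1; ring.
by rewrite sinD2pi.
Qed.

(** Multiplied by [2 * sin b], with [b] half the increment of the angle, the sum telescopes. *)
Lemma sum_cos_eq0 (N j : nat) (phi : R) : (0 < j < N)%N ->
  \sum_(t < N) cos (2 * pi * j%:R * t%:R / N%:R + phi) = 0.
Proof.
move=> /andP[j0 jN]; have N0 : (0 < N)%N by exact: leq_trans jN.
have NR : (N%:R : R) != 0 by rewrite pnatr_eq0 -lt0n.
pose b : R := pi * j%:R / N%:R.
have sb : sin b != 0.
  rewrite gt_eqF// sin_gt0_pi// divr_gt0 ?mulr_gt0 ?pi_gt0 ?ltr0n//=.
  by rewrite ltr_pdivrMr ?ltr0n// ltr_pM2l ?pi_gt0// ltr_nat.
apply: (mulfI (_ : 2 * sin b != 0)); first by rewrite mulf_neq0// pnatr_eq0.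
rewrite mulr0 mulr_sumr.
transitivity (\sum_(t < N) (sin ((2 * t.+1%:R - 1) * b + phi) -
    sin ((2 * t%:R - 1) * b + phi))).
  apply: eq_bigr => t _.
  have -> : 2 * pi * j%:R * t%:R / N%:R + phi = 2 * t%:R * b + phi.
    by rewrite /b; field.
  have -> : (2 * t.+1%:R - 1) * b + phi = (2 * t%:R * b + phi) + b.
    by rewrite -[t.+1%:R]natr1; ring.
  have -> : (2 * t%:R - 1) * b + phi = (2 * t%:R * b + phi) - b by ring.
  rewrite sinD sinB; ring.
rewrite -(big_mkord xpredT (fun t => sin ((2 * t.+1%:R - 1) * b + phi) -
    sin ((2 * t%:R - 1) * b + phi))) telescope_sumr//.
have -> : (2 * N%:R - 1) * b + phi = (2 * 0%:R - 1) * b + phi + 2 * pi * j%:R.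
  by rewrite /b; field.
by rewrite sin_period subrr.
Qed.

Lemma sum_cos_eq0N (N j : nat) (phi : R) : (0 < j < N)%N ->
  \sum_(t < N) cos (- (2 * pi * j%:R) * t%:R / N%:R + phi) = 0.
Proof.
move=> jN; rewrite -[RHS](sum_cos_eq0 (- phi) jN); apply: eq_bigr => t _.
by rewrite -[RHS]cosN; congr cos; ring.
Qed.

End SineBounds.

(** * Eigenmodes of the discrete time derivative *)

Section Modes.
Variables (R : realType) (M : nat).
(** An odd number of steps, so that the frequencies are -M, ..., M and [pi * freq / nsteps] stays
    inside (-pi/2, pi/2): [mode_lam] increases with the frequency and vanishes only at frequency
    0. *)
Definition nsteps := M.*2.+1.

Lemma ltn_nsteps k : (k <= M)%N -> (M + k < nsteps)%N.
Proof. by move=> kM; rewrite /nsteps; lia. Qed.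

Local Notation N := nsteps.
Definition mode := ('I_N * bool)%type.
Implicit Types i j : mode.

Definition freq i : R := i.1%:R - M%:R.
Definition phase i : R := if i.2 then pi / 2 else 0.
(** Positions are sampled at integral times and momenta halfway between them; the difference of each
    component of a mode is then, up to sign, exactly [mode_lam] times the other component. The two
    phases give as many modes as there are values. *)
Definition modeX i (t : nat) : R := cos (2 * pi * freq i * t%:R / N%:R + phase i).
Definition modeY i (t : nat) : R :=
  - sin (2 * pi * freq i * (t%:R + 2^-1) / N%:R + phase i).
Definition mode_lam i : R := 2 * N%:R * sin (pi * freq i / N%:R).

Let NR : (N%:R : R) != 0. Proof. by rewrite pnatr_eq0. Qed.

Lemma modeX_step i t :
  N%:R * (modeX i t.+1 - modeX i t) = mode_lam i * modeY i t.
Proof.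
rewrite /modeX /modeY /mode_lam.
set b := pi * freq i / N%:R.
have -> : 2 * pi * freq i * (t%:R + 2^-1) / N%:R + phase i =
  2 * b * t%:R + phase i + b by rewrite /b; field.
have -> : 2 * pi * freq i * t%:R / N%:R + phase i = 2 * b * t%:R + phase i.
  by rewrite /b; field.
have -> : 2 * pi * freq i * t.+1%:R / N%:R + phase i =
    (2 * b * t%:R + phase i + b) + b.
  by rewrite -[t.+1%:R]natr1 /b; field.
set u := 2 * b * t%:R + phase i + b.
have -> : 2 * b * t%:R + phase i = u - b by rewrite /u; ring.
rewrite cosD cosB; ring.
Qed.

Lemma modeY_step i t :
  N%:R * (modeY i t - modeY i t.+1) = mode_lam i * modeX i t.+1.
Proof.
rewrite /modeX /modeY /mode_lam.
set b := pi * freq i / N%:R.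
set u := 2 * pi * freq i * t.+1%:R / N%:R + phase i.
have -> : 2 * pi * freq i * (t%:R + 2^-1) / N%:R + phase i = u - b.
  by rewrite /u /b -[t.+1%:R]natr1; field.
have -> : 2 * pi * freq i * (t.+1%:R + 2^-1) / N%:R + phase i = u + b.
  by rewrite /u /b; field.
rewrite (sinB u) (sinD u); ring.
Qed.

Lemma mode_periodic i t : modeX i (t + N) = modeX i t /\ modeY i (t + N) = modeY i t.
Proof.
have E : 2 * pi * freq i = 2 * pi * i.1%:R - 2 * pi * M%:R by rewrite /freq; ring.
split; rewrite /modeX /modeY.
  rewrite -(cos_period M) -[RHS](cos_period i.1); congr cos.
  by rewrite E natrD; field.
congr (- _); rewrite -(sin_period M) -[RHS](sin_period i.1); congr sin.
by rewrite E natrD; field.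
Qed.

Lemma modeX_le1 i t : `|modeX i t| <= 1.
Proof. by rewrite ler_norml cos_geN1 cos_le1. Qed.

Lemma modeY_le1 i t : `|modeY i t| <= 1.
Proof. by rewrite normrN ler_norml sin_geN1 sin_le1. Qed.

Let sum_cos_freq (c phi : R) (a b : nat) : (a < N)%N -> (b < N)%N -> a != b ->
  c = 2 * pi * (a%:R - b%:R) ->
  \sum_(t < N) cos (c * t%:R / N%:R + phi) = 0.
Proof.
move=> aN bN ab ->; move: ab; rewrite neq_ltn => /orP[ab|ab].
  rewrite -[RHS](@sum_cos_eq0N R N (b - a) phi); last first.
    by rewrite subn_gt0 ab (leq_ltn_trans (leq_subr _ _)).
  by apply: eq_bigr => t _; rewrite natrB 1?ltnW//; congr (cos (_ * _ / _ + _)); ring.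
rewrite -[RHS](@sum_cos_eq0 R N (a - b) phi); last first.
  by rewrite subn_gt0 ab (leq_ltn_trans (leq_subr _ _)).
by apply: eq_bigr => t _; rewrite natrB 1?ltnW.
Qed.

(** Products become cosines of differences and of sums of the angles. The latter cancel between
    positions and momenta, which are half a step apart: either both sums vanish, or the frequencies
    add up to 0 and the shift has no effect. *)
Lemma mode_orthogonal i j :
  \sum_(t < N) (modeX i t * modeX j t + modeY i t * modeY j t) =
  (i == j)%:R * N%:R.
Proof.
pose ca := 2 * pi * (freq i - freq j); pose cb := 2 * pi * (freq i + freq j).
pose pa := phase i - phase j; pose pb := phase i + phase j.
transitivity (2^-1 * (\sum_(t < N) cos (ca * t%:R / N%:R + pa) +
    \sum_(t < N) cos (cb * t%:R / N%:R + pb) +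
    \sum_(t < N) cos (ca * t%:R / N%:R + (ca / 2 / N%:R + pa)) -
    \sum_(t < N) cos (cb * t%:R / N%:R + (cb / 2 / N%:R + pb)))).
  rewrite -!big_split -sumrB mulr_sumr; apply: eq_bigr => t _ /=.
  rewrite /modeX /modeY mulrNN.
  set a := 2 * pi * freq i * t%:R / N%:R + phase i.
  set a' := 2 * pi * freq j * t%:R / N%:R + phase j.
  set b := 2 * pi * freq i * (t%:R + 2^-1) / N%:R + phase i.
  set b' := 2 * pi * freq j * (t%:R + 2^-1) / N%:R + phase j.
  have -> : ca * t%:R / N%:R + pa = a - a' by rewrite /ca /pa /a /a'; ring.
  have -> : cb * t%:R / N%:R + pb = a + a' by rewrite /cb /pb /a /a'; ring.
  have -> : ca * t%:R / N%:R + (ca / 2 / N%:R + pa) = b - b'.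
    by rewrite /ca /pa /b /b'; field.
  have -> : cb * t%:R / N%:R + (cb / 2 / N%:R + pb) = b + b'.
    by rewrite /cb /pb /b /b'; field.
  rewrite (cosB a) (cosD a) (cosB b) (cosD b).
  by clearbody a a' b b'; field.
have caE : ca = 2 * pi * (i.1%:R - j.1%:R) by rewrite /ca /freq; ring.
have cbE : cb = 2 * pi * (i.1%:R - (M.*2 - j.1)%N%:R).
  rewrite natrB; last by rewrite -ltnS.
  by rewrite /cb /freq -muln2 natrM; ring.
have jN : (M.*2 - j.1 < N)%N by rewrite ltnS leq_subr.
have cb_part : \sum_(t < N) cos (cb * t%:R / N%:R + pb) =
    \sum_(t < N) cos (cb * t%:R / N%:R + (cb / 2 / N%:R + pb)).
  have [eq0|neq0] := eqVneq (i.1 : nat) (M.*2 - j.1)%N.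
    have -> : cb = 0 by rewrite cbE eq0 subrr mulr0.
    by apply: eq_bigr => t _; rewrite !mul0r !add0r.
  by rewrite (sum_cos_freq _ (ltn_ord i.1) jN neq0 cbE)
    (sum_cos_freq _ (ltn_ord i.1) jN neq0 cbE).
rewrite cb_part addrAC addrK.
have [eqi|neqi] := eqVneq (i.1 : nat) (j.1 : nat); last first.
  rewrite !(sum_cos_freq _ (ltn_ord i.1) (ltn_ord j.1) neqi caE) addr0 mulr0.
  by case: eqP => [ij|_]; [rewrite ij eqxx in neqi|rewrite mul0r].
have -> : ca = 0 by rewrite caE eqi subrr mulr0.
have E1 : \sum_(t < N) cos (0 * t%:R / N%:R + pa) = cos pa * N%:R.
  rewrite -[N in RHS]card_ord -sum1_card natr_sum mulr_sumr.
  by apply: eq_bigr => t _; rewrite !mul0r add0r mulr1.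
have -> : 0 / 2 / N%:R + pa = pa by rewrite !mul0r add0r.
have half (u : R) : 2^-1 * (u + u) = u by field.
rewrite E1 half.
congr (_ * _); rewrite /pa /phase.
have -> : (i == j) = (i.2 == j.2).
  case: i j eqi {ca cb pa pb caE cbE cb_part E1 jN} => [i1 i2] [j1 j2] /= eqi.
  by rewrite xpair_eqE (val_inj eqi) eqxx.
case: i.2; case: j.2 => /=.
- by rewrite subrr cos0.
- by rewrite subr0 cos_pihalf.
- by rewrite sub0r cosN cos_pihalf.
- by rewrite subr0 cos0.
Qed.

(* Completeness: the square matrix of the modes is orthogonal up to the
   factor [N]. *)
Lemma mode_complete (t r : 'I_N) :
  [/\ \sum_i modeX i t * modeX i r = (t == r)%:R * N%:R,
      \sum_i modeY i t * modeY i r = (t == r)%:R * N%:R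
    & \sum_i modeX i t * modeY i r = 0].
Proof.
pose U : 'M[R]_#|{: mode}| := \matrix_(k, l)
  let: (s, b) := (enum_val l : mode) in
  if b then modeY (enum_val k) s else modeX (enum_val k) s.
have UUT : (N%:R^-1 *: U) *m U^T = 1%:M.
  apply/matrixP => k l; rewrite -scalemxAl !mxE.
  have -> : \sum_k0 U k k0 * U^T k0 l = \sum_(t < N) (modeX (enum_val k) t *
      modeX (enum_val l) t + modeY (enum_val k) t * modeY (enum_val l) t).
    rewrite (reindex (fun tb : mode => enum_rank tb)); last first.
      by apply: onW_bij; exact: enum_rank_bij.
    transitivity (\sum_(s < N) \sum_(b : bool) U k (enum_rank (s, b)) *
      U^T (enum_rank (s, b)) l).
      by rewrite pair_bigA; apply: eq_bigr => -[s b] _.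
    apply: eq_bigr => s _; rewrite big_bool addrC /=.
    by rewrite !mxE !enum_rankK.
  by rewrite mode_orthogonal (inj_eq enum_val_inj) mulrC mulfK.
have UTU := mulmx1C UUT.
have entry (b c : bool) : \sum_i
    (if b then modeY i t else modeX i t) * (if c then modeY i r else modeX i r) =
    ((t, b) == (r, c))%:R * N%:R.
  have := congr1 (fun A : 'M[R]__ => A (enum_rank (t, b)) (enum_rank (r, c))) UTU.
  rewrite !mxE (inj_eq enum_rank_inj) => <-.
  rewrite mulr_suml (reindex (fun i : mode => enum_rank i)); last first.
    by apply: onW_bij; exact: enum_rank_bij.
  have scale (u v : R) : u * v = u * (N%:R^-1 * v) * N%:R by field.
  by apply: eq_bigr => i _; rewrite !mxE !enum_rankK; exact: scale.
split; have := entry.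
- by move=> /(_ false false); rewrite xpair_eqE eqxx andbT.
- by move=> /(_ true true); rewrite xpair_eqE eqxx andbT.
- by move=> /(_ false true); rewrite xpair_eqE andbF mul0r.
Qed.

Lemma freq_le i : `|freq i| <= M%:R.
Proof.
rewrite /freq ler_distl.
have iN : (i.1 <= M.*2)%N by rewrite -ltnS.
apply/andP; split; first by rewrite subrr ler0n.
by rewrite -natrD ler_nat addnn.
Qed.

Lemma freq_angle i : 0 <= freq i -> 0 <= pi * freq i / N%:R <= pi / 2.
Proof.
move=> f0; have pi0 := pi_gt0 R; have N0 : (0 : R) < N%:R by rewrite ltr0n.
rewrite divr_ge0 ?mulr_ge0 ?(ltW pi0)//= ler_pdivrMr// -mulrA ler_pM2l//.
rewrite mulrC ler_pdivlMr//.
have := freq_le i; rewrite ger0_norm// => fM.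
rewrite (le_trans (ler_wpM2r _ fM))// /nsteps -[M.*2.+1%:R]natr1 -muln2 natrM.
by rewrite lerDl.
Qed.

Lemma freq_ge1 i : (0 < freq i) = (1 <= freq i).
Proof.
rewrite /freq subr_gt0 ltr_nat lerBrDl natr1 ler_nat.
by [].
Qed.

Lemma mode_lam_ge i : 0 <= freq i -> freq i <= mode_lam i.
Proof.
move=> f0; have N0 : (0 : R) < N%:R by rewrite ltr0n.
have := sin_ge_half (freq_angle f0); rewrite /mode_lam.
have := pi_ge2 R => pi2 h.
have : 2 * N%:R * (pi * freq i / N%:R / 2) <= 2 * N%:R * sin (pi * freq i / N%:R).
  by rewrite ler_wpM2l// mulr_ge0// ltW.
have -> : 2 * N%:R * (pi * freq i / N%:R / 2) = pi * freq i by field.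
apply: le_trans; rewrite ler_peMl//; lra.
Qed.

Lemma mode_lam_le0 i : freq i <= 0 -> mode_lam i <= 0.
Proof.
move=> f0; have N0 : (0 : R) < N%:R by rewrite ltr0n.
rewrite /mode_lam mulr_ge0_le0 ?mulr_ge0//.
rewrite -oppr_ge0 -sinN.
have f0' : 0 <= - freq i by rewrite oppr_ge0.
have -> : - (pi * freq i / N%:R) = pi * - freq i / N%:R by ring.
apply: sin_ge0_pi; have pi0 := pi_gt0 R.
rewrite divr_ge0 ?mulr_ge0 ?(ltW pi0)//= ler_pdivrMr// ler_pM2l//.
have := freq_le i; rewrite ler_norml => /andP[fM _].
by rewrite lerNl (le_trans _ fM)// lerN2 /nsteps ler_nat -addnn; lia.
Qed.

Lemma mode_lam_gt0 i : (0 < mode_lam i) = (0 < freq i).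
Proof.
apply/idP/idP; first by apply: contraTT; rewrite -!leNgt; exact: mode_lam_le0.
by move=> f0; apply: lt_le_trans f0 (mode_lam_ge (ltW f0)).
Qed.

Lemma mode_lam1_le i : freq i = 1 -> mode_lam i <= 2 * pi.
Proof.
move=> f1; have N0 : (0 : R) < N%:R by rewrite ltr0n.
have pi0 := pi_gt0 R; rewrite /mode_lam f1 mulr1.
have := @sin_le_id R (pi / N%:R); rewrite divr_ge0 ?(ltW pi0)// => /(_ isT) h.
have := ler_wpM2l (ltW (mulr_gt0 (ltr0Sn R 1) N0)) h.
by have -> : 2 * N%:R * (pi / N%:R) = 2 * pi :> R by field.
Qed.

Lemma mode_lam_mono i j : 0 <= freq i -> freq i <= freq j ->
  mode_lam i <= mode_lam j.
Proof.
move=> f0 ij; have N0 : (0 : R) < N%:R by rewrite ltr0n.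
have pi0 := pi_gt0 R; rewrite /mode_lam ler_wpM2l ?mulr_ge0//.
move: ij; rewrite le_eqVlt => /predU1P[->//|ij]; apply: ltW.
have fj0 : 0 <= freq j by apply: ltW; exact: le_lt_trans ij.
have /andP[i1 i2] := freq_angle f0; have /andP[j1 j2] := freq_angle fj0.
rewrite ltr_sin ?in_itv/=.
- by rewrite ltr_pM2r ?invr_gt0// ltr_pM2l.
- by rewrite i2 andbT; lra.
- by rewrite j2 andbT; lra.
Qed.

(** A lower bound that tends to 2 pi k as the number of steps grows. *)
Lemma mode_lam_ge_cos i (k : R) : 0 <= k -> freq i = k ->
  2 * pi * k * cos (pi * k / N%:R) <= mode_lam i.
Proof.
move=> k0 fk; have N0 : (0 : R) < N%:R by rewrite ltr0n.
have pi0 := pi_gt0 R.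
have f0 : 0 <= freq i by rewrite fk.
have /andP[i1 i2] := freq_angle f0; rewrite /mode_lam fk in i1 i2 *.
have := @sin_ge_cos R (pi * k / N%:R); rewrite i1 (le_trans i2) => [/(_ isT) h|]; last lra.
have := ler_wpM2l (ltW (mulr_gt0 (ltr0Sn R 1) N0)) h; apply: le_trans.
by rewrite le_eqVlt; apply/orP; left; apply/eqP; field.
Qed.

End Modes.

(** * Phase space *)

Section PhaseSpace.
Variables (R : realType) (n : nat).
Local Notation P := (phase_space R n).
Implicit Types (z w u v : P) (k : 'I_n * bool).

Definition pc k z : R := if k.2 then z.2 k.1 0 else z.1 k.1 0.

Definition dotp u v : R := \sum_k pc k u * pc k v.

(** Hamilton's equations for a function with gradient [G] read z' = [ham_rot (G z)]. *)
Definition ham_rot u : P := (u.2, - u.1).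

Lemma pcD k u v : pc k (u + v) = pc k u + pc k v.
Proof. by case: k => j [] /=; rewrite /pc /= mxE. Qed.

Lemma pcN k u : pc k (- u) = - pc k u.
Proof. by case: k => j [] /=; rewrite /pc /= mxE. Qed.

Lemma pcB k u v : pc k (u - v) = pc k u - pc k v.
Proof. by rewrite pcD pcN. Qed.

Lemma pcZ k (a : R) u : pc k (a *: u) = a * pc k u.
Proof. by case: k => j [] /=; rewrite /pc /= mxE. Qed.

Lemma pc0 k : pc k 0 = 0.
Proof. by case: k => j [] /=; rewrite /pc /= mxE. Qed.

Lemma pc_inj u v : (forall k, pc k u = pc k v) -> u = v.
Proof.
move=> uv; rewrite [u]surjective_pairing [v]surjective_pairing.
congr (_, _); apply/colP => j; first exact: (uv (j, false)).
exact: (uv (j, true)).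
Qed.

Lemma prod_norm u : `|u| = Order.max `|u.1| `|u.2|.
Proof. by []. Qed.

Lemma pc_le_norm k z : `|pc k z| <= `|z|.
Proof.
rewrite prod_norm le_max /pc.
by case: k.2; rewrite coord_le_mx_norm ?orbT.
Qed.

Lemma phase_norm_le z (e : R) : 0 <= e -> (forall k, `|pc k z| <= e) -> `|z| <= e.
Proof.
move=> e0 ze; rewrite prod_norm ge_max.
apply/andP; split; apply: mx_norm_le => // i j; rewrite ord1.
  exact: (ze (i, false)).
exact: (ze (i, true)).
Qed.

Lemma cont_pc (T : topologicalType) (f : T -> P) k :
  continuous f -> continuous (fun x => pc k (f x)).
Proof.
move=> fc x; apply/cvgrPdist_le => e e0.
have /cvgrPdist_le/(_ e e0) := fc x.
apply: filterS => y; apply: le_trans.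
by rewrite -pcB; exact: pc_le_norm.
Qed.

Lemma cont_phase (T : topologicalType) (f : T -> P) :
  (forall k, continuous (fun x => pc k (f x))) -> continuous f.
Proof.
move=> fc x; apply/cvgrPdist_le => e e0.
have : \forall y \near x, forall k, `|pc k (f x) - pc k (f y)| <= e.
  by apply: filter_forall => k; have /cvgrPdist_le/(_ e e0) := fc k x.
apply: filterS => y fxy; apply: phase_norm_le; first exact: ltW.
by move=> k; rewrite pcB.
Qed.

Lemma dotpC u v : dotp u v = dotp v u.
Proof. by apply: eq_bigr => k _; rewrite mulrC. Qed.

Lemma dotpDl u v w : dotp (u + v) w = dotp u w + dotp v w.
Proof. by rewrite -big_split; apply: eq_bigr => k _; rewrite pcD mulrDl. Qed.

Lemma dotpZl (a : R) u w : dotp (a *: u) w = a * dotp u w.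
Proof. by rewrite mulr_sumr; apply: eq_bigr => k _; rewrite pcZ mulrA. Qed.

Lemma dotpNl u w : dotp (- u) w = - dotp u w.
Proof. by rewrite -scaleN1r dotpZl mulN1r. Qed.

Lemma dotpBl u v w : dotp (u - v) w = dotp u w - dotp v w.
Proof. by rewrite dotpDl dotpNl. Qed.

Lemma dotpDr u v w : dotp u (v + w) = dotp u v + dotp u w.
Proof. by rewrite dotpC dotpDl -!(dotpC u). Qed.

Lemma dotpZr (a : R) u w : dotp u (a *: w) = a * dotp u w.
Proof. by rewrite dotpC dotpZl dotpC. Qed.

Lemma dotp0l w : dotp 0 w = 0.
Proof. by rewrite -(scale0r (0 : P)) dotpZl mul0r. Qed.

Lemma dotp_pair u v :
  dotp u v = \sum_j (u.1 j 0 * v.1 j 0 + u.2 j 0 * v.2 j 0).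
Proof.
rewrite /dotp; transitivity (\sum_j \sum_b pc (j, b) u * pc (j, b) v).
  by rewrite pair_bigA; apply: eq_bigr => -[j b] _.
by apply: eq_bigr => j _; rewrite big_bool addrC.
Qed.

Lemma omega_ham_rot u v : omega (ham_rot u) v = dotp u v.
Proof.
by rewrite dotp_pair; apply: eq_bigr => j _; rewrite !mxE; ring.
Qed.

Lemma cont_dotp (T : topologicalType) (f g : T -> P) :
  continuous f -> continuous g -> continuous (fun x => dotp (f x) (g x)).
Proof.
by move=> fc gc; apply: cont_sum => k; apply: contM; exact: cont_pc.
Qed.

Lemma dotp_ge0 u : 0 <= dotp u u.
Proof. by apply: sumr_ge0 => k _; exact: sqr_ge0. Qed.

Lemma norm_sq_le_dotp u : `|u| ^+ 2 <= dotp u u.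
Proof.
rewrite -(@sqr_sqrtr _ (dotp u u)) ?dotp_ge0// ler_sqr ?nnegrE ?sqrtr_ge0//.
apply: phase_norm_le; rewrite ?sqrtr_ge0// => k.
rewrite -sqrtr_sqr ler_wsqrtr// /dotp (bigD1 k)//= -expr2 lerDl.
by apply: sumr_ge0 => l _; exact: sqr_ge0.
Qed.

Lemma dotp_le_norm u v : `|dotp u v| <= (n * 2)%:R * (`|u| * `|v|).
Proof.
apply: (le_trans (ler_norm_sum _ _ _)).
rewrite -[(n * 2)%N](_ : #|{: 'I_n * bool}| = _); last first.
  by rewrite card_prod card_ord card_bool.
rewrite mulr_natl -sumr_const; apply: ler_sum => k _.
by rewrite normrM ler_pM ?pc_le_norm.
Qed.

Lemma compact_pball (C : R) : compact [set z : P | `|z| <= C].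
Proof.
have cb : compact [set x : 'cV[R]_n | `|x| <= C].
  have : compact ((fun x : 'rV[R]_n => x^T) @` [set x | `|x| <= C]).
    apply: continuous_compact.
      apply: continuous_subspaceT; apply: cont_mx => i j.
      by under eq_fun => x do rewrite mxE; exact: coord_continuous.
    apply: bounded_closed_compact.
      exists C; split; [rewrite num_real|move=> x Cx c /= /le_trans->//; exact: ltW].
      by [].
    have := @closed_closed_ball_ R 'rV[R]_n 0 C.
    by congr closed; apply/seteqP; split => c /=; rewrite /closed_ball_/= sub0r normrN.
  have trN m l (A : 'M[R]_(m, l)) : `|A^T| = `|A|.
    apply/eqP; rewrite eq_le; apply/andP; split; apply: mx_norm_le => // i j.
      by rewrite mxE coord_le_mx_norm.
    by have := coord_le_mx_norm A^T j i; rewrite mxE.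
  congr compact; apply/seteqP; split => [x [y yC <-]|x xC] /=; first by rewrite trN.
  by exists x^T; rewrite /= ?trN// trmxK.
have := compact_setX cb cb; congr compact.
apply/seteqP; split => [[x y] [/= xC yC]|[x y]] /=.
  by rewrite prod_norm ge_max xC.
by rewrite prod_norm ge_max => /andP[].
Qed.

Lemma pball_bound (f : P -> R) (C : R) : continuous f ->
  exists2 B, 0 <= B & forall z, `|z| <= C -> f z <= B.
Proof.
move=> fc; have [C0|C0] := ltP C 0.
  by exists 0 => // z zC; have := le_lt_trans zC C0; rewrite normr_lt0.
have [||c _ cmax] := @compact_EVT_max _ R f _ _ (@compact_pball C).
- by exists 0; rewrite /= normr0.
- exact: continuous_subspaceT.
exists (Order.max (f c) 0); first by rewrite le_max lexx orbT.
by move=> z zC; rewrite le_max cmax// inE.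
Qed.

Lemma pball_unif (f : P -> P) (C e : R) : continuous f -> 0 < e ->
  exists2 d, 0 < d & forall z w, `|z| <= C -> `|w| <= C ->
    `|z - w| < d -> `|f z - f w| < e.
Proof.
move=> fc e0.
pose A := [set zw : P * P | (`|zw.1| <= C /\ `|zw.2| <= C) /\
  e <= `|f zw.1 - f zw.2|].
have c1 : continuous (fun zw : P * P => zw.1) by move=> x; exact: cvg_fst.
have c2 : continuous (fun zw : P * P => zw.2) by move=> x; exact: cvg_snd.
have dc (h : P -> P) : continuous h ->
    continuous (fun zw : P * P => `|h zw.1 - h zw.2|).
  move=> hc x; apply: cvg_norm; apply: cvgB.
    by apply: (cont_comp c1 hc).
  by apply: (cont_comp c2 hc).
have A_compact : compact A.
  have := compact_setX (@compact_pball C) (@compact_pball C).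
  have : closed [set zw : P * P | e <= `|f zw.1 - f zw.2|].
    apply: (@preimage_closed _ _ (fun zw : P * P => `|f zw.1 - f zw.2|)
      [set x | e <= x]); last exact: closed_ge.
    by move=> x _; exact: dc.
  move=> cl cp.
  have -> : A = ([set z : P | `|z| <= C] `*` [set z : P | `|z| <= C]) `&`
      [set zw : P * P | e <= `|f zw.1 - f zw.2|] by [].
  exact: compact_closedI.
have [/set0P/= A0|/negPn/eqP A0] := boolP (A != set0); last first.
  exists 1 => // z w zC wC _; rewrite ltNge; apply/negP => ezw.
  have : A (z, w) by [].
  by rewrite A0.
have [|c cA cmin] := @compact_EVT_min _ R (fun zw => `|zw.1 - zw.2|) _ A0 A_compact.
  by apply: continuous_subspaceT; apply: (dc id) => x; exact: cvg_id.
exists `|c.1 - c.2|.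
  rewrite normr_gt0 subr_eq0; apply/eqP => cc.
  by move: cA; rewrite inE => -[_]; rewrite cc subrr normr0 leNgt e0.
move=> z w zC wC zw; rewrite ltNge; apply/negP => ezw.
have Azw : A (z, w) by [].
by have := cmin (z, w) (mem_set Azw); rewrite leNgt zw.
Qed.

(** Points closer than [d'] are handled by uniform continuity; for all others [2 * B / d'] is a
    sufficient Lipschitz constant. *)
Lemma compact_supp_modulus (f : P -> P) (C : R) : continuous f ->
  (forall z, C <= `|z| -> f z = 0) ->
  exists2 B, 0 <= B & (forall z, `|f z| <= B) /\
    forall e, 0 < e -> exists2 K, 0 <= K &
      forall z w, `|f z - f w| <= e + K * `|z - w|.
Proof.
move=> fc f0.
have fnc : continuous (fun z => `|f z|) by move=> x; apply: cvg_norm; exact: fc.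
have [B B0 fB] := pball_bound C fnc; exists B => //.
have fB' z : `|f z| <= B.
  have [zC|/ltW Cz] := leP `|z| C; first exact: fB.
  by rewrite f0// normr0.
split=> // e e0; have [d d0 fd] := @pball_unif f (C + 1) e fc e0.
pose d' := Order.min d 1.
have d'0 : 0 < d' by rewrite lt_min d0 ltr01.
exists (2 * B / d'); first by rewrite divr_ge0 ?mulr_ge0// ltW.
move=> z w; have [zw|zw] := ltP `|z - w| d'; last first.
  have : `|f z - f w| <= 2 * B.
    have := ler_normB (f z) (f w); have := fB' z; have := fB' w; lra.
  move=> /le_trans; apply; rewrite -[leLHS]add0r; apply: lerD; first exact: ltW.
  by rewrite mulrAC ler_pdivlMr// ler_wpM2l// mulr_ge0.
have rhs : e <= e + 2 * B / d' * `|z - w|.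
  by rewrite lerDl mulr_ge0// divr_ge0 ?mulr_ge0// ltW.
apply: le_trans rhs.
move: zw; rewrite lt_min => /andP[zwd zw1].
have zw' : `|z| <= `|w| + `|z - w| by have := ler_normD (z - w) w; rewrite subrK addrC.
have wz' : `|w| <= `|z| + `|z - w|.
  by have := ler_normD (w - z) z; rewrite subrK distrC addrC.
have [zC|Cz] := leP `|z| C.
  by apply: ltW; apply: fd => //; lra.
have [wC|Cw] := leP `|w| C.
  by apply: ltW; apply: fd => //; lra.
by rewrite !f0 ?ltW// subrr normr0.
Qed.

End PhaseSpace.

(** * Discrete loops *)

Section LoopCoordinates.
Variables (R : realType) (n M : nat).
Local Notation P := (phase_space R n).
Local Notation N := (nsteps M).
Definition lmode := (mode M * 'I_n)%type.
Local Notation d := #|{: lmode}|.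
Implicit Types (i : lmode) (c v : 'rV[R]_d) (t : nat) (u w : P).

Definition cf c i : R := c 0 (enum_rank i).

(** The value at time [t] of the discrete loop with Fourier coefficients [c]. *)
Definition lift_t t c : P :=
  (\col_j \sum_m cf c (m, j) * modeX R m t, \col_j \sum_m cf c (m, j) * modeY R m t).

Definition mproj i t u : R := u.1 i.2 0 * modeX R i.1 t + u.2 i.2 0 * modeY R i.1 t.

Lemma cfD c v i : cf (c + v) i = cf c i + cf v i.
Proof. by rewrite /cf mxE. Qed.

Lemma cfZ (s : R) c i : cf (s *: c) i = s * cf c i.
Proof. by rewrite /cf mxE. Qed.

Lemma cf_row (f : 'I_d -> R) i : cf (\row_k f k) i = f (enum_rank i).
Proof. by rewrite /cf mxE. Qed.

Lemma sum_cf (f : 'I_d -> R) : \sum_k f k = \sum_i f (enum_rank i).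
Proof.
by rewrite (reindex (@enum_rank lmode))//; apply: onW_bij; exact: enum_rank_bij.
Qed.

Lemma sum_lmode (f : lmode -> R) : \sum_i f i = \sum_j \sum_m f (m, j).
Proof. by rewrite exchange_big pair_bigA; apply: eq_bigr => -[m j]. Qed.

Lemma lift_tD t c v : lift_t t (c + v) = lift_t t c + lift_t t v.
Proof.
congr (_, _); apply/colP => j; rewrite !mxE -big_split; apply: eq_bigr => m _.
  by rewrite cfD mulrDl.
by rewrite cfD mulrDl.
Qed.

Lemma lift_tZ t (s : R) c : lift_t t (s *: c) = s *: lift_t t c.
Proof.
congr (_, _); apply/colP => j; rewrite !mxE mulr_sumr; apply: eq_bigr => m _.
  by rewrite cfZ mulrA.
by rewrite cfZ mulrA.
Qed.

Lemma lift_tB t c v : lift_t t (c - v) = lift_t t c - lift_t t v.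
Proof. by rewrite -scaleN1r lift_tD lift_tZ scaleN1r. Qed.

Lemma dotp_lift t c u : dotp u (lift_t t c) = \sum_i cf c i * mproj i t u.
Proof.
rewrite dotp_pair sum_lmode; apply: eq_bigr => j _.
rewrite !mxE !mulr_sumr -big_split; apply: eq_bigr => m _ /=.
by rewrite /mproj /=; ring.
Qed.

Lemma mprojB i t u w : mproj i t (u - w) = mproj i t u - mproj i t w.
Proof. by rewrite /mproj !mxE; ring. Qed.

Lemma mproj_le i t u : `|mproj i t u| <= 2 * `|u|.
Proof.
rewrite /mproj (le_trans (ler_normD _ _))// !normrM.
have h1 := pc_le_norm (i.2, false) u; have h2 := pc_le_norm (i.2, true) u.
have := ler_pM (normr_ge0 _) (normr_ge0 _) h1 (@modeX_le1 R M i.1 t).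
have := ler_pM (normr_ge0 _) (normr_ge0 _) h2 (@modeY_le1 R M i.1 t).
rewrite /pc /= !mulr1; lra.
Qed.

Lemma lift_le t c : `|lift_t t c| <= #|{: lmode}|%:R * `|c|.
Proof.
apply: phase_norm_le; first by rewrite mulr_ge0.
have cfc i : `|cf c i| <= `|c| by exact: coord_le_mx_norm.
have sum_le (j : 'I_n) (f : mode M -> R) : (forall m, `|f m| <= 1) ->
    `|\sum_m cf c (m, j) * f m| <= #|{: lmode}|%:R * `|c|.
  move=> f1; apply: (le_trans (ler_norm_sum _ _ _)).
  rewrite mulr_natl -sumr_const.
  rewrite (sum_lmode (fun=> `|c|)) (bigD1 j)//= -[leLHS]addr0 lerD//.
    apply: ler_sum => m _; rewrite normrM.
    by rewrite -[leRHS]mulr1 ler_pM.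
  by apply: sumr_ge0 => l _; apply: sumr_ge0.
move=> [j []]; rewrite /pc /= mxE; apply: sum_le => m.
  exact: modeY_le1.
exact: modeX_le1.
Qed.

Lemma mproj_lift i c : \sum_(t < N) mproj i t (lift_t t c) = N%:R * cf c i.
Proof.
case: i => m j; transitivity (\sum_(t < N) \sum_l cf c (l, j) *
    (modeX R l t * modeX R m t + modeY R l t * modeY R m t)).
  apply: eq_bigr => t _; rewrite /mproj /= !mxE !mulr_suml -big_split.
  by apply: eq_bigr => l _ /=; ring.
rewrite exchange_big (bigD1 m)//= -mulr_sumr mode_orthogonal eqxx mul1r.
rewrite big1 ?addr0 1?mulrC// => l lm.
by rewrite -mulr_sumr mode_orthogonal (negPf lm) mul0r mulr0.
Qed.

Lemma parseval c v :
  \sum_(t < N) dotp (lift_t t c) (lift_t t v) = N%:R * \sum_i cf c i * cf v i.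
Proof.
under eq_bigr do rewrite dotp_lift.
rewrite exchange_big mulr_sumr; apply: eq_bigr => i _.
by rewrite -mulr_sumr mproj_lift; ring.
Qed.

Lemma NR_neq0 : (N%:R : R) != 0. Proof. by rewrite pnatr_eq0. Qed.

Lemma lift_complete (w : 'I_N -> P) (t : 'I_N) :
  lift_t t (\row_k (N%:R^-1 * \sum_(s < N) mproj (enum_val k) s (w s))) = w t.
Proof.
have NR := NR_neq0.
have [hX hY] : (forall s : 'I_N, \sum_(m : mode M) modeX R m s * modeX R m t =
    (s == t)%:R * N%:R) /\ (forall s : 'I_N, \sum_(m : mode M)
    modeY R m s * modeY R m t = (s == t)%:R * N%:R).
  by split=> s; have [] := @mode_complete R M s t.
have hXY (s : 'I_N) : \sum_(m : mode M) modeX R m s * modeY R m t = 0.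
  by have [] := @mode_complete R M s t.
have hYX (s : 'I_N) : \sum_(m : mode M) modeY R m s * modeX R m t = 0.
  have [_ _ tY] := @mode_complete R M t s.
  by rewrite -[RHS]tY; apply: eq_bigr => m _; rewrite mulrC.
have pick (g : 'I_N -> R) : \sum_s g s * ((s == t)%:R * N%:R) = g t * N%:R.
  rewrite (bigD1 t)//= eqxx mul1r big1 ?addr0// => s st.
  by rewrite (negPf st) mul0r mulr0.
have entry (j : 'I_n) (f : mode M -> nat -> R) : \sum_m
    cf (\row_k (N%:R^-1 * \sum_(s < N) mproj (enum_val k) s (w s))) (m, j) * f m t =
    N%:R^-1 * \sum_s ((w s).1 j 0 * \sum_m modeX R m s * f m t +
      (w s).2 j 0 * \sum_m modeY R m s * f m t).
  under eq_bigr do rewrite cf_row enum_rankK -mulrA mulr_suml.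
  rewrite -mulr_sumr exchange_big; congr (_ * _); apply: eq_bigr => s _.
  rewrite !mulr_sumr -big_split; apply: eq_bigr => m _.
  by rewrite /mproj /=; ring.
rewrite [RHS]surjective_pairing; congr (_, _); apply/colP => j; rewrite mxE.
  rewrite (entry j (@modeX R M)).
  under eq_bigr do rewrite hX hYX mulr0 addr0.
  by rewrite (pick (fun s => (w s).1 j 0)) mulrC mulfK.
rewrite (entry j (@modeY R M)).
under eq_bigr do rewrite hY hXY mulr0 add0r.
by rewrite (pick (fun s => (w s).2 j 0)) mulrC mulfK.
Qed.

Lemma lift_periodic t c : lift_t (t + N) c = lift_t t c.
Proof.
congr (_, _); apply/colP => j; rewrite !mxE; apply: eq_bigr => m _.
  by rewrite (@mode_periodic R M m t).1.
by rewrite (@mode_periodic R M m t).2.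
Qed.

(** The critical point equation of the discrete action is a symplectic Euler scheme for Hamilton's
    equations: positions advance with the gradient at time t, momenta with the one at time t + 1. *)
Lemma lift_step (c g : 'rV[R]_d) t :
  (forall i, mode_lam R i.1 * cf c i = cf g i) ->
  N%:R *: ((lift_t t.+1 c).1 - (lift_t t c).1) = (lift_t t g).2 /\
  N%:R *: ((lift_t t.+1 c).2 - (lift_t t c).2) = - (lift_t t.+1 g).1.
Proof.
move=> cg; split; apply/colP => j; rewrite !mxE -sumrB mulr_sumr.
  apply: eq_bigr => m _; rewrite -(cg (m, j)) -mulrBr mulrCA modeX_step /=; ring.
rewrite -sumrN; apply: eq_bigr => m _.
rewrite -(cg (m, j)) -mulrBr mulrCA -[RHS]mulrN1.
have := @modeY_step R M m t => h.
have -> : N%:R * (modeY R m t.+1 - modeY R m t) =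
  - (mode_lam R m * modeX R m t.+1) by rewrite -h; ring.
by rewrite /=; ring.
Qed.

End LoopCoordinates.

Lemma finite_pos_min (R : realType) (I : finType) (f : I -> R) :
  (forall i, 0 < f i) -> exists2 e, 0 < e & forall i, e <= f i.
Proof.
move=> f0; exists (1 + \sum_i (f i)^-1)^-1.
  by rewrite invr_gt0 ltr_wpDr// sumr_ge0// => i _; rewrite invr_ge0 ltW.
move=> i; rewrite -[leRHS]invrK lef_pV2 ?posrE ?invr_gt0//; last first.
  by rewrite ltr_wpDr// sumr_ge0// => j _; rewrite invr_ge0 ltW.
rewrite (bigD1 i)//= addrCA lerDl addr_ge0// sumr_ge0// => j _.
by rewrite invr_ge0 ltW.
Qed.

(** * Positivity of the action on the linking set *)

Section GammaEstimate.
Variables (R : realType) (n : nat).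
Local Notation P := (phase_space R n).
Variables (F : P -> R) (zs : P) (A rho : R).
Hypothesis rho_gt0 : 0 < rho.
Hypothesis F_zs : forall z, `|z - zs| < rho -> F z = 0.
Hypothesis A_ge0 : 0 <= A.
Hypothesis F_le : forall z, F z <= A * `|z - zs| ^+ 2.

Section FixedM.
Variable M : nat.
Local Notation N := (nsteps M).
Local Notation d := #|{: lmode n M}|.

(** The coefficients of the constant loop at [zs]. Only frequency 0 occurs; there the mode of phase
    0 is (1, 0) and that of phase pi/2 is (0, -1), whence the sign. *)
Definition cst_coef : 'rV[R]_d := \row_(k < d)
  (let: ((s, b), j) := (enum_val k : lmode n M) in
   if (s : nat) == M then (if b then - zs.2 j 0 else zs.1 j 0) else 0).

Lemma cf_cst (s : 'I_N) b j : cf cst_coef ((s, b), j) =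
  if (s : nat) == M then (if b then - zs.2 j 0 else zs.1 j 0) else 0.
Proof. by rewrite cf_row enum_rankK. Qed.

Lemma cf_cst_freq (i : lmode n M) : freq R i.1 != 0 -> cf cst_coef i = 0.
Proof.
case: i => -[s b] j; rewrite cf_cst /freq /= subr_eq0 eqr_nat.
by move=> /negPf ->.
Qed.

Lemma lift_cst t : lift_t t cst_coef = zs.
Proof.
have MN : (M < N)%N by rewrite /nsteps ltnS -addnn leq_addr.
have entry (j : 'I_n) (f : mode M -> R) :
    \sum_m cf cst_coef (m, j) * f m =
    zs.1 j 0 * f (Ordinal MN, false) - zs.2 j 0 * f (Ordinal MN, true).
  transitivity (\sum_(s < N) \sum_b cf cst_coef ((s, b), j) * f (s, b)).
    by rewrite pair_bigA; apply: eq_bigr => -[s b].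
  rewrite (bigD1 (Ordinal MN))//= [X in _ + X]big1 ?addr0; last first.
    move=> s sM; rewrite big1// => b _; rewrite cf_cst ifF ?mul0r//.
    by apply: contraNF sM => sM; apply/eqP; apply/val_inj/eqP.
  by rewrite big_bool !cf_cst eqxx mulNr addrC.
have f0 b : freq R (Ordinal MN, b) = 0 by rewrite /freq subrr.
rewrite [RHS]surjective_pairing; congr (_, _); apply/colP => j; rewrite mxE entry.
  rewrite /modeX !f0 !mulr0 !mul0r !add0r /phase /= cos0 cos_pihalf; ring.
rewrite /modeY !f0 !mulr0 !mul0r !add0r /phase /= sin0 sin_pihalf; ring.
Qed.

Lemma low_card (m : nat) :
  (#|[pred l : mode M | (0 < freq R l)%R && (freq R l <= m%:R)%R]| <= m * 2)%N.
Proof.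
set A0 := [pred l | _].
pose f (l : mode M) := ((l.1 : nat), l.2).
rewrite cardE -(size_map f).
have -> : (m * 2 = size [seq (x, b) | x <- iota M.+1 m, b <- [:: true; false]])%N.
  by rewrite size_allpairs size_iota.
apply: uniq_leq_size.
  rewrite map_inj_uniq ?enum_uniq// => -[s b] [s' b'] [ss' ->].
  by congr (_, _); apply: val_inj.
move=> x /mapP[[s b]]; rewrite mem_enum inE /freq => sm ->{x}.
apply/allpairsP; exists (s : nat, b); split => //=.
  move: sm; rewrite /= subr_gt0 ltr_nat lerBlDr -natrD ler_nat mem_iota.
  by rewrite addSn ltnS [(m + M)%N]addnC.
by case: (b).
Qed.

(** The low frequencies are few, so their part of the loop is uniformly small and cannot alone leave
    the ball where [F] vanishes. Where [F] is nonzero the high frequencies make up at least half of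
    the displacement, and their sum of squares is at most [s ^+ 2 / m]; [16 * A <= m] makes the loss
    at most half of the action. No constant depends on [M]. *)
Lemma Gamma_fixedM (m : nat) (s : R) (c : 'rV[R]_d) :
  16 * A <= m%:R -> (0 < m)%N -> 0 < s -> m%:R * 2 * s <= rho / 2 ->
  (forall i : lmode n M, mode_lam R i.1 <= 0 -> cf c i = cf cst_coef i) ->
  2^-1 * \sum_(i : lmode n M | 0 < mode_lam R i.1) mode_lam R i.1 * cf c i ^+ 2 =
    s ^+ 2 / 2 ->
  s ^+ 2 / 4 <= 2^-1 * \sum_i mode_lam R i.1 * cf c i ^+ 2 -
    N%:R^-1 * \sum_(t < N) F (lift_t t c).
Proof.
move=> mA m_gt0 s0 ms c_neg c_pos.
have N0 : (0 : R) < N%:R by rewrite ltr0n.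
have mR : (0 : R) < m%:R by rewrite ltr0n.
have c_pos' : \sum_(i : lmode n M | 0 < mode_lam R i.1)
    mode_lam R i.1 * cf c i ^+ 2 = s ^+ 2 by lra.
pose low : pred (mode M) := [pred l | (0 < freq R l) && (freq R l <= m%:R)].
pose high : pred (mode M) := [pred l | m%:R < freq R l].
pose c1 : 'rV[R]_d := \row_k (if low (enum_val k).1 then c 0 k else 0).
pose c2 : 'rV[R]_d := \row_k (if high (enum_val k).1 then c 0 k else 0).
have cf1 i : cf c1 i = if low i.1 then cf c i else 0 by rewrite cf_row enum_rankK.
have cf2 i : cf c2 i = if high i.1 then cf c i else 0 by rewrite cf_row enum_rankK.
have c_eq : c = cst_coef + (c1 + c2).
  apply/rowP => k; rewrite -[k]enum_valK -!/(cf _ _) !cfD cf1 cf2 /low /high /=.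
  set i := enum_val k.
  have [f0|f0] := leP (freq R i.1) 0.
    rewrite c_neg ?mode_lam_le0//= ltNge (le_trans f0) ?ler0n//=.
    by rewrite !addr0.
  rewrite (@cf_cst_freq i) ?gt_eqF// add0r; case: leP => _ /=.
    by rewrite addr0.
  by rewrite add0r.
have cs i : 0 < freq R i.1 -> mode_lam R i.1 * cf c i ^+ 2 <= s ^+ 2.
  rewrite -mode_lam_gt0 => li; rewrite -c_pos' (bigD1 i)//= lerDl sumr_ge0// => l /andP[ll _].
  by rewrite mulr_ge0 ?sqr_ge0// ltW.
have cfs i : 0 < freq R i.1 -> `|cf c i| <= s.
  move=> fi; rewrite -ler_sqr ?nnegrE ?(ltW s0)// real_normK ?num_real//.
  apply: (le_trans _ (cs i fi)); rewrite ler_peMl ?sqr_ge0//.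
  have f1 : 1 <= freq R i.1 by rewrite -freq_ge1.
  by apply: (le_trans f1); apply: mode_lam_ge; exact: ltW.
have sum_low (j : 'I_n) (f : mode M -> R) : (forall l, `|f l| <= 1) ->
    `|\sum_l cf c1 (l, j) * f l| <= rho / 2.
  move=> f1; apply: le_trans ms; apply: (le_trans (ler_norm_sum _ _ _)).
  apply: (@le_trans _ _ (\sum_(l | low l) s)).
    rewrite [leRHS]big_mkcond/=; apply: ler_sum => l _; rewrite cf1 /=.
    case: ifPn => lowl; last by rewrite mul0r normr0.
    rewrite normrM -[leRHS]mulr1 ler_pM//; apply: cfs.
    by case/andP: lowl.
  rewrite sumr_const -[s *+ _]mulr_natl -(natrM _ m 2) ler_pM2r// ler_nat.
  exact: low_card.
have lift1 t : `|lift_t t c1| <= rho / 2.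
  apply: phase_norm_le; first by rewrite divr_ge0// ltW.
  move=> [j []]; rewrite /pc /= mxE; apply: sum_low => l.
    exact: modeY_le1.
  exact: modeX_le1.
have F_high t : F (lift_t t c) <= 4 * A * dotp (lift_t t c2) (lift_t t c2).
  have [lt|ge] := ltP `|lift_t t c - zs| rho.
    rewrite F_zs// mulr_ge0 ?mulr_ge0 ?dotp_ge0//.
  apply: (le_trans (F_le _)); rewrite -[4 * A]mulrC -mulrA ler_wpM2l//.
  have := norm_sq_le_dotp (lift_t t c2); move: ge.
  rewrite {1 2}c_eq !lift_tD lift_cst addrAC subrr add0r.
  have := ler_normD (lift_t t c1) (lift_t t c2); have := lift1 t.
  set u := `|_ + _|; set v := `|lift_t t c1|; set w := `|lift_t t c2|.
  move=> h1 h2 h3 h4.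
  have uw : u <= 2 * w by lra.
  have u0 : 0 <= u by exact: normr_ge0.
  have : u ^+ 2 <= (2 * w) ^+ 2 by rewrite ler_sqr ?nnegrE// (le_trans u0).
  rewrite exprMn; lra.
have sum_F : N%:R^-1 * \sum_(t < N) F (lift_t t c) <= s ^+ 2 / 4.
  apply: (@le_trans _ _ (4 * A * \sum_i cf c2 i ^+ 2)).
    have := @parseval R n M c2 c2.
    under [in RHS]eq_bigr do rewrite -expr2.
    move=> pars; rewrite -[X in _ <= _ * X](mulKf (@NR_neq0 R M)) -pars.
    rewrite mulrCA ler_pM2l ?invr_gt0// mulr_sumr.
    by apply: ler_sum => t _; exact: F_high.
  have : m%:R * \sum_i cf c2 i ^+ 2 <= s ^+ 2.
    rewrite -c_pos' mulr_sumr [leRHS]big_mkcond/=; apply: ler_sum => i _.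
    rewrite cf2 mode_lam_gt0 /high /=; case: ifPn => [mi|_]; last first.
      rewrite expr0n /= mulr0; case: ifPn => // fi.
      by rewrite mulr_ge0 ?sqr_ge0// (le_trans (ltW fi))// mode_lam_ge// ltW.
    have fi : 0 < freq R i.1 by apply: lt_trans mi.
    rewrite fi ler_wpM2r ?sqr_ge0// (le_trans (ltW mi))// mode_lam_ge// ltW//.
  have : 0 <= \sum_i cf c2 i ^+ 2 by apply: sumr_ge0 => i _; exact: sqr_ge0.
  set S := \sum_i _ => S0 Sm.
  have := ler_wpM2r S0 mA; lra.
suff : \sum_(i : lmode n M) mode_lam R i.1 * cf c i ^+ 2 = s ^+ 2 by lra.
rewrite -c_pos' [RHS]big_mkcond/=; apply: eq_bigr => i _.
case: ifPn => //; rewrite -leNgt => li; rewrite (c_neg i li).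
have [f0|f0] := eqVneq (freq R i.1) 0; last first.
  by rewrite cf_cst_freq// expr0n mulr0.
by rewrite /mode_lam f0 mulr0 mul0r sin0 mulr0 mul0r.
Qed.

End FixedM.
End GammaEstimate.

(** * Nonresonance, uniform in the number of steps *)

Section Nonresonance.
Variables (R : realType) (n : nat) (a : 'I_n -> R) (j0 : 'I_n).
Hypothesis a_gt0 : forall j, 0 < a j.
Hypothesis a_lt : forall j, j != j0 -> a j < pi.
Hypothesis a0_gt : pi < a j0.
Hypothesis a0_lt : a j0 < 2 * pi.

(** The numbers 2 a_j avoid 0, 2 pi and 4 pi. With many steps, eigenvalues of frequency at most 0
    are nonpositive, the one of frequency 1 is at most 2 pi and close to it, and those of higher
    frequency are not much below 4 pi. *)
Lemma nonresonance_gap : exists M0 g, [/\ (1 < M0)%N, 0 < g &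
  forall M, (M0 <= M)%N -> forall (m : mode M) j,
    g <= `|mode_lam R m - 2 * a j|].
Proof.
have pi0 := pi_gt0 R; have pin : (pi : R) != 0 by rewrite gt_eqF.
have [g g0 gj] : exists2 g, 0 < g & forall j, g <= Order.min (2 * a j)
    (if j == j0 then Order.min (2 * a j - 2 * pi) (4 * pi - 2 * a j)
     else 2 * pi - 2 * a j).
  apply: finite_pos_min => j; rewrite lt_min mulr_gt0 ?a_gt0//=.
  have [->|jj0] := eqVneq j j0; first by have := a0_gt; have := a0_lt; rewrite /= lt_min => *; apply/andP; split; lra.
  by have := a_lt jj0; lra.
have e0 : 0 < g / 2 / (4 * pi) by rewrite !divr_gt0// mulr_gt0.
have /continuous_dist/(_ 0 _ e0)[dl dl0 cos_near] := @continuous_cos R.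
have cos_ge x : `|x| < dl -> 4 * pi * cos x >= 4 * pi - g / 2.
  move=> xd; have := cos_near x; rewrite sub0r normrN cos0 => /(_ xd).
  move=> /(le_trans (ler_norm _)) h.
  have := ler_wpM2l (ltW (mulr_gt0 (ltr0Sn R 3) pi0)) h.
  rewrite [X in _ <= X]mulrC divfK ?mulf_neq0 ?pnatr_eq0//.
  lra.
pose M0 := (Num.truncn (2 * pi / dl)).+2.
exists M0, (g / 2); split=> //; first by rewrite divr_gt0.
move=> M MM0 m j.
have N0 : (0 : R) < (nsteps M)%:R by rewrite ltr0n.
have angle (k : R) : 0 <= k <= 2 -> `|pi * k / (nsteps M)%:R| < dl.
  move=> /andP[k0 k2]; rewrite ger0_norm ?divr_ge0 ?mulr_ge0 ?(ltW pi0)//.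
  rewrite ltr_pdivrMr//; apply: (@le_lt_trans _ _ (2 * pi)).
    by rewrite mulrC ler_pM2r.
  rewrite -ltr_pdivrMl// mulrC; apply: (lt_le_trans (truncnS_gt _)).
  rewrite ler_nat (leq_trans _ (_ : M <= _)%N)//.
    by rewrite (leq_trans _ MM0).
  by rewrite /nsteps -addnn leqW// leq_addr.
have := gj j; rewrite le_min => /andP[gj1 gj2].
have [f0|f0] := leP (freq R m) 0.
  have := mode_lam_le0 f0 => l0; rewrite ler0_norm; last lra.
  by lra.
have M_gt1 : (1 < M)%N by apply: leq_trans MM0; rewrite /M0.
have M1 : (M.+1 < nsteps M)%N by rewrite -addn1 ltn_nsteps// ltnW.
have M2 : (M.+2 < nsteps M)%N by rewrite -addn2 ltn_nsteps.
have fr1 : freq R (Ordinal M1, false) = 1.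
  by rewrite /freq /= -[M.+1%:R]natr1; ring.
have fr2 : freq R (Ordinal M2, false) = 2.
  by rewrite /freq /= -[M.+2]addn2 natrD; ring.
have lam1 : 2 * pi - g / 2 <= mode_lam R m.
  have f1 : freq R (Ordinal M1, false) <= freq R m by rewrite fr1 -freq_ge1.
  apply: (le_trans _ (mode_lam_mono _ f1)); last by rewrite fr1.
  apply: (le_trans _ (mode_lam_ge_cos _ fr1)) => //.
  have := cos_ge (pi * 1 / (nsteps M)%:R) (angle 1 _); rewrite mulr1.
  by rewrite ler01 ler1n => /(_ isT); lra.
have [jj|jj] := eqVneq j j0; last first.
  by move: gj2; rewrite (negPf jj) => gj2; rewrite ger0_norm; lra.
move: gj2; rewrite jj eqxx le_min => /andP[gj2 gj3].
have [f1|f1] := eqVneq (freq R m) 1.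
  by have := mode_lam1_le f1 => l1; rewrite ler0_norm; lra.
have f2 : freq R (Ordinal M2, false) <= freq R m.
  rewrite fr2; move: f0 f1; rewrite /freq subr_gt0 ltr_nat => Mm m1.
  rewrite lerBrDl -natrD ler_nat addn2 ltn_neqAle Mm andbT.
  apply: contra m1 => /eqP <-; apply/eqP; rewrite -[M.+1%:R]natr1; ring.
have lam2 : 4 * pi - g / 2 <= mode_lam R m.
  apply: (le_trans _ (mode_lam_mono _ f2)); last by rewrite fr2.
  apply: (le_trans _ (mode_lam_ge_cos _ fr2)) => //.
  have := cos_ge (pi * 2 / (nsteps M)%:R) (angle 2 _).
  by rewrite ler0n lexx => /(_ isT); lra.
by rewrite ger0_norm; lra.
Qed.

End Nonresonance.

(** * Hamiltonians that are quadratic at infinity *)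

Section QuadraticAtInfinity.
Variables (R : realType) (n : nat) (a : 'I_n -> R).
Local Notation P := (phase_space R n).
Implicit Types z w : P.

Definition aquad z : R := \sum_k a k.1 * pc k z ^+ 2.
Definition alin z : P :=
  (\col_j (2 * a j * z.1 j 0), \col_j (2 * a j * z.2 j 0)).
Definition asum : R := \sum_(k : 'I_n * bool) a k.1.

Lemma pc_alin k z : pc k (alin z) = 2 * a k.1 * pc k z.
Proof. by case: k => j [] /=; rewrite /pc /= mxE. Qed.

Lemma dotp_alin z : dotp (alin z) z = 2 * aquad z.
Proof.
by rewrite mulr_sumr; apply: eq_bigr => k _; rewrite pc_alin; ring.
Qed.

Lemma alinB z w : alin (z - w) = alin z - alin w.
Proof. by apply: pc_inj => k; rewrite pcB !pc_alin pcB; ring. Qed.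

Lemma cont_alin : continuous alin.
Proof.
apply: cont_phase => k; under eq_fun => z do rewrite pc_alin.
by apply: contM; [exact: cont_cst|apply: cont_pc => z; exact: cvg_id].
Qed.

Lemma cont_aquad : continuous aquad.
Proof.
apply: cont_sum => k; apply: contM; first exact: cont_cst.
by apply: contX; apply: cont_pc => z; exact: cvg_id.
Qed.

Hypothesis a_gt0 : forall j, 0 < a j.

Lemma asum_ge0 : 0 <= asum.
Proof. by apply: sumr_ge0 => k _; exact: ltW. Qed.

Lemma a_le_asum j : a j <= asum.
Proof.
rewrite /asum (bigD1 (j, true))//= lerDl sumr_ge0// => k _; exact: ltW.
Qed.

Lemma aquad_le z : aquad z <= asum * `|z| ^+ 2.
Proof.
rewrite mulr_suml; apply: ler_sum => k _; rewrite ler_pM2l//.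
by rewrite -(real_normK (num_real _)) ler_sqr ?nnegrE// pc_le_norm.
Qed.

Lemma alin_le z : `|alin z| <= 2 * asum * `|z|.
Proof.
apply: phase_norm_le => [|k]; first by rewrite !mulr_ge0// asum_ge0.
rewrite pc_alin normrM [`|_ * _|]ger0_norm ?mulr_ge0 ?(ltW (a_gt0 _))//.
rewrite -!mulrA ler_pM2l// ler_pM ?pc_le_norm ?(ltW (a_gt0 _))//.
exact: a_le_asum.
Qed.

Variables (F : P -> R) (G : P -> P) (C0 : R).
Hypothesis F_cont : continuous F.
Hypothesis G_cont : continuous G.
Hypothesis G_out : forall z, C0 <= `|z| -> G z = alin z.
Hypothesis F_out : forall z, C0 <= `|z| -> F z = aquad z.

Lemma gradient_modulus : exists2 B, 0 <= B & (forall z, `|G z - alin z| <= B) /\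
  forall e, 0 < e -> exists2 K, 0 <= K & forall z w,
    `|G z - G w| <= e + K * `|z - w|.
Proof.
have [||B B0 [QB Qmod]] := @compact_supp_modulus R n (fun z => G z - alin z) C0.
- by move=> z; apply: cvgB; [exact: G_cont|exact: cont_alin].
- by move=> z zC; rewrite G_out// subrr.
exists B => //; split=> // e e0; have [K K0 QK] := Qmod e e0.
exists (K + 2 * asum); first by rewrite addr_ge0// mulr_ge0// asum_ge0.
move=> z w; have -> : G z - G w =
    (G z - alin z - (G w - alin w)) + alin (z - w).
  by apply: pc_inj => k; rewrite alinB !(pcD, pcN); ring.
apply: (le_trans (ler_normD _ _)).
by have := QK z w; have := alin_le (z - w); lra.
Qed.

Lemma F_growth : exists C, forall z, aquad z - C <= F z.
Proof.
have [|B B0 FB] := @pball_bound R n (fun z => aquad z - F z) C0.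
  by apply: contB; [exact: cont_aquad|exact: F_cont].
exists B => z; have [zC|/ltW Cz] := leP `|z| C0; first by have := FB z zC; lra.
by rewrite F_out// lerBlDr lerDl.
Qed.

(** As [F] vanishes near [zs], a multiple of the squared distance dominates both its bound on a ball
    and its quadratic growth. *)
Lemma F_quadratic zs rho : 0 < rho -> (forall z, `|z - zs| < rho -> F z = 0) ->
  exists2 A, 0 <= A & forall z, F z <= A * `|z - zs| ^+ 2.
Proof.
move=> rho0 F0; have [B B0 FB] := @pball_bound R n F C0 F_cont.
have S0 := asum_ge0; set S := asum in S0 *.
have [T0 r0] : 0 <= 2 * S * `|zs| ^+ 2 /\ 0 < rho ^+ 2.
  by split; [rewrite !mulr_ge0 ?sqr_ge0|rewrite exprn_gt0].
pose T := 2 * S * `|zs| ^+ 2.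
exists ((B + T) / rho ^+ 2 + 2 * S).
  by rewrite addr_ge0 ?divr_ge0 ?(mulr_ge0 _ S0) ?addr_ge0// ltW.
move=> z; have [lt|ge] := ltP `|z - zs| rho.
  rewrite F0// mulr_ge0 ?sqr_ge0//.
  by rewrite addr_ge0 ?divr_ge0 ?(mulr_ge0 _ S0) ?addr_ge0// ltW.
have FBS : F z <= B + S * `|z| ^+ 2.
  have [zC|/ltW Cz] := leP `|z| C0.
    by apply: (le_trans (FB z zC)); rewrite lerDl mulr_ge0 ?sqr_ge0.
  by rewrite F_out// (le_trans (aquad_le z))// lerDr.
have := ler_normD (z - zs) zs; rewrite subrK.
set u := `|z - zs| in ge *; set v := `|zs| => zuv.
have sq : `|z| ^+ 2 <= 2 * u ^+ 2 + 2 * v ^+ 2.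
  apply: (@le_trans _ _ ((u + v) ^+ 2)).
    by rewrite ler_sqr ?nnegrE ?addr_ge0 /u /v.
  by have := sqr_ge0 (u - v); rewrite (sqrrD u v) (sqrrB u v); lra.
have : (B + T) <= (B + T) / rho ^+ 2 * u ^+ 2.
  rewrite mulrAC ler_pdivlMr// ler_wpM2l ?addr_ge0//.
  by rewrite ler_sqr ?nnegrE ?(ltW rho0)// /u.
have := ler_wpM2l S0 sq; rewrite /T -/v; lra.
Qed.

End QuadraticAtInfinity.

(** * Periodic orbits of the discretized system *)

Section DiscreteOrbit.
Variables (R : realType) (n : nat) (a : 'I_n -> R) (j0 : 'I_n).
Local Notation P := (phase_space R n).
Variables (F : P -> R) (G : P -> P) (C0 rho : R) (zs : P).
Hypothesis a_gt0 : forall j, 0 < a j.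
Hypothesis a_lt : forall j, j != j0 -> a j < pi.
Hypothesis a0_gt : pi < a j0.
Hypothesis a0_lt : a j0 < 2 * pi.
Hypothesis F_derive : forall (z v : P) (t : R), is_derive t (1 : R)
  (fun s : R => F (z + s *: v)) (dotp (G (z + t *: v)) v).
Hypothesis F_cont : continuous F.
Hypothesis G_cont : continuous G.
Hypothesis G_out : forall z, C0 <= `|z| -> G z = alin a z.
Hypothesis F_out : forall z, C0 <= `|z| -> F z = aquad a z.
Hypothesis F_ge0 : forall z, 0 <= F z.
Hypothesis rho_gt0 : 0 < rho.
Hypothesis F_zs : forall z, `|z - zs| < rho -> F z = 0.

(** Along a critical loop the quadratic part of the action is the mean of half the pairing of
    gradient and position, so the action is the mean of this function. *)
Definition act_density (z : P) : R := 2^-1 * dotp (G z) z - F z.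

Section FixedM.
Variable M : nat.
Local Notation N := (nsteps M).
Local Notation d := #|{: lmode n M}|.
Hypothesis M_gt0 : (0 < M)%N.
Let N0 : (0 : R) < N%:R. Proof. by rewrite ltr0n. Qed.
Let NR : (N%:R : R) != 0. Proof. by rewrite gt_eqF. Qed.

Let lam (k : 'I_d) : R := mode_lam R (enum_val k : lmode n M).1.
Let ak (k : 'I_d) : R := a (enum_val k : lmode n M).2.
Let Gc (c : 'rV[R]_d) : R := N%:R^-1 * \sum_(t < N) F (lift_t t c).
Let gGc (k : 'I_d) (c : 'rV[R]_d) : R :=
  N%:R^-1 * \sum_(t < N) mproj (enum_val k : lmode n M) t (G (lift_t t c)).

Let cont_lift t : continuous (fun c : 'rV[R]_d => lift_t t c).
Proof.
apply/continuous_dist => c e e0.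
have D0 : (0 : R) < #|{: lmode n M}|%:R + 1 by rewrite ltr_wpDl.
exists (e / (#|{: lmode n M}|%:R + 1)); first by rewrite divr_gt0.
move=> y; rewrite ltr_pdivlMr// => cy.
rewrite -lift_tB (le_trans (lift_le _ _))//.
apply: ltW; apply: le_lt_trans cy.
by rewrite mulrC ler_wpM2l// lerDl.
Qed.

Let avg_le (f : 'I_N -> R) (B : R) : (forall t, `|f t| <= B) ->
  `|N%:R^-1 * \sum_t f t| <= B.
Proof.
move=> fB; rewrite normrM gtr0_norm ?invr_gt0// ler_pdivrMl//.
apply: (le_trans (ler_norm_sum _ _ _)).
rewrite -[X in X%:R * _]card_ord mulr_natl -sumr_const.
by apply: ler_sum => t _; exact: fB.
Qed.

Let mproj_alin (i : lmode n M) t z : mproj i t (alin a z) = 2 * a i.2 * mproj i t z.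
Proof. by rewrite /mproj !mxE; ring. Qed.

(** The linking theorem in Fourier coordinates. The extra direction [i0] is a mode of frequency 1 in
    the plane [j0]: its eigenvalue is at most 2 pi < 2 a_j0, so the quadratic form at infinity
    outweighs the action there. *)
Lemma discrete_crit (Cg eta r beta B : R) :
  (forall z, aquad a z - Cg <= F z) ->
  (forall z, `|G z - alin a z| <= B) ->
  (forall e, 0 < e -> exists2 K, 0 <= K & forall z w,
    `|G z - G w| <= e + K * `|z - w|) ->
  0 < eta -> (forall j, eta <= a j) -> eta <= a j0 - pi ->
  (forall (m : mode M) j, mode_lam R m != 2 * a j) ->
  0 < r -> 0 < beta ->
  (forall c : 'rV[R]_d,
    (forall i : lmode n M, mode_lam R i.1 <= 0 -> cf c i = cf (cst_coef zs M) i) ->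
    2^-1 * \sum_(i : lmode n M | 0 < mode_lam R i.1) mode_lam R i.1 * cf c i ^+ 2 = r ->
    beta <= 2^-1 * \sum_i mode_lam R i.1 * cf c i ^+ 2 - Gc c) ->
  exists2 c : 'rV[R]_d,
    beta <= 2^-1 * \sum_i mode_lam R i.1 * cf c i ^+ 2 - Gc c &
    forall i : lmode n M, mode_lam R i.1 * cf c i = gGc (enum_rank i) c.
Proof.
move=> Fgr GB Gmod eta0 eta_a eta_j0 nonres r0 beta0 Gam.
have M1 : (M.+1 < N)%N by rewrite -addn1; exact: ltn_nsteps.
pose i0 : 'I_d := enum_rank (((Ordinal M1, false), j0) : lmode n M).
have fr1 : freq R (Ordinal M1, false) = 1.
  by rewrite /freq /= -[M.+1%:R]natr1; ring.
have lam0 : 0 < lam i0 by rewrite /lam enum_rankK mode_lam_gt0 fr1.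
have mproj_sum (u v : R) (f g : 'I_N -> P) (k : 'I_d) :
    u * \sum_(t < N) mproj (enum_val k : lmode n M) t (f t) -
    v * \sum_(t < N) mproj (enum_val k : lmode n M) t (g t) =
    \sum_(t < N) (u * mproj (enum_val k : lmode n M) t (f t) -
            v * mproj (enum_val k : lmode n M) t (g t)).
  by rewrite !mulr_sumr -sumrB.
have [|||||||||||||c Hc Hcrit] := @linking R d lam i0 Gc gGc ak Cg (2 * B) eta r
    beta (cst_coef zs M).
- move=> c v t; rewrite /Gc.
  have dF (s : 'I_N) : is_derive t (1 : R) (fun x : R => F (lift_t s (c + x *: v)))
      (dotp (G (lift_t s (c + t *: v))) (lift_t s v)).
    have := F_derive (lift_t s c) (lift_t s v) t.
    rewrite -lift_tZ -lift_tD; congr (is_derive _ _ _ _).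
    by apply/funext => x; rewrite -lift_tZ -lift_tD.
  have := is_deriveZ N%:R^-1 (is_derive_sum (fun s => dF s)).
  have -> : N%:R^-1 \*: \sum_(s < N) (fun x : R => F (lift_t s (c + x *: v))) =
      (fun x : R => N%:R^-1 * \sum_(s < N) F (lift_t s (c + x *: v))).
    by apply/funext => x; rewrite /= fct_sumE scaleRE.
  move/is_derive_eq; apply; rewrite scaleRE mulr_sumr.
  under eq_bigr do rewrite dotp_lift mulr_sumr.
  rewrite exchange_big sum_cf; apply: eq_bigr => i _.
  rewrite /gGc enum_rankK -/(cf v i) mulr_sumr mulr_suml.
  by apply: eq_bigr => s _; ring.
- apply: contM; first exact: cont_cst.
  by apply: cont_sum => t; exact: (cont_comp (@cont_lift t) F_cont).
- move=> e e0; have e2 : 0 < e / 2 by rewrite divr_gt0.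
  have [K K0 GK] := Gmod (e / 2) e2.
  exists (2 * (K * #|{: lmode n M}|%:R)); first by rewrite !mulr_ge0.
  move=> k c c'; rewrite /gGc mproj_sum.
  under eq_bigr do rewrite -mulrBr -mprojB.
  rewrite -mulr_sumr; apply: avg_le => t.
  apply: (le_trans (mproj_le _ _ _)).
  have := GK (lift_t t c) (lift_t t c'); rewrite -lift_tB.
  have := ler_wpM2l K0 (lift_le t (c - c')); lra.
- move=> k c; have := @mproj_lift R n M (enum_val k) c.
  rewrite /cf enum_valK => ck.
  have -> : 2 * ak k * c 0 k = N%:R^-1 * \sum_(t < N)
      mproj (enum_val k : lmode n M) t (alin a (lift_t t c)).
    under eq_bigr do rewrite mproj_alin.
    by rewrite -mulr_sumr ck /ak; field.
  rewrite /gGc mproj_sum.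
  under eq_bigr do rewrite -mulrBr -mprojB.
  rewrite -mulr_sumr; apply: avg_le => t.
  by apply: (le_trans (mproj_le _ _ _)); rewrite ler_pM2l.
- by move=> k; exact: nonres.
- by move=> c; rewrite mulr_ge0 ?invr_ge0// sumr_ge0.
- move=> c; rewrite /Gc ler_pdivlMl//.
  (* By Parseval, the diagonal form is the mean of [aquad a] along the loop. *)
  have -> : \sum_i ak i * c 0 i ^+ 2 =
      N%:R^-1 * \sum_(t < N) aquad a (lift_t t c).
    pose c' : 'rV[R]_d := \row_k (2 * ak k * c 0 k).
    have alc t : alin a (lift_t t c) = lift_t t c'.
      congr (_, _); apply/colP => j; rewrite !mxE mulr_sumr; apply: eq_bigr => m _;
        by rewrite /cf mxE /ak enum_rankK mulrA.
    have aq t : aquad a (lift_t t c) = 2^-1 * dotp (lift_t t c') (lift_t t c).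
      by rewrite -alc dotp_alin mulKf.
    under [in RHS]eq_bigr do rewrite aq.
    rewrite -mulr_sumr parseval mulrCA mulKf// mulr_sumr sum_cf.
    apply: eq_bigr => i _; rewrite /cf mxE.
    have half (x y : R) : x * y ^+ 2 = 2^-1 * (2 * x * y * y) by field.
    exact: half.
  rewrite mulrBr mulVKf// lerBlDr.
  have -> : N%:R * Cg = \sum_(t < N) Cg.
    by rewrite sumr_const card_ord mulr_natl.
  rewrite -big_split; apply: ler_sum => t _.
  by have := Fgr (lift_t t c); rewrite lerBlDr.
- by [].
- move=> k [lk|->].
    by have := eta_a (enum_val k : lmode n M).2; rewrite /ak; lra.
  have := mode_lam1_le fr1; rewrite /ak /lam enum_rankK /=; lra.
- by [].
- by [].
- by [].
- move=> c c_neg c_pos; rewrite /linkPsi /quad_action.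
  have := Gam c; rewrite sum_cf.
  have -> : \sum_i lam (enum_rank i) * c 0 (enum_rank i) ^+ 2 =
      \sum_i mode_lam R i.1 * cf c i ^+ 2.
    by apply: eq_bigr => i _; rewrite /lam enum_rankK.
  apply.
    by move=> i li; apply: c_neg; rewrite /lam enum_rankK.
  rewrite -c_pos; congr (_ * _); rewrite [RHS]big_mkcond sum_cf -big_mkcond.
  rewrite [RHS](eq_bigl (fun i : lmode n M => 0 < mode_lam R i.1)); last first.
    by move=> i; rewrite /lam enum_rankK.
  by apply: eq_bigr => i _; rewrite /lam enum_rankK.
- exists c.
    apply: (le_trans Hc); rewrite /linkPsi /quad_action sum_cf.
    rewrite le_eqVlt; apply/orP; left; apply/eqP; congr (_ * _ - _).
    by apply: eq_bigr => i _; rewrite /lam enum_rankK.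
  by move=> i; have := Hcrit (enum_rank i); rewrite /lam enum_rankK.
Qed.

Let avg_exists (f : 'I_N -> R) (b : R) : b <= N%:R^-1 * \sum_t f t ->
  exists t, b <= f t.
Proof.
move=> bf; apply: contrapT => no.
have f_lt t : f t < b by rewrite ltNge; apply/negP => bt; apply: no; exists t.
have : \sum_t f t < \sum_(t < N) b.
  rewrite (bigD1 ord0)//= [ltRHS](bigD1 ord0)//= ltr_leD//.
  by apply: ler_sum => t _; exact: ltW.
rewrite sumr_const card_ord -[b *+ _]mulr_natl => lt.
by move: bf; rewrite ler_pdivlMl// leNgt lt.
Qed.

Section CritSequence.
Variables (c : 'rV[R]_d) (B g : R).
Hypothesis crit : forall i : lmode n M, mode_lam R i.1 * cf c i = gGc (enum_rank i) c.
Hypothesis B_ge0 : 0 <= B.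
Hypothesis GB : forall z, `|G z - alin a z| <= B.
Hypothesis g_gt0 : 0 < g.
Hypothesis gap : forall (m : mode M) j, g <= `|mode_lam R m - 2 * a j|.
Let q : 'rV[R]_d := \row_k gGc k c.
Let z t := lift_t t c.

Let z_mod t : z (t %% N) = z t.
Proof.
rewrite [in RHS](divn_eq t N) addnC; elim: (t %/ N)%N => [|k IH].
  by rewrite mul0n addn0.
by rewrite mulSnr addnA /z lift_periodic.
Qed.

Let lift_q t : lift_t t q = G (z t).
Proof.
have q_mod s : lift_t (s %% N) q = lift_t s q.
  rewrite [in RHS](divn_eq s N) addnC; elim: (s %/ N)%N => [|k IH].
    by rewrite mul0n addn0.
  by rewrite mulSnr addnA lift_periodic.
have tN : (t %% N < N)%N by rewrite ltn_mod.
rewrite -q_mod -z_mod.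
have := lift_complete (fun s : 'I_N => G (lift_t s c)) (Ordinal tN).
by [].
Qed.

Let steps t : N%:R *: ((z t.+1).1 - (z t).1) = (G (z t)).2 /\
  N%:R *: ((z t.+1).2 - (z t).2) = - (G (z t.+1)).1.
Proof.
rewrite -!lift_q; apply: lift_step => i.
by rewrite crit cf_row.
Qed.

(** By criticality the coefficients of [G - alin a] along the loop are those of the loop times
    [mode_lam - 2 a]. The former are bounded in mean square by [B], and the gap [g] bounds the
    latter. *)
Let coef_bound : \sum_i cf c i ^+ 2 <= (n * 2)%:R * B ^+ 2 / g ^+ 2.
Proof.
pose q' : 'rV[R]_d := \row_k (q 0 k - 2 * ak k * c 0 k).
have lift_q' t : lift_t t q' = G (z t) - alin a (z t).
  have -> : q' = q - \row_k (2 * ak k * c 0 k) by apply/rowP => k; rewrite !mxE.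
  rewrite lift_tB lift_q; congr (_ - _).
  congr (_, _); apply/colP => j; rewrite !mxE mulr_sumr; apply: eq_bigr => m _;
    by rewrite /cf mxE /ak enum_rankK mulrA.
rewrite ler_pdivlMr ?exprn_gt0//.
apply: (@le_trans _ _ (\sum_i cf q' i * cf q' i)).
  rewrite mulr_suml; apply: ler_sum => i _.
  have -> : cf q' i = (mode_lam R i.1 - 2 * a i.2) * cf c i.
    by rewrite mulrBl crit /q' /cf !mxE /ak enum_rankK.
  rewrite -expr2 exprMn mulrC ler_wpM2r ?sqr_ge0//.
  by rewrite -(real_normK (num_real (_ - _))) ler_sqr ?nnegrE ?(ltW g_gt0).
rewrite -[X in X <= _](mulKf NR) -parseval ler_pdivrMl// .
have -> : N%:R * ((n * 2)%:R * B ^+ 2) = \sum_(t < N) ((n * 2)%:R * B ^+ 2).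
  by rewrite sumr_const card_ord mulr_natl.
apply: ler_sum => t _; rewrite lift_q'; apply: (le_trans (ler_norm _)); apply: (le_trans (dotp_le_norm _ _)).
by rewrite ler_wpM2l// expr2 ler_pM.
Qed.

Let C1 := (n * 2)%:R * B ^+ 2 / g ^+ 2.
Let sq_bound : N%:R^-1 * \sum_(t < N) `|z t| ^+ 2 <= C1.
Proof.
apply: le_trans coef_bound; rewrite ler_pdivrMl//.
under [in leRHS]eq_bigr do rewrite expr2.
rewrite -parseval; apply: ler_sum => t _; exact: norm_sq_le_dotp.
Qed.

Definition orbit_variation (B C : R) := 2 * (2 * asum a * (1 + C) + B).
Definition orbit_bound (B C : R) := 1 + C + orbit_variation B C.

Let V := orbit_variation B C1.
Let S0 := asum_ge0 a_gt0.

Let G_le w : `|G w| <= 2 * asum a * (1 + `|w| ^+ 2) + B.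
Proof.
rewrite -[G w](subrK (alin a w)) (le_trans (ler_normD _ _))// addrC lerD//.
apply: (le_trans (alin_le a_gt0 _)); rewrite ler_wpM2l ?mulr_ge0//.
have := sqr_ge0 (`|w| - 1); rewrite sqrrB; have := sqr_ge0 `|w|; lra.
Qed.

(** A step has length of order |G|/N, and |G| is of order at most 1 + |z|^2, whose mean is bounded;
    hence the total variation is bounded uniformly in the number of steps. *)
Let variation : \sum_(t < N) `|z t.+1 - z t| <= V.
Proof.
pose f t := 2 * asum a * (1 + `|z t| ^+ 2) + B.
have step_le t : `|z t.+1 - z t| <= N%:R^-1 * (f t + f t.+1).
  have [h1 h2] := steps t.
  have e1 : (z t.+1 - z t).1 = N%:R^-1 *: (G (z t)).2 by rewrite -h1 scalerA mulVf// scale1r.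
  have e2 : (z t.+1 - z t).2 = - (N%:R^-1 *: (G (z t.+1)).1).
    by rewrite -scalerN -h2 scalerA mulVf// scale1r.
  have f0 s : 0 <= f s by rewrite addr_ge0// mulr_ge0 ?mulr_ge0// addr_ge0// sqr_ge0.
  have N0' : 0 <= N%:R^-1 :> R by rewrite invr_ge0 ltW.
  apply: phase_norm_le => [|[j b]]; first by rewrite mulr_ge0// addr_ge0.
  case: b; rewrite /pc ?e1 ?e2 /= !mxE ?normrN normrM [`|_^-1|]ger0_norm// ler_wpM2l//.
    have := pc_le_norm (j, false) (G (z t.+1)); rewrite /pc /= => /le_trans; apply.
    by apply: (le_trans (G_le _)); rewrite lerDr.
  have := pc_le_norm (j, true) (G (z t)); rewrite /pc /= => /le_trans; apply.
  by apply: (le_trans (G_le _)); rewrite lerDl.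
have shift : \sum_(t < N) f t.+1 = \sum_(t < N) f t.
  rewrite -!(big_mkord xpredT f) -(big_mkord xpredT (fun t => f t.+1)).
  have fN : f N = f 0%N by rewrite /f -(z_mod N) modnn.
  have h1 : \sum_(0 <= t < N.+1) f t = f 0%N + \sum_(0 <= t < N) f t.+1.
    by rewrite big_nat_recl.
  have h2 : \sum_(0 <= t < N.+1) f t = \sum_(0 <= t < N) f t + f N.
    by rewrite big_nat_recr.
  by apply: (@addrI _ (f 0%N)); rewrite -h1 h2 fN addrC.
apply: (@le_trans _ _ (\sum_(t < N) N%:R^-1 * (f t + f t.+1))).
  by apply: ler_sum => t _; exact: step_le.
rewrite -mulr_sumr big_split shift /=.
have -> : \sum_(t < N) f t = N%:R * (2 * asum a + B) + 2 * asum a * \sum_(t < N) `|z t| ^+ 2.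
  have -> : N%:R * (2 * asum a + B) = \sum_(t < N) (2 * asum a + B).
    by rewrite sumr_const card_ord mulr_natl.
  rewrite (mulr_sumr _ _ (fun t : 'I_N => `|z t| ^+ 2)) -big_split.
  by apply: eq_bigr => t _; rewrite /f /=; ring.
have := ler_wpM2l (mulr_ge0 (ler0n R 2) S0) sq_bound.
set Q := \sum_t _; rewrite /V /orbit_variation => h.
have -> : N%:R^-1 * (N%:R * (2 * asum a + B) + 2 * asum a * Q +
    (N%:R * (2 * asum a + B) + 2 * asum a * Q)) =
  2 * (2 * asum a + B + 2 * asum a * (N%:R^-1 * Q)) by field.
lra.
Qed.

(** Some point is as small as the mean square allows, and all others are within the total variation
    of it. *)
Let sup_bound t : `|z t| <= orbit_bound B C1.
Proof.
have [t0 zt0] : exists t0 : 'I_N, `|z t0| <= 1 + C1.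
  have [|t0 ht] := @avg_exists (fun t => - `|z t| ^+ 2) (- C1).
    by rewrite sumrN mulrN lerN2.
  exists t0; move: ht; rewrite lerN2 => ht.
  have := sqr_ge0 (`|z t0| - 1); rewrite sqrrB; have := sqr_ge0 `|z t0|; lra.
have tele (s r : nat) : (s <= r)%N -> (r <= N)%N -> `|z r - z s| <= V.
  move=> sr rN; apply: le_trans variation.
  rewrite -(big_mkord xpredT (fun t => `|z t.+1 - z t|)) -(telescope_sumr z sr).
  apply: (le_trans (ler_norm_sum _ _ _)).
  rewrite (big_cat_nat (leq0n s) (leq_trans sr rN))/= (big_cat_nat sr rN)/=.
  by rewrite addrCA lerDl addr_ge0 ?sumr_ge0.
rewrite -z_mod; have tN : (t %% N < N)%N by rewrite ltn_mod.
have dist : `|z (t %% N)%N - z t0| <= V.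
  have [le|/ltnW le] := leqP t0 (t %% N)%N; first exact: tele (ltnW tN).
  by rewrite distrC; apply: tele => //; exact: ltnW.
have := ler_normD (z (t %% N)%N - z t0) (z t0); rewrite subrK /orbit_bound -/V.
lra.
Qed.

Lemma crit_sequence (beta : R) :
  beta <= 2^-1 * \sum_i mode_lam R i.1 * cf c i ^+ 2 - Gc c ->
  exists w : nat -> P, [/\ forall t, w (t + N)%N = w t,
    forall t, N%:R *: ((w t.+1).1 - (w t).1) = (G (w t)).2 /\
      N%:R *: ((w t.+1).2 - (w t).2) = - (G (w t.+1)).1,
    forall t, `|w t| <= orbit_bound B C1
    & beta <= act_density (w 0%N)].
Proof.
(* The mean of the density is the critical value, so at some time the density is at least [beta];
   the orbit is started at that time. *)
move=> Hbeta; have [|t0 ht0] := @avg_exists (fun t => act_density (z t)) beta.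
  apply: (le_trans Hbeta); rewrite le_eqVlt; apply/orP; left; apply/eqP.
  rewrite /act_density sumrB mulrBr; congr (_ - _).
  rewrite -mulr_sumr mulrCA; congr (_ * _).
  under [in RHS]eq_bigr do rewrite -lift_q.
  rewrite parseval mulKf//; apply: eq_bigr => i _.
  by rewrite expr2 mulrA crit cf_row.
exists (fun t => z (t0 + t)%N); split=> [t|t|t|].
- by rewrite addnA /z lift_periodic.
- by rewrite addnS; exact: steps.
- exact: sup_bound.
- by rewrite addn0.
Qed.

End CritSequence.
End FixedM.

Lemma discrete_orbits : exists beta L M0, 0 < beta /\ forall M, (M0 <= M)%N ->
  exists w : nat -> P, [/\ forall t, w (t + nsteps M)%N = w t,
    forall t, (nsteps M)%:R *: ((w t.+1).1 - (w t).1) = (G (w t)).2 /\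
      (nsteps M)%:R *: ((w t.+1).2 - (w t).2) = - (G (w t.+1)).1,
    forall t, `|w t| <= L
    & beta <= act_density (w 0%N)].
Proof.
have [M0 [g [M0_gt1 g0 gap]]] := nonresonance_gap a_gt0 a_lt a0_gt a0_lt.
have [B B0 [GB Gmod]] := gradient_modulus a_gt0 G_cont G_out.
have [Cg Fgr] := F_growth F_cont F_out.
have [A A0 FA] := F_quadratic a_gt0 F_cont F_out rho_gt0 F_zs.
have [e1 e10 e1a] := finite_pos_min a_gt0.
pose eta := Order.min e1 (a j0 - pi).
pose m := (Num.truncn (16 * A)).+1.
have mR : (0 : R) < m%:R by rewrite ltr0n.
(* The largest value with [m%:R * 2 * s <= rho / 2], as [Gamma_fixedM] requires. *)
pose s := rho / (4 * m%:R).
have s0 : 0 < s by rewrite divr_gt0// mulr_gt0.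
exists (s ^+ 2 / 4), (orbit_bound B ((n * 2)%:R * B ^+ 2 / g ^+ 2)), M0.
split; first by rewrite divr_gt0// exprn_gt0.
move=> M M0M; have M_gt0 : (0 < M)%N by apply: leq_trans M0M; exact: ltnW.
have gapM := gap M M0M.
have a0' := a0_gt.
have [|||||||c Hc Hcrit] := @discrete_crit M M_gt0 Cg eta (s ^+ 2 / 2) (s ^+ 2 / 4) B Fgr GB Gmod.
- by rewrite lt_min e10 subr_gt0.
- by move=> j; rewrite ge_min e1a.
- by rewrite ge_min lexx orbT.
- move=> l j; rewrite -subr_eq0 -normr_gt0; exact: lt_le_trans (gapM l j).
- by rewrite divr_gt0// exprn_gt0.
- by rewrite divr_gt0// exprn_gt0.
- move=> c c_neg c_pos.
  apply: (@Gamma_fixedM R n F zs A rho rho_gt0 F_zs A0 FA M m s) => //.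
    by apply/ltW; exact: truncnS_gt.
  by rewrite /s le_eqVlt; apply/orP; left; apply/eqP; field; rewrite gt_eqF.
exact: (crit_sequence Hcrit B0 GB g0 gapM Hc).
Qed.

End DiscreteOrbit.

(** * Periodic orbits of Hamiltonian systems *)

Lemma is_derive_of_bound (R : realType) (V : normedModType R) (z : R -> V) (t : R)
    (v : V) :
  (forall e : R, 0 < e -> exists2 d, 0 < d & forall s, `|s - t| < d ->
    `|z s - z t - (s - t) *: v| <= e * `|s - t|) ->
  is_derive t (1 : R) z v.
Proof.
move=> zd.
have lim_v : h^-1 *: (z (h *: (1 : R) + t) - z t) @[h --> 0^'] --> v.
  apply/cvgrPdist_le => e e0; have [d d0 dz] := zd e e0.
  rewrite /dnbhs; apply/nbhs_ballP; exists d => //= h.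
  rewrite -ball_normE /= sub0r normrN => hd h0.
  have := dz (h + t); rewrite addrK => /(_ hd).
  have -> : h *: (1 : R) = h by exact: mulr1.
  move=> le_e; rewrite distrC.
  have -> : h^-1 *: (z (h + t) - z t) - v = h^-1 *: (z (h + t) - z t - h *: v).
    by rewrite [RHS]scalerBr scalerA mulVf// scale1r.
  rewrite normrZ normfV ler_pdivrMl ?normr_gt0// mulrC.
  exact: le_e.
apply: DeriveDef; first by apply/cvg_ex; exists v.
exact: cvg_lim lim_v.
Qed.

Lemma compact_ultra_lim (T : topologicalType) (U : set_system nat) (A : set T)
    (f : nat -> T) : UltraFilter U -> compact A -> (\forall M \near U, A (f M)) ->
  exists2 l, A l & f @ U --> l.
Proof.
move=> UU cA fA; have UP := @ultra_proper _ _ UU.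
have [l [Al lclu]] := cA (f @ U) _ fA.
exists l => // B nB; rewrite /fmap /=.
have [//|UB] := in_ultra_setVsetC (f @^-1` B) UU.
have [x [/= nBx Bx]] := lclu (~` B) B UB nB.
by [].
Qed.

Section PeriodicLimit.
Variables (R : realType) (n : nat).
Local Notation P := (phase_space R n).
Variables (G : P -> P) (gd : P -> R) (beta L : R) (M0 : nat) (Nst : nat -> nat).
Hypothesis G_cont : continuous G.
Hypothesis gd_cont : continuous gd.
Hypothesis Nst_ge : forall M, (M < Nst M)%N.

Variable w : nat -> nat -> P.
Hypothesis w_periodic : forall M, (M0 <= M)%N -> forall t, w M (t + Nst M)%N = w M t.
Hypothesis w_step1 : forall M, (M0 <= M)%N -> forall t,
  (Nst M)%:R *: ((w M t.+1).1 - (w M t).1) = (G (w M t)).2.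
Hypothesis w_step2 : forall M, (M0 <= M)%N -> forall t,
  (Nst M)%:R *: ((w M t.+1).2 - (w M t).2) = - (G (w M t.+1)).1.
Hypothesis w_bound : forall M, (M0 <= M)%N -> forall t, `|w M t| <= L.
Hypothesis w_density : forall M, (M0 <= M)%N -> beta <= gd (w M 0%N).

Let X z := ham_rot (G z).
(** The discrete orbit, extended to all integers by periodicity. *)
Let ww M (k : int) : P := w M `|(k %% (Nst M)%:Z)%Z|%N.

Let N_gt0 M : (0 < Nst M)%N. Proof. exact: leq_ltn_trans (Nst_ge M). Qed.
Let NR0 M : (0 : R) < (Nst M)%:R. Proof. by rewrite ltr0n. Qed.

Let ww_succ M (k : int) : (M0 <= M)%N ->
  exists2 t, ww M k = w M t & ww M (k + 1) = w M t.+1.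
Proof.
move=> MM; have Nz : (Nst M)%:Z != 0 by have := N_gt0 M; lia.
exists `|(k %% (Nst M)%:Z)%Z|%N => //.
rewrite /ww -modzDml; set r := (k %% _)%Z.
have r0 : 0 <= r by exact: modz_ge0.
have rN : r < (Nst M)%:Z by apply: ltz_pmod; have := N_gt0 M; lia.
have [rN1|rN1] := ltP (r + 1) (Nst M)%:Z.
  rewrite modz_small; first by congr w; lia.
  by apply/andP; split=> //; exact: addr_ge0.
have -> : r + 1 = (Nst M)%:Z by lia.
rewrite modzz /= -(w_periodic MM 0); congr w; lia.
Qed.

Let ww_bound M k : (M0 <= M)%N -> `|ww M k| <= L.
Proof. by move=> MM; exact: w_bound. Qed.

Let G_bound : exists2 BL, 0 < BL & forall z, `|z| <= L -> `|G z| <= BL.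
Proof.
have [|B B0 GB] := @pball_bound R n (fun z => `|G z|) L.
  by move=> x; apply: cvg_norm; exact: G_cont.
by exists (B + 1) => [|z /GB /le_trans->//]; rewrite ?ltr_wpDl// lerDl.
Qed.

(** Position coordinates use the field at the left end of the step, momentum coordinates the one at
    the right end. *)
Let ww_step M k (kap : 'I_n * bool) : (M0 <= M)%N -> exists2 l : bool,
  True & pc kap (ww M (k + 1)) - pc kap (ww M k) =
  (Nst M)%:R^-1 * pc kap (X (ww M (k + l%:R))).
Proof.
move=> MM; have [t e1 e2] := ww_succ k MM; have NR := lt0r_neq0 (NR0 M).
case: kap => j []; last first.
  exists false => //; rewrite addr0 e1 e2 /pc /=.
  by have := congr1 (fun u : 'cV_n => u j 0) (w_step1 MM t); rewrite !mxE => <-; rewrite mulKf.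
exists true => //; rewrite e1 e2 /pc /=.
have := congr1 (fun u : 'cV_n => u j 0) (w_step2 MM t); rewrite !mxE => <-.
by rewrite mulKf.
Qed.

Let X_norm z w' : `|X z - X w'| <= `|G z - G w'|.
Proof.
apply: phase_norm_le => // -[j []]; rewrite /pc /= !mxE.
  have := pc_le_norm (j, false) (G z - G w'); rewrite /pc /= !mxE.
  by rewrite -opprD normrN.
by have := pc_le_norm (j, true) (G z - G w'); rewrite /pc /= !mxE.
Qed.

Let X_bound BL : (forall z, `|z| <= L -> `|G z| <= BL) ->
  forall z, `|z| <= L -> `|X z| <= BL.
Proof.
move=> GB z zL; apply: le_trans (GB z zL); apply: phase_norm_le => // -[j []].
  rewrite /pc /= !mxE normrN; exact: (pc_le_norm (j, false) (G z)).
by rewrite /pc /=; exact: (pc_le_norm (j, true) (G z)).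
Qed.

Let ww_lip M k (m : nat) BL : (M0 <= M)%N -> 0 < BL ->
  (forall z, `|z| <= L -> `|G z| <= BL) ->
  `|ww M (k + m%:Z) - ww M k| <= m%:R / (Nst M)%:R * BL.
Proof.
move=> MM BL0 GB; elim: m => [|m IH]; first by rewrite addr0 subrr normr0 !mul0r.
have -> : k + m.+1%:Z = k + m%:Z + 1 by rewrite -addrA; congr (_ + _); lia.
set k' := k + m%:Z in IH *.
have one : `|ww M (k' + 1) - ww M k'| <= (Nst M)%:R^-1 * BL.
  apply: phase_norm_le => [|kap]; first by rewrite mulr_ge0 ?invr_ge0// ltW.
  rewrite pcB; have [l _ ->] := ww_step k' kap MM.
  rewrite normrM ger0_norm ?invr_ge0// ler_wpM2l ?invr_ge0//.
  by apply: (le_trans (pc_le_norm _ _)); apply: (X_bound GB); exact: ww_bound.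
have := ler_normD (ww M (k' + 1) - ww M k') (ww M k' - ww M k).
rewrite addrA subrK; set u := `|ww M (k' + 1) - ww M k|.
rewrite -[m.+1%:R]natr1 mulrDl mul1r mulrDl; lra.
Qed.

(** A discrete Taylor estimate of first order: during [m] steps the orbit stays within [d] of its
    starting point, so the field changes by at most [e]. *)
Let ww_taylor M k (m : nat) BL e d : (M0 <= M)%N -> 0 < BL ->
  (forall z, `|z| <= L -> `|G z| <= BL) -> 0 < e ->
  (forall z z', `|z| <= L -> `|z'| <= L -> `|z - z'| < d -> `|G z - G z'| < e) ->
  m%:R / (Nst M)%:R * BL < d ->
  `|ww M (k + m%:Z) - ww M k - (m%:R / (Nst M)%:R) *: X (ww M k)| <=
    m%:R / (Nst M)%:R * e.
Proof.
move=> MM BL0 GB e0 Gu md.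
have Ni : 0 <= (Nst M)%:R^-1 :> R by rewrite invr_ge0.
suff H j : (j <= m)%N ->
    `|ww M (k + j%:Z) - ww M k - (j%:R / (Nst M)%:R) *: X (ww M k)| <=
      j%:R / (Nst M)%:R * e by exact: H.
elim: j => [_|j IH jm]; first by rewrite addr0 subrr !mul0r scale0r subr0 normr0.
have {}IH := IH (ltnW jm).
have eqk : k + j.+1%:Z = k + j%:Z + 1 by rewrite -addrA; congr (_ + _); lia.
have near (l : bool) : `|X (ww M (k + j%:Z + l%:R)) - X (ww M k)| <= e.
  apply: (le_trans (X_norm _ _)); apply: ltW; apply: Gu; rewrite ?ww_bound//.
  have -> : k + j%:Z + l%:R = k + (j + l)%N%:Z.
    by rewrite PoszD addrA; case: l.
  apply: (le_lt_trans (ww_lip k (j + l) MM BL0 GB)); apply: le_lt_trans md.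
  rewrite ler_pM2r// ler_wpM2r// ler_nat.
  by case: l; rewrite ?addn1 ?addn0// ltnW.
have one : `|ww M (k + j%:Z + 1) - ww M (k + j%:Z) - (Nst M)%:R^-1 *: X (ww M k)| <=
    (Nst M)%:R^-1 * e.
  apply: phase_norm_le => [|kap]; first by rewrite mulr_ge0// ltW.
  rewrite !pcB pcZ; have [l _ ->] := ww_step (k + j%:Z) kap MM.
  rewrite -mulrBr -pcB normrM ger0_norm// ler_wpM2l//.
  by apply: (le_trans (pc_le_norm _ _)); exact: near.
rewrite eqk -[j.+1%:R]natr1 mulrDl mul1r scalerDl mulrDl.
have -> : ww M (k + j%:Z + 1) - ww M k - ((j%:R / (Nst M)%:R) *: X (ww M k) +
    (Nst M)%:R^-1 *: X (ww M k)) =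
  (ww M (k + j%:Z) - ww M k - (j%:R / (Nst M)%:R) *: X (ww M k)) +
  (ww M (k + j%:Z + 1) - ww M (k + j%:Z) - (Nst M)%:R^-1 *: X (ww M k)).
  by apply: pc_inj => kap; rewrite !(pcD, pcN, pcZ); ring.
by apply: (le_trans (ler_normD _ _)); rewrite lerD.
Qed.

Let ZM M (t : R) := ww M (Num.floor (t * (Nst M)%:R)).

(** The bounded values converge at every time along one ultrafilter, so no subsequences have to be
    extracted; the Taylor estimate passes to the limit and yields the derivative. *)
Lemma periodic_limit : exists z : R -> P,
  [/\ forall t, is_derive t (1 : R) z (ham_rot (G (z t))),
      forall t, z (t + 1) = z t & beta <= gd (z 0)].
Proof.
have [U [UU ooU]] := ultraFilterLemma (eventually_filter : ProperFilter \oo).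
have UP := @ultra_proper _ _ UU.
have UM0 (Q : nat -> Prop) : (forall M, (M0 <= M)%N -> Q M) -> \forall M \near U, Q M.
  by move=> HQ; apply: ooU; exists M0.
have /choice[z zP] : forall t, exists l, `|l| <= L /\ (fun M => ZM M t) @ U --> l.
  move=> t.
  have [|l lL lc] := @compact_ultra_lim P U _ (fun M => ZM M t) UU (@compact_pball R n L).
    by apply: UM0 => M MM; exact: ww_bound.
  by exists l.
have zL t : `|z t| <= L := (zP t).1.
have zc t : (fun M => ZM M t) @ U --> z t := (zP t).2.
have [BL BL0 GB] := G_bound.
have invN_small (e : R) : 0 < e -> exists M1, forall M, (M1 <= M)%N -> (Nst M)%:R^-1 < e.
  move=> e0; exists (Num.truncn e^-1) => M MM.
  rewrite invf_plt ?posrE//; apply: (lt_le_trans (truncnS_gt _)).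
  by rewrite ler_nat (leq_ltn_trans MM).
pose mm M (s t : R) := (`|Num.floor (t * (Nst M)%:R) - Num.floor (s * (Nst M)%:R)|%N).
have mmP M s t : s <= t -> Num.floor (t * (Nst M)%:R) =
    Num.floor (s * (Nst M)%:R) + (mm M s t)%:Z /\
    `|(t - s) - (mm M s t)%:R / (Nst M)%:R| <= (Nst M)%:R^-1.
  move=> st; have fl : Num.floor (s * (Nst M)%:R) <= Num.floor (t * (Nst M)%:R).
    by apply: le_floor; rewrite ler_pM2r.
  have eqf : Num.floor (t * (Nst M)%:R) =
      Num.floor (s * (Nst M)%:R) + (mm M s t)%:Z.
    by rewrite /mm gez0_abs ?subr_ge0//; exact: (esym (subrKC _ _)).
  split=> //; have := floor_itv (t * (Nst M)%:R); have := floor_itv (s * (Nst M)%:R).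
  rewrite {}eqf; set m := mm M s t; set f := Num.floor _.
  rewrite !intrD -pmulrn => /andP[h1 h2] /andP[h3 h4].
  have -> : t - s - m%:R / (Nst M)%:R =
      ((t * (Nst M)%:R - s * (Nst M)%:R) - m%:R) / (Nst M)%:R.
    by field; rewrite gt_eqF.
  rewrite normrM [`|_^-1|]ger0_norm ?invr_ge0// -[leRHS]mul1r ler_wpM2r ?invr_ge0//.
  rewrite ler_norml; apply/andP; split; lra.
have mm_cvg s t : s <= t -> (fun M => (mm M s t)%:R / (Nst M)%:R : R) @ U --> t - s.
  move=> st; apply/cvgrPdist_le => e e0; have [M1 HM1] := invN_small e e0.
  apply: ooU; exists M1 => // M MM.
  by have [_ /le_trans] := mmP M s t st; apply; apply/ltW/HM1.
have taylor e d s t : 0 < e ->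
    (forall z z', `|z| <= L -> `|z'| <= L -> `|z - z'| < d -> `|G z - G z'| < e) ->
    s <= t -> (t - s) * BL < d ->
    `|z t - z s - (t - s) *: X (z s)| <= (t - s) * e.
  move=> e0 Gu st tsd.
  have X_cont : continuous X.
    apply: cont_phase => -[j []]; rewrite /pc /=.
      under eq_fun do rewrite mxE.
      by apply: contN; exact: (@cont_pc _ _ _ G (j, false)).
    exact: (@cont_pc _ _ _ G (j, true)).
  have cv : (fun M => (mm M s t)%:R / (Nst M)%:R * e - `|ZM M t - ZM M s -
      ((mm M s t)%:R / (Nst M)%:R) *: X (ZM M s)|) @ U -->
      (t - s) * e - `|z t - z s - (t - s) *: X (z s)|.
    apply: cvgB; first by apply: cvgM; [exact: mm_cvg|exact: cvg_cst].
    apply: cvg_norm; apply: cvgB; first by apply: cvgB; exact: zc.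
    apply: cvgZ; first exact: mm_cvg.
    by apply: continuous_cvg; [exact: X_cont|exact: zc].
  rewrite -subr_ge0; apply: (cvgr_to_ge cv).
  have lt_d : \forall M \near U, (mm M s t)%:R / (Nst M)%:R * BL < d.
    have cB : (fun M => (mm M s t)%:R / (Nst M)%:R * BL) @ U --> (t - s) * BL.
      by apply: cvgM; [exact: mm_cvg|exact: cvg_cst].
    exact: (cvgr_lt _ cB).
  have M0U := UM0 _ (fun M (MM : (M0 <= M)%N) => MM).
  apply: filterS2 lt_d M0U => M lt_d MM; rewrite subr_ge0.
  have [eqf _] := mmP M s t st; rewrite /ZM eqf.
  exact: ww_taylor MM BL0 GB e0 Gu lt_d.
exists z; split=> [t|t|].
- apply: is_derive_of_bound => e e0.
  have e2 : 0 < e / 2 by rewrite divr_gt0.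
  have [d d0 Gu] := @pball_unif R n G L (e / 2) G_cont e2.
  (* The second bound serves for times before [t]: there the Taylor estimate starts at [s], and the
     field at [z s] has to be compared with the one at [z t]. *)
  pose d' := Order.min (d / (2 * BL)) (d / (2 * (BL + e))).
  have d'0 : 0 < d' by rewrite lt_min !divr_gt0// mulr_gt0// addr_gt0.
  exists d' => // s sd.
  have [st|/ltW ts] := leP s t; last first.
    rewrite ger0_norm ?subr_ge0// in sd *.
    apply: (@le_trans _ _ ((s - t) * (e / 2))); last first.
      by rewrite mulrC ler_wpM2r ?subr_ge0//; lra.
    apply: (taylor _ d) => //.
    move: sd; rewrite lt_min => /andP[sd _].
    by move: sd; rewrite ltr_pdivlMr ?mulr_gt0//; lra.
  rewrite distrC ger0_norm ?subr_ge0// in sd *.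
  have tsd : (t - s) * BL < d / 2.
    move: sd; rewrite lt_min => /andP[sd _].
    by move: sd; rewrite ltr_pdivlMr ?mulr_gt0//; lra.
  have tsd2 : (t - s) * (BL + e) < d.
    move: sd; rewrite lt_min => /andP[_ sd].
    have ts0 : 0 <= t - s by rewrite subr_ge0.
    move: sd; rewrite ltr_pdivlMr ?mulr_gt0 ?addr_gt0//.
    have : 0 <= (t - s) * (BL + e) by rewrite mulr_ge0// addr_ge0 ?ltW.
    lra.
  have h1 := taylor (e / 2) d s t e2 Gu st _; have {}h1 := h1 ltac:(lra).
  have zts : `|z t - z s| < d.
    apply: le_lt_trans tsd2; rewrite -[z t - z s](subrK ((t - s) *: X (z s))).
    apply: (le_trans (ler_normD _ _)); rewrite addrC mulrDr lerD//.
      rewrite normrZ ger0_norm ?subr_ge0// ler_wpM2l ?subr_ge0//.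
      exact: (X_bound GB).
    by apply: (le_trans h1); rewrite ler_wpM2l ?subr_ge0//; lra.
  have h2 : `|X (z t) - X (z s)| <= e / 2.
    by apply: (le_trans (X_norm _ _)); apply: ltW; apply: Gu.
  have -> : z s - z t - (s - t) *: ham_rot (G (z t)) =
      - (z t - z s - (t - s) *: X (z s)) + (t - s) *: (X (z t) - X (z s)).
    by apply: pc_inj => kap; rewrite !(pcD, pcN, pcZ) /X; ring.
  apply: (le_trans (ler_normD _ _)); rewrite normrN.
  have : `|(t - s) *: (X (z t) - X (z s))| <= (t - s) * (e / 2).
    by rewrite normrZ ger0_norm ?subr_ge0// ler_wpM2l// subr_ge0.
  lra.
- have eqZ : (fun M => ZM M (t + 1)) = (fun M => ZM M t).
    apply/funext => M; rewrite /ZM mulrDl mul1r.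
    have -> : Num.floor (t * (Nst M)%:R + (Nst M)%:R) =
        Num.floor (t * (Nst M)%:R) + (Nst M)%:Z.
      by rewrite floorDrz ?natr_int// (intrKfloor (Nst M)%:Z).
    by rewrite /ww modzDr.
  have := zc (t + 1); rewrite eqZ => zt1.
  by apply: cvg_unique zt1 (zc t); exact: norm_hausdorff.
- have cg : (fun M => gd (ZM M 0)) @ U --> gd (z 0).
    by apply: continuous_cvg; [exact: gd_cont|exact: zc].
  apply: (cvgr_to_ge cg); apply: UM0 => M MM.
  by rewrite /ZM mul0r floor0 /ww mod0z /=; exact: w_density.
Qed.

End PeriodicLimit.

(** At a zero of [G] the density is [- F], hence at most 0; the positive density at time 0 therefore
    rules out constant solutions. *)
Theorem periodic_orbit (R : realType) (n : nat) (a : 'I_n -> R) (j0 : 'I_n)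
    (F : phase_space R n -> R) (G : phase_space R n -> phase_space R n)
    (C0 rho : R) (zs : phase_space R n) :
  (forall j, 0 < a j) -> (forall j, j != j0 -> a j < pi) ->
  pi < a j0 -> a j0 < 2 * pi ->
  (forall (z v : phase_space R n) (t : R), is_derive t (1 : R)
    (fun s : R => F (z + s *: v)) (dotp (G (z + t *: v)) v)) ->
  continuous F -> continuous G ->
  (forall z, C0 <= `|z| -> G z = alin a z) ->
  (forall z, C0 <= `|z| -> F z = aquad a z) ->
  (forall z, 0 <= F z) -> 0 < rho -> (forall z, `|z - zs| < rho -> F z = 0) ->
  exists z : R -> phase_space R n,
    [/\ forall t, is_derive t (1 : R) z (ham_rot (G (z t))),
        forall t, z (t + 1) = z t & 0 < act_density F G (z 0)].
Proof.
move=> a0 alt a0gt a0lt dF Fc Gc Gout Fout F0 rho0 Fzs.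
have [beta [L [M0 [beta0 orb]]]] :=
  discrete_orbits a0 alt a0gt a0lt dF Fc Gc Gout Fout F0 rho0 Fzs.
have /choice[w wP] : forall M, exists w : nat -> phase_space R n, (M0 <= M)%N ->
    [/\ forall t, w (t + nsteps M)%N = w t,
    forall t, (nsteps M)%:R *: ((w t.+1).1 - (w t).1) = (G (w t)).2 /\
      (nsteps M)%:R *: ((w t.+1).2 - (w t).2) = - (G (w t.+1)).1,
    forall t, `|w t| <= L & beta <= act_density F G (w 0%N)].
  move=> M; have [MM|MM] := boolP (M0 <= M)%N; last by exists (fun=> 0).
  by have [w ?] := orb M MM; exists w.
have gdc : continuous (act_density F G).
  apply: contB => //; apply: contM; first exact: cont_cst.
  by apply: cont_dotp => // z; exact: cvg_id.
have [||||||z [z1 z2 z3]] :=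
  @periodic_limit R n G (act_density F G) beta L M0 nsteps Gc gdc _ w.
- by move=> M; rewrite /nsteps ltnS -addnn leq_addr.
- by move=> M /wP[].
- by move=> M MM t; have [_ /(_ t)[]] := wP M MM.
- by move=> M MM t; have [_ /(_ t)[]] := wP M MM.
- by move=> M /wP[].
- by move=> M /wP[].
by exists z; split => //; exact: lt_le_trans z3.
Qed.

(** * Integrals of continuous functions *)

Section Primitives.
Variable R : realType.
Local Notation mu := (@lebesgue_measure R).
Implicit Types (f g F : R -> R) (a b c t : R).

Lemma is_derive_continuous F f : (forall t, is_derive t (1 : R) F (f t)) -> continuous F.
Proof.
move=> dF t; apply: differentiable_continuous; apply/derivable1_diffP.
by have [] := dF t.
Qed.

(** Integrals from -1, -2, ..., normalized to vanish at 0, agree where they overlap and are glued to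
    a primitive on the whole line. *)
Let base f (k : nat) t : R := \int[mu]_(s in `[- k.+1%:R, t]) f s.
Let shifted f k t : R := base f k t - base f k 0.

Let shifted_derive f k t : continuous f -> - k.+1%:R < t ->
  is_derive t (1 : R) (shifted f k) (f t).
Proof.
move=> fc kt.
have [dF eF] : derivable (base f k) t 1 /\ derive1 (base f k) t = f t.
  apply: (@continuous_FTC1_closed R f _ t (t + 1)) => //.
  - by rewrite ltrDl.
  - apply: continuous_compact_integrable; first exact: segment_compact.
    exact: continuous_subspaceT.
  - exact: fc.
have d1 : is_derive t (1 : R) (base f k) (f t).
  exact: DeriveDef dF (etrans (esym (derive1E _ _)) eF).
have d2 := is_derive_cst (base f k 0) t (1 : R).
by have := is_deriveB d1 d2; rewrite subr0.
Qed.

Let shifted_eq f k l t : continuous f -> (k <= l)%N -> - k.+1%:R < t ->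
  shifted f k t = shifted f l t.
Proof.
move=> fc kl kt; pose D s := shifted f k s - shifted f l s.
have D0 (s : R) : - k.+1%:R < s -> is_derive s (1 : R) D 0.
  move=> ks; have d1 := shifted_derive fc ks.
  have d2 : is_derive s (1 : R) (shifted f l) (f s).
    by apply: shifted_derive fc _; apply: le_lt_trans ks; rewrite lerN2 ler_nat.
  by have := is_deriveB d1 d2; rewrite subrr.
have D00 : D 0 = 0 by rewrite /D /shifted !subrr.
have const (a b : R) : a <= b -> - k.+1%:R < a -> D b = D a.
  move=> ab ka; have [||c _] := @MVT_segment R D (fun=> 0) a b ab.
  - by move=> x; rewrite in_itv/= => /andP[ax _]; apply: D0; exact: lt_trans ax.
  - apply: derivable_within_continuous => x; rewrite in_itv/= => /andP[ax _].
    by have [] := D0 x (lt_le_trans ka ax).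
  by rewrite mul0r => /eqP; rewrite subr_eq0 => /eqP.
suff : D t = 0 by rewrite /D => /eqP; rewrite subr_eq0 => /eqP.
have [t0|/ltW t0] := leP 0 t.
  by rewrite (const 0 t t0) ?D00// oppr_lt0 ltr0n.
by rewrite -(const t 0 t0 kt).
Qed.

Lemma prim_exists f : continuous f -> exists F, forall t, is_derive t (1 : R) F (f t).
Proof.
move=> fc; pose F t := shifted f (Num.truncn `|t|) t; exists F => t.
pose K := Num.truncn (`|t| + 1).
have lowK s : `|s - t| < 1 -> (Num.truncn `|s| <= K)%N.
  move=> st; apply: le_truncn; have := ler_normD (s - t) t; rewrite subrK; lra.
have low (s : R) : - (Num.truncn `|s|).+1%:R < s.
  rewrite ltrNl; apply: le_lt_trans (truncnS_gt _).
  by rewrite -normrN ler_norm.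
have nearF : {near t, shifted f K =1 F}.
  apply/nbhs_ballP; exists 1; first exact: ltr01.
  move=> s; rewrite -ball_normE => ts; have {}ts : `|t - s| < 1 := ts.
  by rewrite /F (@shifted_eq f _ K)// lowK// distrC.
have dK : is_derive t (1 : R) (shifted f K) (f t).
  apply: shifted_derive fc _; apply: (le_lt_trans _ (low t)).
  by rewrite lerN2 ler_nat ltnS; apply: lowK; rewrite subrr normr0.
exact: (@near_eq_is_derive _ _ _ _ _ _ _ _ nearF dK).
Qed.

Definition prim f : R -> R :=
  xget (fun=> 0) [set F | forall t, is_derive t (1 : R) F (f t)].

Lemma prim_derive f : continuous f -> forall t, is_derive t (1 : R) (prim f) (f t).
Proof.
move=> fc; rewrite /prim; case: xgetP => [F _ //|noF].
by have [F dF] := prim_exists fc; have := noF F.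
Qed.

(** An oriented integral, defined for endpoints in any order; additivity in the interval and the
    evaluation by any primitive are immediate. *)
Definition itg a b f : R := prim f b - prim f a.

Lemma prim_unique F f a b : continuous f ->
  (forall t, is_derive t (1 : R) F (f t)) -> itg a b f = F b - F a.
Proof.
move=> fc dF; have D0 (t : R) : is_derive t (1 : R) (fun s => prim f s - F s) 0.
  by have := is_deriveB (prim_derive fc t) (dF t); rewrite subrr.
have := @is_derive_0_is_cst R _ b a D0.
by rewrite /itg; lra.
Qed.

Lemma itgD f g a b : continuous f -> continuous g ->
  itg a b (fun t => f t + g t) = itg a b f + itg a b g.
Proof.
move=> fc gc.
have dF (t : R) : is_derive t (1 : R) (fun t => prim f t + prim g t) (f t + g t).
  exact: is_deriveD (prim_derive fc t) (prim_derive gc t).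
by rewrite (prim_unique a b (contD fc gc) dF) /itg; ring.
Qed.

Lemma itgZ k f a b : continuous f -> itg a b (fun t => k * f t) = k * itg a b f.
Proof.
move=> fc.
have dF (t : R) : is_derive t (1 : R) (fun t => k * prim f t) (k * f t).
  by have := is_deriveZ k (prim_derive fc t).
by rewrite (prim_unique a b (contM (@cont_cst R R k) fc) dF) /itg; ring.
Qed.

Lemma itgN f a b : continuous f -> itg a b (fun t => - f t) = - itg a b f.
Proof.
move=> fc; rewrite -mulN1r -itgZ//; congr itg; apply/funext => t.
by rewrite mulN1r.
Qed.

Lemma itgB f g a b : continuous f -> continuous g ->
  itg a b (fun t => f t - g t) = itg a b f - itg a b g.
Proof. by move=> fc gc; rewrite itgD// ?itgN//; exact: contN. Qed.

Lemma itg_cst k a b : itg a b (fun=> k) = k * (b - a).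
Proof.
have dF (t : R) : is_derive t (1 : R) (fun t => k * t) k.
  by have := is_deriveZ k (is_derive_id t (1 : R)); rewrite /= scaleRE mulr1.
by rewrite (prim_unique a b (@cont_cst R R k) dF) mulrBr.
Qed.

Lemma itg_sum (I : finType) (f : I -> R -> R) a b : (forall i, continuous (f i)) ->
  itg a b (fun t => \sum_i f i t) = \sum_i itg a b (f i).
Proof.
move=> fc; elim: (index_enum I) => [|i s IH].
  under eq_fun do rewrite big_nil.
  by rewrite big_nil itg_cst mul0r.
rewrite big_cons -IH -itgD//; last by apply: continuous_big => //; exact: add_continuous.
by congr itg; apply/funext => t; rewrite big_cons.
Qed.

Lemma itg_cat f a b c : itg a b f + itg b c f = itg a c f.
Proof. by rewrite /itg; ring. Qed.

Lemma le_itg f g a b : a <= b -> continuous f -> continuous g ->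
  (forall t, a <= t <= b -> f t <= g t) -> itg a b f <= itg a b g.
Proof.
move=> ab fc gc fg.
have [|c cab] := @MVT_is_derive R (fun t => prim g t - prim f t) (fun t => g t - f t) a b ab.
  by move=> t; exact: is_deriveB (prim_derive gc t) (prim_derive fc t).
have : 0 <= (g c - f c) * (b - a) by rewrite mulr_ge0// subr_ge0// fg.
by rewrite /itg; lra.
Qed.

Lemma itg_ge0 f a b : a <= b -> continuous f ->
  (forall t, a <= t <= b -> 0 <= f t) -> 0 <= itg a b f.
Proof.
move=> ab fc f0; rewrite -[leLHS](mul0r (b - a)) -(itg_cst 0).
by apply: le_itg => //; exact: cont_cst.
Qed.

Lemma integral_itg f a b : a < b -> continuous f ->
  (\int[mu]_(t in `[a, b]) (f t)%:E)%E = (itg a b f)%:E.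
Proof.
move=> ab fc; have dF := prim_derive fc.
rewrite (@continuous_FTC2 R f (prim f) a b)//.
- exact: continuous_subspaceT.
- split.
  + by move=> x _; have [] := dF x.
  + by apply: cvg_at_right_filter; exact: (is_derive_continuous dF).
  + by apply: cvg_at_left_filter; exact: (is_derive_continuous dF).
- by move=> x _; rewrite derive1E; have [_ ->] := dF x.
Qed.

Lemma Rintegral_itg f a b : a < b -> continuous f ->
  \int[mu]_(t in `[a, b]) f t = itg a b f.
Proof. by move=> ab fc; rewrite /Rintegral integral_itg. Qed.

Lemma itg_shift f a b c : continuous f ->
  itg a b (fun t => f (t + c)) = itg (a + c) (b + c) f.
Proof.
move=> fc; have fcc : continuous (fun t => f (t + c)).
  apply: (@cont_comp R R R f (fun t => t + c)) => //; apply: contD; last exact: cont_cst.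
  by move=> x; exact: cvg_id.
have dF (t : R) : is_derive t (1 : R) (fun t => prim f (t + c)) (f (t + c)).
  have := prim_derive fc (t + c) => dF.
  have dc : is_derive t (1 : R) (fun s : R => s + c) (1 : R).
    by have := is_deriveD (is_derive_id t (1 : R)) (is_derive_cst c t (1 : R)); rewrite addr0.
  have := @is_derive1_comp R (prim f) (fun s => s + c) t _ _ dF dc.
  by rewrite mulr1.
by rewrite (prim_unique a b fcc dF).
Qed.

Lemma eps_le (phi : R -> R) (x : R) : continuous phi ->
  (forall e, 0 < e -> x <= phi e) -> x <= phi 0.
Proof.
move=> phic xphi; have c0 : phi e @[e --> 0^'+] --> phi 0.
  by apply: cvg_at_right_filter; exact: phic.
apply: (cvgr_to_ge c0); near=> e; apply: xphi.
by near: e; exact: nbhs_right_gt.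
Unshelve. all: by end_near. Qed.

End Primitives.

(** * Integral inequalities *)

Section IntegralInequalities.
Variables (R : realType) (p : R).
Hypothesis p_gt1 : 1 < p.
Local Notation q := (conj_exp p).
Let p0 := p_gt0 p_gt1.
Let q0 := q_gt0 p_gt1.
Let p10 := p1_gt0 p_gt1.

Lemma hoelder_itg (h f g : R -> R) (a b : R) : a <= b ->
  continuous h -> continuous f -> continuous g ->
  (forall t, a <= t <= b -> 0 <= f t) -> (forall t, a <= t <= b -> 0 <= g t) ->
  (forall t, a <= t <= b -> h t <= f t `^ p^-1 * g t `^ q^-1) ->
  0 <= itg a b h ->
  itg a b h `^ p <= itg a b f * itg a b g `^ (p - 1).
Proof.
move=> ab hc fc gc f0 g0 hfg h0.
have If0 := itg_ge0 ab fc f0; have Ig0 := itg_ge0 ab gc g0.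
(* Adding [e] makes both integrals positive, so that they can be used for normalization. *)
pose phi e := (itg a b f + e) * `|itg a b g + e| `^ (p - 1).
have phic : continuous phi.
  apply: contM; first by apply: contD; [exact: cont_cst|move=> x; exact: cvg_id].
  apply: (@cont_comp R R R (fun s => `|s| `^ (p - 1))); last exact: cont_powR.
  by apply: contD; [exact: cont_cst|move=> x; exact: cvg_id].
have -> : itg a b f * itg a b g `^ (p - 1) = phi 0.
  by rewrite /phi !addr0 ger0_norm.
apply: eps_le phic _ => e e0; rewrite /phi.
set F := itg a b f + e; set A := itg a b g + e.
have F0 : 0 < F by rewrite ltr_wpDl.
have A0 : 0 < A by rewrite ltr_wpDl.
pose K := F `^ p^-1 * A `^ q^-1.
have K0 : 0 < K by rewrite mulr_gt0// powR_gt0.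
have pt t : a <= t <= b -> h t <= K / (F * p) * f t + K / (A * q) * g t.
  move=> tab; apply: (le_trans (hfg t tab)).
  have fF : 0 <= f t / F by rewrite divr_ge0 ?f0// ltW.
  have gA : 0 <= g t / A by rewrite divr_ge0 ?g0// ltW.
  have := conjugate_powR (powR_ge0 (f t / F) p^-1) (powR_ge0 (g t / A) q^-1) p0 q0 (conjE p_gt1).
  rewrite !powRKV ?gt_eqF// => yng.
  have eqf : f t `^ p^-1 = F `^ p^-1 * (f t / F) `^ p^-1.
    by rewrite -powRM ?(ltW F0)// mulrC divfK// gt_eqF.
  have eqg : g t `^ q^-1 = A `^ q^-1 * (g t / A) `^ q^-1.
    by rewrite -powRM ?(ltW A0)// mulrC divfK// gt_eqF.
  rewrite eqf eqg mulrACA -/K.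
  have := ler_wpM2l (ltW K0) yng => /le_trans; apply; apply: eqle.
  by field; rewrite !gt_eqF.
have int_le : itg a b h <= K.
  have c1 : continuous (fun t => K / (F * p) * f t) by apply: contM => //; exact: cont_cst.
  have c2 : continuous (fun t => K / (A * q) * g t) by apply: contM => //; exact: cont_cst.
  apply: (le_trans (le_itg ab hc (contD c1 c2) pt)).
  rewrite itgD// !itgZ//.
  have e1 : K / (F * p) * itg a b f <= K / p.
    have -> : K / (F * p) * itg a b f = K / p * (itg a b f / F).
      by field; rewrite !gt_eqF.
    rewrite ler_piMr ?divr_ge0 ?(ltW K0) ?(ltW p0)// ler_pdivrMr// mul1r lerDl.
    exact: ltW.
  have e2 : K / (A * q) * itg a b g <= K / q.
    have -> : K / (A * q) * itg a b g = K / q * (itg a b g / A).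
      by field; rewrite !gt_eqF.
    rewrite ler_piMr ?divr_ge0 ?(ltW K0) ?(ltW q0)// ler_pdivrMr// mul1r lerDl.
    exact: ltW.
  apply: (le_trans (lerD e1 e2)); rewrite -mulrDr conjE// mulr1.
  exact: lexx.
apply: (le_trans (powR_pos_mono (ltW p0) h0 int_le)).
rewrite /K powRM ?powR_ge0// powRKV ?gt_eqF ?(ltW F0)// -powRrM divpq//.
by rewrite (ger0_norm (ltW A0)).
Qed.

(** The upper half of the curve |r|^p + |t|^p = 1 as a graph, extended by 0. *)
Definition theta (r : R) : R := `|Num.max (1 - `|r| `^ p) 0| `^ p^-1.
Definition theta_int : R := itg 0 1 theta.

Lemma cont_theta : continuous theta.
Proof.
apply: (@cont_comp R R R (fun s => `|s| `^ p^-1)); last by apply: cont_powR; rewrite invr_gt0.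
apply: cont_max; last exact: cont_cst.
by apply: contB; [exact: cont_cst|exact: cont_powR].
Qed.

Lemma theta_ge0 r : 0 <= theta r. Proof. exact: powR_ge0. Qed.

Lemma thetaN r : theta (- r) = theta r. Proof. by rewrite /theta normrN. Qed.

Lemma theta_int_ge0 : 0 <= theta_int.
Proof. by apply: itg_ge0 => //; [exact: cont_theta|move=> t _; exact: theta_ge0]. Qed.

Definition Theta (r : R) : R := prim theta r - prim theta 0.

Lemma Theta_derive r : is_derive r (1 : R) Theta (theta r).
Proof.
have := is_deriveB (prim_derive cont_theta r) (is_derive_cst (prim theta 0) r (1 : R)).
by rewrite subr0.
Qed.

Lemma ThetaN r : Theta (- r) = - Theta r.
Proof.
have D0 (t : R) : is_derive t (1 : R) (fun s => Theta s + Theta (- s)) 0.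
  have dN : is_derive t (1 : R) (fun s : R => - s) (-1 : R).
    exact: is_deriveN (is_derive_id t (1 : R)).
  have d2 := @is_derive1_comp R Theta (fun s => - s) t _ _ (Theta_derive (- t)) dN.
  have := is_deriveD (Theta_derive t) d2.
  by rewrite thetaN mulrN1 subrr.
have := @is_derive_0_is_cst R _ r 0 D0.
rewrite oppr0 {3 4}/Theta subrr addr0 => h.
by apply: (@addrI _ (Theta r)); rewrite subrr.
Qed.

Lemma Theta1 : Theta 1 = theta_int. Proof. by []. Qed.

(** Let m be the maximum of |u|. Up to the sign of u, Theta (u / m) reaches Theta 1 and has opposite
    values at the two ends, so its variation on [0, s] is at least twice Theta 1. Hoelder's
    inequality for its derivative, and elimination of m^p, give the sharp constant. *)
Lemma dirichlet (u du : R -> R) (s : R) : 0 < s ->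
  (forall t : R, is_derive t (1 : R) u (du t)) -> continuous du -> u s = - u 0 ->
  4 * (2 * theta_int) `^ p * itg 0 s (fun t => `|u t| `^ p) <=
  s ^+ 2 * itg 0 s (fun t => `|du t| `^ q) `^ (p - 1).
Proof.
move=> s0 dU duc us; have uc := is_derive_continuous dU.
have upc : continuous (fun t => `|u t| `^ p).
  by apply: (@cont_comp R R R (fun s => `|s| `^ p)); last exact: cont_powR.
have duqc : continuous (fun t => `|du t| `^ q).
  by apply: (@cont_comp R R R (fun s => `|s| `^ q)); last exact: cont_powR.
set N := itg 0 s _; set E := itg 0 s _.
have E0 : 0 <= E by apply: itg_ge0 => [|//|t _]; [exact: ltW|exact: powR_ge0].
have N0 : 0 <= N by apply: itg_ge0 => [|//|t _]; [exact: ltW|exact: powR_ge0].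
have I0 := theta_int_ge0.
have [tm tm_in tm_max] : exists2 tm, 0 <= tm <= s & forall t, 0 <= t <= s -> `|u t| <= `|u tm|.
  have [|c c_in c_max] := @EVT_max R (fun t => `|u t|) 0 s (ltW s0).
    by apply: continuous_subspaceT; exact: cont_norm.
  by exists c => [|t ts]; [move: c_in; rewrite in_itv|apply: c_max; rewrite in_itv].
set m := `|u tm| in tm_max.
have [m_eq0|m_neq0] := eqVneq m 0.
  have -> : N = 0.
    apply/eqP; rewrite eq_le N0 andbT -[leRHS](mul0r (s - 0)) -(itg_cst 0).
    apply: le_itg => [||//|t /tm_max]; [exact: ltW|exact: upc|exact: cont_cst|].
    by rewrite m_eq0 normr_le0 => /eqP ->; rewrite normr0 powR0// gt_eqF.
  by rewrite mulr0 mulr_ge0 ?sqr_ge0 ?powR_ge0.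
have m0 : 0 < m by rewrite lt_def m_neq0 /m /=.
(* The sign makes the extreme value of [u1] equal to [m] rather than [- m]. *)
pose u1 t := Num.sg (u tm) * u t.
pose k t := theta (u1 t / m) * (`|du t| / m).
have sg1 : `|Num.sg (u tm)| = 1.
  by rewrite normr_sg -normr_eq0 -/m m_neq0.
have u1m : u1 tm = m by rewrite /u1 /m normrEsg.
have u1c : continuous u1 by apply: contM => //; exact: cont_cst.
have um1c : continuous (fun t => u1 t / m) by apply: contM => //; exact: cont_cst.
have kc : continuous k.
  apply: contM; first exact: (@cont_comp R R R theta _ um1c cont_theta).
  by apply: contM; [exact: cont_norm|exact: cont_cst].
have dTheta (t : R) : is_derive t (1 : R) (fun t => Theta (u1 t / m))
    (theta (u1 t / m) * (Num.sg (u tm) * du t / m)).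
  have d1 : is_derive t (1 : R) (fun t => u1 t / m) (Num.sg (u tm) * du t / m).
    have := is_deriveZ (Num.sg (u tm) / m) (dU t).
    rewrite scaleRE mulrAC; congr (is_derive _ _ _ _).
    by apply/funext => x; rewrite /= scaleRE /u1 mulrAC.
  exact: @is_derive1_comp R Theta (fun t => u1 t / m) t _ _ (Theta_derive _) d1.
have dTc : continuous (fun t => theta (u1 t / m) * (Num.sg (u tm) * du t / m)).
  apply: contM; first exact: (@cont_comp R R R theta _ um1c cont_theta).
  apply: contM; last exact: cont_cst.
  by apply: contM => //; exact: cont_cst.
have kbound t : `|theta (u1 t / m) * (Num.sg (u tm) * du t / m)| <= k t.
  rewrite /k normrM (ger0_norm (theta_ge0 _)) ler_wpM2l ?theta_ge0//.
  by rewrite !normrM sg1 mul1r normfV (gtr0_norm m0).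
have var a b : a <= b -> `|Theta (u1 b / m) - Theta (u1 a / m)| <= itg a b k.
  move=> ab; rewrite -(prim_unique a b dTc dTheta) ler_norml.
  rewrite -itgN//; apply/andP; split; apply: le_itg => //.
  - exact: contN.
  - by move=> t _; have := kbound t; rewrite ler_norml => /andP[].
  - by move=> t _; have := kbound t; rewrite ler_norml => /andP[].
have I_le : 2 * theta_int <= itg 0 s k.
  case/andP: tm_in => tm0 tms.
  have h1 := var _ _ tm0; have h2 := var _ _ tms.
  rewrite u1m divff// Theta1 in h1 h2.
  have us' : Theta (u1 s / m) = - Theta (u1 0 / m).
    by rewrite -ThetaN; congr Theta; rewrite /u1 us; ring.
  rewrite -(itg_cat k 0 tm s).
  move: h1 h2; rewrite us' !ler_norml => /andP[_ h1] /andP[h2 _]; lra.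
pose f t := 1 - `|u t| `^ p / m `^ p.
pose g t := `|du t| `^ q / m `^ q.
have mp0 : 0 < m `^ p by rewrite powR_gt0.
have mq0 : 0 < m `^ q by rewrite powR_gt0.
have fc : continuous f by apply: contB; [exact: cont_cst|apply: contM => //; exact: cont_cst].
have gc : continuous g by apply: contM => //; exact: cont_cst.
have f0 t : 0 <= t <= s -> 0 <= f t.
  move=> /tm_max um; rewrite subr_ge0 ler_pdivrMr// mul1r.
  by apply: powR_pos_mono => //; exact: ltW.
have g0 t : 0 <= t <= s -> 0 <= g t by move=> _; rewrite divr_ge0 ?powR_ge0.
have kfg t : 0 <= t <= s -> k t <= f t `^ p^-1 * g t `^ q^-1.
  move=> ts; have ft := f0 t ts.
  have e1 : theta (u1 t / m) = f t `^ p^-1.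
    rewrite /theta /u1 !normrM sg1 mul1r normfV (gtr0_norm m0).
    rewrite powRM ?invr_ge0 ?(ltW m0)// powR_inv ?(ltW m0)// -/(f t).
    by rewrite (max_idPl ft) ger0_norm.
  have e2 : `|du t| / m = g t `^ q^-1.
    rewrite /g -powR_inv ?(ltW m0)// -powRM ?invr_ge0 ?(ltW m0)//.
    by rewrite powRK ?gt_eqF// divr_ge0// ltW.
  by rewrite /k e1 e2.
have Ik0 : 0 <= itg 0 s k by apply: le_trans I_le; rewrite mulr_ge0.
have hoel := hoelder_itg (ltW s0) kc fc gc f0 g0 kfg Ik0.
have A_le : (2 * theta_int) `^ p <= itg 0 s k `^ p.
  by apply: powR_pos_mono => //; [exact: ltW|rewrite mulr_ge0].
have {}hoel := le_trans A_le hoel.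
have If : itg 0 s f = s - N / m `^ p.
  rewrite itgB ?itg_cst//; last 2 first.
  - exact: cont_cst.
  - by apply: contM => //; exact: cont_cst.
  rewrite subr0 mul1r; congr (_ - _).
  under [X in itg _ _ X]eq_fun do rewrite mulrC.
  by rewrite itgZ// mulrC.
have Ig : itg 0 s g `^ (p - 1) = E `^ (p - 1) / m `^ p.
  have -> : itg 0 s g = (m `^ q)^-1 * E.
    by rewrite -itgZ//; congr itg; apply/funext => t; rewrite mulrC.
  rewrite mulrC powRM ?invr_ge0 ?powR_ge0// powR_inv ?powR_ge0//.
  by rewrite -powRrM [q * _]mulrC mul_p1q.
move: hoel; rewrite If Ig {If Ig}.
set A := (2 * theta_int) `^ p; set K := m `^ p in mp0 *; set E' := E `^ (p - 1).
have A0 : 0 <= A by exact: powR_ge0.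
have E'0 : 0 <= E' by exact: powR_ge0.
move=> hoel.
have hoel2 : A * K ^+ 2 <= (s * K - N) * E'.
  have := ler_wpM2r (sqr_ge0 K) hoel.
  have -> : (s - N / K) * (E' / K) * K ^+ 2 = (s * K - N) * E'.
    by field; rewrite gt_eqF.
  by [].
have [E'_eq0|E'_neq0] := eqVneq E' 0.
  move: hoel2; rewrite E'_eq0 !mulr0 => hoel2.
  have -> : A = 0.
    apply/eqP; rewrite eq_le A0 andbT -(pmulr_lle0 _ (exprn_gt0 2 mp0)).
    exact: hoel2.
  by rewrite mulr0 mul0r.
have E'_gt0 : 0 < E' by rewrite lt_def E'_neq0.
rewrite -(ler_pM2r E'_gt0).
(* The square eliminates K = m^p from A K^2 <= (s K - N) E'. *)
have := sqr_ge0 (2 * A * K - s * E').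
have := ler_wpM2l (mulr_ge0 (ler0n R 4) A0) hoel2.
have -> : (2 * A * K - s * E') ^+ 2 = 4 * A * (A * K ^+ 2) - 4 * A * (s * K) * E' + s ^+ 2 * E' * E'.
  by ring.
lra.
Qed.

End IntegralInequalities.

(** Convexity of the power at the points [v i / w i] with weights [w i]. *)
Lemma jensen_powR (R : realType) (I : finType) (r : R) (w v : I -> R) : 1 < r ->
  (forall i, 0 < w i) -> \sum_i w i = 1 -> (forall i, 0 <= v i) ->
  (\sum_i v i) `^ r <= \sum_i w i `^ (1 - r) * v i `^ r.
Proof.
move=> r1 w0 w1 v0; set c := \sum_i v i.
have r0 := p_gt0 r1; have c0 : 0 <= c by exact: sumr_ge0.
have tangent i : v i * c `^ (r - 1) <=
    (w i `^ (1 - r) * v i `^ r) / r + w i * (c `^ r / conj_exp r).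
  have wi0 := w0 i.
  have := young r1 (v i / w i) (c `^ (r - 1)).
  rewrite (ger0_norm (divr_ge0 (v0 i) (ltW wi0))) (ger0_norm (powR_ge0 _ _)).
  rewrite -powRrM (mul_p1q r1) powRM ?invr_ge0 ?(ltW wi0)// => yng.
  have := ler_wpM2l (ltW wi0) yng.
  have -> : w i * (v i / w i * c `^ (r - 1)) = v i * c `^ (r - 1).
    by field; rewrite gt_eqF.
  move=> /le_trans; apply; apply: eqle; rewrite mulrDr; congr (_ + _).
  rewrite powR_inv ?(ltW wi0)// powR_gt0D//= ?powRr1 ?(ltW wi0)//.
  rewrite powRN; ring.
have : \sum_i v i * c `^ (r - 1) <=
    \sum_i ((w i `^ (1 - r) * v i `^ r) / r + w i * (c `^ r / conj_exp r)).
  by apply: ler_sum => i _; exact: tangent.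
rewrite -mulr_suml -/c big_split /= -!mulr_suml w1 mul1r.
have -> : c * c `^ (r - 1) = c `^ r.
  have [->|c_neq0] := eqVneq c 0; first by rewrite mul0r powR0// gt_eqF.
  have c_gt0 : 0 < c by rewrite lt_def c_neq0.
  by rewrite -{1}(powRr1 c0) -powR_gt0D// addrC subrK.
have e := conjE r1; set S := \sum_i _ => h.
have h2 : c `^ r / r <= S / r.
  have : c `^ r = c `^ r / r + c `^ r / conj_exp r by rewrite -mulrDr e mulr1.
  lra.
by rewrite -(ler_pM2r (_ : 0 < r^-1)) ?invr_gt0.
Qed.

Section VectorDirichlet.
Variables (R : realType) (n : nat) (p : R).
Hypothesis p_gt2 : 2 < p.
Hypothesis n_gt0 : (0 < n)%N.
Local Notation q := (conj_exp p).
Let p1 : 1 < p. Proof. by apply: lt_trans p_gt2; rewrite ltr1n. Qed.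
Let p0 := p_gt0 p1.
Let q0 := q_gt0 p1.
Let p10 := p1_gt0 p1.

(** The scalar inequalities are summed through [jensen_powR] with weights proportional to the
    energies of the coordinates, the choice that loses no constant; the exponent p - 1 exceeds 1
    because p > 2. The summand [e] keeps the weights positive. *)
Lemma vector_dirichlet (u du : R -> 'cV[R]_n) (s : R) : 0 < s ->
  (forall j (t : R), is_derive t (1 : R) (fun t => u t j 0) (du t j 0)) ->
  continuous du -> u s = - u 0 ->
  4 * (2 * theta_int p) `^ p * itg 0 s (fun t => psum q (u t) `^ (p - 1)) <=
  s ^+ 2 * itg 0 s (fun t => psum q (du t)) `^ (p - 1).
Proof.
move=> s0 dU duc us.
have ducc j : continuous (fun t => du t j 0).
  by apply: (@cont_comp R _ R (fun x : 'cV[R]_n => x j 0) du) => //; exact: coord_continuous.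
have uc j := is_derive_continuous (dU j).
have duqc j : continuous (fun t => `|du t j 0| `^ q).
  by apply: (@cont_comp R R R (fun s => `|s| `^ q)); last exact: cont_powR.
have upc j : continuous (fun t => `|u t j 0| `^ p).
  by apply: (@cont_comp R R R (fun s => `|s| `^ p)); last exact: cont_powR.
pose E j := itg 0 s (fun t => `|du t j 0| `^ q).
pose N j := itg 0 s (fun t => `|u t j 0| `^ p).
have E_ge0 j : 0 <= E j.
  by apply: itg_ge0 => [|//|t _]; [exact: ltW|exact: powR_ge0].
have dir j : 4 * (2 * theta_int p) `^ p * N j <= s ^+ 2 * E j `^ (p - 1).
  by apply: (dirichlet p1 s0 (dU j)) => //; rewrite us mxE.
have sumE : itg 0 s (fun t => psum q (du t)) = \sum_j E j.
  by rewrite -itg_sum//; congr itg; apply/funext => t; rewrite psumE.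
rewrite sumE.
have uc' : continuous u by apply: cont_mx => i j; rewrite ord1; exact: uc.
pose phi e : R := s ^+ 2 * `|\sum_j E j + e * n%:R| `^ (p - 1).
have phic : continuous phi.
  apply: contM; first exact: cont_cst.
  apply: (@cont_comp R R R (fun s => `|s| `^ (p - 1))); last exact: cont_powR.
  apply: contD; first exact: cont_cst.
  by apply: contM; [move=> x; exact: cvg_id|exact: cont_cst].
have -> : s ^+ 2 * (\sum_j E j) `^ (p - 1) = phi 0.
  by rewrite /phi mul0r addr0 ger0_norm ?sumr_ge0.
apply: eps_le phic _ => e e0; rewrite /phi.
have nR : (0 : R) < n%:R by rewrite ltr0n.
set Et := \sum_j E j + e * n%:R.
have Et0 : 0 < Et by rewrite ltr_wpDl ?sumr_ge0// mulr_gt0.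
rewrite (gtr0_norm Et0).
pose w (j : 'I_n) := (E j + e) / Et.
have w0 j : 0 < w j by rewrite divr_gt0// ltr_wpDl.
have w1 : \sum_j w j = 1.
  rewrite -mulr_suml big_split /= sumr_const card_ord -[e *+ n]mulr_natr -/Et.
  by rewrite divff// gt_eqF.
have pt t : psum q (u t) `^ (p - 1) <=
    \sum_j w j `^ (1 - (p - 1)) * `|u t j 0| `^ p.
  rewrite psumE.
  have r1 : 1 < p - 1 by have := p_gt2; lra.
  apply: (le_trans (jensen_powR r1 w0 w1 (fun j => powR_ge0 _ _))).
  apply: ler_sum => j _; apply: eqle; congr (_ * _).
  by rewrite -powRrM [q * _]mulrC mul_p1q.
have psc : continuous (fun t => psum q (u t) `^ (p - 1)).
  have -> : (fun t => psum q (u t) `^ (p - 1)) = (fun t => `|psum q (u t)| `^ (p - 1)).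
    by apply/funext => t; rewrite ger0_norm ?psum_ge0.
  exact: (@cont_comp R R R (fun s => `|s| `^ (p - 1)) (fun t => psum q (u t))
    (cont_comp uc' (cont_psum q0)) (cont_powR p10)).
have termc j : continuous (fun t => w j `^ (1 - (p - 1)) * `|u t j 0| `^ p).
  by apply: contM => //; exact: cont_cst.
have C0 : 0 <= 4 * (2 * theta_int p) `^ p by rewrite mulr_ge0 ?powR_ge0.
have sumc : continuous (fun t => \sum_j w j `^ (1 - (p - 1)) * `|u t j 0| `^ p).
  exact: (@cont_sum R R _ xpredT _ termc).
have := le_itg (ltW s0) psc sumc (fun t _ => pt t).
rewrite itg_sum// => /(ler_wpM2l C0) /le_trans; apply.
rewrite mulr_sumr.
apply: (@le_trans _ _ (\sum_j s ^+ 2 * (w j * Et `^ (p - 1)))).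
  apply: ler_sum => j _; rewrite itgZ// -/(N j) mulrCA.
  have wp : 0 <= w j `^ (1 - (p - 1)) by exact: powR_ge0.
  apply: (le_trans (ler_wpM2l wp (dir j))); rewrite mulrCA ler_wpM2l ?sqr_ge0//.
  have Eje : E j <= w j * Et by rewrite /w divfK ?gt_eqF// lerDl ltW.
  apply: (le_trans (ler_wpM2l wp (powR_pos_mono (ltW p10) (E_ge0 j) Eje))).
  rewrite powRM ?(ltW (w0 j)) ?(ltW Et0)// mulrA -powR_gt0D// subrK powRr1 ?(ltW (w0 j))//.
by rewrite -mulr_sumr -mulr_suml w1 mul1r.
Qed.

End VectorDirichlet.

(** * The energy and its flow *)

Section CurveDerivatives.
Variables (R : realType) (n : nat).
Local Notation P := (phase_space R n).

Lemma is_derive_pc (z : R -> P) (v : P) (t : R) k :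
  is_derive t (1 : R) z v -> is_derive t (1 : R) (fun s => pc k (z s)) (pc k v).
Proof.
move=> [dz ez].
have lim_v : h^-1 *: (z (h *: (1 : R) + t) - z t) @[h --> 0^'] --> v.
  by rewrite -ez; exact: dz.
have lim_k : pc k (h^-1 *: (z (h *: (1 : R) + t) - z t)) @[h --> 0^'] --> pc k v.
  apply/cvgrPdist_le => e e0; have /cvgrPdist_le/(_ e e0) := lim_v.
  by apply: filterS => h; apply: le_trans; rewrite -pcB; exact: pc_le_norm.
have lim : h^-1 *: (pc k (z (h *: (1 : R) + t)) - pc k (z t) : R^o) @[h --> 0^'] --> (pc k v : R^o).
  apply: cvg_trans lim_k; apply: near_eq_cvg; near=> h.
  by rewrite pcZ pcB scaleRE.
apply: DeriveDef; first by apply/cvg_ex; exists (pc k v).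
exact: cvg_lim lim.
Unshelve. all: by end_near. Qed.

Lemma is_derive_sum_fin (I : finType) (f : I -> R -> R) (df : I -> R) (t : R) :
  (forall i, is_derive t (1 : R) (f i) (df i)) ->
  is_derive t (1 : R) (fun s => \sum_i f i s) (\sum_i df i).
Proof.
move=> dF; elim: (index_enum I) => [|i s IH].
  under eq_fun do rewrite big_nil.
  by rewrite big_nil; exact: is_derive_cst.
under eq_fun do rewrite big_cons.
by rewrite big_cons; exact: is_deriveD (dF i) IH.
Qed.

Lemma is_derive_scale (k : R) (f : R -> R) (df t : R) :
  is_derive t (1 : R) f df -> is_derive t (1 : R) (fun s => k * f s) (k * df).
Proof. by move=> d; have := is_deriveZ k d. Qed.

Lemma is_derive_mulmx m (A : 'M[R]_(m, n)) (z : R -> 'cV[R]_n) (v : 'cV[R]_n) (t : R) :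
  (forall j, is_derive t (1 : R) (fun s => z s j 0) (v j 0)) ->
  forall i, is_derive t (1 : R) (fun s => (A *m z s) i 0) ((A *m v) i 0).
Proof.
move=> dz i; under eq_fun do rewrite mxE.
rewrite mxE.
exact: (is_derive_sum_fin (fun j => is_derive_scale (A i j) (dz j))).
Qed.

Lemma is_derive_fst (z : R -> P) (v : P) (t : R) :
  is_derive t (1 : R) z v ->
  forall j, is_derive t (1 : R) (fun s => (z s).1 j 0) (v.1 j 0).
Proof. by move=> dz j; exact: (is_derive_pc (j, false) dz). Qed.

Lemma is_derive_snd (z : R -> P) (v : P) (t : R) :
  is_derive t (1 : R) z v ->
  forall j, is_derive t (1 : R) (fun s => (z s).2 j 0) (v.2 j 0).
Proof. by move=> dz j; exact: (is_derive_pc (j, true) dz). Qed.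

Lemma is_derive_dotc (x y : R -> 'cV[R]_n) (dx dy : 'cV[R]_n) (t : R) :
  (forall j, is_derive t (1 : R) (fun s => x s j 0) (dx j 0)) ->
  (forall j, is_derive t (1 : R) (fun s => y s j 0) (dy j 0)) ->
  is_derive t (1 : R) (fun s => dotc (x s) (y s)) (dotc dx (y t) + dotc (x t) dy).
Proof.
move=> ddx ddy; under eq_fun do rewrite dotc_sum.
rewrite !dotc_sum -big_split /=; apply: is_derive_sum_fin => j.
have := is_deriveM (ddx j) (ddy j) => /is_derive_eq; apply.
by rewrite !scaleRE; ring.
Qed.

Lemma is_derive_phase_continuous (z : R -> P) (dz : R -> P) :
  (forall t, is_derive t (1 : R) z (dz t)) -> continuous z.
Proof.
move=> d; apply: cont_phase => k; apply: is_derive_continuous => t.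
exact: is_derive_pc (d t).
Qed.

Lemma is_derive_phase (z : R -> P) (v : P) (t : R) :
  (forall k, is_derive t (1 : R) (fun s => pc k (z s)) (pc k v)) ->
  is_derive t (1 : R) z v.
Proof.
move=> dz.
have lim_k k : h^-1 *: (pc k (z (h *: (1 : R) + t)) - pc k (z t) : R^o) @[h --> 0^'] -->
    (pc k v : R^o).
  by have [d <-] := dz k; exact: d.
have lim_v : h^-1 *: (z (h *: (1 : R) + t) - z t) @[h --> 0^'] --> v.
  apply/cvgrPdist_le => e e0.
  have : \forall h \near 0^', forall k : 'I_n * bool,
      `|pc k v - (h^-1 *: (pc k (z (h *: (1 : R) + t)) - pc k (z t) : R^o))| <= e.
    by apply: filter_forall => k; have /cvgrPdist_le/(_ e e0) := lim_k k.
  apply: filterS => h hk; apply: phase_norm_le; first exact: ltW.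
  by move=> k; rewrite pcB pcZ pcB; have := hk k; rewrite scaleRE.
apply: DeriveDef; first by apply/cvg_ex; exists v.
exact: cvg_lim lim_v.
Qed.

Lemma is_derive_comp_phase (z : R -> P) (v : P) (f : R -> R) (df t : R) :
  is_derive (f t) (1 : R) z v -> is_derive t (1 : R) f df ->
  is_derive t (1 : R) (fun s => z (f s)) (df *: v).
Proof.
move=> dz dF; apply: is_derive_phase => k.
have := @is_derive1_comp R (fun s => pc k (z s)) f t _ _ (is_derive_pc k dz) dF.
by rewrite pcZ mulrC.
Qed.

Lemma is_derive_shift (c t : R) : is_derive t (1 : R) (fun s : R => s + c) (1 : R).
Proof.
by have := is_deriveD (is_derive_id t (1 : R)) (is_derive_cst c t (1 : R)); rewrite addr0.
Qed.

Lemma is_derive_phase_shift (z : R -> P) (v : P) (c t : R) :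
  is_derive (t + c) (1 : R) z v -> is_derive t (1 : R) (fun s => z (s + c)) v.
Proof.
move=> dz; have := @is_derive_comp_phase z v (fun s => s + c) 1 t dz (is_derive_shift c t).
by rewrite scale1r.
Qed.

End CurveDerivatives.

Section Energy.
Variables (R : realType) (n : nat) (p : R) (B D : 'M[R]_n).
Hypothesis p_gt1 : 1 < p.
Local Notation P := (phase_space R n).
Let p0 := p_gt0 p_gt1.

Definition energy (z : P) : R := psum p (B *m z.1) + psum p (D *m z.2).
Definition energy_grad (z : P) : P :=
  (p *: (B^T *m spowv p (B *m z.1)), p *: (D^T *m spowv p (D *m z.2))).

Lemma is_derive_psum (x : R -> 'cV[R]_n) (dx : 'cV[R]_n) (t : R) :
  (forall j, is_derive t (1 : R) (fun s => x s j 0) (dx j 0)) ->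
  is_derive t (1 : R) (fun s => psum p (x s)) (p * dotc (spowv p (x t)) dx).
Proof.
move=> ddx; under eq_fun do rewrite psumE.
rewrite dotc_sum mulr_sumr; apply: is_derive_sum_fin => j.
have := @is_derive1_comp R (fun r => `|r| `^ p) (fun s => x s j 0) t _ _
  (is_derive_abs_powR p_gt1 (x t j 0)) (ddx j).
by move/is_derive_eq; apply; rewrite mxE; ring.
Qed.

Lemma dotp_dotc (u v : P) : dotp u v = dotc u.1 v.1 + dotc u.2 v.2.
Proof. by rewrite dotp_pair !dotc_sum big_split. Qed.

Lemma dotcZl (k : R) (x y : 'cV[R]_n) : dotc (k *: x) y = k * dotc x y.
Proof. by rewrite !dotc_sum mulr_sumr; apply: eq_bigr => i _; rewrite mxE mulrA. Qed.

Lemma dotcBl (x y z : 'cV[R]_n) : dotc (x - y) z = dotc x z - dotc y z.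
Proof. by rewrite !dotc_sum -sumrB; apply: eq_bigr => i _; rewrite !mxE mulrBl. Qed.

Lemma energy_chain (g : R -> P) (v : P) (t : R) : is_derive t (1 : R) g v ->
  is_derive t (1 : R) (fun s => energy (g s)) (dotp (energy_grad (g t)) v).
Proof.
move=> dg.
have d1 := is_derive_psum (is_derive_mulmx B (is_derive_fst dg)).
have d2 := is_derive_psum (is_derive_mulmx D (is_derive_snd dg)).
have := is_deriveD d1 d2 => /is_derive_eq; apply.
have e (A : 'M[R]_n) (x dx : 'cV[R]_n) :
    p * dotc (spowv p (A *m x)) (A *m dx) = dotc (p *: (A^T *m spowv p (A *m x))) dx.
  by rewrite dotcZl dotc_mulmx trmxK.
rewrite dotp_dotc; exact: (f_equal2 +%R (e B (g t).1 v.1) (e D (g t).2 v.2)).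
Qed.

Lemma cont_mulmx (T : topologicalType) m k (A : 'M[R]_(m, n)) (f : T -> 'M[R]_(n, k)) :
  continuous f -> continuous (fun x => A *m f x).
Proof.
move=> fc; apply: cont_mx => i j; under eq_fun do rewrite mxE.
apply: cont_sum => l; apply: contM; first exact: cont_cst.
by apply: (@cont_comp T _ R (fun X : 'M[R]_(n, k) => X l j) f) => //; exact: coord_continuous.
Qed.

Lemma cont_spowv (T : topologicalType) (f : T -> 'cV[R]_n) : continuous f ->
  continuous (fun x => spowv p (f x)).
Proof.
move=> fc; apply: cont_mx => i j; under eq_fun do rewrite mxE.
apply: (@cont_comp T _ R (spow p) (fun x => f x i 0)); last exact: cont_spow.
by apply: (@cont_comp T _ R (fun X : 'cV[R]_n => X i 0) f) => //; exact: coord_continuous.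
Qed.

Lemma cont_fst (T : topologicalType) (f : T -> P) : continuous f ->
  continuous (fun x => (f x).1).
Proof.
move=> fc; apply: cont_mx => i j; rewrite ord1.
by have := @cont_pc R n T f (i, false) fc.
Qed.

Lemma cont_snd (T : topologicalType) (f : T -> P) : continuous f ->
  continuous (fun x => (f x).2).
Proof.
move=> fc; apply: cont_mx => i j; rewrite ord1.
by have := @cont_pc R n T f (i, true) fc.
Qed.

Lemma cont_energy : continuous energy.
Proof.
have idc : continuous (fun z : P => z) by move=> z; exact: cvg_id.
apply: contD.
  by apply: (cont_comp (cont_mulmx (cont_fst idc)) (cont_psum p0)).
by apply: (cont_comp (cont_mulmx (cont_snd idc)) (cont_psum p0)).
Qed.

Lemma cont_energy_grad : continuous energy_grad.
Proof.
have idc : continuous (fun z : P => z) by move=> z; exact: cvg_id.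
have c (A : 'M[R]_n) (f : P -> 'cV[R]_n) : continuous f ->
    continuous (fun z => p *: (A^T *m spowv p (A *m f z))).
  move=> fc; apply: cont_mx => i j; under eq_fun do rewrite mxE.
  apply: contM; first exact: cont_cst.
  apply: (@cont_comp P _ R (fun X : 'cV[R]_n => X i j)
    (fun z => A^T *m spowv p (A *m f z))); last exact: coord_continuous.
  by apply: cont_mulmx; apply: cont_spowv; exact: cont_mulmx.
apply: cont_phase => -[j []]; rewrite /pc /=.
  apply: (@cont_comp P _ R (fun X : 'cV[R]_n => X j 0)); last exact: coord_continuous.
  exact: c (cont_snd idc).
apply: (@cont_comp P _ R (fun X : 'cV[R]_n => X j 0)); last exact: coord_continuous.
exact: c (cont_fst idc).
Qed.

Lemma cont_spowv_coord (T : topologicalType) (f : T -> 'cV[R]_n) i : continuous f ->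
  continuous (fun x => spowv p (f x) i 0).
Proof.
move=> fc; apply: (@cont_comp T _ R (fun X : 'cV[R]_n => X i 0) (fun x => spowv p (f x))).
  exact: cont_spowv.
exact: coord_continuous.
Qed.

Lemma cont_dotc (T : topologicalType) (f g : T -> 'cV[R]_n) :
  continuous f -> continuous g -> continuous (fun x => dotc (f x) (g x)).
Proof.
move=> fc gc; under eq_fun do rewrite dotc_sum.
apply: cont_sum => i; apply: contM.
  by apply: (@cont_comp T _ R (fun X : 'cV[R]_n => X i 0) f) => //; exact: coord_continuous.
by apply: (@cont_comp T _ R (fun X : 'cV[R]_n => X i 0) g) => //; exact: coord_continuous.
Qed.

End Energy.

(** * Periods of the energy flow *)

Lemma mul_le_sqrD (R : realType) (x y : R) : x * y <= (x + y) ^+ 2 / 4.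
Proof. by have := sqr_ge0 (x - y); rewrite !expr2; lra. Qed.

Lemma half_bound_arith (R : realType) (A v1 v2 v3 v4 v5 v6 S s : R) :
  A * v1 <= A * (v5 * S * v2) -> v5 * v2 * (4 * A * S) <= v5 * v2 * (s ^+ 2 * (v6 * v3)) ->
  v5 * v6 * s ^+ 2 * (v2 * v3) <= v5 * v6 * s ^+ 2 * v4 ->
  A * v1 <= v5 * (v6 * (s ^+ 2 / 4 * v4)).
Proof. lra. Qed.

Local Lemma halve (R : realType) (x s : R) : x + x = s + s -> x = s.
Proof. lra. Qed.

Section PeriodBound.
Variables (R : realType) (n : nat) (p : R) (B D : 'M[R]_n) (M : R) (a : 'cV[R]_n).
Hypotheses (p_gt2 : 2 < p) (n_gt0 : (0 < n)%N).
Hypotheses (orthB : orthogonal_mx B) (orthD : orthogonal_mx D).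
Local Notation P := (phase_space R n).
Local Notation O := (B *m D^T).
Hypothesis ext : extremal p O M a.
Local Notation q := (conj_exp p).
Local Notation GK := (energy p B D).
Local Notation gK := (energy_grad p B D).
Let p1 : 1 < p. Proof. by apply: lt_trans p_gt2; rewrite ltr1n. Qed.
Let p0 := p_gt0 p1.
Let q0 := q_gt0 p1.
Let p10 := p1_gt0 p1.
Let M0 : 0 < M. Proof. by case: ext. Qed.
Let DTD : D^T *m D = 1%:M. Proof. exact: mulmx1C orthD. Qed.
Let DDT : D *m D^T = 1%:M. Proof. exact: orthD. Qed.
Let BBT : B *m B^T = 1%:M. Proof. exact: orthB. Qed.

(** With a' and b' the integrals of the two summands of the energy, Hoelder's inequality gives
    (s/2)^p <= M^p S a'^(p-1), and [vector_dirichlet] bounds S by a multiple of b'^(p-1). As a' + b'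
    = s, the product a' b' is at most s^2/4, however the energy is shared. *)
Lemma half_bound (X Xi Y : R -> 'cV[R]_n) (s : R) :
  continuous X -> continuous Y ->
  (forall (t : R) j, is_derive t (1 : R) (fun s => Xi s j 0) ((p *: spowv p (Y t)) j 0)) ->
  (forall t, psum p (X t) + psum p (Y t) = 1) -> 0 < s ->
  s / 2 <= itg 0 s (fun t => dotc (O *m (Xi t - 2^-1 *: (Xi 0 + Xi s))) (spowv p (X t))) ->
  4 * theta_int p <= M * (p * s).
Proof.
move=> Xc Yc dXi XY1 s0; set mid := 2^-1 *: _; pose u t := Xi t - mid => J.
have psXc : continuous (fun t => psum p (X t)) := cont_comp Xc (cont_psum p0).
have psYc : continuous (fun t => psum p (Y t)) := cont_comp Yc (cont_psum p0).
have du j t : is_derive t (1 : R) (fun t => u t j 0) ((p *: spowv p (Y t)) j 0).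
  have := is_deriveB (dXi t j) (is_derive_cst (mid j 0) t (1 : R)).
  rewrite subr0; have -> // : (fun t => u t j 0) = (fun t => Xi t j 0) - cst (mid j 0).
  by apply/funext => x; rewrite /u [LHS]mxE [X in _ + X]mxE.
have duc : continuous (fun t => p *: spowv p (Y t)).
  apply: cont_mx => i j; rewrite ord1; under eq_fun do rewrite mxE.
  by apply: contM; [exact: cont_cst|exact: cont_spowv_coord].
have us : u s = - u 0.
  by apply/colP => j; rewrite /u /mid !mxE; field.
have dir := vector_dirichlet p_gt2 n_gt0 s0 du duc us.
have I0 := theta_int_ge0 p1.
set a' := itg 0 s (fun t => psum p (X t)).
set b' := itg 0 s (fun t => psum p (Y t)).
have a0 : 0 <= a' := itg_ge0 (ltW s0) psXc (fun t _ => psum_ge0 _ _).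
have b0 : 0 <= b' := itg_ge0 (ltW s0) psYc (fun t _ => psum_ge0 _ _).
have ab : a' + b' = s.
  rewrite /a' /b' -(itgD 0 s psXc psYc).
  have -> : (fun t => psum p (X t) + psum p (Y t)) = (fun=> 1) by apply/funext.
  by rewrite itg_cst mul1r subr0.
have psY : itg 0 s (fun t => psum q (p *: spowv p (Y t))) = p `^ q * b'.
  rewrite -itgZ//; congr itg; apply/funext => t.
  by rewrite psumZ (gtr0_norm p0) psum_spow_q.
have psYp : (p `^ q * b') `^ (p - 1) = p `^ p * b' `^ (p - 1).
  by rewrite (powRM _ (powR_ge0 _ _) b0) -powRrM [q * _]mulrC mul_p1q.
rewrite psY psYp in dir.
set S := itg 0 s (fun t => psum q (u t) `^ (p - 1)) in dir.
pose f t := M `^ p * psum q (u t) `^ (p - 1).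
have uc : continuous u.
  by apply: cont_mx => i j; rewrite ord1; exact: (is_derive_continuous (du i)).
have psc : continuous (fun t => psum q (u t) `^ (p - 1)).
  have -> : (fun t => psum q (u t) `^ (p - 1)) = (fun t => `|psum q (u t)| `^ (p - 1)).
    by apply/funext => t; rewrite ger0_norm ?psum_ge0.
  exact: (@cont_comp R R R (fun s => `|s| `^ (p - 1)) (fun t => psum q (u t))
    (cont_comp uc (cont_psum q0)) (cont_powR p10)).
have fc : continuous f by apply: contM => //; exact: cont_cst.
have hc : continuous (fun t => dotc (O *m u t) (spowv p (X t))).
  by apply: cont_dotc; [exact: cont_mulmx|exact: cont_spowv].
have hfg t : 0 <= t <= s -> dotc (O *m u t) (spowv p (X t)) <=
    f t `^ p^-1 * psum p (X t) `^ q^-1.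
  move=> _; apply: (le_trans (hoelder_le p1 _ _)); rewrite psum_spow_q//.
  rewrite ler_wpM2r ?powR_ge0//.
  apply: powR_pos_mono; rewrite ?invr_ge0 ?(ltW p0) ?psum_ge0//.
  by case: ext => _ _ _; apply.
have J0 : 0 <= itg 0 s (fun t => dotc (O *m u t) (spowv p (X t))).
  by apply: le_trans J; rewrite divr_ge0// ltW.
have f0 t : 0 <= t <= s -> 0 <= f t by move=> _; rewrite mulr_ge0 ?powR_ge0.
have hoel := hoelder_itg p1 (ltW s0) hc fc psXc f0 (fun t _ => psum_ge0 _ _) hfg J0.
have s20 : 0 <= s / 2 by rewrite divr_ge0// ltW.
have {}hoel := le_trans (powR_pos_mono (ltW p0) s20 J) hoel.
rewrite itgZ// -/S -/a' in hoel.
have key : (4 * theta_int p * s) `^ p <= (M * (p * s) * s) `^ p.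
  have e1 : 4 * theta_int p * s = 4 * (2 * theta_int p * (s / 2)) by field.
  have e2 : M * (p * s) * s = 4 * (M * (p * (s ^+ 2 / 4))) by field.
  have q4 : 0 <= s ^+ 2 / 4 by rewrite divr_ge0 ?sqr_ge0.
  have I20 : 0 <= 2 * theta_int p by rewrite mulr_ge0.
  have Mp0 : 0 <= M * (p * (s ^+ 2 / 4)).
    exact: (mulr_ge0 (ltW M0) (mulr_ge0 (ltW p0) q4)).
  rewrite e1 e2 (powRM p (ler0n R 4) (mulr_ge0 I20 s20)) (powRM p (ler0n R 4) Mp0).
  rewrite ler_wpM2l ?powR_ge0//.
  have pq0 : 0 <= p * (s ^+ 2 / 4) by rewrite mulr_ge0// ltW.
  rewrite (powRM p I20 s20) (powRM p (ltW M0) pq0) (powRM p (ltW p0) q4).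
  set A := (2 * theta_int p) `^ p in dir *.
  have A0 : 0 <= A by exact: powR_ge0.
  have Mp : 0 <= M `^ p by exact: powR_ge0.
  have pp : 0 <= p `^ p by exact: powR_ge0.
  have abs : (a' * b') `^ (p - 1) <= (s ^+ 2 / 4) `^ (p - 1).
    apply: powR_pos_mono; [exact: ltW|exact: mulr_ge0|].
    by have := mul_le_sqrD a' b'; rewrite ab.
  rewrite powRM// in abs.
  have ap0 : 0 <= a' `^ (p - 1) by exact: powR_ge0.
  have s4 : (s ^+ 2 / 4) `^ p = s ^+ 2 / 4 * (s ^+ 2 / 4) `^ (p - 1).
    rewrite -{2}(powRr1 q4) -powR_gt0D ?divr_gt0 ?exprn_gt0//.
    by rewrite addrC subrK.
  have h1 := ler_wpM2l A0 hoel.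
  have h2 := ler_wpM2l (mulr_ge0 Mp ap0) dir.
  have h3 := ler_wpM2l (mulr_ge0 (mulr_ge0 Mp pp) (sqr_ge0 s)) abs.
  by rewrite s4; exact: half_bound_arith h1 h2 h3.
have pos2 : 0 <= M * (p * s) * s.
  exact: (mulr_ge0 (mulr_ge0 (ltW M0) (mulr_ge0 (ltW p0) (ltW s0))) (ltW s0)).
rewrite -(ler_pM2r s0 (4 * theta_int p)) leNgt; apply/negP => lt.
by have := powR_pos_ltr p0 pos2 lt; rewrite ltNge key.
Qed.

Lemma period_bound (w : R -> P) (tau : R) :
  (forall t, is_derive t (1 : R) w (ham_rot (gK (w t)))) ->
  (forall t, GK (w t) = 1) -> 0 < tau -> w tau = w 0 ->
  4 * theta_int p / M <= p / 2 * tau.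
Proof.
move=> dw w_energy tau0 wtau.
pose s := tau / 2; have s0 : 0 < s by rewrite divr_gt0.
have s2 : s + s = tau by rewrite /s; field.
suff main : 4 * theta_int p <= M * (p * s).
  rewrite ler_pdivrMr//; apply: (le_trans main); apply: eqle; rewrite /s.
  by field.
have wc : continuous w := is_derive_phase_continuous dw.
pose X t := B *m (w t).1; pose Xi t := D *m (w t).1; pose Y t := D *m (w t).2.
have OXi t : O *m Xi t = X t.
  by rewrite /Xi /X mulmxA -[B *m D^T *m D]mulmxA DTD mulmx1.
have Xc : continuous X by apply: cont_mulmx; exact: cont_fst.
have Yc : continuous Y by apply: cont_mulmx; exact: cont_snd.
have psXc : continuous (fun t => psum p (X t)) := cont_comp Xc (cont_psum p0).
have psYc : continuous (fun t => psum p (Y t)) := cont_comp Yc (cont_psum p0).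
have spc i : continuous (fun t => spowv p (X t) i 0).
  by have := @cont_spowv_coord R n p p1 _ X i Xc.
(* Since [Xi] agrees at 0 and [tau], this is the midpoint for both halves of the period. *)
pose mid := 2^-1 *: (Xi 0 + Xi s).
pose h t := dotc (O *m (Xi t - mid)) (spowv p (X t)).
pose g t := dotc (O *m mid) (spowv p (X t)).
have hE t : h t = psum p (X t) - g t.
  by rewrite /h mulmxBr dotcBl OXi dotc_spow.
have gc : continuous g.
  rewrite /g; under eq_fun do rewrite dotc_sum.
  by apply: cont_sum => i; apply: contM => //; exact: cont_cst.
have hfun : h = (fun t => psum p (X t) - g t) by apply/funext.
have hc : continuous h by rewrite hfun; exact: (contB psXc gc).
(* [spowv p (X t)] is a constant times the derivative of the closed curve B y, so [mid] contributes
   nothing over the full period. *)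
have int_spow i : itg 0 tau (fun t => spowv p (X t) i 0) = 0.
  pose eta t := (- p^-1) * (B *m (w t).2) i 0.
  have deta t : is_derive t (1 : R) eta (spowv p (X t) i 0).
    have := is_derive_scale (- p^-1) (is_derive_mulmx B (is_derive_snd (dw t)) i).
    move/is_derive_eq; apply.
    rewrite /= mulmxN -scalemxAr mulmxA BBT mul1mx !mxE; field; rewrite gt_eqF//.
  by rewrite (prim_unique 0 tau (spc i) deta) /eta wtau subrr.
have int_g : itg 0 tau g = 0.
  have -> : g = (fun t => \sum_i (O *m mid) i 0 * spowv p (X t) i 0).
    by apply/funext => t; rewrite /g dotc_sum.
  rewrite itg_sum; last by move=> i; apply: contM => //; exact: cont_cst.
  by rewrite big1// => i _; rewrite itgZ// int_spow mulr0.
(* The derivative of <x, y> is p times the difference of the two summands of the energy, so both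
   have the same integral. *)
have int_psX : itg 0 tau (fun t => psum p (X t)) = s.
  have dxy t : is_derive t (1 : R) (fun t => dotc (w t).1 (w t).2)
      (p * psum p (Y t) - p * psum p (X t)).
    have := is_derive_dotc (is_derive_fst (dw t)) (is_derive_snd (dw t)).
    move/is_derive_eq; apply.
    rewrite /= dotcZl dotc_mulmx trmxK [dotc (spowv p _) _]dotcC dotc_spow//.
    rewrite [dotc (w t).1 _]dotcC -scaleNr dotcZl mulNr dotc_mulmx trmxK.
    by rewrite [dotc (spowv p _) _]dotcC dotc_spow.
  have c1 : continuous (fun t => p * psum p (Y t)) := contM (@cont_cst R R p) psYc.
  have c2 : continuous (fun t => p * psum p (X t)) := contM (@cont_cst R R p) psXc.
  have := prim_unique 0 tau (contB c1 c2) dxy.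
  rewrite wtau subrr (itgB 0 tau c1 c2) (itgZ p 0 tau psYc) (itgZ p 0 tau psXc) => /eqP; rewrite subr_eq0.
  move=> /eqP/(mulfI (lt0r_neq0 p0)) eqXY.
  have : itg 0 tau (fun t => psum p (X t) + psum p (Y t)) = tau.
    have -> : (fun t => psum p (X t) + psum p (Y t)) = (fun=> 1) by apply/funext.
    by rewrite itg_cst mul1r subr0.
  rewrite (itgD 0 tau psXc psYc) eqXY -s2 => hh; exact: halve hh.
have int_h : itg 0 s h + itg s tau h = s.
  by rewrite itg_cat hfun (itgB 0 tau psXc gc) int_psX int_g subr0.
have dXi t j : is_derive t (1 : R) (fun s => Xi s j 0) ((p *: spowv p (Y t)) j 0).
  have := is_derive_mulmx D (is_derive_fst (dw t)) j.
  by rewrite /= -scalemxAr mulmxA DDT mul1mx.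
have [J|J] := leP (s / 2) (itg 0 s h).
  exact: (half_bound Xc Yc dXi w_energy s0 J).
have shc (f : R -> 'cV[R]_n) : continuous f -> continuous (fun t => f (t + s)).
  by move=> fc; apply: (cont_comp _ fc); exact: is_derive_continuous (is_derive_shift s).
have dXi1 (t : R) j : is_derive t (1 : R) (fun r => Xi (r + s) j 0)
    ((p *: spowv p (Y (t + s))) j 0).
  have := @is_derive1_comp R (fun r => Xi r j 0) (fun r => r + s) t _ _
    (dXi (t + s) j) (is_derive_shift s t).
  by rewrite mulr1.
apply: (half_bound (shc X Xc) (shc Y Yc) dXi1 (fun t => w_energy (t + s)) s0).
have -> : (fun t => dotc (O *m (Xi (t + s) - 2^-1 *: (Xi (0 + s) + Xi (s + s))))
    (spowv p (X (t + s)))) = (fun t => h (t + s)).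
  apply/funext => t; rewrite /h /mid add0r s2 [Xi tau]/Xi wtau.
  by rewrite -/(Xi 0) [Xi 0 + _]addrC.
by rewrite itg_shift// add0r s2; lra.
Qed.

End PeriodBound.

(** * Symplectic embeddings *)

Lemma diff_bound (R : realType) (V W : normedModType R) (f : V -> W) (x : V) :
  differentiable f x -> forall e : R, 0 < e -> exists2 d, 0 < d &
    forall h, `|h| < d -> `|f (x + h) - f x - 'd f x h| <= e * `|h|.
Proof.
move=> /diff_locally /eqaddoP df e e0.
have /nbhs_ballP[d /= d0 xd] := df e e0.
exists d => // h hd; have := xd h; rewrite -ball_normE /= sub0r normrN => /(_ hd).
have -> : (f \o shift x - (cst (f x) + 'd f x)) h = f (h + x) - (f x + 'd f x h) by [].
by rewrite opprD addrA [h + x]addrC.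
Qed.

Lemma is_derive_bound (R : realType) (V : normedModType R) (z : R -> V) (t : R)
    (v : V) : is_derive t (1 : R) z v ->
  forall e : R, 0 < e -> exists2 d, 0 < d & forall s, `|s - t| < d ->
    `|z s - z t - (s - t) *: v| <= e * `|s - t|.
Proof.
move=> [dz ez] e e0.
have lim_v : h^-1 *: (z (h *: (1 : R) + t) - z t) @[h --> 0^'] --> v.
  by rewrite -ez; exact: dz.
have /cvgrPdist_le/(_ e e0) := lim_v.
move=> /nbhs_ballP[d /= d0 xd]; exists d => // s sd.
have [->|st] := eqVneq s t; first by rewrite !subrr scale0r subr0 !normr0 mulr0.
have st0 : s - t != 0 by rewrite subr_eq0.
have := xd (s - t); rewrite -ball_normE /= sub0r normrN => /(_ sd st0).
have -> : (s - t) *: (1 : R) + t = s by rewrite scaleRE mulr1 subrK.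
move=> le_e; have -> : z s - z t - (s - t) *: v =
    - ((s - t) *: (v - (s - t)^-1 *: (z s - z t))).
  by rewrite scalerBr scalerA mulfV// scale1r opprB.
by rewrite normrN normrZ mulrC ler_wpM2r.
Qed.

Section SymplecticLinear.
Variables (R : realType) (n : nat).
Local Notation P := (phase_space R n).
Implicit Types (u v : P) (k : 'I_n * bool).

Definition phase_basis k : P :=
  (\col_i ((~~ k.2) && (i == k.1))%:R, \col_i (k.2 && (i == k.1))%:R).

Lemma pc_basis k l : pc l (phase_basis k) = (l == k)%:R.
Proof.
case: k l => [k b] [l c]; rewrite /pc /phase_basis xpair_eqE /=.
by case: c; case: b; rewrite mxE /= ?andbT ?andbF.
Qed.

Lemma phase_sum u : u = \sum_k pc k u *: phase_basis k.
Proof.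
apply: pc_inj => l; transitivity (\sum_k pc l (pc k u *: phase_basis k)).
  rewrite (bigD1 l)//= pcZ pc_basis eqxx mulr1 big1 ?addr0// => k kl.
  by rewrite pcZ pc_basis eq_sym (negPf kl) mulr0.
elim/big_rec2 : _ => [|k x y _ ->]; first by rewrite pc0.
by rewrite pcD.
Qed.

Lemma ham_rotK u : ham_rot (ham_rot u) = - u.
Proof. by apply: pc_inj => -[j []]; rewrite pcN /pc /= ?mxE. Qed.

Lemma ham_rotN u : ham_rot (- u) = - ham_rot u.
Proof. by apply: pc_inj => -[j []]; rewrite pcN /pc /= ?mxE. Qed.

Lemma ham_rotZ (a : R) u : ham_rot (a *: u) = a *: ham_rot u.
Proof. by apply: pc_inj => -[j []]; rewrite !pcZ /pc /= !mxE ?mulrN. Qed.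

Lemma cont_ham_rot (T : topologicalType) (f : T -> P) : continuous f ->
  continuous (fun x => ham_rot (f x)).
Proof.
move=> fc; apply: cont_phase => -[j []]; rewrite /pc /=.
  under eq_fun do rewrite mxE.
  by apply: contN; have := @cont_pc R n T f (j, false) fc.
by have := @cont_pc R n T f (j, true) fc.
Qed.

Lemma omega_dotp u v : omega u v = dotp (- ham_rot u) v.
Proof. by rewrite -omega_ham_rot ham_rotN ham_rotK opprK. Qed.

Lemma omega_dotpr u v : omega u v = dotp (ham_rot v) u.
Proof. by rewrite dotp_pair; apply: eq_bigr => j _; rewrite !mxE; ring. Qed.

Lemma ham_rot_le u : `|ham_rot u| <= `|u|.
Proof.
apply: phase_norm_le => // -[j []]; rewrite /pc /=.
  by rewrite mxE normrN; exact: (pc_le_norm (j, false) u).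
exact: (pc_le_norm (j, true) u).
Qed.

Lemma omega_le u v : `|omega u v| <= (n * 2)%:R * (`|u| * `|v|).
Proof.
rewrite omega_dotp (le_trans (dotp_le_norm _ _))// ler_wpM2l// ler_wpM2r//.
by rewrite normrN; exact: ham_rot_le.
Qed.

Lemma pc_sum (I : finType) (f : I -> P) k : pc k (\sum_i f i) = \sum_i pc k (f i).
Proof.
by elim/big_rec2 : _ => [|i x y _ <-]; [rewrite pc0|rewrite pcD].
Qed.

Lemma pc_lincomb (a : 'I_n * bool -> R) k : pc k (\sum_l a l *: phase_basis l) = a k.
Proof.
rewrite pc_sum (bigD1 k)//= pcZ pc_basis eqxx mulr1 big1 ?addr0// => l lk.
by rewrite pcZ pc_basis eq_sym (negPf lk) mulr0.
Qed.

Lemma dotp_basis u k : dotp u (phase_basis k) = pc k u.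
Proof.
rewrite /dotp (bigD1 k)//= pc_basis eqxx mulr1 big1 ?addr0// => l lk.
by rewrite pc_basis (negPf lk) mulr0.
Qed.

Let d := #|{: 'I_n * bool}|.
Let row_of (v : P) : 'rV[R]_d := \row_k pc (enum_val k) v.

Let row_of_inj u v : row_of u = row_of v -> u = v.
Proof.
move=> uv; apply: pc_inj => k; have := congr1 (fun r : 'rV_d => r 0 (enum_rank k)) uv.
by rewrite !mxE enum_rankK.
Qed.

Let mat_of (L : P -> P) : 'M[R]_d :=
  \matrix_(k, l) pc (enum_val l) (L (phase_basis (enum_val k))).

Let row_of_lin (L : P -> P) :
  (forall v, L v = \sum_k pc k v *: L (phase_basis k)) ->
  forall v, row_of (L v) = row_of v *m mat_of L.
Proof.
move=> Llin v; apply/rowP => l; rewrite !mxE [in LHS]Llin pc_sum.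
rewrite (reindex (@enum_val _ {: 'I_n * bool})) /=; last first.
  by apply: onW_bij; exact: enum_val_bij.
by apply: eq_bigr => k _; rewrite pcZ !mxE.
Qed.

Variable L : {linear P -> P}.
Hypothesis L_symp : forall u v, omega (L u) (L v) = omega u v.

(* The symplectic adjoint of [L], which is its inverse. *)
Definition symp_inverse v : P :=
  ham_rot (\sum_k omega v (L (phase_basis k)) *: phase_basis k).
Local Notation T := symp_inverse.

Lemma symp_inverseK u : T (L u) = u.
Proof.
transitivity (ham_rot (- ham_rot u)); last by rewrite ham_rotN ham_rotK opprK.
congr ham_rot.
rewrite [RHS]phase_sum; apply: eq_bigr => k _.
by rewrite L_symp omega_dotp dotp_basis.
Qed.

(** For square matrices a one-sided inverse is two-sided; [L] and its adjoint are written as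
    matrices in [phase_basis]. *)
Lemma symp_inverseVK v : L (T v) = v.
Proof.
have linL u : L u = \sum_k pc k u *: L (phase_basis k).
  rewrite {1}(phase_sum u) linear_sum; apply: eq_bigr => k _.
  by rewrite linearZ.
have linT u : T u = \sum_k pc k u *: T (phase_basis k).
  apply: pc_inj => l; rewrite pc_sum /symp_inverse.
  have omega_lin w : omega u w = \sum_k pc k u * omega (phase_basis k) w.
    rewrite omega_dotpr dotpC; apply: eq_bigr => k _.
    by rewrite omega_dotpr dotp_basis; ring.
  have pcT x : pc l (T x) = - dotp (ham_rot (phase_basis l)) (\sum_k omega x (L (phase_basis k)) *: phase_basis k).
    by rewrite -dotp_basis /symp_inverse -omega_dotpr omega_dotp dotpNl.
  rewrite pcT dotpC /dotp -sumrN.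
  under eq_bigr do rewrite pc_lincomb.
  under [RHS]eq_bigr => k _ do rewrite pcZ pcT /dotp -sumrN mulr_sumr.
  rewrite exchange_big; apply: eq_bigr => k _ /=.
  rewrite omega_lin mulr_suml -sumrN; apply: eq_bigr => k' _.
  by rewrite pc_lincomb; ring.
have LT : mat_of L *m mat_of T = 1%:M.
  apply/row_matrixP => k; rewrite row_mul row1.
  have -> : row k (mat_of L) = row_of (L (phase_basis (enum_val k))).
    by apply/rowP => l; rewrite !mxE.
  rewrite -row_of_lin// symp_inverseK; apply/rowP => l; rewrite !mxE pc_basis.
  by rewrite (inj_eq enum_val_inj) eq_sym.
apply: row_of_inj; rewrite row_of_lin// row_of_lin// -mulmxA (mulmx1C LT).
by rewrite mulmx1.
Qed.

Definition symp_inverse_norm : R := (n * 2)%:R * \sum_k `|L (phase_basis k)|.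

Lemma symp_inverse_le v : `|T v| <= symp_inverse_norm * `|v|.
Proof.
apply: (le_trans (ham_rot_le _)); apply: phase_norm_le => [|k].
  by rewrite mulr_ge0// mulr_ge0// sumr_ge0.
rewrite pc_lincomb (le_trans (omega_le _ _))//.
rewrite /symp_inverse_norm -mulrA ler_wpM2l// mulrC ler_wpM2r//.
by rewrite (bigD1 k)//= lerDl sumr_ge0.
Qed.

Lemma symp_le u : `|u| <= symp_inverse_norm * `|L u|.
Proof. by rewrite -{1}(symp_inverseK u); exact: symp_inverse_le. Qed.

End SymplecticLinear.

Section SymplecticEmbedding.
Variables (R : realType) (n : nat).
Local Notation P := (phase_space R n).
Variables (U : set P) (phi : P -> P).
Hypothesis U_open : open U.
Hypothesis phi_smooth : smooth_on U phi.
Hypothesis phi_inj : set_inj U phi.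
Hypothesis phi_symp : forall z, U z -> forall u v,
  omega ('d phi z u) ('d phi z v) = omega u v.

Lemma embed_differentiable x : U x -> differentiable phi x.
Proof. by move=> Ux; exact: (@phi_smooth [::] x Ux). Qed.

Let sub_ball x : U x -> exists2 r, 0 < r & forall y, `|y - x| < r -> U y.
Proof.
move=> Ux; have /nbhs_ballP[r /= r0 rU] : nbhs x U by exact: open_nbhs_nbhs.
by exists r => // y yx; apply: rU; rewrite -ball_normE /= distrC.
Qed.

Lemma closed_pball (x : P) (r : R) : closed [set y : P | `|y - x| <= r].
Proof.
apply: (@preimage_closed _ _ (fun y : P => `|y - x|) [set s | s <= r]); last exact: closed_le.
by move=> y _; apply: cvg_norm; apply: cvgB; [exact: cvg_id|exact: cvg_cst].
Qed.

Lemma compact_pball_at (x : P) (r : R) : compact [set y : P | `|y - x| <= r].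
Proof.
apply: (@subclosed_compact _ _ [set y : P | `|y| <= r + `|x|]); first exact: closed_pball.
  exact: compact_pball.
move=> y /= yx; have := ler_normD (y - x) x; rewrite subrK; lra.
Qed.

Let dist2 (y z : P) : R := dotp (y - z) (y - z).

Let dist2_tri (x y z : P) : dist2 x z <= 2 * dist2 x y + 2 * dist2 y z.
Proof.
rewrite /dist2 /dotp !mulr_sumr -big_split; apply: ler_sum => k _ /=.
have -> : pc k (x - z) = pc k (x - y) + pc k (y - z) by rewrite !pcB; ring.
have := sqr_ge0 (pc k (x - y) - pc k (y - z)); rewrite !expr2; lra.
Qed.

Let dist2C y z : dist2 y z = dist2 z y.
Proof.
by rewrite /dist2 /dotp; apply: eq_bigr => k _; rewrite !pcB; ring.
Qed.

Let dist2_le y z : dist2 y z <= (n * 2)%:R * `|y - z| ^+ 2.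
Proof. by apply: (le_trans (ler_norm _)); rewrite expr2; exact: dotp_le_norm. Qed.

(** A least squares argument. The squared distance from [phi x] to [y] has a minimum on a closed
    ball around [x0], attained in the interior because the sphere is mapped far from [phi x0]. There
    a nonzero residue could be decreased, since the differential is onto. *)
Lemma embed_open (x0 : P) (e : R) : U x0 -> 0 < e -> exists2 d, 0 < d &
  forall y, `|y - phi x0| < d -> exists x, [/\ U x, `|x - x0| < e & phi x = y].
Proof.
move=> Ux0 e0; have [r0 r00 r0U] := sub_ball Ux0.
pose r := Order.min e r0 / 2.
have [re rr0] : r < e /\ r < r0.
  have : Order.min e r0 <= e by rewrite ge_min lexx.
  have : Order.min e r0 <= r0 by rewrite ge_min lexx orbT.
  have : 0 < Order.min e r0 by rewrite lt_min e0.
  by rewrite /r; lra.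
have r_gt0 : 0 < r by rewrite divr_gt0// lt_min e0.
have ballU y : `|y - x0| <= r -> U y by move=> yr; apply: r0U; exact: le_lt_trans rr0.
have phic y : U y -> {for y, continuous phi}.
  by move=> Uy; apply: differentiable_continuous; exact: embed_differentiable.
have dist2c z y : U y -> {for y, continuous (fun x => dist2 (phi x) z)}.
  move=> Uy; have c2 : continuous (fun w => dist2 w z).
    have cB : continuous (fun w : P => w - z).
      by move=> w; apply: cvgB; [exact: cvg_id|exact: cvg_cst].
    exact: cont_dotp.
  exact: (@continuous_comp _ _ _ phi (fun w => dist2 w z) y (phic y Uy) (c2 _)).
have [mu mu0 mu_sph] : exists2 mu, 0 < mu &
    forall x, `|x - x0| = r -> mu <= dist2 (phi x) (phi x0).
  pose S := [set x : P | `|x - x0| = r].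
  have S_compact : compact S.
    apply: (@subclosed_compact _ _ [set y : P | `|y - x0| <= r]).
    - apply: (@preimage_closed _ _ (fun y : P => `|y - x0|) [set s | s = r]); last exact: closed_eq.
      by move=> y _; apply: cvg_norm; apply: cvgB; [exact: cvg_id|exact: cvg_cst].
    - exact: compact_pball_at.
    - by move=> y /= ->.
  have [/set0P S0|/negPn/eqP S0] := boolP (S != set0); last first.
    by exists 1 => // x xr; have : S x by []; rewrite S0.
  have [|c cS cmin] := @compact_EVT_min _ R (fun x => dist2 (phi x) (phi x0)) S S0 S_compact.
    apply: continuous_in_subspaceT => x; rewrite inE => xS; apply: dist2c.
    by apply: ballU; rewrite (_ : `|x - x0| = r).
  exists (dist2 (phi c) (phi x0)); last by move=> x xr; apply: cmin; rewrite inE.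
  rewrite inE in cS.
  have cx0 : c != x0.
    by apply: contra_eq_neq cS => ->; rewrite subrr normr0 lt_eqF.
  have Uc : U c by apply: ballU; rewrite (_ : `|c - x0| = r).
  have : phi c != phi x0.
    by apply: contra_neq cx0; apply: phi_inj; rewrite inE.
  rewrite -subr_eq0 -normr_gt0 => h.
  by apply: lt_le_trans (norm_sq_le_dotp _); rewrite exprn_gt0.
pose N : R := (n * 2)%:R + 1.
have N0 : 0 < N by rewrite ltr_wpDl.
pose d := Order.min 1 (mu / (8 * N)).
have d0 : 0 < d by rewrite lt_min ltr01 divr_gt0// mulr_gt0.
exists d => // y yd.
have y_small : dist2 y (phi x0) < mu / 4.
  apply: (le_lt_trans (dist2_le _ _)).
  have [d1 d2] : d <= 1 /\ d <= mu / (8 * N) by rewrite !ge_min !lexx orbT.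
  have h1 : `|y - phi x0| ^+ 2 <= d.
    rewrite -[leRHS]mulr1 expr2; apply: ler_pM => //; first exact: ltW.
    exact: le_trans (ltW yd) d1.
  have h2 : N * d <= mu / 8.
    have := ler_wpM2l (ltW N0) d2; have -> // : N * (mu / (8 * N)) = mu / 8.
    by field; rewrite gt_eqF.
  have h3 : 0 <= `|y - phi x0| ^+ 2 by exact: sqr_ge0.
  have := ler_wpM2l (ler0n R (n * 2)) h1.
  have : (n * 2)%:R * d <= N * d by rewrite ler_pM2r// /N lerDl.
  lra.
have [||x xin xmin] := @compact_EVT_min _ R (fun x => dist2 (phi x) y) _ _ (@compact_pball_at x0 r).
- by exists x0; rewrite /= subrr normr0 ltW.
- apply: continuous_in_subspaceT => z; rewrite inE => zr; apply: dist2c.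
  exact: ballU.
rewrite inE /= in xin.
have xmin0 : dist2 (phi x) y < mu / 4.
  apply: le_lt_trans y_small; rewrite (dist2C y); apply: xmin.
  by rewrite inE /= subrr normr0 ltW.
have xr : `|x - x0| < r.
  rewrite lt_def xin andbT; apply/eqP => xr.
  have := mu_sph x (esym xr); have := dist2_tri (phi x) y (phi x0); lra.
have Ux : U x by exact: ballU.
exists x; split=> //; first exact: lt_trans re.
apply/eqP; rewrite -subr_eq0; apply/eqP; set w := phi x - y.
apply: contrapT => /eqP w_neq0.
have D0 : 0 < dotp w w.
  by apply: lt_le_trans (norm_sq_le_dotp w); rewrite exprn_gt0 ?normr_gt0.
(* The Newton direction, whose image under the differential is the negative of the residue. *)
pose h := symp_inverse ('d phi x) (- w).
have dh : 'd phi x h = - w by apply: symp_inverseVK; exact: phi_symp.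
set Dw := dotp w w in D0.
pose A := (n * 2)%:R * `|w|; pose B := (n * 2)%:R : R.
(* With this [eps] the error of the expansion costs at most [s * Dw / 2], against a first-order gain
   of [2 * s * Dw]. *)
pose eps := Order.min 1 (Dw / (2 * (2 * A * `|h| + B * `|h| ^+ 2 + 1))).
have A0 : 0 <= A by rewrite mulr_ge0.
have B0 : 0 <= B by exact: ler0n.
have den0 : 0 < 2 * A * `|h| + B * `|h| ^+ 2 + 1.
  by rewrite ltr_wpDl// addr_ge0// ?mulr_ge0// ?sqr_ge0.
have eps0 : 0 < eps by rewrite lt_min ltr01 divr_gt0// mulr_gt0.
have [dl dl0 phi_near] := diff_bound (embed_differentiable Ux) eps0.
pose s := Order.min 2^-1 (Order.min (dl / (2 * (`|h| + 1))) ((r - `|x - x0|) / (`|h| + 1))).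
have h1 : 0 < `|h| + 1 by rewrite ltr_wpDl.
have s0 : 0 < s by rewrite !lt_min invr_gt0 ltr0n !divr_gt0 ?subr_gt0// mulr_gt0.
have s2 : s <= 2^-1 by rewrite ge_min lexx.
have s_dl : `|s *: h| < dl.
  rewrite normrZ gtr0_norm//.
  have : s <= dl / (2 * (`|h| + 1)) by rewrite !ge_min lexx ?orbT.
  rewrite ler_pdivlMr ?mulr_gt0// => sdl.
  have : 0 <= s * `|h| by rewrite mulr_ge0// ltW.
  lra.
have s_r : `|x + s *: h - x0| <= r.
  have : s <= (r - `|x - x0|) / (`|h| + 1) by rewrite !ge_min lexx ?orbT.
  rewrite ler_pdivlMr// => sr.
  have : `|x + s *: h - x0| <= `|x - x0| + s * `|h|.
    rewrite addrAC (le_trans (ler_normD _ _))// normrZ gtr0_norm//.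
  have : 0 <= s by exact: ltW.
  lra.
have := xmin (x + s *: h); rewrite inE /= => /(_ s_r).
have := phi_near (s *: h) s_dl; rewrite linearZ /= dh.
set er := phi (x + s *: h) - phi x - s *: - w => er_le.
have e1 : phi (x + s *: h) - y = (1 - s) *: w + er.
  by apply: pc_inj => k; rewrite /er /w !(pcD, pcN, pcZ); ring.
clearbody er; rewrite /dist2 e1 -/w -/Dw dotpDl !dotpDr !dotpZl !dotpZr [dotp er w]dotpC -/Dw.
rewrite normrZ gtr0_norm// in er_le.
have c1 : dotp w er <= A * (eps * (s * `|h|)).
  apply: (le_trans (ler_norm _)); apply: (le_trans (dotp_le_norm _ _)).
  by rewrite /A mulrA ler_wpM2l.
have c2 : dotp er er <= B * (eps * (s * `|h|)) ^+ 2.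
  apply: (le_trans (ler_norm _)); apply: (le_trans (dotp_le_norm _ _)).
  rewrite ler_wpM2l// -expr2 ler_sqr ?nnegrE// ?mulr_ge0 ?(ltW eps0) ?(ltW s0)//.
have [eps1 eps2] : eps <= 1 /\ eps <= Dw / (2 * (2 * A * `|h| + B * `|h| ^+ 2 + 1)).
  by rewrite !ge_min !lexx orbT.
have key : eps * (2 * A * `|h| + B * `|h| ^+ 2) <= Dw / 2.
  move: eps2; rewrite ler_pdivlMr ?mulr_gt0//.
  have := ltW eps0; lra.
have c3 : 2 * ((1 - s) * (A * (eps * (s * `|h|)))) <= s * (eps * (2 * A * `|h|)).
  have : 0 <= s * (s * (eps * (2 * A * `|h|))).
    by rewrite !mulr_ge0// ltW.
  lra.
have c4 : B * (eps * (s * `|h|)) ^+ 2 <= s * (eps * (B * `|h| ^+ 2)).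
  have -> : B * (eps * (s * `|h|)) ^+ 2 = (eps * s) * (s * (eps * (B * `|h| ^+ 2))) by ring.
  rewrite ler_piMl ?mulr_ge0 ?sqr_ge0 ?(ltW s0) ?(ltW eps0)//.
  rewrite -[leRHS]mulr1; apply: ler_pM => //; try exact: ltW.
  by apply: le_trans s2 _; lra.
have c5 := ler_wpM2l (ltW s0) key.
have c6 : (1 - s) * dotp w er <= (1 - s) * (A * (eps * (s * `|h|))).
  by rewrite ler_wpM2l// subr_ge0; lra.
have c7 : s * s * Dw <= 2^-1 * (s * Dw).
  by rewrite -mulrA ler_wpM2r// mulr_ge0// ltW.
have c8 : 0 < s * Dw by rewrite mulr_gt0.
move: c2 c3 c4 c5 c6 c7 c8; clear; set a1 := dotp w er; set a2 := dotp er er.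
clearbody a1 a2 A B eps s; lra.
Qed.

Definition embed_inv (y : P) : P := xget 0 [set x | U x /\ phi x = y].

Lemma embed_invK x : U x -> embed_inv (phi x) = x.
Proof.
move=> Ux; rewrite /embed_inv; case: xgetP => [y _ [Uy /(phi_inj _ _) ->]//|/(_ x)[]//];
  by rewrite inE.
Qed.

Lemma embed_inv_near x0 (e : R) : U x0 -> 0 < e -> exists2 d, 0 < d &
  forall y, `|y - phi x0| < d ->
    [/\ U (embed_inv y), `|embed_inv y - x0| < e & phi (embed_inv y) = y].
Proof.
move=> Ux0 e0; have [d d0 dphi] := embed_open Ux0 e0; exists d => // y yd.
by have [x [Ux xe <-]] := dphi y yd; rewrite embed_invK.
Qed.

Lemma embed_diff_le x u : U x -> `|u| <= symp_inverse_norm ('d phi x) * `|'d phi x u|.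
Proof. by move=> Ux; apply: symp_le; exact: phi_symp. Qed.

(** The error [er] of the pulled back curve is estimated through its image under the differential,
    which is bounded below by symplecticity; the part of the error proportional to the displacement
    is absorbed because [C * eps <= 2^-1]. *)
Lemma curve_pullback (y : R -> P) (t : R) (v x u : P) :
  is_derive t (1 : R) y v -> U x -> phi x = y t -> 'd phi x u = v ->
  is_derive t (1 : R) (fun s => embed_inv (y s)) u.
Proof.
move=> dy Ux xy duv.
have C0 : 0 <= symp_inverse_norm ('d phi x) by rewrite mulr_ge0// sumr_ge0.
set C := symp_inverse_norm _ in C0.
have tx : embed_inv (y t) = x by rewrite -xy embed_invK.
apply: is_derive_of_bound => e e0.
pose eps := Order.min (2 * (C + 1))^-1 (e / (2 * (C + 1) * (2 + `|u|))).
have C1 : 0 < C + 1 by rewrite ltr_wpDl.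
have u2 : 0 < 2 + `|u| by rewrite ltr_wpDr.
have eps0 : 0 < eps by rewrite lt_min invr_gt0 divr_gt0 ?mulr_gt0.
have [d1 d10 phi_near] := diff_bound (embed_differentiable Ux) eps0.
have [d2 d20 inv_near] := embed_inv_near Ux d10.
have [d3 d30 y_near] := is_derive_bound dy eps0.
have [d4 d40 y_near1] := is_derive_bound dy (ltr01 : 0 < (1 : R)).
exists (Order.min (Order.min d3 d4) (d2 / (2 + `|v|))).
  by rewrite !lt_min d30 d40 divr_gt0// ltr_wpDr.
move=> s; rewrite !lt_min => /andP[/andP[sd3 sd4] sd2].
have v2 : 0 < 2 + `|v| by rewrite ltr_wpDr.
have ys_close : `|y s - phi x| < d2.
  rewrite xy; move: sd2; rewrite ltr_pdivlMr// => sd2.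
  have := y_near1 s sd4; rewrite mul1r.
  have := ler_normD (y s - y t - (s - t) *: v) ((s - t) *: v).
  rewrite subrK normrZ; have := normr_ge0 (s - t); lra.
have [Us xs_close phi_s] := inv_near _ ys_close.
rewrite tx; set xs := embed_inv (y s) in Us xs_close phi_s *.
set er := xs - x - (s - t) *: u.
have xs_le : `|xs - x| <= `|er| + `|s - t| * `|u|.
  rewrite -[xs - x](subrK ((s - t) *: u)) (le_trans (ler_normD _ _))//.
  by rewrite normrZ.
have L_er : 'd phi x er = (y s - y t - (s - t) *: v) -
    (phi (x + (xs - x)) - phi x - 'd phi x (xs - x)).
  rewrite /er linearB linearZ /= duv [x + _]addrC subrK phi_s xy.
  by apply: pc_inj => k; rewrite !(pcD, pcN, pcZ); ring.
have er_le : `|er| <= C * (eps * `|s - t| + eps * `|xs - x|).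
  apply: (le_trans (embed_diff_le _ Ux)); rewrite -/C ler_wpM2l// L_er.
  apply: (le_trans (ler_normB _ _)); apply: lerD; first exact: y_near.
  exact: phi_near.
have [eps1 eps2] : eps <= (2 * (C + 1))^-1 /\ eps <= e / (2 * (C + 1) * (2 + `|u|)).
  by rewrite !ge_min !lexx orbT.
have Ceps : C * eps <= 2^-1.
  apply: (@le_trans _ _ ((C + 1) * eps)); first by rewrite ler_wpM2r ?lerDl// ltW.
  have := ler_wpM2l (ltW C1) eps1; have -> // : (C + 1) * (2 * (C + 1))^-1 = 2^-1.
  by field; rewrite gt_eqF.
have Ceps2 : (C + 1) * eps * (2 + `|u|) <= e / 2.
  have := ler_wpM2l (mulr_ge0 (ltW C1) (ltW u2)) eps2.
  have -> : (C + 1) * (2 + `|u|) * (e / (2 * (C + 1) * (2 + `|u|))) = e / 2.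
    by field; rewrite !gt_eqF.
  lra.
have st0 := normr_ge0 (s - t); have er0 := normr_ge0 er; have u0 := normr_ge0 u.
have Ce0 : 0 <= C * eps by rewrite mulr_ge0// ltW.
have k1 : C * eps * `|xs - x| <= C * eps * (`|er| + `|s - t| * `|u|) by rewrite ler_wpM2l.
have k2 : C * eps * `|er| <= 2^-1 * `|er| by rewrite ler_wpM2r.
have k3 : C * eps * (1 + `|u|) * `|s - t| <= e / 2 * `|s - t|.
  rewrite ler_wpM2r//; apply: le_trans Ceps2.
  have h1 : 0 <= eps * (1 + `|u|) by rewrite mulr_ge0 ?addr_ge0// ltW.
  have h2 : 0 <= (C + 1) * eps by rewrite mulr_ge0// ltW.
  lra.
move: er_le k1 k2 k3.
set n1 := `|er|; set n2 := `|s - t|; set n3 := `|xs - x|; set n4 := `|u|.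
move: n1 n2 n3 n4 => n1 n2 n3 n4; clear; lra.
Qed.

Lemma embed_diff_sum x u : U x -> 'd phi x u = \sum_k pc k u *: 'D_(phase_basis R k) phi x.
Proof.
move=> Ux; rewrite {1}(phase_sum u) linear_sum; apply: eq_bigr => k _.
by rewrite linearZ deriveE//; exact: embed_differentiable.
Qed.

(** The differential is expanded in the basis; the directional derivatives that occur are continuous
    by smoothness. *)
Lemma embed_diff_continuous (T : topologicalType) (f a : T -> P) (x : T) :
  U (f x) -> (\forall y \near x, U (f y)) -> {for x, continuous f} ->
  {for x, continuous a} ->
  {for x, continuous (fun y => 'd phi (f y) (a y))}.
Proof.
move=> Ux Unear fc ac.
have sum_cvg : (\sum_k pc k (a y) *: 'D_(phase_basis R k) phi (f y)) @[y --> x] -->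
    \sum_k pc k (a x) *: 'D_(phase_basis R k) phi (f x).
  have term k : (pc k (a y) *: 'D_(phase_basis R k) phi (f y)) @[y --> x] -->
      pc k (a x) *: 'D_(phase_basis R k) phi (f x); last first.
    elim: (index_enum _) => [|k s IH].
      by under eq_fun do rewrite big_nil; rewrite big_nil; exact: cvg_cst.
    by under eq_fun do rewrite big_cons; rewrite big_cons; exact: cvgD (term k) IH.
  apply: cvgZ.
    apply/cvgrPdist_le => e e0; have /cvgrPdist_le/(_ e e0) := ac.
    by apply: filterS => y; apply: le_trans; rewrite -pcB; exact: pc_le_norm.
  have dk : differentiable ('D_(phase_basis R k) phi) (f x).
    exact: (@phi_smooth [:: phase_basis R k] (f x) Ux).
  exact: (@continuous_comp _ _ _ f ('D_(phase_basis R k) phi) x fc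
    (differentiable_continuous dk)).
have transfer (e : R) (v w v' w' : P) : v = v' -> w = w' ->
  `|v' - w'| <= e -> `|v - w| <= e by move=> -> ->.
apply/cvgrPdist_le => e e0; have /cvgrPdist_le/(_ e e0) near_sum := sum_cvg.
have near_both := @filterI _ _ (nbhs_filter x) _ _ Unear near_sum.
apply: (@filterS _ _ (nbhs_filter x) _ _ _ near_both) => y [Uy].
exact: transfer (embed_diff_sum (a x) Ux) (embed_diff_sum (a y) Uy).
Qed.

End SymplecticEmbedding.

(** * Profile functions *)

Section SmoothRamp.
Variables (R : realType) (dl : R).
Hypothesis dl0 : 0 < dl.
Implicit Types u v s t : R.

Definition pos_part s : R := Num.max s 0.

Lemma cont_pos_part : continuous pos_part.
Proof. by apply: cont_max; [move=> x; exact: cvg_id|exact: cont_cst]. Qed.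

Lemma is_derive_pos_sq t :
  is_derive t (1 : R) (fun s => pos_part s ^+ 2) (2 * pos_part t).
Proof.
apply: is_derive_of_bound => e e0; exists e => // s st.
apply: (@le_trans _ _ ((s - t) ^+ 2)); last first.
  by rewrite -(real_normK (num_real _)) expr2 ler_wpM2r// ltW.
rewrite scaleRE /pos_part ler_norml.
have := sqr_ge0 s; have := sqr_ge0 t; have := sqr_ge0 (s - t); rewrite !expr2 => h1 h2 h3.
have [s0|s0] := leP s 0; have [t0|t0] := leP t 0.
- by apply/andP; split; lra.
- by have st0 := mulr_le0_ge0 s0 (ltW t0); apply/andP; split; lra.
- by have st0 := mulr_ge0_le0 (ltW s0) t0; apply/andP; split; lra.
- by apply/andP; split; lra.
Qed.

(** A continuously differentiable version of max(u, 0), altered on [-dl, dl] only. *)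
Definition ramp u : R := (pos_part (u + dl) ^+ 2 - pos_part (u - dl) ^+ 2) / (4 * dl).
Definition dramp u : R := (pos_part (u + dl) - pos_part (u - dl)) / (2 * dl).

Lemma is_derive_ramp u : is_derive u (1 : R) ramp (dramp u).
Proof.
have sh (c : R) : is_derive u (1 : R) (fun s => pos_part (s + c) ^+ 2) (2 * pos_part (u + c)).
  have dc : is_derive u (1 : R) (fun s : R => s + c) (1 : R).
    by have := is_deriveD (is_derive_id u (1 : R)) (is_derive_cst c u (1 : R)); rewrite addr0.
  have := @is_derive1_comp R _ (fun s => s + c) u _ _ (is_derive_pos_sq (u + c)) dc.
  by rewrite mulr1.
have := is_deriveZ (4 * dl)^-1 (is_deriveB (sh dl) (sh (- dl))).
have -> : (4 * dl)^-1 \*: ((fun s => pos_part (s + dl) ^+ 2) - (fun s => pos_part (s - dl) ^+ 2)) = ramp.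
  by apply/funext => s; rewrite /ramp /= scaleRE mulrC.
move/is_derive_eq; apply; rewrite scaleRE /dramp; field; exact: lt0r_neq0.
Qed.

Lemma cont_dramp : continuous dramp.
Proof.
apply: contM; last exact: cont_cst.
by apply: contB; apply: (@cont_comp R R R pos_part); try exact: cont_pos_part;
  apply: contD; try exact: cont_cst; move=> x; exact: cvg_id.
Qed.

Lemma ramp_low u : u <= - dl -> ramp u = 0 /\ dramp u = 0.
Proof.
move=> ul; have dl0' := dl0.
have e1 : pos_part (u + dl) = 0 by apply/max_idPr; lra.
have e2 : pos_part (u - dl) = 0 by apply/max_idPr; lra.
by rewrite /ramp /dramp e1 e2 expr0n /= subrr !mul0r.
Qed.

Lemma ramp_high u : dl <= u -> ramp u = u /\ dramp u = 1.
Proof.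
move=> ul; have dl0' := dl0; have e1 : pos_part (u + dl) = u + dl by apply/max_idPl; lra.
have e2 : pos_part (u - dl) = u - dl by apply/max_idPl; lra.
by rewrite /ramp /dramp e1 e2; split; field; rewrite lt0r_neq0.
Qed.

Lemma dramp_mono u v : u <= v -> dramp u <= dramp v.
Proof.
move=> uv; rewrite /dramp ler_pM2r ?invr_gt0 ?mulr_gt0// /pos_part.
have dl0' := dl0.
by have [h1|h1] := leP (u + dl) 0; have [h2|h2] := leP (u - dl) 0;
  have [h3|h3] := leP (v + dl) 0; have [h4|h4] := leP (v - dl) 0; lra.
Qed.

Lemma dramp_ge0 u : 0 <= dramp u.
Proof.
rewrite /dramp divr_ge0 ?mulr_ge0 ?(ltW dl0)// subr_ge0 /pos_part.
have dl0' := dl0.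
by have [h1|h1] := leP (u + dl) 0; have [h2|h2] := leP (u - dl) 0; lra.
Qed.

Lemma dramp_le1 u : dramp u <= 1.
Proof.
rewrite /dramp ler_pdivrMr ?mulr_gt0// mul1r /pos_part.
have dl0' := dl0.
by have [h1|h1] := leP (u + dl) 0; have [h2|h2] := leP (u - dl) 0; lra.
Qed.

Lemma ramp_mono u v : u <= v -> ramp u <= ramp v.
Proof.
move=> uv; have [c _ eq] := MVT_is_derive uv is_derive_ramp.
by rewrite -subr_ge0 eq mulr_ge0 ?dramp_ge0// subr_ge0.
Qed.

Lemma ramp_ge0 u : 0 <= ramp u.
Proof.
have [ul|ul] := leP u (- dl); first by rewrite (ramp_low ul).1.
by rewrite -(ramp_low (lexx (- dl))).1 ramp_mono// ltW.
Qed.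

(** All tangent lines of the ramp have nonnegative height at 0; this gives the sign in
    [Fout_density]. *)
Lemma ramp_convex u : u * dramp u <= ramp u.
Proof.
have [ul|ul] := leP u (- dl); first by have [-> ->] := ramp_low ul; rewrite mulr0.
have [uh|uh] := leP dl u; first by have [-> ->] := ramp_high uh; rewrite mulr1.
have dl0' := dl0; have e1 : pos_part (u + dl) = u + dl by apply/max_idPl; lra.
have e2 : pos_part (u - dl) = 0 by apply/max_idPr; lra.
rewrite /ramp /dramp e1 e2 subr0 expr0n /= subr0.
rewrite ler_pdivlMr ?mulr_gt0//.
have -> : u * ((u + dl) / (2 * dl)) * (4 * dl) = 2 * u * (u + dl).
  by field; rewrite lt0r_neq0.
rewrite expr2 -subr_ge0 -mulrBl mulr_ge0//; lra.
Qed.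

End SmoothRamp.

Lemma is_derive_powR_pos (R : realType) (r l : R) : 0 < l ->
  is_derive l (1 : R) (fun s => s `^ r) (r * l `^ (r - 1)).
Proof.
move=> l0.
have d1 : is_derive l (1 : R) (fun s => expR (r * ln s)) (expR (r * ln l) * (r * l^-1)).
  have dl := is_deriveZ r (is_derive1_ln l0).
  exact: @is_derive1_comp R expR (fun s => r * ln s) l _ _ (is_derive_expR _) dl.
have eqn : {near l, (fun s => expR (r * ln s)) =1 (fun s => s `^ r)}.
  near=> s; rewrite /powR gt_eqF//; near: s; exact: lt_nbhsr.
have := @near_eq_is_derive _ _ _ _ _ _ _ _ eqn d1 => /is_derive_eq; apply.
rewrite -[expR (r * ln l)]/(expR (r * ln l)) powR_gt0D// powRN powRr1 ?ltW//.
by rewrite /powR gt_eqF//; ring.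
Unshelve. all: by end_near. Qed.

Section Profile.
Variables (R : realType) (p m c : R).
Hypotheses (p_gt2 : 2 < p) (m_gt0 : 0 < m) (mc : m < c).

(** In the variable l^(2/p) the expression bounded by [c] is the slope of the profile, and by
    [flow_bound] it is the action of a 1-periodic orbit on the level l, rescaled to the boundary of
    K. Slope [c] suffices to climb from 0 to [m] inside the unit interval because [m < c]. *)
Lemma profile_exists : exists f df l0 l1, [/\ 0 < l0, 0 < l1 < 1,
  (forall l : R, 0 <= l -> is_derive l (1 : R) f (df l)),
  continuous f /\ continuous df & [/\
  forall l : R, 0 <= l -> l < l0 -> f l = 0 /\ df l = 0,
  forall l : R, l1 <= l -> f l = m /\ df l = 0,
  forall l : R, 0 <= f l &
  forall l : R, 0 < l -> 0 <= df l * l `^ (1 - 2 / p) * (p / 2) <= c]].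
Proof.
have c0 : 0 < c by exact: lt_trans mc.
pose g := 1 - m / c.
have g0 : 0 < g by rewrite subr_gt0 ltr_pdivrMr// mul1r.
have g1 : g < 1 by rewrite /g gtrBl divr_gt0.
pose dl := g / 4; have dl0 : 0 < dl by rewrite divr_gt0.
(* The corners of a piecewise linear profile of slope [c]; the smoothing width g/4 keeps it constant
   near 0 and near 1. *)
pose sa := g / 2; pose sb := 1 - g / 2.
have sab : c * (sb - sa) = m by rewrite /sb /sa /g; field; rewrite lt0r_neq0.
have p0 : 0 < p by apply: lt_trans p_gt2.
pose r := 2 / p; have r0 : 0 < r by rewrite divr_gt0.
have r_neq0 := lt0r_neq0 r0.
pose fh (s : R) := c * (ramp dl (s - sa) - ramp dl (s - sb)).
pose dfh (s : R) := c * (dramp dl (s - sa) - dramp dl (s - sb)).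
have dfh_derive (s : R) : is_derive s (1 : R) fh (dfh s).
  have sh (b : R) : is_derive s (1 : R) (fun s => ramp dl (s - b)) (dramp dl (s - b)).
    have dc : is_derive s (1 : R) (fun s : R => s - b) (1 : R).
      by have := is_deriveB (is_derive_id s (1 : R)) (is_derive_cst b s (1 : R)); rewrite subr0.
    have := @is_derive1_comp R _ (fun s => s - b) s _ _ (is_derive_ramp dl0 (s - b)) dc.
    by rewrite mulr1.
  by have := is_deriveZ c (is_deriveB (sh sa) (sh sb)).
have ab : sa <= sb by rewrite /sa /sb; lra.
have dfh_ge0 s : 0 <= dfh s.
  by rewrite mulr_ge0 ?(ltW c0)// subr_ge0 dramp_mono// lerB.
have dfh_le s : dfh s <= c.
  rewrite -[leRHS]mulr1 ler_pM2l//.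
  by have := dramp_le1 dl0 (s - sa); have := dramp_ge0 dl0 (s - sb); lra.
have fh_ge0 s : 0 <= fh s.
  by rewrite mulr_ge0 ?(ltW c0)// subr_ge0 ramp_mono// lerB.
have fh_low s : s <= g / 4 -> fh s = 0 /\ dfh s = 0.
  move=> sg; rewrite /fh /dfh.
  have [|-> ->] := @ramp_low _ dl dl0 (s - sa); first by rewrite /dl /sa; lra.
  have [|-> ->] := @ramp_low _ dl dl0 (s - sb); first by rewrite /dl /sb; lra.
  by rewrite subrr mulr0.
have fh_high s : 1 - g / 4 <= s -> fh s = m /\ dfh s = 0.
  move=> sg; rewrite /fh /dfh.
  have [|-> ->] := @ramp_high _ dl dl0 (s - sa); first by rewrite /dl /sa; lra.
  have [|-> ->] := @ramp_high _ dl dl0 (s - sb); first by rewrite /dl /sb; lra.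
  by rewrite subrr mulr0; split=> //; rewrite -sab; ring.
pose f (l : R) := fh (`|l| `^ r).
pose l0 : R := (g / 4) `^ r^-1.
have l00 : 0 < l0 by apply: powR_gt0.
have l0r : l0 `^ r = g / 4 by rewrite powRKV// divr_ge0// ltW.
pose l1 : R := (1 - g / 4) `^ r^-1.
have gg : 0 < 1 - g / 4 by lra.
have l1r : l1 `^ r = 1 - g / 4 by rewrite powRKV// ltW.
have l10 : 0 < l1 by apply: powR_gt0.
clearbody l0 l1.
have l11 : l1 < 1.
  rewrite ltNge; apply/negP => l1_ge1.
  by have := powR_pos_mono (ltW r0) ler01 l1_ge1; rewrite powR1 l1r; lra.
(* The maximum with [l0] tames the factor 1/l near 0, where [dfh] vanishes anyway. *)
pose df (l : R) := dfh (`|l| `^ r) * (r * `|l| `^ r / Num.max `|l| l0).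
have dfhc : continuous dfh.
  apply: contM; first exact: cont_cst.
  apply: contB; apply: (@cont_comp R R R (dramp dl)); try exact: cont_dramp;
    by apply: contB; [move=> x; exact: cvg_id|exact: cont_cst].
have max_gt0 (l : R) : 0 < Num.max `|l| l0 by rewrite lt_max l00 orbT.
have df_eq l : 0 < l -> df l = dfh (l `^ r) * (r * l `^ (r - 1)).
  move=> lp; rewrite /df (gtr0_norm lp).
  have [ll|ll] := leP l l0.
    have lr : l `^ r <= g / 4.
      by rewrite -l0r; exact: powR_pos_mono (ltW r0) (ltW lp) ll.
    by rewrite (fh_low _ lr).2 !mul0r.
  have e : l `^ (r - 1) = l `^ r / l.
    by rewrite (powR_gt0D r (-1) lp) powRN (powRr1 (ltW lp)).
  by rewrite e -mulrA.
exists f, df, l0, l1; split.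
- exact: l00.
- by rewrite l10.
- move=> l l_ge0; have [ll|ll] := ltP l l0.
    have lr : `|l| `^ r < g / 4.
      by rewrite -l0r ger0_norm// powR_pos_ltr.
    have -> : df l = 0 by rewrite /df (fh_low _ (ltW lr)).2 mul0r.
    have eqn : {near l, cst 0 =1 f}.
      have cpow : continuous (fun s : R => `|s| `^ r) by exact: cont_powR.
      near=> s; have sg : `|s| `^ r < g / 4.
        by near: s; apply: (cvgr_lt (`|l| `^ r)) => //; exact: cpow.
      by rewrite /f (fh_low _ (ltW sg)).1.
    exact: (@near_eq_is_derive _ _ _ _ _ _ _ _ eqn (is_derive_cst 0 l (1 : R))).
  have lp : 0 < l by exact: lt_le_trans ll.
  rewrite (df_eq l lp).
  have d1 := @is_derive1_comp R fh (fun s => s `^ r) l _ _ (dfh_derive (l `^ r)) (is_derive_powR_pos r lp).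
  have eqn : {near l, fh \o (fun s => s `^ r) =1 f}.
    near=> s; rewrite /f /= ger0_norm// ltW//; near: s; exact: lt_nbhsr.
  exact: (@near_eq_is_derive _ _ _ _ _ _ _ _ eqn d1).
- split.
    apply: (@cont_comp R R R fh); first exact: cont_powR.
    exact: is_derive_continuous dfh_derive.
  apply: contM; first by apply: (@cont_comp R R R dfh); first exact: cont_powR.
  apply: contM; first by apply: contM; [exact: cont_cst|exact: cont_powR].
  apply: cont_inv; first by move=> l; rewrite lt0r_neq0.
  apply: cont_max; last exact: cont_cst.
  by apply: cont_norm => x; exact: cvg_id.
- split.
  + move=> l l_ge0 ll; have lr : `|l| `^ r <= g / 4.
      by rewrite -l0r ger0_norm//; exact: powR_pos_mono (ltW r0) l_ge0 (ltW ll).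
    by rewrite /f /df; have [-> ->] := fh_low _ lr; rewrite mul0r.
  + move=> l ll; have lp : 0 < l by exact: lt_le_trans ll.
    have lr : 1 - g / 4 <= `|l| `^ r.
      by rewrite -l1r gtr0_norm//; apply: powR_pos_mono; rewrite ?(ltW r0) ?(ltW l10).
    by rewrite /f /df; have [-> ->] := fh_high _ lr; rewrite mul0r.
  + by move=> l; exact: fh_ge0.
  + move=> l lp; rewrite (df_eq l lp).
    have -> : dfh (l `^ r) * (r * l `^ (r - 1)) * l `^ (1 - 2 / p) * (p / 2) = dfh (l `^ r).
      have e1 : l `^ (r - 1) * l `^ (1 - 2 / p) = 1.
        by rewrite -powR_gt0D// /r addrA subrK subrr powRr0.
      have e2 : r * (p / 2) = 1 by rewrite /r; field; rewrite lt0r_neq0.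
      have e3 (x y z w v : R) : x * (w * y) * z * v = x * ((w * v) * (y * z)) by ring.
      by rewrite e3 e2 e1 !mulr1.
    by rewrite dfh_ge0 dfh_le.
Unshelve. all: by end_near. Qed.

End Profile.

(** * Lower bound for the cylindrical capacity *)

Section EnergySublevels.
Variables (R : realType) (n : nat) (p : R) (B D : 'M[R]_n).
Hypotheses (p_gt1 : 1 < p) (orthB : orthogonal_mx B) (orthD : orthogonal_mx D).
Local Notation P := (phase_space R n).
Local Notation GK := (energy p B D).
Let p0 := p_gt0 p_gt1.

Lemma energy_ge0 z : 0 <= GK z.
Proof. by rewrite addr_ge0 ?psum_ge0. Qed.

Lemma energy0 : GK 0 = 0.
Proof. by rewrite /energy /= !mulmx0 !psum0// addr0. Qed.

Lemma KpE : Kp p B D = [set z | GK z <= 1].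
Proof.
apply/funext => z; apply: (congr1 (fun s : R => is_true (s <= 1))).
exact: (f_equal2 (fun s t : R => s + t) (psum_lp_norm (B *m z.1) p0)
  (psum_lp_norm (D *m z.2) p0)).
Qed.

(** By orthogonality x = A^T (A x), and the entries of A x are at most 1 in absolute value. *)
Let coord_bound (A : 'M[R]_n) (x : 'cV[R]_n) : orthogonal_mx A -> psum p (A *m x) <= 1 ->
  `|x| <= \sum_i \sum_j `|A i j|.
Proof.
move=> orthA Ax.
have ATA : A^T *m A = 1%:M by exact: mulmx1C orthA.
have S0 : 0 <= \sum_i \sum_j `|A i j| by apply: sumr_ge0 => i _; exact: sumr_ge0.
apply: mx_norm_le => // j k; rewrite ord1 -[x]mul1mx -ATA -mulmxA mxE.
apply: (le_trans (ler_norm_sum _ _ _)); apply: ler_sum => i _.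
rewrite mxE normrM (bigD1 j)//= -[leLHS]addr0 lerD ?sumr_ge0//.
rewrite ler_piMr// leNgt; apply/negP => gt1.
have := coord_le_psum p (A *m x) i; rewrite leNgt => /negP; apply.
by apply: le_lt_trans Ax _; have := powR_pos_ltr p0 ler01 gt1; rewrite powR1.
Qed.

Lemma energy_bounded : exists2 C, 0 <= C & forall z, GK z <= 1 -> `|z| <= C.
Proof.
exists (\sum_i \sum_j `|B i j| + \sum_i \sum_j `|D i j|).
  by rewrite addr_ge0// sumr_ge0// => i _; exact: sumr_ge0.
move=> z z1; have := psum_ge0 p (B *m z.1); have := psum_ge0 p (D *m z.2).
move: z1; rewrite /energy => z1 h1 h2.
rewrite prod_norm ge_max; apply/andP; split.
  apply: (le_trans (coord_bound orthB _)); first by lra.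
  by rewrite lerDl sumr_ge0// => i _; exact: sumr_ge0.
apply: (le_trans (coord_bound orthD _)); first by lra.
by rewrite lerDr sumr_ge0// => i _; exact: sumr_ge0.
Qed.

Lemma energy_sub_compact (Q : set R) : closed Q -> Q `<=` [set l | l <= 1] ->
  compact [set z : P | Q (GK z)].
Proof.
move=> Qc Q1; have [C C0 zC] := energy_bounded.
apply: (@subclosed_compact _ _ [set z : P | `|z| <= C]).
- by apply: (@preimage_closed _ _ GK Q) => // z _; exact: cont_energy.
- exact: compact_pball.
- by move=> z /= /Q1; exact: zC.
Qed.

Lemma spowv_scale (k : R) (x : 'cV[R]_n) : 0 <= k ->
  spowv p (k *: x) = k `^ (p - 1) *: spowv p x.
Proof.
by move=> k0; apply/colP => i; rewrite !mxE spowM spow_pos.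
Qed.

Lemma energy_scale (k : R) (z : P) : 0 <= k -> GK (k *: z) = k `^ p * GK z.
Proof.
move=> k0; rewrite /energy /= -!scalemxAr !psumZ ger0_norm//; ring.
Qed.

Lemma energy_grad_scale (k : R) (z : P) : 0 <= k ->
  energy_grad p B D (k *: z) = k `^ (p - 1) *: energy_grad p B D z.
Proof.
move=> k0; rewrite /energy_grad /= -!scalemxAr !spowv_scale// -!scalemxAr.
congr (_, _); rewrite !scalerA; congr (_ *: _); ring.
Qed.

Lemma dotp_ham_rot (u : P) : dotp u (ham_rot u) = 0.
Proof. by rewrite dotp_pair big1// => j _; rewrite !mxE; ring. Qed.

End EnergySublevels.

Lemma clopen_line (R : realType) (S : set R) (t0 : R) : S t0 ->
  (forall t, S t -> exists2 d, 0 < d & forall s, `|s - t| < d -> S s) ->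
  closed S -> forall t, S t.
Proof.
move=> St0 Sop Scl t.
have Sopen : open S.
  rewrite openE => s /Sop[d d0 sd]; apply/nbhs_ballP; exists d => // r.
  by rewrite -ball_normE /= distrC; exact: sd.
have tmm : Order.min t0 t <= t <= Order.max t0 t.
  by rewrite ge_min le_max lexx !orbT.
have t0mm : Order.min t0 t <= t0 <= Order.max t0 t.
  by rewrite ge_min le_max lexx.
pose I : set R := `[Order.min t0 t, Order.max t0 t]%classic.
have con : connected I by exact: segment_connected.
have eqS : I `&` S = I.
  apply: con; [|by exists S|by exists S].
  by exists t0; split => //; rewrite /I /= in_itv.
have : I t by rewrite /I /= in_itv.
by rewrite -eqS => -[].
Qed.

Lemma locally_constant (R : realType) (h : R -> R) (t d : R) :
  (forall s, `|s - t| < d -> is_derive s (1 : R) h 0) ->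
  forall s, `|s - t| < d -> h s = h t.
Proof.
move=> dh s st.
have seg a b : a <= b -> (forall c, a <= c <= b -> `|c - t| < d) -> h a = h b.
  move=> ab cd; have [||c _ eq] := @MVT_segment R h (fun=> 0) a b ab.
  - by move=> x; rewrite in_itv /= => /andP[/ltW x1 /ltW x2]; apply: dh; apply: cd; rewrite x1.
  - apply: derivable_within_continuous => x; rewrite in_itv /= => xab.
    by have [] := dh x (cd x xab).
  by apply/esym/eqP; rewrite -subr_eq0 eq mul0r.
move: st; rewrite ltr_norml => /andP[st1 st2].
have [ts|ts] := leP t s.
  apply/esym; apply: seg => // c /andP[c1 c2]; rewrite ltr_norml.
  by apply/andP; split; lra.
apply: seg; first exact: ltW.
by move=> c /andP[c1 c2]; rewrite ltr_norml; apply/andP; split; lra.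
Qed.

Lemma is_derive_line (R : realType) (n : nat) (z v : phase_space R n) (t : R) :
  is_derive t (1 : R) (fun s => z + s *: v) v.
Proof.
apply: is_derive_of_bound => e e0; exists 1 => // s _.
rewrite (_ : z + s *: v - (z + t *: v) - (s - t) *: v = 0); first by rewrite normr0 mulr_ge0 ?(ltW e0).
by apply: pc_inj => k; rewrite !(pcB, pcD, pcZ) pc0; ring.
Qed.

Lemma near_dist (R : realType) (V : normedModType R) (x : V) (d : R) (Q : V -> Prop) :
  0 < d -> (forall y, `|y - x| < d -> Q y) -> \forall y \near x, Q y.
Proof.
move=> d0 dQ; apply/nbhs_ballP; exists d => // y.
by rewrite -ball_normE /= distrC; exact: dQ.
Qed.

Lemma omegaZl (R : realType) (n : nat) (c : R) (u v : phase_space R n) :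
  omega (c *: u) v = c * omega u v.
Proof. by rewrite !omega_dotp ham_rotZ !dotpNl dotpZl mulrN. Qed.

Section AmbientHamiltonian.
Variables (R : realType) (n : nat) (a : 'I_n -> R) (m dl : R).
Hypotheses (dl0 : 0 < dl) (m0 : 0 < m).
Local Notation P := (phase_space R n).

(* The Hamiltonian is [Fin + Fout]: [Fin] is the push-forward of [f \o G - m] by the
   embedding, extended by 0, and [Fout] is [m] on the image of [K] and the quadratic
   form [aquad a] far away. *)
Definition Fout (z : P) : R := m + ramp dl (aquad a z - m).
Definition Gout (z : P) : P := dramp dl (aquad a z - m) *: alin a z.

Lemma is_derive_aquad (y : R -> P) (v : P) (t : R) : is_derive t (1 : R) y v ->
  is_derive t (1 : R) (fun s => aquad a (y s)) (dotp (alin a (y t)) v).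
Proof.
move=> dy.
have dk k : is_derive t (1 : R) (fun s => a k.1 * pc k (y s) ^+ 2)
    (a k.1 * (2 * pc k (y t) * pc k v)).
  have d1 := is_derive_pc k dy.
  have := is_deriveM d1 d1 => /is_derive_eq d2.
  apply: is_derive_scale; under eq_fun do rewrite expr2.
  by apply: d2; rewrite scaleRE; ring.
have := is_derive_sum_fin dk => /is_derive_eq; apply.
by apply: eq_bigr => k _; rewrite pc_alin; ring.
Qed.

Lemma Fout_derive (z v : P) (t : R) : is_derive t (1 : R)
  (fun s : R => Fout (z + s *: v)) (dotp (Gout (z + t *: v)) v).
Proof.
have d1 := is_derive_aquad (is_derive_line z v t).
have d2 : is_derive t (1 : R) (fun s => aquad a (z + s *: v) - m) (dotp (alin a (z + t *: v)) v).
  by have := is_deriveB d1 (is_derive_cst m t (1 : R)); rewrite subr0.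
have d3 := @is_derive1_comp R (ramp dl) (fun s => aquad a (z + s *: v) - m) t _ _
  (is_derive_ramp dl0 (aquad a (z + t *: v) - m)) d2.
have := is_deriveD (is_derive_cst m t (1 : R)) d3; rewrite add0r => /is_derive_eq; apply.
by rewrite /Gout dotpZl.
Qed.

Lemma cont_Fout : continuous Fout.
Proof.
apply: contD; first exact: cont_cst.
apply: (@cont_comp _ _ _ (ramp dl) (fun z : P => aquad a z - m)).
  by apply: contB; [exact: cont_aquad|exact: cont_cst].
exact: is_derive_continuous (is_derive_ramp dl0).
Qed.

Lemma cont_Gout : continuous Gout.
Proof.
apply: cont_phase => k.
have -> : (fun x => pc k (Gout x)) = (fun x => dramp dl (aquad a x - m) * pc k (alin a x)).
  by apply/funext => x; rewrite /Gout pcZ.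
apply: contM; last by apply: cont_pc; exact: cont_alin.
apply: (@cont_comp _ _ _ (dramp dl) (fun z : P => aquad a z - m)).
  by apply: contB; [exact: cont_aquad|exact: cont_cst].
exact: cont_dramp.
Qed.

Lemma Fout_low z : aquad a z <= m - dl -> Fout z = m /\ Gout z = 0.
Proof.
move=> zl; have [|r1 r2] := @ramp_low _ dl dl0 (aquad a z - m); first by lra.
by rewrite /Fout /Gout r1 r2 addr0 scale0r.
Qed.

Lemma Fout_high z : m + dl <= aquad a z -> Fout z = aquad a z /\ Gout z = alin a z.
Proof.
move=> zl; have [|r1 r2] := @ramp_high _ dl dl0 (aquad a z - m); first by lra.
by rewrite /Fout /Gout r1 r2 scale1r addrC subrK.
Qed.

Lemma Fout_ge z : m <= Fout z.
Proof. by rewrite lerDl; exact: ramp_ge0. Qed.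

(** Hence a point of positive action density must lie where [Fin] is active. *)
Lemma Fout_density z : 2^-1 * dotp (Gout z) z - Fout z <= 0.
Proof.
have h1 := @ramp_convex _ dl dl0 (aquad a z - m).
have h2 := @dramp_le1 _ dl dl0 (aquad a z - m).
have h3 := ler_wpM2l (ltW m0) h2.
rewrite /Gout /Fout dotpZl dotp_alin.
move: h1 h3; set A := aquad a z; set d := dramp _ _; set r := ramp _ _.
clearbody A d r; lra.
Qed.

End AmbientHamiltonian.

(** * The Hamiltonian transplanted to the image of K *)

Section InsideHamiltonian.
Variables (R : realType) (n : nat) (p : R) (B D : 'M[R]_n).
Hypotheses (p_gt1 : 1 < p) (orthB : orthogonal_mx B) (orthD : orthogonal_mx D).
Local Notation P := (phase_space R n).
Local Notation GK := (energy p B D).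
Local Notation gK := (energy_grad p B D).
Variables (U : set P) (phi : P -> P) (f df : R -> R) (m l1 : R).
Hypothesis U_open : open U.
Hypothesis phi_smooth : smooth_on U phi.
Hypothesis phi_inj : set_inj U phi.
Hypothesis phi_symp : forall z, U z -> forall u v,
  omega ('d phi z u) ('d phi z v) = omega u v.
Hypothesis K_U : forall z, GK z <= 1 -> U z.
Hypothesis l1_lt1 : l1 < 1.
Hypothesis f_derive : forall l : R, 0 <= l -> is_derive l (1 : R) f (df l).
Hypothesis f_cont : continuous f.
Hypothesis df_cont : continuous df.
Hypothesis f_high : forall l, l1 <= l -> f l = m /\ df l = 0.
Local Notation psi := (embed_inv U phi).

Definition Fin (z : P) : R :=
  if pselect ((phi @` U) z) then f (GK (psi z)) - m else 0.
(** The gradient of [Fin]: a symplectic map carries the Hamiltonian field of [f \o G] to that of its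
    push-forward, and [- ham_rot] recovers the gradient from the field. *)
Definition Gin (z : P) : P :=
  if pselect ((phi @` U) z)
  then - ham_rot ('d phi (psi z) (df (GK (psi z)) *: ham_rot (gK (psi z)))) else 0.

Lemma Fin_image x : U x -> Fin (phi x) = f (GK x) - m.
Proof.
by move=> Ux; rewrite /Fin; case: pselect => h; [rewrite embed_invK|exfalso; apply: h; exists x].
Qed.

Lemma Gin_image x : U x ->
  Gin (phi x) = - ham_rot ('d phi x (df (GK x) *: ham_rot (gK x))).
Proof.
by move=> Ux; rewrite /Gin; case: pselect => h; [rewrite embed_invK|exfalso; apply: h; exists x].
Qed.

Lemma image_sub_compact (Q : set R) : closed Q -> Q `<=` [set l | l <= 1] ->
  compact (phi @` [set z : P | Q (GK z)]).
Proof.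
move=> Qc Q1; apply: continuous_compact; last exact: energy_sub_compact.
apply: continuous_in_subspaceT => x; rewrite inE => /Q1 /K_U Ux.
by apply: differentiable_continuous; exact: (embed_differentiable phi_smooth).
Qed.

Local Notation core := (phi @` [set z : P | GK z <= l1]).

(** Off the compact core both [Fin] and [Gin] vanish, because the profile is constant from [l1] on;
    this makes the extension by 0 regular across the boundary of the image. *)
Lemma core_closed : closed core.
Proof.
apply: compact_closed; first exact: norm_hausdorff.
apply: (@image_sub_compact [set l | l <= l1]); first exact: closed_le.
by move=> l /= ll; exact: le_trans (ltW l1_lt1).
Qed.

Lemma Fin_out z : ~ core z -> Fin z = 0 /\ Gin z = 0.
Proof.
move=> Cz; have [[x Ux xz]|nU] := pselect ((phi @` U) z); last first.
  by rewrite /Fin /Gin; case: pselect => h.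
have xl : l1 <= GK x.
  by rewrite leNgt; apply/negP => /ltW xl; apply: Cz; exists x.
have [e1 e2] := f_high xl.
rewrite -xz (Fin_image Ux) (Gin_image Ux) e1 e2 subrr; split => //.
by rewrite scale0r linear0; apply: pc_inj => -[j []]; rewrite pcN /pc /= ?mxE ?oppr0.
Qed.

(** Regularity is checked separately at points of the image, by pulling back, and at points near
    which the extension is 0. *)
Lemma Fin_cases z : (exists2 x, U x & phi x = z) \/
  (exists2 d, 0 < d & forall y, `|y - z| < d -> Fin y = 0 /\ Gin y = 0).
Proof.
have [[x xl xz]|Cz] := pselect (core z).
  by left; exists x => //; apply: K_U; exact: le_trans (ltW l1_lt1).
right; have Copen : open (~` core) by apply: closed_openC; exact: core_closed.
have /nbhs_ballP[d /= d0 dC] : nbhs z (~` core) by exact: open_nbhs_nbhs.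
exists d => // y yd; apply: Fin_out; apply: dC.
by rewrite -ball_normE /= distrC.
Qed.

Lemma Fin_near x e : U x -> 0 < e -> exists2 d, 0 < d & forall y, `|y - phi x| < d ->
  [/\ U (psi y), `|psi y - x| < e, phi (psi y) = y & Fin y = f (GK (psi y)) - m /\
  Gin y = - ham_rot ('d phi (psi y) (df (GK (psi y)) *: ham_rot (gK (psi y))))].
Proof.
move=> Ux e0; have [d d0 dP] := embed_inv_near U_open phi_smooth phi_inj phi_symp Ux e0.
exists d => // y yd; have [Uy ye yy] := dP y yd; split => //.
by rewrite -{1 3}yy (Fin_image Uy) (Gin_image Uy).
Qed.

Lemma pullback_curve (y : R -> P) (v x : P) (t : R) :
  is_derive t (1 : R) y v -> U x -> phi x = y t ->
  is_derive t (1 : R) (fun s => psi (y s)) (symp_inverse ('d phi x) v).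
Proof.
move=> dy Ux xy; apply: (curve_pullback U_open phi_smooth phi_inj phi_symp dy Ux xy).
by apply: symp_inverseVK; exact: phi_symp.
Qed.

(** A curve in the image is pulled back to U, where the chain rule for the energy applies;
    symplecticity turns the result into a pairing with [Gin]. *)
Lemma Fin_derive (y : R -> P) (v : P) (t : R) : is_derive t (1 : R) y v ->
  is_derive t (1 : R) (fun s : R => Fin (y s)) (dotp (Gin (y t)) v).
Proof.
move=> dy.
have yc (d : R) : 0 < d -> \forall s \near t, `|y s - y t| < d.
  move=> d0; have [d1 _] := dy.
  have cy : {for t, continuous y} by apply: differentiable_continuous; exact/derivable1_diffP.
  have /cvgrPdist_lt/(_ d d0) := cy.
  by apply: filterS => s; rewrite distrC.
have [[x Ux xy]|[d d0 F0]] := Fin_cases (y t); last first.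
  have [_ ->] : Fin (y t) = 0 /\ Gin (y t) = 0 by apply: F0; rewrite subrr normr0.
  rewrite dotp0l.
  have eqn : {near t, cst 0 =1 (fun s => Fin (y s))}.
    by have := yc d d0; apply: filterS => s sd; rewrite (F0 _ sd).1.
  exact: (@near_eq_is_derive _ _ _ _ _ _ _ _ eqn (is_derive_cst 0 t (1 : R))).
have [d d0 dP] := Fin_near Ux ltr01.
have eqn : {near t, (fun s => f (GK (psi (y s))) - m) =1 (fun s => Fin (y s))}.
  have := yc d d0; apply: filterS => s sd; rewrite -xy in sd.
  by have [_ _ _ []] := dP _ sd.
have d1 := pullback_curve dy Ux xy.
set u := symp_inverse _ v in d1.
have Lu : 'd phi x u = v by apply: symp_inverseVK; exact: phi_symp.
have d2 := energy_chain B D p_gt1 d1.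
have xt : psi (y t) = x by rewrite -xy embed_invK.
have d3 := @is_derive1_comp R f (fun s => GK (psi (y s))) t _ _ (f_derive (energy_ge0 _ _ _ _)) d2.
have d4 := is_deriveB d3 (is_derive_cst m t (1 : R)).
rewrite subr0 xt in d4.
have := @near_eq_is_derive _ _ _ _ _ _ _ _ eqn d4 => /is_derive_eq; apply.
rewrite -xy (Gin_image Ux) -omega_dotp -Lu (phi_symp Ux).
by rewrite omegaZl omega_ham_rot.
Qed.

Lemma psi_continuous x : U x -> {for phi x, continuous psi}.
Proof.
move=> Ux; apply/cvgrPdist_le => e e0; have [d d0 dP] := Fin_near Ux e0.
rewrite (embed_invK phi_inj Ux).
have near_e : \forall y \near phi x, `|x - psi y| <= e.
  by apply: (near_dist d0) => y /dP[_ /ltW ye _ _]; rewrite distrC.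
exact: near_e.
Qed.

Lemma cont_Fin : continuous Fin.
Proof.
move=> z; have [[x Ux <-]|[d d0 F0]] := Fin_cases z; last first.
  have eqn : {near z, cst 0 =1 Fin}.
    by apply: (near_dist d0) => y /F0[->].
  rewrite /continuous_at; have -> : Fin z = 0 by have [|->] := F0 z; rewrite ?subrr ?normr0.
  by apply: cvg_trans (near_eq_cvg eqn) _; exact: cvg_cst.
have [d d0 dP] := Fin_near Ux ltr01.
have eqn : {near phi x, (fun y => f (GK (psi y)) - m) =1 Fin}.
  by apply: (near_dist d0) => y /dP[_ _ _ []].
rewrite /continuous_at (Fin_image Ux).
apply: cvg_trans (near_eq_cvg eqn) _; apply: cvgB; last exact: cvg_cst.
have cGK : continuous (fun z => f (GK z)).
  by apply: (@cont_comp _ _ _ f GK) => //; exact: cont_energy.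
have lim : f (GK (psi y)) @[y --> phi x] --> f (GK (psi (phi x))).
  exact: (@continuous_comp _ _ _ psi (fun z => f (GK z)) (phi x) (psi_continuous Ux) (cGK _)).
by move: lim; rewrite (embed_invK phi_inj Ux).
Qed.

Lemma cont_Gin : continuous Gin.
Proof.
move=> z; have [[x Ux <-]|[d d0 F0]] := Fin_cases z; last first.
  have eqn : {near z, cst 0 =1 Gin}.
    by apply: (near_dist d0) => y /F0[_ ->].
  rewrite /continuous_at; have -> : Gin z = 0 by have [|_ ->] := F0 z; rewrite ?subrr ?normr0.
  by apply: cvg_trans (near_eq_cvg eqn) _; exact: cvg_cst.
have [d d0 dP] := Fin_near Ux ltr01.
pose dir (z : P) := df (GK z) *: ham_rot (gK z).
have dirc : continuous dir.
  apply: cont_phase => k; under eq_fun do rewrite /dir pcZ.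
  apply: contM; first by apply: (@cont_comp _ _ _ df GK) => //; exact: cont_energy.
  by apply: cont_pc; apply: cont_ham_rot; exact: cont_energy_grad.
have psic := psi_continuous Ux.
have := @embed_diff_continuous R n U phi phi_smooth P psi (fun y => dir (psi y)) (phi x).
rewrite (embed_invK phi_inj Ux) => /(_ Ux _ psic).
have Unear : \forall y \near phi x, U (psi y).
  by apply: (near_dist d0) => y /dP[].
have dpc : {for phi x, continuous (fun y => dir (psi y))}.
  exact: @continuous_comp _ _ _ psi dir (phi x) psic (dirc _).
move=> /(_ Unear dpc) Lc.
have hc : continuous (fun z : P => - ham_rot z).
  apply: cont_phase => k; under eq_fun do rewrite pcN.
  by apply: contN; apply: cont_pc; apply: cont_ham_rot => y; exact: cvg_id.
have lim : - ham_rot ('d phi (psi y) (dir (psi y))) @[y --> phi x] -->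
    - ham_rot ('d phi (psi (phi x)) (dir (psi (phi x)))).
  exact: (@continuous_comp _ _ _ (fun y => 'd phi (psi y) (dir (psi y)))
    (fun z : P => - ham_rot z) (phi x) Lc (hc _)).
have eqn : {near phi x, (fun y => - ham_rot ('d phi (psi y) (dir (psi y)))) =1 Gin}.
  by apply: (near_dist d0) => y /dP[_ _ _ [_ ->]].
rewrite /continuous_at (Gin_image Ux).
apply: cvg_trans (near_eq_cvg eqn) _.
rewrite (embed_invK phi_inj Ux) in lim; exact: lim.
Qed.

End InsideHamiltonian.

(** * The periodic orbit and its pull-back *)

Section PullbackOrbit.
Variables (R : realType) (n : nat) (p : R) (B D : 'M[R]_n).
Hypotheses (p_gt1 : 1 < p) (orthB : orthogonal_mx B) (orthD : orthogonal_mx D).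
Local Notation P := (phase_space R n).
Local Notation GK := (energy p B D).
Local Notation gK := (energy_grad p B D).
Variables (U : set P) (phi : P -> P) (f df : R -> R) (m dl l0 l1 : R).
Variables (a : 'I_n -> R) (j0 : 'I_n) (C1 : R).
Hypothesis U_open : open U.
Hypothesis phi_smooth : smooth_on U phi.
Hypothesis phi_inj : set_inj U phi.
Hypothesis phi_symp : forall z, U z -> forall u v,
  omega ('d phi z u) ('d phi z v) = omega u v.
Hypothesis K_U : forall z, GK z <= 1 -> U z.
Hypotheses (dl0 : 0 < dl) (m0 : 0 < m) (l0_gt0 : 0 < l0) (l1_lt1 : l1 < 1).
Hypothesis f_derive : forall l : R, 0 <= l -> is_derive l (1 : R) f (df l).
Hypothesis f_cont : continuous f.
Hypothesis df_cont : continuous df.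
Hypothesis f_low : forall l, 0 <= l -> l < l0 -> f l = 0 /\ df l = 0.
Hypothesis f_high : forall l, l1 <= l -> f l = m /\ df l = 0.
Hypothesis f_ge0 : forall l, 0 <= f l.
Hypothesis a_gt0 : forall j, 0 < a j.
Hypothesis a_lt : forall j, j != j0 -> a j < pi.
Hypotheses (a0_gt : pi < a j0) (a0_lt : a j0 < 2 * pi).
Hypothesis a_K : forall x, GK x <= 1 -> aquad a (phi x) <= m - dl.
Hypothesis a_far : forall z, C1 <= `|z| -> m + dl <= aquad a z.
Local Notation psi := (embed_inv U phi).
Let Fi := Fin p B D U phi f m.
Let Gi := Gin p B D U phi df.
Let Fo := Fout a m dl.
Let Go := Gout a m dl.

Let orbit : exists z : R -> P,
  [/\ forall t, is_derive t (1 : R) z (ham_rot (Gi (z t) + Go (z t))),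
      forall t, z (t + 1) = z t &
      0 < act_density (fun z => Fi z + Fo z) (fun z => Gi z + Go z) (z 0)].
Proof.
have [CK CK0 phiCK] : exists2 C, 0 <= C & forall x, GK x <= 1 -> `|phi x| <= C.
  have := @image_sub_compact _ _ _ _ _ p_gt1 orthB orthD _ _ phi_smooth K_U [set l | l <= 1] (@closed_le _ 1) (fun l h => h).
  move=> /compact_bounded[C [_ Cb]]; exists (`|C| + 1); first by rewrite addr_ge0.
  move=> x x1; apply: (Cb (`|C| + 1)); first by rewrite (le_lt_trans (ler_norm C))// ltrDl.
  by exists x.
(* Beyond this radius [Fin] is 0 and [Fout] is the quadratic form. *)
pose C0 := Order.max (CK + 1) C1.
have out z : C0 <= `|z| -> Fi z = 0 /\ Gi z = 0.
  move=> zC; apply: (Fin_out phi_inj f_high) => -[x /= xl xz].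
  have := phiCK x (le_trans xl (ltW l1_lt1)); rewrite xz.
  have : CK + 1 <= C0 by rewrite le_max lexx.
  lra.
have far z : C0 <= `|z| -> m + dl <= aquad a z.
  by move=> zC; apply: a_far; apply: le_trans zC; rewrite le_max lexx orbT.
have U0 : U 0 by apply: K_U; rewrite energy0// ler01.
have [e e0 eP] : exists2 e, 0 < e & forall x : P, `|x - 0| < e -> GK x < l0.
  have GKc : continuous GK by exact: cont_energy.
  have := GKc 0 => /cvgrPdist_lt/(_ l0 l0_gt0).
  rewrite energy0// => /nbhs_ballP[d /= d0 dP]; exists d => // x xd.
  have := dP x; rewrite -ball_normE /= -normrN opprB => /(_ xd).
  by rewrite sub0r normrN ger0_norm// energy_ge0.
have [rho rho0 rhoP] := Fin_near p B D f df m U_open phi_smooth phi_inj phi_symp U0 e0.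
apply: (@periodic_orbit R n a j0 (fun z => Fi z + Fo z) (fun z => Gi z + Go z) C0 rho (phi 0)) => //.
- move=> z v t; rewrite dotpDl; apply: is_deriveD; last exact: Fout_derive.
  apply: (Fin_derive p_gt1 orthB orthD U_open phi_smooth phi_inj phi_symp K_U l1_lt1 f_derive f_high); exact: is_derive_line.
- by apply: contD; [exact: (cont_Fin p_gt1 orthB orthD U_open phi_smooth phi_inj phi_symp K_U l1_lt1 f_cont f_high)|exact: cont_Fout].
- apply: cont_phase => k; under eq_fun do rewrite pcD.
  by apply: contD; apply: cont_pc; [exact: (cont_Gin p_gt1 orthB orthD U_open phi_smooth phi_inj phi_symp K_U l1_lt1 df_cont f_high)|exact: cont_Gout].
- move=> z zC; have [_ ->] := out z zC.
  by have [_ e2] := @Fout_high R n a m dl dl0 z (far z zC); rewrite /Go e2 add0r.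
- move=> z zC; have [-> _] := out z zC.
  by have [e2 _] := @Fout_high R n a m dl dl0 z (far z zC); rewrite /Fo e2 add0r.
- move=> z; have h1 : m <= Fo z by exact: Fout_ge.
  suff : - m <= Fi z by lra.
  rewrite /Fi /Fin; case: pselect => h; last by rewrite oppr_le0 (ltW m0).
  by rewrite lerDr; exact: f_ge0.
(* Near [phi 0] the profile is 0, so [Fin] is [- m] and cancels [Fout]. *)
- move=> z zr; have [Ux xe xz [Fz _]] := rhoP z zr.
  rewrite /Fi Fz; have xl := eP _ xe; have [-> _] := f_low (energy_ge0 _ _ _ _) xl.
  rewrite sub0r -[in Fo _]xz /Fo; have [|-> _] := @Fout_low R n a m dl dl0 (phi (psi z)); last by rewrite addNr.
  apply: a_K; rewrite leNgt; apply/negP => x1.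
  have l1x : l1 <= GK (psi z) by rewrite ltW// (lt_trans l1_lt1).
  have := (f_high l1x).1; rewrite (f_low (energy_ge0 _ _ _ _) xl).1 => m00.
  by have := m0; rewrite -m00 ltxx.
Qed.

(** Positive density forces the starting point into the core, at a level where the profile has
    nonzero slope. The times at which the orbit lies over that level form a closed set by
    compactness and an open one by conservation of energy, so these are all times. *)
Lemma pullback_orbit : exists lv w, [/\ 0 < lv < 1, df lv != 0,
  forall t, is_derive t (1 : R) w (df lv *: ham_rot (gK (w t))),
  forall t, GK (w t) = lv & w 1 = w 0].
Proof.
have [z [dz z1 z_act]] := orbit.
have Go0 x : GK x <= 1 -> Go (phi x) = 0 /\ Fo (phi x) = m.
  by move=> /a_K /(Fout_low dl0)[].
have [x0 x0l1 [x0z df0]] : exists2 x, GK x <= l1 & phi x = z 0 /\ df (GK x) != 0.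
  have [[x xl xz]|nc] := pselect ((phi @` [set x | GK x <= l1]) (z 0)); last first.
    have [e1 e2] := @Fin_out R n p B D U phi f df m l1 phi_inj f_high _ nc.
    move: z_act; rewrite /act_density /Fi /Gi e1 e2 !add0r.
    by have := @Fout_density R n a m dl dl0 m0 (z 0); rewrite /Go /Fo; lra.
  (* If the slope vanished, the density would be [- f (GK x)], which is not positive. *)
  exists x => //; split => //; apply/eqP => df0.
  have x1 : GK x <= 1 by exact: le_trans xl (ltW l1_lt1).
  have [g1 g2] := Go0 x x1; have Ux := K_U x1.
  move: z_act; rewrite /act_density -xz g1 g2 /Fi /Gi (Fin_image p B D f m phi_inj Ux).
  rewrite (Gin_image p B D df phi_inj Ux) df0 scale0r linear0 (_ : ham_rot 0 = 0).
    by rewrite oppr0 addr0 dotp0l mulr0; have := f_ge0 (GK x); lra.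
  by rewrite -[0 in LHS](scale0r (0 : P)) ham_rotZ scale0r.
pose lv := GK x0.
have lv0 : 0 < lv.
  rewrite (lt_le_trans l0_gt0)// leNgt; apply/negP => h.
  by move: df0; rewrite (f_low (energy_ge0 _ _ _ _) h).2 eqxx.
have lv1 : lv < 1 by exact: le_lt_trans x0l1 l1_lt1.
pose S := [set t | (phi @` [set x | GK x = lv]) (z t)].
have zc : continuous z by exact: is_derive_phase_continuous dz.
have local_flow t x : GK x <= 1 -> phi x = z t ->
    is_derive t (1 : R) (fun s => psi (z s)) (df (GK x) *: ham_rot (gK x)).
  move=> x1 xz; have Ux := K_U x1.
  apply: (curve_pullback U_open phi_smooth phi_inj phi_symp (dz t) Ux xz).
  rewrite -xz (Go0 x x1).1 addr0 /Gi (Gin_image p B D df phi_inj Ux).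
  by rewrite ham_rotN ham_rotK opprK.
have S_closed : closed S.
  apply: (@closed_comp _ _ z (phi @` [set x | GK x = lv])); first by move=> t _; exact: zc.
  apply: compact_closed; first exact: norm_hausdorff.
  apply: (@image_sub_compact _ _ _ _ _ p_gt1 orthB orthD _ _ phi_smooth K_U [set l | l = lv]).
    exact: closed_eq.
  by move=> l /= ->; exact: ltW.
have S_open t : S t -> exists2 d, 0 < d & forall s, `|s - t| < d -> S s.
  move=> [x xl xz]; have Ux : U x by apply: K_U; rewrite [GK x]xl ltW.
  have [e e0 eP] : exists2 e, 0 < e & forall y : P, `|y - x| < e -> GK y < 1.
    have GKc : continuous GK by exact: cont_energy.
    have xl' : GK x = lv by exact: xl.
    have e0 : 0 < 1 - lv by rewrite subr_gt0.
    have := GKc x => /cvgrPdist_lt/(_ _ e0) /nbhs_ballP[d /= d0 dP]; exists d => // y yd.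
    have := dP y; rewrite -ball_normE /= -normrN opprB => /(_ yd).
    by rewrite xl' ltr_norml => /andP[h _]; lra.
  have [d d0 dP] := embed_inv_near U_open phi_smooth phi_inj phi_symp Ux e0.
  have [d' d'0 zd] : exists2 d', 0 < d' & forall s, `|s - t| < d' -> `|z s - phi x| < d.
    have := zc t => /cvgrPdist_lt/(_ _ d0) /nbhs_ballP[d1 /= d10 d1P]; exists d1 => // s st.
    have := d1P s; rewrite -ball_normE /= distrC => /(_ st).
    by rewrite xz distrC.
  exists d' => // s st.
  have dGK r : `|r - t| < d' -> is_derive r (1 : R) (fun s => GK (psi (z s))) 0.
    move=> rt; have [Ur re rr] := dP _ (zd r rt).
    have fl := local_flow r (psi (z r)) (ltW (eP _ re)) rr.
    have := energy_chain B D p_gt1 fl => /is_derive_eq; apply.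
    by rewrite dotpZr dotp_ham_rot mulr0.
  have [Us se ss] := dP _ (zd s st).
  exists (psi (z s)) => //=; rewrite (locally_constant dGK st) -xz.
  by rewrite (embed_invK phi_inj Ux).
have St := @clopen_line R S 0 (ex_intro2 _ _ x0 erefl x0z) S_open S_closed.
have wE t : exists2 x, GK x = lv & phi x = z t /\ psi (z t) = x.
  have [x xl xz] := St t; exists x => //; split=> //; rewrite -xz embed_invK//.
  by apply: K_U; rewrite [GK x]xl ltW.
exists lv, (fun t => psi (z t)); split => //.
- by rewrite lv0.
- move=> t; have [x xl [xz xe]] := wE t.
  have x1 : GK x <= 1 by rewrite xl ltW.
  by have := local_flow t x x1 xz; rewrite xl xe.
- by move=> t; have [x xl [_ ->]] := wE t.
- by rewrite -[1]add0r z1.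
Qed.

End PullbackOrbit.

(** * Non-squeezing *)

Section CapacityLower.
Variables (R : realType) (n : nat) (p : R) (B D : 'M[R]_n) (M : R) (ea : 'cV[R]_n).
Hypotheses (p_gt2 : 2 < p) (n_gt0 : (0 < n)%N).
Hypotheses (orthB : orthogonal_mx B) (orthD : orthogonal_mx D).
Hypothesis ext : extremal p (B *m D^T) M ea.
Local Notation P := (phase_space R n).
Local Notation GK := (energy p B D).
Local Notation gK := (energy_grad p B D).
Let p1 : 1 < p. Proof. by apply: lt_trans p_gt2; rewrite ltr1n. Qed.
Let p0 := p_gt0 p1.

(** Homogeneity of the energy moves the orbit to the level 1, and a change of time turns it into an
    orbit of the flow in [period_bound], with period [sg]. *)
Let flow_bound (lv k : R) (w : R -> P) : 0 < lv -> 0 < k ->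
  (forall t, is_derive t (1 : R) w (k *: ham_rot (gK (w t)))) ->
  (forall t, GK (w t) = lv) -> w 1 = w 0 ->
  4 * theta_int p / M <= k * lv `^ (1 - 2 / p) * (p / 2).
Proof.
move=> lv0 k0 dw wl w1.
have p_neq0 := lt0r_neq0 p0.
pose kap := lv `^ (- p^-1); have kap0 : 0 < kap by exact: powR_gt0.
pose sg := k * lv `^ (1 - 2 / p); have sg0 : 0 < sg by rewrite mulr_gt0 ?powR_gt0.
have sg_neq0 := lt0r_neq0 sg0.
rewrite -/sg [leRHS]mulrC.
have key : kap * (sg^-1 * k) = kap `^ (p - 1).
  have e1 : kap `^ (p - 1) = kap `^ p * kap^-1 by rewrite powR_gt0D// powR_inv1 ?ltW.
  have e2 : kap `^ p = lv^-1 by rewrite /kap -powRrM mulNr mulVf// powR_inv1 ?ltW.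
  have e3 : lv `^ (1 - 2 / p) = lv * (kap * kap).
    rewrite powR_gt0D// powRr1 ?ltW// /kap -powR_gt0D//; congr (_ * lv `^ _); field.
    exact: p_neq0.
  rewrite e1 e2 /sg e3; field.
  by rewrite !gt_eqF.
pose v t := kap *: w (sg^-1 * t).
have dlin t : is_derive t (1 : R) (fun s : R => sg^-1 * s) sg^-1.
  by have := is_derive_scale sg^-1 (is_derive_id t (1 : R)); rewrite mulr1.
apply: (@period_bound R n p B D M ea p_gt2 n_gt0 orthB orthD ext v sg) => //.
- move=> t; have d1 := is_derive_comp_phase (dw (sg^-1 * t)) (dlin t).
  have d2 := is_deriveZ kap d1.
  have -> : ham_rot (gK (v t)) = kap *: (sg^-1 *: (k *: ham_rot (gK (w (sg^-1 * t))))).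
    by rewrite /v energy_grad_scale ?ltW// ham_rotZ -key !scalerA mulrA.
  exact: d2.
- move=> t; rewrite /v energy_scale ?ltW// wl /kap -powRrM mulNr mulVf//.
  by rewrite powR_inv1 ?ltW// mulVf// gt_eqF.
- by rewrite /v mulVf// mulr0 w1.
Qed.

Let aquad_split (a : 'I_n -> R) (j0 : 'I_n) (b : R) (z : P) : 0 <= b ->
  (forall j, j != j0 -> a j = b) ->
  aquad a z <= a j0 * (z.1 j0 0 ^+ 2 + z.2 j0 0 ^+ 2) + b * ((n * 2)%:R * `|z| ^+ 2).
Proof.
move=> b0 ab.
have -> : aquad a z = \sum_j a j * (z.1 j 0 ^+ 2 + z.2 j 0 ^+ 2).
  apply: (mulfI (_ : (2 : R) != 0)) => //.
  rewrite -dotp_alin dotp_pair mulr_sumr; apply: eq_bigr => j _; rewrite !mxE; ring.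
rewrite (bigD1 j0)//= lerD2l.
have le2 j : j != j0 -> a j * (z.1 j 0 ^+ 2 + z.2 j 0 ^+ 2) <= b * (2 * `|z| ^+ 2).
  move=> jj; rewrite ab// ler_wpM2l//.
  have sq k : pc k z ^+ 2 <= `|z| ^+ 2.
    by rewrite -(real_normK (num_real (pc k z))) ler_sqr ?nnegrE// pc_le_norm.
  by have := sq (j, true); have := sq (j, false); rewrite /pc /=; lra.
apply: (le_trans (ler_sum _ le2)).
apply: (@le_trans _ _ (\sum_(j < n) b * (2 * `|z| ^+ 2))).
  rewrite [leRHS](bigD1 j0)//= lerDr.
  by rewrite mulr_ge0// mulr_ge0// sqr_ge0.
rewrite sumr_const card_ord -mulr_natl natrM; apply: eqle; ring.
Qed.

Lemma capacity_lower r : 0 < r -> embeds_in_cylinder n_gt0 (Kp p B D) r ->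
  4 * theta_int p / M <= pi * r ^+ 2.
Proof.
move=> r0 [U [phi [U_open KU [phi_smooth phi_inj _ phi_symp] phiU]]].
have [c ce] : exists c, c = 4 * theta_int p / M by exists (4 * theta_int p / M).
rewrite -ce leNgt; apply/negP => rc.
have K_U z : GK z <= 1 -> U z by move=> z1; apply: KU; rewrite KpE.
have [CK CK0 phiCK] : exists2 C, 0 <= C & forall x, GK x <= 1 -> `|phi x| <= C.
  have := @image_sub_compact _ _ _ _ _ p1 orthB orthD _ _ phi_smooth K_U [set l | l <= 1] (@closed_le _ 1) (fun l h => h).
  move=> /compact_bounded[C [_ Cb]]; exists (`|C| + 1); first by rewrite addr_ge0.
  move=> x x1; apply: (Cb (`|C| + 1)); first by rewrite (le_lt_trans (ler_norm C))// ltrDl.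
  by exists x.
have pi0 : 0 < pi :> R by exact: pi_gt0.
have pi1 : 1 < pi :> R by apply: lt_le_trans (pi_ge2 R); rewrite ltr1n.
have r20 : 0 < r ^+ 2 by rewrite exprn_gt0.
set r2 := r ^+ 2 in rc r20.
have pr0 : 0 < pi * r2 by rewrite mulr_gt0.
(* The height of the profile lies between the area of the cylinder and [c], and the slope [c']
   between that height and [c]. *)
pose m := (pi * r2 + c) / 2; have m0 : 0 < m by rewrite /m; lra.
pose c' := (m + c) / 2.
have [prm mc' c'c] : [/\ pi * r2 < m, m < c' & c' < c] by rewrite /c' /m; split; lra.
(* The frequency must exceed pi for the linking and still keep the quadratic form below [m] on the
   cylinder, which is possible as pi r^2 < m. *)
have [a0 [a0pi a02pi a0m]] : exists a0, [/\ pi < a0, a0 < 2 * pi & a0 * r2 < m].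
  have h : pi < m / r2 by rewrite ltr_pdivlMr.
  have h' : m / r2 * r2 = m by rewrite divfK// gt_eqF.
  exists (Order.min (3 / 2 * pi) ((pi + m / r2) / 2)); split.
  - by rewrite lt_min; apply/andP; split; lra.
  - by rewrite gt_min; apply/orP; left; lra.
  - apply: (@le_lt_trans _ _ ((pi + m / r2) / 2 * r2)).
      by rewrite ler_pM2r// ge_min lexx orbT.
    have -> : (pi + m / r2) / 2 * r2 = (pi * r2 + m / r2 * r2) / 2 by ring.
    by rewrite h'; lra.
pose dl := (m - a0 * r2) / 2; have dl0 : 0 < dl by rewrite /dl; lra.
have mdl : a0 * r2 + dl = m - dl by rewrite /dl; lra.
pose N := (n * 2)%:R * CK ^+ 2 + 1.
have N0 : 0 < N by rewrite ltr_wpDl// mulr_ge0// sqr_ge0.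
(* The other frequencies are so small that they add at most [dl] on the bounded image of K. *)
pose b := Order.min 1 (dl / N).
have b0 : 0 < b by rewrite lt_min ltr01 divr_gt0.
have b1 : b <= 1 by rewrite ge_min lexx.
have bN : b * ((n * 2)%:R * CK ^+ 2) <= dl.
  have : b <= dl / N by rewrite ge_min lexx orbT.
  rewrite ler_pdivlMr// /N; lra.
pose j0 := Ordinal n_gt0.
pose a j := if j == j0 then a0 else b.
have aj0 : a j0 = a0 by rewrite /a eqxx.
have ab j : j != j0 -> a j = b by rewrite /a => /negPf ->.
clearbody a b dl m c'.
have [f [df [l0 [l1 [l00 /andP[l10 l11] fd [fc dfc] [flow fhigh fge0 fslope]]]]]] :=
  profile_exists p_gt2 m0 mc'.
have a_ge j : b <= a j.
  by have [->|/ab ->//] := eqVneq j j0; rewrite aj0; lra.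
have [||||||lv [w [/andP[lv0 lv1] dlv dw wl w1]]] := @pullback_orbit R n p B D p1 orthB orthD U phi f df m dl l0 l1 a j0
  ((m + dl) / b + 1) U_open phi_smooth phi_inj phi_symp K_U dl0 m0 l00 l11 fd fc dfc flow fhigh fge0.
- by move=> j; exact: lt_le_trans b0 (a_ge j).
- by move=> j /ab ->; lra.
- by rewrite aj0.
- by rewrite aj0.
- move=> x x1; have Ux := K_U x x1.
  have zc : (phi x).1 j0 0 ^+ 2 + (phi x).2 j0 0 ^+ 2 < r2 by apply: phiU; exists x.
  apply: (le_trans (aquad_split (phi x) (ltW b0) ab)); rewrite aj0 -mdl.
  apply: lerD; first by rewrite ler_wpM2l// ltW//; lra.
  apply: le_trans bN; rewrite ler_wpM2l ?(ltW b0)// ler_wpM2l//.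
  by rewrite ler_sqr ?nnegrE//; exact: phiCK.
- move=> z zC.
  have q0 : 0 <= (m + dl) / b by rewrite divr_ge0 ?addr_ge0// ltW.
  have : b * `|z| ^+ 2 <= aquad a z.
    apply: (@le_trans _ _ (b * dotp z z)); first by rewrite ler_pM2l// norm_sq_le_dotp.
    rewrite mulr_sumr; apply: ler_sum => k _; rewrite -expr2 ler_wpM2r ?sqr_ge0//.
  apply: le_trans.
  have z2 : (m + dl) / b <= `|z| ^+ 2.
    rewrite expr2 -[leLHS]mulr1; apply: ler_pM => //; lra.
  by move: z2; rewrite ler_pdivrMr// mulrC.
have dlv0 : 0 <= df lv.
  have := fslope lv lv0 => /andP[+ _].
  have h : 0 < lv `^ (1 - 2 / p) * (p / 2) by rewrite mulr_gt0 ?powR_gt0// divr_gt0.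
  by rewrite -mulrA pmulr_lge0.
have dlv_gt0 : 0 < df lv by rewrite lt_def dlv.
have := flow_bound lv0 dlv_gt0 dw wl w1; rewrite -ce leNgt => /negP; apply.
have := fslope lv lv0 => /andP[_ h].
exact: le_lt_trans h c'c.
Qed.

End CapacityLower.

(** * Closed characteristics *)

Section Characteristics.
Variables (R : realType) (n : nat) (p : R) (B D : 'M[R]_n).
Hypotheses (p_gt1 : 1 < p) (orthB : orthogonal_mx B) (orthD : orthogonal_mx D).
Local Notation P := (phase_space R n).
Local Notation GK := (energy p B D).
Local Notation gK := (energy_grad p B D).
Let p0 := p_gt0 p_gt1.

Lemma dotp_energy_grad z : dotp (gK z) z = p * GK z.
Proof.
have e (A : 'M[R]_n) (x : 'cV[R]_n) :
    dotc (p *: (A^T *m spowv p (A *m x))) x = p * psum p (A *m x).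
  by rewrite dotcZl dotc_mulmx trmxK dotcC dotc_spow.
rewrite dotp_dotc; transitivity (p * psum p (B *m z.1) + p * psum p (D *m z.2)).
  exact: (f_equal2 _ (e B z.1) (e D z.2)).
by rewrite -mulrDr.
Qed.

Lemma bdry_KpE : bdry (Kp p B D) = [set z | GK z = 1].
Proof.
have K_closed : closed (Kp p B D).
  rewrite KpE//; apply: (@closed_comp _ _ GK [set l | l <= 1]); last exact: closed_le.
  by move=> z _; exact: cont_energy.
rewrite /bdry -(closure_id _).1//; apply/seteqP; rewrite KpE//; split => z /=.
  move=> [z1 zI]; apply/eqP; rewrite eq_le z1 leNgt; apply/negP => zlt; apply: zI.
  have op : open [set z | GK z < 1].
    apply: (@open_comp _ _ GK [set l | l < 1]); last exact: open_lt.
    by move=> w _; exact: cont_energy.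
  apply: (@filterS _ _ (nbhs_filter z) [set z | GK z < 1]) => [w|]; first exact: ltW.
  exact: open_nbhs_nbhs.
move=> z1; split; first by rewrite z1.
move=> zI; have {}zI : nbhs z [set z | GK z <= 1] by exact: zI.
have [d d0 dP] : exists2 d, 0 < d & forall y : P, `|y - z| < d -> GK y <= 1.
  move: zI => /nbhs_ballP[d /= d0 dP]; exists d => // y yd; apply: dP.
  by rewrite -ball_normE /= distrC.
pose e := d / (`|z| + 1); have zp : 0 < `|z| + 1 by rewrite ltr_wpDl.
have e0 : 0 < e by rewrite divr_gt0.
(* A dilation leaves K from any point of energy 1, so such a point is not interior. *)
have /dP : `|(1 + e) *: z - z| < d.
  rewrite (_ : (1 + e) *: z - z = e *: z); last by rewrite scalerDl scale1r addrAC subrr add0r.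
  rewrite normrZ gtr0_norm// /e -mulrA gtr_pMr// mulrC ltr_pdivrMr// mul1r.
  by rewrite ltrDl.
rewrite energy_scale ?z1 ?mulr1//; last by rewrite addr_ge0 ?ltW.
rewrite leNgt => /negP; apply.
have e1 : 1 < 1 + e by rewrite ltrDl.
by have := powR_pos_ltr p0 ler01 e1; rewrite powR1.
Qed.

(** A vector orthogonal to the gradient is the velocity of the line z + s v, rescaled radially to
    energy 1: the scaling factor has derivative 0 at s = 0. *)
Lemma energy_tangent z : GK z = 1 ->
  tangent_space [set z | GK z = 1] z = [set v | dotp (gK z) v = 0].
Proof.
move=> z1; apply/seteqP; split => v /=.
  move=> [c [cz cS dc]]; have d1 := energy_chain B D p_gt1 dc.
  have eqn : {near 0, (fun s : R => GK (c s)) =1 cst 1}.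
    by move: cS; apply: filterS.
  have d2 := @near_eq_is_derive _ _ _ _ _ _ _ _ eqn d1.
  rewrite cz in d2; have [_ e1] := d2; have [_ e2] := is_derive_cst (1 : R) (0 : R) (1 : R).
  by rewrite -e1 e2.
move=> v0.
have dl := is_derive_line z v 0.
have d1 := energy_chain B D p_gt1 dl; rewrite /= scale0r addr0 v0 in d1.
have z10 : z + 0 *: v = z by rewrite scale0r addr0.
have d2 : is_derive (0 : R) (1 : R) (fun s => GK (z + s *: v) `^ (- p^-1)) 0.
  have lt01 : (0 : R) < GK (z + 0 *: v) by rewrite z10 z1.
  have := @is_derive1_comp R (fun s => s `^ (- p^-1)) (fun s => GK (z + s *: v)) 0 _ _
    (is_derive_powR_pos (- p^-1) lt01) d1.
  by rewrite mulr0.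
exists (fun s => GK (z + s *: v) `^ (- p^-1) *: (z + s *: v)); split.
- by rewrite z10 z1 powR1 scale1r.
- have GKc : {for 0, continuous (fun s : R => GK (z + s *: v))}.
    by apply: differentiable_continuous; apply/derivable1_diffP; have [] := d1.
  near=> s.
  have pos : 0 < GK (z + s *: v).
    near: s; apply: (cvgr_gt (GK (z + 0 *: v)) GKc).
    by rewrite z10 z1.
  suff : GK (GK (z + s *: v) `^ (- p^-1) *: (z + s *: v)) = 1 by [].
  rewrite energy_scale ?powR_ge0// -powRrM mulNr mulVf ?gt_eqF// powR_inv1 ?ltW//.
  by rewrite mulVf// gt_eqF.
- apply: is_derive_phase => k; under eq_fun do rewrite pcZ.
  have := is_deriveM d2 (is_derive_pc k dl) => /is_derive_eq; apply.
  by rewrite z10 z1 powR1 !scaleRE mulr0 addr0 mul1r.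
Unshelve. all: by end_near. Qed.

(** The vector [- ham_rot u] is orthogonal to everything orthogonal to the gradient, hence a
    multiple of the gradient. *)
Lemma energy_kernel z u : GK z = 1 ->
  omega_kernel [set z | GK z = 1] z u ->
  u = (dotp (- ham_rot u) (gK z) / dotp (gK z) (gK z)) *: ham_rot (gK z).
Proof.
move=> z1 [_]; rewrite energy_tangent// => uker; set w := - ham_rot u; set g := gK z.
have g0 : dotp g g != 0.
  apply/eqP => g0; have gz : g = 0.
    apply/eqP; rewrite -normr_eq0 -sqrf_eq0 eq_le sqr_ge0 andbT -g0.
    exact: norm_sq_le_dotp.
  have := dotp_energy_grad z; rewrite -/g gz dotp0l z1 mulr1 => /esym/eqP.
  by rewrite gt_eqF.
set k := _ / _; have v0 : dotp g (w - k *: g) = 0.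
  by rewrite dotpDr -scaleNr dotpZr [dotp g w]dotpC mulNr /k divfK// subrr.
have wv : dotp w (w - k *: g) = 0 by rewrite -omega_dotp; apply: uker.
have vv : w - k *: g = 0.
  apply/eqP; rewrite -normr_eq0 -sqrf_eq0 eq_le sqr_ge0 andbT.
  apply: (le_trans (norm_sq_le_dotp _)).
  by rewrite dotpBl dotpZl wv v0 mulr0 subrr.
have : ham_rot w = k *: ham_rot g by rewrite -ham_rotZ; congr ham_rot; apply/eqP; rewrite -subr_eq0 vv.
by rewrite /w ham_rotN ham_rotK opprK.
Qed.

Lemma kernel_flow z : GK z = 1 ->
  omega_kernel [set z | GK z = 1] z = [set a *: ham_rot (gK z) | a in [set: R]].
Proof.
move=> z1; apply/seteqP; split => u /=.
  by move=> /(energy_kernel z1) ->; exists (dotp (- ham_rot u) (gK z) / dotp (gK z) (gK z)).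
move=> [a _ <-]; split; rewrite energy_tangent//=.
  by rewrite dotpZr dotp_ham_rot mulr0.
by move=> v v0; rewrite omegaZl omega_ham_rot v0 mulr0.
Qed.

End Characteristics.

(** * Reparametrization of closed characteristics *)

Section PeriodicPrimitive.
Variables (R : realType) (lam L : R -> R) (T : R).
Hypotheses (T0 : 0 < T) (lam_neq0 : forall t, lam t != 0).
Hypothesis lam_per : forall t, lam (t + T) = lam t.
Hypothesis dL : forall t, is_derive t (1 : R) L (lam t).
Hypothesis L0 : L 0 = 0.

Let L_inj : injective L.
Proof.
have lt_neq s t : s < t -> L s != L t.
  move=> st; have [c _ eq] := MVT_is_derive (ltW st) dL.
  rewrite eq_sym -subr_eq0 eq mulf_neq0// subr_eq0 gt_eqF//.
move=> s t; apply: contra_eq; rewrite neq_lt => /orP[/lt_neq//|/lt_neq].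
by rewrite eq_sym.
Qed.

Lemma primitive_shift t : L (t + T) = L t + L T.
Proof.
have d (s : R) : is_derive s (1 : R) (fun s => L (s + T) - L s) 0.
  have d1 := @is_derive1_comp R L (fun s => s + T) s _ _ (dL (s + T)) (is_derive_shift T s).
  by have := is_deriveB d1 (dL s); rewrite mulr1 lam_per subrr.
by have := @is_derive_0_is_cst R _ t 0 d; rewrite add0r L0; lra.
Qed.

Lemma primitive_period_neq0 : L T != 0.
Proof. by rewrite -L0; apply/eqP => /L_inj e; move: T0; rewrite e ltxx. Qed.

Let L_mul (k : nat) : L (k%:R * T) = k%:R * L T.
Proof.
elim: k => [|k IH]; first by rewrite !mul0r L0.
by rewrite -natr1 mulrDl mul1r primitive_shift IH; ring.
Qed.

Let L_mulN (k : nat) : L (- (k%:R * T)) = - (k%:R * L T).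
Proof.
elim: k => [|k IH]; first by rewrite !mul0r oppr0 L0.
have := primitive_shift (- (k.+1%:R * T)).
by rewrite -natr1 (_ : - ((k%:R + 1) * T) + T = - (k%:R * T)); [rewrite IH; lra|ring].
Qed.

(** [L] is injective since its derivative has no zero, and onto since it changes by the nonzero
    amount [L T] over each period. The sign of [L T] depends on the orientation of the curve. *)
Lemma primitive_inverse : exists iota, cancel iota L /\ cancel L iota.
Proof.
have LT := primitive_period_neq0.
have surj y : exists x, L x = y.
  have [k ky] : exists k : nat, `|y| <= k%:R * `|L T|.
    exists (Num.bound (`|y| / `|L T|)); rewrite -ler_pdivrMr ?normr_gt0//.
    by apply: ltW; apply: archi_boundP; rewrite divr_ge0.
  have kT : - (k%:R * T) <= k%:R * T by rewrite ge0_cp ?mulr_ge0// ltW.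
  have [||x _ xy] := @IVT R L (- (k%:R * T)) (k%:R * T) y kT.
  - apply: derivable_within_continuous => x _; by have [] := dL x.
  - rewrite L_mul L_mulN; move: ky; rewrite ler_norml => /andP[k1 k2].
    have kn : 0 <= k%:R :> R by [].
    have [l0|l0] := leP 0 (L T).
      rewrite (ger0_norm l0) in k1 k2; have := mulr_ge0 kn l0 => h.
      by rewrite ge_min le_max; apply/andP; split; apply/orP; [left|right]; lra.
    rewrite (ltr0_norm l0) in k1 k2; have := mulr_ge0_le0 kn (ltW l0) => h.
    by rewrite ge_min le_max; apply/andP; split; apply/orP; [right|left]; lra.
  by exists x.
have /choice[iota iotaP] := surj.
by exists iota; split => // t; apply: L_inj; exact: iotaP.
Qed.

End PeriodicPrimitive.

Section ActionBound.
Variables (R : realType) (n : nat) (p : R) (B D : 'M[R]_n) (M : R) (ea : 'cV[R]_n).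
Hypotheses (p_gt2 : 2 < p) (n_gt0 : (0 < n)%N).
Hypotheses (orthB : orthogonal_mx B) (orthD : orthogonal_mx D).
Hypothesis ext : extremal p (B *m D^T) M ea.
Local Notation P := (phase_space R n).
Local Notation GK := (energy p B D).
Local Notation gK := (energy_grad p B D).
Let p1 : 1 < p. Proof. by apply: lt_trans p_gt2; rewrite ltr1n. Qed.
Let p0 := p_gt0 p1.

(** The kernel condition makes the velocity a multiple of the Hamiltonian field; the explicit
    quotient for [lam] shows continuity and periodicity. *)
Lemma characteristic_flow T g : closed_characteristic (Kp p B D) T g ->
  exists lam : R -> R, [/\ continuous lam, forall t, lam t != 0, forall t, lam (t + T) = lam t,
    forall t, is_derive t (1 : R) g (lam t *: ham_rot (gK (g t))) &
    forall t, derive1 g t = lam t *: ham_rot (gK (g t))].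
Proof.
move=> [[T0 gT] [gd gc] gb gker].
have g1 t : GK (g t) = 1 by have := gb t; rewrite bdry_KpE.
have dg t : is_derive t (1 : R) g (derive1 g t).
  by rewrite derive1E; apply: DeriveDef => //; exact: gd.
pose lam t := dotp (- ham_rot (derive1 g t)) (gK (g t)) / dotp (gK (g t)) (gK (g t)).
have lamE t : derive1 g t = lam t *: ham_rot (gK (g t)).
  apply: (energy_kernel p1 (g1 t)); rewrite -bdry_KpE// (gker t).2.
  by exists 1 => //; rewrite scale1r.
have gg_neq0 t : dotp (gK (g t)) (gK (g t)) != 0.
  apply/eqP => g0; have gz : gK (g t) = 0.
    apply/eqP; rewrite -normr_eq0 -sqrf_eq0 eq_le sqr_ge0 andbT -g0.
    exact: norm_sq_le_dotp.
  have := dotp_energy_grad B D p1 (g t); rewrite gz dotp0l g1 mulr1 => /esym/eqP.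
  by rewrite gt_eqF.
have gcont : continuous g by exact: is_derive_phase_continuous dg.
have gKc : continuous (fun t => gK (g t)).
  by apply: (@cont_comp _ _ _ gK g) => //; exact: cont_energy_grad.
have dper t : derive1 g (t + T) = derive1 g t.
  have d1 := is_derive_phase_shift (dg (t + T)).
  have e : (fun s => g (s + T)) = g by apply/funext => s.
  rewrite e in d1; rewrite [RHS]derive1E.
  by have [_ ->] := d1.
exists lam; split; last exact: lamE.
- apply: (contM (cont_dotp _ gKc) (cont_inv gg_neq0 (cont_dotp gKc gKc))).
  apply: cont_phase => k; under eq_fun do rewrite pcN.
  by apply: contN; apply: cont_pc; exact: cont_ham_rot.
- move=> t; apply/eqP => l0; have := lamE t; rewrite l0 scale0r => /eqP.
  by apply/negP; exact: (gker t).1.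
- by move=> t; rewrite /lam dper gT.
- by move=> t; rewrite -lamE.
Qed.

(** By Euler's identity the pairing of a point with the gradient is p times its energy, so the
    action integrand is a constant multiple of [lam]. *)
Lemma action_flow T g (lam : R -> R) : 0 < T -> continuous lam ->
  (forall t, GK (g t) = 1) ->
  (forall t, derive1 g t = lam t *: ham_rot (gK (g t))) ->
  action T g = `|p / 2 * itg 0 T lam|.
Proof.
move=> T0 lamc g1 dg; rewrite /action.
have e t : omega (g t) (derive1 g t) = - p * lam t.
  rewrite dg omega_dotpr ham_rotZ ham_rotK scalerN dotpNl dotpZl dotp_energy_grad// g1.
  by rewrite mulr1 mulrC mulNr.
have -> : (fun t => omega (g t) (derive1 g t)) = (fun t => - p * lam t) by exact/funext.
rewrite Rintegral_itg//; last by apply: contM => //; exact: cont_cst.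
rewrite itgZ// mulrA mulrN mulNr normrN; congr (`|_|); ring.
Qed.

Theorem action_lower T g : closed_characteristic (Kp p B D) T g ->
  4 * theta_int p / M <= action T g.
Proof.
move=> cc; have [lam [lamc lam0 lamT dg dg1]] := characteristic_flow cc.
have [[T0 gT] _ gb _] := cc.
have g1 t : GK (g t) = 1 by have := gb t; rewrite bdry_KpE.
rewrite (@action_flow T g lam)//.
pose L t := itg 0 t lam.
have dL t : is_derive t (1 : R) L (lam t).
  by have := is_deriveB (prim_derive lamc t) (is_derive_cst (prim lam 0) t (1 : R)); rewrite subr0.
have L0 : L 0 = 0 by rewrite /L /itg subrr.
have [iota [iK Ki]] := primitive_inverse T0 lam0 lamT dL L0.
have LT := primitive_period_neq0 T0 lam0 dL L0.
have diota s : is_derive s (1 : R) iota (lam (iota s))^-1.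
  rewrite -{1}(iK s); apply: (@is_derive_inverse R L iota (lam (iota s)) (iota s)) => //.
    exact: (@near_dist R R (iota s) 1 _ ltr01 (fun t _ => Ki t)).
  exact: (@near_dist R R (iota s) 1 _ ltr01 (fun t _ => is_derive_continuous dL (x := t))).
(* In the new time the curve follows the Hamiltonian flow of [energy] itself and closes up after
   time |L T|. *)
pose w s := g (iota s).
have dw s : is_derive s (1 : R) w (ham_rot (gK (w s))).
  have := is_derive_comp_phase (dg (iota s)) (diota s) => /is_derive_eq; apply.
  by rewrite scalerA mulVf// scale1r.
have w1 s : GK (w s) = 1 by exact: g1.
rewrite normrM gtr0_norm ?divr_gt0// -/(L T).
apply: (@period_bound R n p B D M ea p_gt2 n_gt0 orthB orthD ext w `|L T|) => //.
  by rewrite normr_gt0.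
have i0 : iota 0 = 0 by rewrite -L0 Ki.
have [l0|l0] := leP 0 (L T).
  by rewrite /w ger0_norm// Ki i0 -[in LHS](add0r T) gT.
have LN : - L T = L (- T).
  by have := primitive_shift lamT dL L0 (- T); rewrite addNr L0; lra.
by rewrite /w ltr0_norm// LN Ki i0 -[in RHS](addNr T) gT.
Qed.

End ActionBound.

(** * A closed characteristic of minimal action *)

(* The unit circle of [|s|^p + |u|^p = 1] in polar coordinates. *)
Section PlanarCurve.
Variables (R : realType) (p : R).
Hypothesis p_gt1 : 1 < p.
Let p0 := p_gt0 p_gt1.
Let p_neq0 := lt0r_neq0 p0.

Definition polar_norm (t : R) : R := `|cos t| `^ p + `|sin t| `^ p.
Local Notation N := polar_norm.
Definition curve_s (t : R) : R := N t `^ (- p^-1) * cos t.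
Definition curve_u (t : R) : R := N t `^ (- p^-1) * sin t.
(** The square of the polar radius, so its integral over an angle is twice the area swept. *)
Definition curve_speed (t : R) : R := N t `^ (- (2 / p)).

Lemma polar_norm_gt0 t : 0 < N t.
Proof.
rewrite lt_def addr_ge0 ?powR_ge0// andbT paddr_eq0 ?powR_ge0// !powR_eq0 p_neq0 !andbT !normr_eq0.
apply/negP => /andP[/eqP c0 /eqP s0]; have := cos2Dsin2 t.
by rewrite c0 s0 expr0n /= addr0 => /esym/eqP; rewrite oner_eq0.
Qed.

Lemma curve_speed_gt0 t : 0 < curve_speed t.
Proof. by rewrite powR_gt0 ?polar_norm_gt0. Qed.

Lemma cont_polar_pow r : continuous (fun t => N t `^ r).
Proof.
move=> t; apply: differentiable_continuous; apply/derivable1_diffP.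
have ds := is_derive_sin t; have dc := is_derive_cos t.
have d1 := @is_derive1_comp R (fun s => `|s| `^ p) sin t _ _ (is_derive_abs_powR p_gt1 (sin t)) ds.
have d2 := @is_derive1_comp R (fun s => `|s| `^ p) cos t _ _ (is_derive_abs_powR p_gt1 (cos t)) dc.
by have [] := @is_derive1_comp R (fun s => s `^ r) N t _ _
  (is_derive_powR_pos r (polar_norm_gt0 t)) (is_deriveD d2 d1).
Qed.

Let spow_curve (x t : R) : spow p (N t `^ (- p^-1) * x) = N t `^ (- p^-1) `^ (p - 1) * spow p x.
Proof. by rewrite spowM spow_pos ?powR_ge0. Qed.

Let dN (r t : R) : is_derive t (1 : R) (fun s => N s `^ r)
  (r * N t `^ (r - 1) * (p * (spow p (sin t) * cos t - spow p (cos t) * sin t))).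
Proof.
have d1 := @is_derive1_comp R (fun s => `|s| `^ p) sin t _ _
  (is_derive_abs_powR p_gt1 (sin t)) (is_derive_sin t).
have d2 := @is_derive1_comp R (fun s => `|s| `^ p) cos t _ _
  (is_derive_abs_powR p_gt1 (cos t)) (is_derive_cos t).
have := @is_derive1_comp R (fun s => s `^ r) N t _ _
  (is_derive_powR_pos r (polar_norm_gt0 t)) (is_deriveD d2 d1).
move/is_derive_eq; apply; ring.
Qed.

Let pow_split t : [/\ N t `^ (- p^-1) = N t * N t `^ (- p^-1 - 1),
  curve_speed t * N t `^ (- p^-1) `^ (p - 1) = N t `^ (- p^-1 - 1) &
  N t = cos t * spow p (cos t) + sin t * spow p (sin t)].
Proof.
have N0 := polar_norm_gt0 t; split.
- by rewrite -{2}(powRr1 (ltW N0)) -powR_gt0D// addrC subrK.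
- rewrite /curve_speed -powRrM -powR_gt0D//; congr (_ `^ _); field; exact: p_neq0.
- by rewrite !mul_spow.
Qed.

Lemma curve_s_derive t : is_derive t (1 : R) curve_s (- curve_speed t * spow p (curve_u t)).
Proof.
have := is_deriveM (dN (- p^-1) t) (is_derive_cos t) => /is_derive_eq; apply.
have [e1 e2 e3] := pow_split t; rewrite /curve_u spow_curve [in RHS]mulNr [in RHS]mulrA e2 -[in RHS]mulNr !scaleRE e1.
move: (N t `^ (- p^-1 - 1)) => Q; rewrite e3.
have sc := cos2Dsin2 t.
have -> : - Q * spow p (sin t) = - Q * spow p (sin t) * (cos t ^+ 2 + sin t ^+ 2) by rewrite sc mulr1.
by field; exact: p_neq0.
Qed.

Lemma curve_u_derive t : is_derive t (1 : R) curve_u (curve_speed t * spow p (curve_s t)).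
Proof.
have := is_deriveM (dN (- p^-1) t) (is_derive_sin t) => /is_derive_eq; apply.
have [e1 e2 e3] := pow_split t; rewrite /curve_s spow_curve [in RHS]mulrA e2 !scaleRE e1.
move: (N t `^ (- p^-1 - 1)) => Q; rewrite e3.
have sc := cos2Dsin2 t.
have -> : Q * spow p (cos t) = Q * spow p (cos t) * (cos t ^+ 2 + sin t ^+ 2) by rewrite sc mulr1.
by field; exact: p_neq0.
Qed.

Lemma curve_energy t : `|curve_s t| `^ p + `|curve_u t| `^ p = 1.
Proof.
have N0 := polar_norm_gt0 t.
rewrite /curve_s /curve_u !normrM !powRM//.
rewrite ger0_norm ?powR_ge0// -mulrDr -powRrM mulNr mulVf// powR_inv1 ?ltW//.
by rewrite mulVf// gt_eqF.
Qed.

Lemma polar_normDpi t : N (t + pi) = N t.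
Proof. by rewrite /N cosDpi sinDpi !normrN. Qed.

(** Twice the area of the planar ball. Where s >= 0 one has [theta p u = s], and 2 Theta (u) - s u
    is a primitive of s u' - s' u, which is the speed; the rest follows from the period pi. *)
Lemma curve_speed_int : itg 0 (2 * pi) curve_speed = 8 * theta_int p.
Proof.
have rc : continuous curve_speed by exact: cont_polar_pow.
have shift (x y : R) : itg x y curve_speed = itg (x + pi) (y + pi) curve_speed.
  transitivity (itg x y (fun t => curve_speed (t + pi))); last exact: itg_shift.
  have e : curve_speed = (fun t => curve_speed (t + pi)).
    by apply/funext => t; exact: (congr1 (fun z => z `^ (- (2 / p))) (esym (polar_normDpi t))).
  exact: (congr1 (itg x y) e).
have half : itg (- (pi / 2)) (pi / 2) curve_speed = 4 * theta_int p.
  have sc : continuous curve_s by exact: is_derive_continuous curve_s_derive.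
  have uc : continuous curve_u by exact: is_derive_continuous curve_u_derive.
  pose du t := curve_speed t * spow p (curve_s t).
  pose ds t := - curve_speed t * spow p (curve_u t).
  have spc : continuous (spow p) by exact: cont_spow.
  have duc : continuous du by apply: contM => //; exact: (@cont_comp _ _ _ (spow p) curve_s).
  have dsc : continuous ds.
    by apply: contM; [exact: contN|exact: (@cont_comp _ _ _ (spow p) curve_u)].
  pose d t := 2 * (`|curve_s t| * du t) - (ds t * curve_u t + curve_s t * du t).
  have dc : continuous d.
    apply: contB; last by apply: contD; exact: contM.
    by apply: contM; [exact: cont_cst|apply: contM => //; exact: cont_norm].
  have thetaE t : theta p (curve_u t) = `|curve_s t|.
    have e := curve_energy t.
    have e' : 1 - `|curve_u t| `^ p = `|curve_s t| `^ p by rewrite -e addrK.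
    rewrite /theta e' (max_idPl _) ?powR_ge0// ger0_norm ?powR_ge0//.
    by rewrite -powRrM mulfV// powRr1.
  have dH t : is_derive t (1 : R) (fun t => 2 * Theta p (curve_u t) - curve_s t * curve_u t) (d t).
    have h1 := @is_derive1_comp R (Theta p) curve_u t _ _ (Theta_derive p_gt1 (curve_u t)) (curve_u_derive t).
    have := is_deriveB (is_derive_scale 2 h1) (is_deriveM (curve_s_derive t) (curve_u_derive t)).
    by move/is_derive_eq; apply; rewrite thetaE !scaleRE /d /du /ds; ring.
  have deq t : - (pi / 2) <= t <= pi / 2 -> curve_speed t = d t.
    move=> tpi; have s0 : 0 <= curve_s t by rewrite mulr_ge0 ?powR_ge0// cos_ge0_pihalf.
    rewrite /d /du /ds ger0_norm//.
    have e : curve_s t * spow p (curve_s t) + curve_u t * spow p (curve_u t) = 1.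
      by rewrite (mul_spow p_gt1 (curve_s t)) (mul_spow p_gt1 (curve_u t)); exact: curve_energy.
    transitivity (curve_speed t * (curve_s t * spow p (curve_s t) + curve_u t * spow p (curve_u t))).
      by rewrite e mulr1.
    ring.
  have pi20 : - (pi / 2) <= pi / 2 :> R by have := pi_gt0 R; lra.
  have -> : itg (- (pi / 2)) (pi / 2) curve_speed = itg (- (pi / 2)) (pi / 2) d.
    by apply/eqP; rewrite eq_le; apply/andP; split; apply: le_itg => // t /deq ->.
  have N1 : N (pi / 2) = 1.
    by rewrite /N cos_pihalf sin_pihalf normr0 normr1 (powR0 p_neq0) powR1 add0r.
  have NN t : N (- t) = N t by rewrite /N cosN sinN normrN.
  have sN : curve_s (- (pi / 2)) = 0 by rewrite /curve_s cosN cos_pihalf mulr0.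
  have s1 : curve_s (pi / 2) = 0 by rewrite /curve_s cos_pihalf mulr0.
  have u1 : curve_u (pi / 2) = 1 by rewrite /curve_u N1 sin_pihalf powR1 mulr1.
  have uN : curve_u (- (pi / 2)) = - 1.
    by rewrite /curve_u NN N1 sinN sin_pihalf powR1 mul1r.
  apply: (etrans (prim_unique (- (pi / 2)) (pi / 2) dc dH)).
  rewrite s1 sN !mul0r u1 uN (ThetaN p_gt1 1) Theta1 !subr0; clear; move: (theta_int p) => I.
  by rewrite mulrN opprK -mulrDl; congr (_ * _); rewrite -natrD.
have e1 : itg 0 pi curve_speed = 4 * theta_int p.
  rewrite -(itg_cat _ 0 (pi / 2) pi) -half -(itg_cat _ (- (pi / 2)) 0 (pi / 2)) addrC; congr (_ + _).
  by rewrite [RHS]shift add0r; congr (itg _ _ _); field.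
rewrite -(itg_cat _ 0 pi (2 * pi)) e1.
have -> : itg pi (2 * pi) curve_speed = itg 0 pi curve_speed.
  by rewrite [RHS]shift add0r; congr (itg _ _ _); ring.
by rewrite e1; ring.
Qed.

End PlanarCurve.

Section Minimizer.
Variables (R : realType) (n : nat) (p : R) (B D : 'M[R]_n) (M : R) (ea : 'cV[R]_n).
Hypotheses (p_gt2 : 2 < p).
Hypotheses (orthB : orthogonal_mx B) (orthD : orthogonal_mx D).
Local Notation O := (B *m D^T).
Hypothesis ext : extremal p O M ea.
Local Notation P := (phase_space R n).
Local Notation q := (conj_exp p).
Local Notation GK := (energy p B D).
Local Notation gK := (energy_grad p B D).
Let p1 : 1 < p. Proof. by apply: lt_trans p_gt2; rewrite ltr1n. Qed.
Let p0 := p_gt0 p1.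
Let M0 : 0 < M. Proof. by case: ext. Qed.
Let M_neq0 := lt0r_neq0 M0.
Let p_neq0 := lt0r_neq0 p0.
Let eb := ext_b p O M ea.
Definition min_x : 'cV[R]_n := M^-1 *: (D^T *m ea).
Definition min_y : 'cV[R]_n := M^-1 *: (B^T *m eb).

Let Bx : B *m min_x = spowv q eb.
Proof. by rewrite /min_x -scalemxAr mulmxA (ext_O p_gt2 ext) scalerA mulVf// scale1r. Qed.

Let Dy : D *m min_y = spowv q ea.
Proof.
rewrite /min_y -scalemxAr mulmxA.
have -> : D *m B^T = O^T by rewrite trmx_mul trmxK.
by rewrite (ext_OT p_gt2 ext) scalerA mulVf// scale1r.
Qed.

Let spowvKp (x : 'cV[R]_n) : spowv p (spowv q x) = x.
Proof. by apply/colP => i; rewrite !mxE spowK. Qed.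

(** On the plane of [min_x] and [min_y] the two parts of the energy are |s|^p and |u|^p, and the
    Hamiltonian field is tangent to this plane, by the Euler-Lagrange equations. [min_speed] is
    negative because the polar curve turns against the flow. *)
Definition min_curve (t : R) : P := (curve_s p t *: min_x, curve_u p t *: min_y).
Definition min_speed (t : R) : R := - (curve_speed p t / (p * M)).

Let spowv_scale' (k : R) (x : 'cV[R]_n) : spowv p (k *: x) = spow p k *: spowv p x.
Proof. by apply/colP => i; rewrite !mxE spowM. Qed.

Lemma min_curve_energy t : GK (min_curve t) = 1.
Proof.
have e1 : psum p (B *m (curve_s p t *: min_x)) = `|curve_s p t| `^ p.
  rewrite -scalemxAr psumZ Bx psum_spow_p// (psum_ext_b p_gt2 ext); exact: mulr1.
have e2 : psum p (D *m (curve_u p t *: min_y)) = `|curve_u p t| `^ p.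
  rewrite -scalemxAr psumZ Dy psum_spow_p//; case: ext => _ -> _ _; exact: mulr1.
exact: etrans (f_equal2 +%R e1 e2) (curve_energy p1 t).
Qed.

Lemma min_curve_derive t :
  is_derive t (1 : R) min_curve (min_speed t *: ham_rot (gK (min_curve t))).
Proof.
have e1 : p *: (B^T *m spowv p (B *m (curve_s p t *: min_x))) =
    (p * M * spow p (curve_s p t)) *: min_y.
  rewrite -scalemxAr Bx spowv_scale' spowvKp -scalemxAr /min_y !scalerA.
  by congr (_ *: _); field.
have e2 : p *: (D^T *m spowv p (D *m (curve_u p t *: min_y))) =
    (p * M * spow p (curve_u p t)) *: min_x.
  rewrite -scalemxAr Dy spowv_scale' spowvKp -scalemxAr /min_x !scalerA.
  by congr (_ *: _); field.
have grad : gK (min_curve t) = ((p * M * spow p (curve_s p t)) *: min_y,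
    (p * M * spow p (curve_u p t)) *: min_x).
  exact: (f_equal2 pair e1 e2).
have cN (k : R) (v : 'cV[R]_n) j : (- (k *: v)) j 0 = - (k * v j 0) by rewrite !mxE.
have cZ (k : R) (v : 'cV[R]_n) j : (k *: v) j 0 = k * v j 0 by rewrite mxE.
rewrite grad /min_speed; apply: is_derive_phase => -[j []]; rewrite pcZ /pc /=.
  have -> : (fun s => (min_curve s).2 j 0) = (fun s => min_y j 0 * curve_u p s).
    by apply/funext => s; rewrite /min_curve /= mxE mulrC.
  have := is_derive_scale (min_y j 0) (curve_u_derive p1 t) => /is_derive_eq; apply.
  apply: etrans (congr1 ( *%R _) (esym (cN (p * M * spow p (curve_s p t)) min_y j))).
  move: (curve_speed p t) (spow p _) (min_y j 0) => v w x; field.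
  by rewrite ?M_neq0 ?p_neq0.
have -> : (fun s => (min_curve s).1 j 0) = (fun s => min_x j 0 * curve_s p s).
  by apply/funext => s; rewrite /min_curve /= mxE mulrC.
have := is_derive_scale (min_x j 0) (curve_s_derive p1 t) => /is_derive_eq; apply.
apply: etrans (congr1 ( *%R _) (esym (cZ (p * M * spow p (curve_u p t)) min_x j))).
move: (curve_speed p t) (spow p _) (min_x j 0) => v w x; field.
by rewrite ?M_neq0 ?p_neq0.
Qed.

Let min_speed_neq0 t : min_speed t != 0.
Proof.
rewrite oppr_eq0 mulf_neq0//; first by rewrite gt_eqF ?curve_speed_gt0.
by rewrite invr_neq0// mulf_neq0.
Qed.

Let cont_min_speed : continuous min_speed.
Proof.
apply: contN; apply: contM; last exact: cont_cst.
exact: (cont_polar_pow p1).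
Qed.

Let min_curve_derive1 t : derive1 min_curve t = min_speed t *: ham_rot (gK (min_curve t)).
Proof. by rewrite derive1E; have [_ ->] := min_curve_derive t. Qed.

Lemma min_curve_characteristic : closed_characteristic (Kp p B D) (2 * pi) min_curve.
Proof.
split.
- split; first by rewrite mulr_gt0 ?pi_gt0.
  move=> t.
  have pN : polar_norm p (t + 2 * pi) = polar_norm p t.
    by rewrite mulr_natl mulr2n addrA !polar_normDpi.
  have ec : cos (t + 2 * pi) = cos t by rewrite mulr_natl mulr2n addrA !cosDpi opprK.
  have es : sin (t + 2 * pi) = sin t by rewrite mulr_natl mulr2n addrA !sinDpi opprK.
  have e1 : curve_s p (t + 2 * pi) = curve_s p t by rewrite /curve_s pN ec.
  have e2 : curve_u p (t + 2 * pi) = curve_u p t by rewrite /curve_u pN es.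
  by rewrite /min_curve e1 e2.
- split; first by move=> t; have [] := min_curve_derive t.
  have -> : derive1 min_curve = (fun t => min_speed t *: ham_rot (gK (min_curve t))).
    by apply/funext => t; exact: min_curve_derive1.
  apply: cont_phase => k; under eq_fun do rewrite pcZ.
  apply: contM; first exact: cont_min_speed.
  apply: cont_pc; apply: cont_ham_rot.
  apply: (@cont_comp _ _ _ gK min_curve); last exact: cont_energy_grad.
  exact: is_derive_phase_continuous min_curve_derive.
- by move=> t; rewrite bdry_KpE//; exact: min_curve_energy.
- move=> t; rewrite min_curve_derive1; split.
    rewrite scaler_eq0 negb_or min_speed_neq0 /=; apply/eqP => h0.
    have ham0 : ham_rot (0 : P) = 0 by have := ham_rotZ 0 (0 : P); rewrite !scale0r.
    have g0 : gK (min_curve t) = 0.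
      by apply: oppr_inj; rewrite -ham_rotK h0 oppr0.
    have := dotp_energy_grad B D p1 (min_curve t); rewrite g0 dotp0l min_curve_energy mulr1.
    by move/esym/eqP; apply/negP.
  rewrite bdry_KpE// kernel_flow//; last exact: min_curve_energy.
  apply/seteqP; split => u /= [a _ <-].
    by exists (a / min_speed t) => //; rewrite scalerA divfK.
  by exists (a * min_speed t) => //; rewrite scalerA.
Qed.

Lemma min_curve_action : action (2 * pi) min_curve = 4 * theta_int p / M.
Proof.
rewrite (@action_flow R n p B D p_gt2 _ _ min_speed)//.
- have -> : itg 0 (2 * pi) min_speed = - (p * M)^-1 * itg 0 (2 * pi) (curve_speed p).
    rewrite -itgZ; last exact: (cont_polar_pow p1).
    have e : min_speed = (fun t => - (p * M)^-1 * curve_speed p t).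
      by apply/funext => t; rewrite /min_speed mulNr mulrC.
    exact: (congr1 (itg 0 (2 * pi)) e).
  rewrite curve_speed_int//; have I0 := theta_int_ge0 p1; move: (theta_int p) I0 => I I0.
  have -> : p / 2 * (- (p * M)^-1 * (8 * I)) = - (4 * I / M).
    by field; rewrite ?M_neq0 ?p_neq0.
  by rewrite normrN ger0_norm// divr_ge0 ?mulr_ge0// ltW.
- by rewrite mulr_gt0 ?pi_gt0.
- exact: min_curve_energy.
Qed.

End Minimizer.

(** * The area of the planar l_p ball *)

Section UnitBallArea.
Variables (R : realType) (p : R).
Hypothesis p_gt1 : 1 < p.
Let p0 := p_gt0 p_gt1.
Let p_neq0 := lt0r_neq0 p0.
Local Notation mu := (@lebesgue_measure R).

Let slice (x : R) : mu (xsection (lp_ball2 p) x) = (2 * theta p x)%:E.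
Proof.
have [x1|x1] := leP (`|x| `^ p) 1; last first.
  have -> : xsection (lp_ball2 p) x = set0.
    rewrite -subset0 => y /=; rewrite /xsection /= inE /lp_ball2 /= => xy.
    by have := powR_ge0 `|y| p; lra.
  rewrite measure0 /theta (max_idPr _); last by lra.
  by rewrite normr0 powR0 ?invr_neq0// mulr0.
have th : theta p x `^ p = 1 - `|x| `^ p.
  rewrite /theta (max_idPl _); last by lra.
  rewrite -powRrM mulVf// powRr1 ger0_norm//; lra.
have th0 := theta_ge0 p x.
have -> : xsection (lp_ball2 p) x = `[- theta p x, theta p x]%classic.
  apply/seteqP; split => y; rewrite /xsection /= inE /lp_ball2 /= in_itv /= -ler_norml => h.
    rewrite leNgt; apply/negP => lt; have := powR_pos_ltr p0 th0 lt; rewrite th; lra.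
  have := powR_pos_mono (ltW p0) (normr_ge0 y) h; rewrite th; lra.
rewrite lebesgue_measure_itv /= lte_fin.
have [lt|ge] := ltP (- theta p x) (theta p x).
  by rewrite -EFinB; congr (_%:E); ring.
by congr (_%:E); lra.
Qed.

Lemma c0_theta : c0 p = (4 * theta_int p)%:E.
Proof.
rewrite /c0 /product_measure1.
have tc := cont_theta p_gt1.
have t2c : continuous (fun x => 2 * theta p x) by apply: contM => //; exact: cont_cst.
have -> : ((@lebesgue_measure R) \o xsection (lp_ball2 p)) =
    ((fun x => (2 * theta p x)%:E) \_ `[-1, 1]%classic).
  apply/funext => x; rewrite /= slice /patch; case: ifPn => //.
  rewrite notin_setE /= in_itv /= -ler_norml => /negP; rewrite -ltNge => x1.
  have := powR_pos_ltr p0 ler01 x1; rewrite powR1 => x1'.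
  rewrite /theta (max_idPr _); last by lra.
  by rewrite normr0 powR0 ?invr_neq0// mulr0.
have lt11 : -1 < 1 :> R by lra.
rewrite -integral_mkcond (integral_itg lt11 t2c).
congr (_%:E); rewrite itgZ// -(itg_cat _ (-1) 0 1).
have -> : itg (-1) 0 (theta p) = theta_int p.
  have dN (t : R) : is_derive t (1 : R) (fun s => - prim (theta p) (- s)) (theta p t).
    have d1 := @is_derive1_comp R (prim (theta p)) -%R t _ _ (prim_derive tc (- t)) (is_deriveN (is_derive_id t (1 : R))).
    have := is_deriveN d1 => /is_derive_eq; apply.
    by rewrite thetaN mulrN1 opprK.
  rewrite (prim_unique (-1) 0 tc dN) oppr0 !opprK /theta_int /itg; ring.
rewrite -/(theta_int p); ring.
Qed.

End UnitBallArea.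

(** * Upper bound for the cylindrical capacity *)

Lemma differentiable_near (R : realType) (V W : normedModType R) (f g : V -> W) (x : V) :
  (\forall y \near x, f y = g y) -> differentiable f x -> differentiable g x.
Proof.
move=> fg df; have dfc : continuous ('d f x) by exact: diff_continuous.
have fgx : f x = g x by exact: nbhs_singleton fg.
have g_o : g \o shift x = cst (g x) + 'd f x +o_ 0 id.
  apply/eqaddoP => e e0.
  have [d d0 dP] := diff_bound df e0.
  have [d' /= d'0 fgP] : exists2 d', 0 < d' & forall y, `|y - x| < d' -> f y = g y.
    move: fg => /nbhs_ballP[d' /= d'0 dP']; exists d' => // y yx; apply: dP'.
    by rewrite -ball_normE /= distrC.
  have dd : 0 < Order.min d d' by rewrite lt_min d0.
  apply: (@near_dist R V 0 _ _ dd) => h; rewrite subr0 lt_min => /andP[hd hd'].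
  have := dP h hd; rewrite fgx (fgP (x + h)); last by rewrite addrAC subrr add0r.
  have -> : (g \o shift x - (cst (g x) + 'd f x)) h = g (h + x) - (g x + 'd f x h) by [].
  by rewrite opprD addrA [h + x]addrC.
have dE : 'd g x = 'd f x :> (V -> W) by exact: diff_unique.
by apply/diff_locallyP; rewrite dE.
Qed.

Lemma is_derive_chain (R : realType) (V : normedModType R) (h : R -> R) (f : V -> R)
    (x v : V) (dh : R) : differentiable f x -> is_derive (f x) (1 : R) h dh ->
  differentiable (fun y => h (f y)) x /\ 'D_v (fun y => h (f y)) x = dh * 'D_v f x.
Proof.
move=> dfx [dhx eh].
have dh' : differentiable h (f x) by exact/derivable1_diffP.
have dc : differentiable (h \o f) x by exact: differentiable_comp.
split; first exact: dc.
rewrite -[LHS]/('D_v (h \o f) x) !deriveE// diff_comp//= diff1E//.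
by rewrite derive1E eh scaleRE mulrC.
Qed.

Section SmoothTerms.
Variables (R : realType) (n : nat).
Local Notation P := (phase_space R n).
Variable U : set P.
Hypothesis U_open : open U.

(* A class of functions stable under directional derivatives on [U]. *)
Inductive smooth_term : (P -> R) -> Prop :=
| st_cst c : smooth_term (fun=> c)
| st_coord k : smooth_term (@pc R n k)
| st_add f g : smooth_term f -> smooth_term g -> smooth_term (fun z => f z + g z)
| st_mul f g : smooth_term f -> smooth_term g -> smooth_term (fun z => f z * g z)
| st_pow f r : smooth_term f -> (forall z, U z -> 0 < f z) ->
    smooth_term (fun z => f z `^ r)
| st_cos f : smooth_term f -> smooth_term (fun z => cos (f z))
| st_sin f : smooth_term f -> smooth_term (fun z => sin (f z))
| st_prim H g : continuous H -> smooth_term g -> smooth_term (fun z => H (g z)) ->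
    smooth_term (fun z => prim H (g z))
| st_ext f g : smooth_term f -> (forall z, U z -> f z = g z) -> smooth_term g.

Lemma nearU z : U z -> \forall y \near z, U y.
Proof. by move=> Uz; exact: open_nbhs_nbhs. Qed.

Lemma pc_differentiable k (z : P) : differentiable (@pc R n k) z.
Proof.
have @f : {linear P -> R}.
  by exists (pc k); do 2![eexists]; do ?[constructor];
    first [exact: pc0 | by move=> a b; exact: pcD | by move=> a v; exact: pcZ].
rewrite (_ : pc k = f)//; apply: linear_differentiable.
have pcc : continuous (fun z : P => pc k z) by apply: cont_pc => y; exact: cvg_id.
exact: pcc.
Qed.

Lemma pc_derive k (z v : P) : 'D_v (@pc R n k) z = pc k v.
Proof.
apply: cvg_lim; first exact: norm_hausdorff.
have eqn : {near 0^', (fun=> pc k v) =1 (fun h : R => h^-1 *: (pc k (h *: v + z) - pc k z : R^o))}.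
  near=> h; rewrite pcD pcZ addrK scaleRE mulrA mulVf ?mul1r//.
  by near: h; exact: nbhs_dnbhs_neq.
apply: cvg_trans (near_eq_cvg eqn) _; exact: cvg_cst.
Unshelve. all: by end_near. Qed.

Lemma smooth_term_derive f : smooth_term f ->
  (forall z, U z -> differentiable f z) /\ forall v, smooth_term ('D_v f).
Proof.
elim=> {f} [c|k|f g sf [df Df] sg [dg Dg]|f g sf [df Df] sg [dg Dg]|f r sf [df Df] f0|f sf [df Df]|f sf [df Df]|H g Hc sg [dg Dg] sH [dH DH]|f g sf [df Df] fg].
- split; first by move=> z _; exact: differentiable_cst.
  by move=> v; apply: st_ext (st_cst 0) _ => z _; rewrite derive_cst.
- split; first by move=> z _; exact: pc_differentiable.
  by move=> v; apply: st_ext (st_cst (pc k v)) _ => z _; rewrite pc_derive.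
- split; first by move=> z Uz; apply: differentiableD; [exact: df|exact: dg].
  move=> v; apply: st_ext (st_add (Df v) (Dg v)) _ => z Uz.
  by apply/esym; apply: deriveD; apply: diff_derivable; [exact: df|exact: dg].
- split; first by move=> z Uz; apply: differentiableM; [exact: df|exact: dg].
  move=> v; apply: st_ext (st_add (st_mul sf (Dg v)) (st_mul sg (Df v))) _ => z Uz.
  by apply/esym; apply: deriveM; apply: diff_derivable; [exact: df|exact: dg].
- have H z (v : P) (Uz : U z) := is_derive_chain v (df z Uz) (is_derive_powR_pos r (f0 z Uz)).
  split; first by move=> z Uz; exact: (H z 0 Uz).1.
  move=> v; apply: st_ext (st_mul (st_mul (st_cst r) (st_pow (r - 1) sf f0)) (Df v)) _.
  by move=> z Uz; rewrite (H z v Uz).2.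
- have H z (v : P) (Uz : U z) := is_derive_chain v (df z Uz) (is_derive_cos (f z)).
  split; first by move=> z Uz; exact: (H z 0 Uz).1.
  move=> v; apply: st_ext (st_mul (st_mul (st_cst (-1)) (st_sin sf)) (Df v)) _.
  by move=> z Uz; rewrite (H z v Uz).2 mulN1r.
- have H z (v : P) (Uz : U z) := is_derive_chain v (df z Uz) (is_derive_sin (f z)).
  split; first by move=> z Uz; exact: (H z 0 Uz).1.
  move=> v; apply: st_ext (st_mul (st_cos sf) (Df v)) _.
  by move=> z Uz; rewrite (H z v Uz).2.
- have K z (v : P) (Uz : U z) := is_derive_chain v (dg z Uz) (prim_derive Hc (g z)).
  split; first by move=> z Uz; exact: (K z 0 Uz).1.
  move=> v; apply: st_ext (st_mul sH (Dg v)) _.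
  by move=> z Uz; rewrite (K z v Uz).2.
- have near_fg z : U z -> \forall y \near z, f y = g y.
    by move=> Uz; apply: (@filterS _ _ (nbhs_filter z) U) => //; exact: nearU.
  split.
    by move=> z Uz; exact: differentiable_near (near_fg z Uz) (df z Uz).
  move=> v; apply: st_ext (Df v) _ => z Uz.
  exact: near_eq_derive (near_fg z Uz).
Qed.

(** The coordinates of an iterated derivative are again terms on U, so differentiability of terms
    suffices. *)
Lemma smooth_term_on (f : P -> P) : (forall k, smooth_term (fun z => pc k (f z))) ->
  smooth_on U f.
Proof.
move=> sf.
have differ (g : P -> P) : (forall k, smooth_term (fun z => pc k (g z))) ->
    forall z, U z -> differentiable g z.
  move=> sg z Uz.
  have -> : g = \sum_(k < #|{: 'I_n * bool}|) (fun y => pc (enum_val k) (g y) *: phase_basis R (enum_val k)).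
    apply/funext => y; rewrite fct_sumE [LHS]phase_sum.
    rewrite (reindex (@enum_val _ {: 'I_n * bool})) //=.
    by apply: onW_bij; exact: enum_val_bij.
  apply: differentiable_sum => k; apply: differentiableZl.
  by have [d _] := smooth_term_derive (sg (enum_val k)); exact: d.
have iter vs : forall k, smooth_term (fun z => pc k (iter_derive vs f z)).
  elim: vs => [|v vs IH] k; first exact: sf.
  have [dk Dk] := smooth_term_derive (IH k).
  apply: st_ext (Dk v) _ => z Uz.
  have dg := differ _ IH z Uz.
  have pd : differentiable (pc k) (iter_derive vs f z) by exact: pc_differentiable.
  rewrite -[LHS]/('D_v (pc k \o iter_derive vs f) z).
  rewrite deriveE; last exact: differentiable_comp.
  rewrite diff_comp//= -deriveE//.
  by rewrite -deriveE// pc_derive.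
by move=> vs z Uz; exact: differ (iter vs) z Uz.
Qed.

Lemma st_opp f : smooth_term f -> smooth_term (fun z => - f z).
Proof.
by move=> sf; apply: st_ext (st_mul (st_cst (-1)) sf) _ => z _; rewrite mulN1r.
Qed.

Lemma st_sum (I : finType) (f : I -> P -> R) : (forall i, smooth_term (f i)) ->
  smooth_term (fun z => \sum_i f i z).
Proof.
move=> sf; elim: (index_enum I) => [|i s IH].
  by apply: st_ext (st_cst 0) _ => z _; rewrite big_nil.
by apply: st_ext (st_add (sf i) IH) _ => z _; rewrite big_cons.
Qed.

End SmoothTerms.

(** The line is embedded as one coordinate of a phase space with n = 1, where [pball_unif]
    applies. *)
Lemma continuous_unif (R : realType) (f : R -> R) (C e : R) : continuous f -> 0 < e ->
  exists2 d, 0 < d & forall x y, `|x| <= C -> `|y| <= C -> `|x - y| < d -> `|f x - f y| < e.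
Proof.
move=> fc e0; pose P := phase_space R 1; pose k : 'I_1 * bool := (ord0, true).
pose F (z : P) : P := (0, \col_i f (pc k z)).
have pcF l z : pc l (F z) = if l.2 then f (pc k z) else 0.
  by case: l => j []; rewrite /pc /= mxE.
have Fc : continuous F.
  apply: cont_phase => l; under eq_fun do rewrite pcF.
  case: l.2; last exact: cont_cst.
  apply: (@cont_comp _ _ _ f (fun z : P => pc k z)) => //.
  by apply: cont_pc => z; exact: cvg_id.
have [d d0 dP] := pball_unif C Fc e0; exists d => // x y xC yC xy.
pose emb (s : R) : P := (0, \col_i s).
have pce l s : pc l (emb s) = if l.2 then s else 0.
  by case: l => j []; rewrite /pc /= mxE.
have norm_emb (s b : R) : `|s| <= b -> `|emb s| <= b.
  move=> sb; apply: phase_norm_le => [|l]; first exact: le_trans sb.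
  by rewrite pce; case: l.2 => //; rewrite normr0; exact: le_trans sb.
have embB : emb x - emb y = emb (x - y).
  by apply: pc_inj => l; rewrite pcB !pce; case: l.2; rewrite ?subrr.
have := dP (emb x) (emb y) (norm_emb _ _ xC) (norm_emb _ _ yC).
rewrite embB => /(_ (le_lt_trans (norm_emb _ _ (lexx _)) xy)).
apply: le_lt_trans; rewrite -[leLHS](_ : `|pc k (F (emb x) - F (emb y))| = _).
  exact: pc_le_norm.
by rewrite pcB !pcF /= !pce.
Qed.

Section Profile.
Local Lemma margin (R : realType) (x y d : R) : x - y < d -> x + d <= y + 2 * d.
Proof. lra. Qed.

Local Lemma total (R : realType) (a b c d e : R) :
  a <= b + c -> 4 * c = e -> d = 4 * b -> 4 * a <= d + e.
Proof. lra. Qed.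

Variables (R : realType) (p M : R).
Hypotheses (p_gt2 : 2 < p) (M_gt0 : 0 < M).
Let p1 : 1 < p. Proof. by apply: lt_trans p_gt2; rewrite ltr1n. Qed.
Let p0 := p_gt0 p1.

(* A smooth majorant of the graph function [theta p (M s)] of the planar projection;
   away from the zeros of the absolute value it is built from powers of positive
   functions. *)
Definition bump (k eps dl s : R) : R :=
  `|k - `|M ^+ 2 * s ^+ 2 + eps| `^ (p / 2)| `^ p^-1 + dl.

Lemma cont_bump k eps dl : continuous (bump k eps dl).
Proof.
apply: contD; last exact: cont_cst.
apply: (@cont_comp R R R (fun s => `|s| `^ p^-1)); last by apply: cont_powR; rewrite invr_gt0.
apply: contB; first exact: cont_cst.
apply: (@cont_comp R R R (fun s => `|s| `^ (p / 2))); last by apply: cont_powR; rewrite divr_gt0.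
apply: contD; last exact: cont_cst.
by apply: contM; [exact: cont_cst|apply: contX => x; exact: cvg_id].
Qed.

(** With k slightly above 1 the radicand is positive up to the ends of the interval; uniform
    continuity of the two powers keeps the excess over the graph of [theta] as small as required. *)
Lemma bump_exists e : 0 < e -> exists k eps dl, [/\ 0 < eps, 0 < dl,
  forall s, `|M * s| <= 1 -> 0 < k - `|M ^+ 2 * s ^+ 2 + eps| `^ (p / 2),
  forall s, `|M * s| <= 1 -> theta p (M * s) < bump k eps dl s &
  4 * itg 0 M^-1 (bump k eps dl) <= 4 * theta_int p / M + e].
Proof.
move=> e0; have p20 : 0 < p / 2 by rewrite divr_gt0.
have c1 : continuous (fun s : R => `|s| `^ (p / 2)) by exact: cont_powR.
have c2 : continuous (fun s : R => `|s| `^ p^-1) by apply: cont_powR; rewrite invr_gt0.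
(* Four times the integral of [2 * dl] over an interval of length 1/M is [e]. *)
pose dl := e * M / 8; have dl0 : 0 < dl by rewrite divr_gt0// mulr_gt0.
have [d2 d20 f2] := continuous_unif 4 c2 dl0.
pose e1 := Order.min 1 (d2 / 4); have e10 : 0 < e1 by rewrite lt_min ltr01 divr_gt0.
have e11 : e1 <= 1 by rewrite ge_min lexx.
have e1d : e1 <= d2 / 4 by rewrite ge_min lexx orbT.
have [d1 d10 f1] := continuous_unif 2 c1 e10.
pose eps := Order.min 1 (d1 / 2); have eps0 : 0 < eps by rewrite lt_min ltr01 divr_gt0.
have eps1 : eps <= 1 by rewrite ge_min lexx.
have epsd : eps < d1.
  by apply: (@le_lt_trans _ _ (d1 / 2)); [rewrite ge_min lexx orbT|lra].
have x2 (x : R) : `|x| <= 1 -> 0 <= x ^+ 2 <= 1.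
  by move=> x1; rewrite sqr_ge0 /= -(real_normK (num_real x)) expr_le1.
have xp (x : R) : `|x ^+ 2| `^ (p / 2) = `|x| `^ p.
  by rewrite normrX -powR_mulrn// -powRrM mulrC divfK.
have key (x : R) : `|x| <= 1 ->
    `|x| `^ p <= `|x ^+ 2 + eps| `^ (p / 2) /\ `|x ^+ 2 + eps| `^ (p / 2) < `|x| `^ p + e1.
  move=> x1; have /andP[x20 x21] := x2 x x1; rewrite -xp; split.
    apply: powR_pos_mono; [exact: ltW|exact: normr_ge0|].
    by rewrite !ger0_norm ?lerDl ?addr_ge0 ?(ltW eps0).
  have := f1 (x ^+ 2 + eps) (x ^+ 2); rewrite !(ger0_norm x20) ger0_norm ?addr_ge0 ?(ltW eps0)//.
  rewrite (addrAC (x ^+ 2)) subrr add0r ger0_norm ?(ltW eps0)//.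
  have h1 : x ^+ 2 + eps <= 2 by lra.
  have h2 : x ^+ 2 <= 2 by lra.
  by move=> /(_ h1 h2 epsd); rewrite ltr_norml => /andP[_]; lra.
have xp1 (x : R) : `|x| <= 1 -> 0 <= `|x| `^ p <= 1.
  move=> x1; rewrite powR_ge0 /=.
  by have := powR_pos_mono (ltW p0) (normr_ge0 x) x1; rewrite powR1.
have thE (x : R) : `|x| <= 1 -> theta p x = `|1 - `|x| `^ p| `^ p^-1.
  by move=> /xp1/andP[_ h]; rewrite /theta (max_idPl _)// subr_ge0.
exists (1 + e1), eps, dl; split => //.
- move=> s s1; rewrite -exprMn; have [_ h] := key _ s1; have /andP[h1 h2] := xp1 _ s1; lra.
- move=> s s1; rewrite /bump -exprMn (thE _ s1).
  have [_ h] := key _ s1; have /andP[h1 h2] := xp1 _ s1.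
  apply: (@le_lt_trans _ _ (`|1 + e1 - `|(M * s) ^+ 2 + eps| `^ (p / 2)| `^ p^-1)); last first.
    by rewrite ltrDl.
  apply: powR_pos_mono; [by rewrite invr_ge0 ltW|exact: normr_ge0|].
  move: h h1 h2; set u := `|_ + eps| `^ _; set v := `|M * s| `^ p => h h1 h2.
  have a1 : 0 <= 1 + e1 - u by lra.
  have a2 : 0 <= 1 - v by lra.
  rewrite (ger0_norm a1) (ger0_norm a2); lra.
- have upper (s : R) : 0 <= s <= M^-1 -> bump (1 + e1) eps dl s <= theta p (M * s) + 2 * dl.
    move=> /andP[s0 sM].
    have s1 : `|M * s| <= 1.
      by rewrite ger0_norm ?mulr_ge0 ?(ltW M_gt0)// mulrC -ler_pdivlMr// div1r.
    rewrite /bump -exprMn (thE _ s1).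
    have [g h] := key _ s1; have /andP[h1 h2] := xp1 _ s1.
    move: g h h1 h2; set u := `|_ + eps| `^ _; set v := `|M * s| `^ p => g h h1 h2.
    have a1 : 0 <= 1 + e1 - u by lra.
    have a2 : 0 <= 1 - v by lra.
    have := f2 (1 + e1 - u) (1 - v); rewrite (ger0_norm a1) (ger0_norm a2).
    have b1 : 1 + e1 - u <= 4 by lra.
    have b2 : 1 - v <= 4 by lra.
    have b3 : `|1 + e1 - u - (1 - v)| < d2 by rewrite ltr_norml; apply/andP; split; lra.
    by move=> /(_ b1 b2 b3); rewrite ltr_norml => /andP[_]; exact: margin.
  have thc : continuous (fun s => theta p (M * s)).
    apply: (@cont_comp R R R (theta p)); last exact: cont_theta.
    by apply: contM; [exact: cont_cst|move=> x; exact: cvg_id].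
  have Mi0 : 0 <= M^-1 by rewrite invr_ge0 ltW.
  have thE2 : itg 0 M^-1 (fun s => theta p (M * s)) = theta_int p / M.
    have dT (t : R) : is_derive t (1 : R) (fun s => M^-1 * Theta p (M * s)) (theta p (M * t)).
      have dM : is_derive t (1 : R) (fun s : R => M * s) M.
        by have := is_deriveZ M (is_derive_id t (1 : R)); rewrite scaleRE mulr1.
      have := is_deriveZ M^-1 (@is_derive1_comp R (Theta p) (fun s => M * s) t _ _ (Theta_derive p1 (M * t)) dM).
      by move/is_derive_eq; apply; rewrite scaleRE; field; exact: lt0r_neq0.
    apply: (etrans (prim_unique 0 M^-1 thc dT)).
    have T0 : Theta p 0 = 0 by exact: subrr.
    by rewrite mulfV ?lt0r_neq0// mulr0 Theta1 T0 mulr0 subr0 mulrC.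
  have c2d : continuous (fun _ : R => 2 * dl) by exact: cont_cst.
  have bc : continuous (bump (1 + e1) eps dl) by exact: cont_bump.
  have := le_itg Mi0 bc (contD thc c2d) upper.
  rewrite (itgD 0 M^-1 thc c2d) thE2 itg_cst subr0 => hh.
  have ee : 4 * (2 * dl / M) = e by rewrite /dl; field; exact: lt0r_neq0.
  have e4 : 4 * theta_int p / M = 4 * (theta_int p / M) by rewrite mulrA.
  exact: total hh ee e4.
Qed.

End Profile.

(** The map (x, y) |-> (A x, C y) is symplectic when A^T C = 1. Both matrices are rank-one
    perturbations of the identity, inverse to each other up to transposition; the factor [k] keeps
    the denominators from vanishing. *)
Lemma symplectic_completion (R : realType) n (j0 : 'I_n) (u v : 'cV[R]_n) : dotc u v = 1 ->
  exists A C : 'M[R]_n, exists2 k, k != 0 & [/\ A^T *m C = 1%:M,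
    forall x, (A *m x) j0 0 = k * dotc u x & forall y, (C *m y) j0 0 = k^-1 * dotc v y].
Proof.
move=> uv.
have [k [k0 ku kv]] : exists k, [/\ k != 0, k * u j0 0 != 1 & k^-1 * v j0 0 != 1].
  have pos (c : R) : 0 < c -> `|v j0 0| < c -> c != 0 /\ c^-1 * v j0 0 != 1.
    move=> c0 vc; split; first exact: lt0r_neq0.
    apply/eqP => e; have : v j0 0 = c by rewrite -[LHS](mulVKf (lt0r_neq0 c0)) e mulr1.
    by move=> vE; move: vc; rewrite vE gtr0_norm// ltxx.
  have v0 := normr_ge0 (v j0 0).
  (* Both candidates for [k] exceed the modulus of the entry of [v], and at most one of them has
     product 1 with the entry of [u]. *)
  have [||c1 c2] := pos (`|v j0 0| + 1); [by lra|by rewrite ltrDl|].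
  have [||d1 d2] := pos (`|v j0 0| + 2); [by lra|by rewrite ltrDl|].
  have [e|ne] := eqVneq ((`|v j0 0| + 1) * u j0 0) 1; last by exists (`|v j0 0| + 1).
  exists (`|v j0 0| + 2); split => //; apply/eqP => e'.
  have u0 : u j0 0 = 0 by lra.
  by move: e; rewrite u0 mulr0 => /esym/eqP; rewrite oner_eq0.
pose u1 := k *: u; pose v1 := k^-1 *: v.
have uv1 : dotc u1 v1 = 1.
  have -> : dotc u1 v1 = dotc u v.
    by rewrite !dotc_sum; apply: eq_bigr => i _; rewrite !mxE mulrACA mulfV// mul1r.
  exact: uv.
have u1j : u1 j0 0 = k * u j0 0 by rewrite mxE.
have v1j : v1 j0 0 = k^-1 * v j0 0 by rewrite mxE.
have v1n : 1 - v1 j0 0 != 0 by rewrite subr_eq0 eq_sym v1j.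
pose e0 : 'cV[R]_n := \col_i (i == j0)%:R.
have e0j : e0 j0 0 = 1 by rewrite mxE eqxx.
have dot_e0 x : dotc e0 x = x j0 0.
  rewrite dotc_sum (bigD1 j0)//= e0j mul1r big1 ?addr0// => i ij.
  by rewrite mxE (negPf ij) mul0r.
have dotBl (x y z : 'cV[R]_n) : dotc (x - y) z = dotc x z - dotc y z by exact: dotcBl.
(* This choice makes row [j0] of the first matrix [u1] and that of the second [v1]. *)
pose w := e0 - v1; pose f := (1 - v1 j0 0)^-1 *: (u1 - e0).
have fj : f j0 0 = (1 - v1 j0 0)^-1 * (u1 j0 0 - 1) by rewrite /f -e0j !mxE.
have f0 : f j0 0 != 0.
  by rewrite fj mulf_neq0 ?invr_eq0// subr_eq0 u1j.
have wj : w j0 0 = 1 - v1 j0 0 by rewrite /w -e0j !mxE.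
have fv : dotc f v1 = 1.
  by rewrite /f dotcZl dotBl uv1 dot_e0 mulVf.
have wf : dotc w f = f j0 0 - 1 by rewrite /w dotBl dot_e0 (dotcC v1) fv.
pose F := f *m w^T.
have FF : F *m F = (f j0 0 - 1) *: F.
  rewrite /F mulmxA -(mulmxA f) (_ : w^T *m f = (f j0 0 - 1)%:M).
    by rewrite -scalemx1 -scalemxAr mulmx1 scalemxAl.
  by rewrite [LHS]mx11_scalar -dotcE wf.
exists (1%:M + w *m f^T), (1%:M - (f j0 0)^-1 *: F), k => //; split.
- have -> : (1%:M + w *m f^T)^T = 1%:M + F by rewrite linearD /= trmx1 trmx_mul trmxK.
  rewrite mulmxDl mul1mx mulmxBr mulmx1 -scalemxAr FF scalerA.
  move: F {FF} (f j0 0) f0 => X c c0; apply/matrixP => i j; rewrite !mxE; field; exact: c0.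
- move=> x; rewrite mulmxDl mul1mx -mulmxA.
  have -> : f^T *m x = (dotc f x)%:M by rewrite [LHS]mx11_scalar -dotcE.
  rewrite -scalemx1 -scalemxAr mulmx1 mxE [X in _ + X]mxE wj.
  rewrite /f dotcZl dotBl dot_e0 (dotcZl k); field; exact: v1n.
- move=> y; rewrite mulmxBl mul1mx -scalemxAl /F -mulmxA.
  have -> : w^T *m y = (dotc w y)%:M by rewrite [LHS]mx11_scalar -dotcE.
  rewrite -scalemx1 -scalemxAr mulmx1 mxE [X in _ + X]mxE [X in - X]mxE [X in _ * X]mxE.
  rewrite /w dotBl dot_e0 (dotcZl k^-1); move: (f j0 0) f0 (y j0 0) (dotc v y) => c c0 yj vy; field.
  by rewrite ?c0 ?k0.
Qed.

Lemma cos_eq1 (R : realType) (x : R) : `|x| < 2 * pi -> cos x = 1 -> x = 0.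
Proof.
have pos (y : R) : 0 < y -> y < 2 * pi -> cos y = 1 -> False.
  move=> y0 ypi cy.
  have s0 : 0 < sin (y / 2) by apply: sin_gt0_pi; apply/andP; split; lra.
  have e : cos (y / 2 + y / 2) = 1 - 2 * sin (y / 2) ^+ 2.
    by rewrite cosD; have := cos2Dsin2 (y / 2); rewrite !expr2; lra.
  have yy : y / 2 + y / 2 = y by lra.
  have := exprn_gt0 2 s0; rewrite yy cy in e; lra.
move=> xpi cx; apply/eqP; rewrite eq_le !leNgt; apply/andP; split; apply/negP => x0.
  by apply: (pos x) => //; rewrite (gtr0_norm x0) in xpi.
by apply: (pos (- x)); rewrite ?oppr_gt0 ?cosN//; rewrite (ltr0_norm x0) in xpi.
Qed.

(** * A symplectic embedding through action-angle coordinates *)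

Section PolarEmbedding.
Variables (R : realType) (n : nat) (n_gt0 : (0 < n)%N).
Local Notation P := (phase_space R n).
Local Notation j0 := (Ordinal n_gt0).
Variables (u0 v0 : 'cV[R]_n) (A C : 'M[R]_n) (kap : R) (H : R -> R) (a0 : R) (U : set P).
Hypothesis kap0 : kap != 0.
Hypothesis AC : A^T *m C = 1%:M.
Hypothesis A_j0 : forall x, (A *m x) j0 0 = kap * dotc u0 x.
Hypothesis C_j0 : forall y, (C *m y) j0 0 = kap^-1 * dotc v0 y.
Hypothesis H_cont : continuous H.
Hypothesis H_gt0 : forall s, 0 < H s.
Hypothesis U_open : open U.

Definition base_s (z : P) : R := dotc u0 z.1.
Definition base_t (z : P) : R := dotc v0 z.2.
(* Action-angle coordinates: d act /\ d ang = d s /\ d t, and likewise for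
   [polar_x], [polar_y]. *)
Definition polar_act (z : P) : R := pi^-1 * (prim H (base_s z) + a0).
Definition polar_ang (z : P) : R := pi * (base_t z * H (base_s z) `^ (-1) + 1).
Definition polar_rad (z : P) : R := (2 * polar_act z) `^ 2^-1.
Definition polar_x (z : P) : R := polar_rad z * cos (polar_ang z).
Definition polar_y (z : P) : R := polar_rad z * sin (polar_ang z).
Definition polar_embed (z : P) : P :=
  (\col_j (if j == j0 then polar_x z else (A *m z.1) j 0),
   \col_j (if j == j0 then polar_y z else (C *m z.2) j 0)).

Hypothesis H_derivable : forall z, U z -> derivable H (base_s z) 1.
Hypothesis H_term : smooth_term U (fun z => H (base_s z)).
Hypothesis act_gt0 : forall z, U z -> 0 < polar_act z.
Hypothesis ang_in : forall z, U z -> 0 < polar_ang z < 2 * pi.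

Let pi0 : 0 < (pi : R). Proof. exact: pi_gt0. Qed.
Let pi_neq0 : (pi : R) != 0. Proof. exact: lt0r_neq0. Qed.

Let row_term (c : 'rV[R]_n) b : smooth_term U (fun z : P => \sum_i c 0 i * pc (i, b) z).
Proof.
by apply: st_sum => i; exact: (st_mul (st_cst _ _) (st_coord _ _)).
Qed.

Lemma base_s_term : smooth_term U base_s.
Proof.
by apply: st_ext (row_term u0^T false) _ => z _; rewrite /base_s dotc_sum; apply: eq_bigr => i _; rewrite mxE.
Qed.

Let t_term : smooth_term U base_t.
Proof.
by apply: st_ext (row_term v0^T true) _ => z _; rewrite /base_t dotc_sum; apply: eq_bigr => i _; rewrite mxE.
Qed.

Let act_term : smooth_term U polar_act.
Proof. exact: (st_mul (st_cst _ _) (st_add (st_prim H_cont base_s_term H_term) (st_cst _ _))). Qed.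

Let ang_term : smooth_term U polar_ang.
Proof.
exact: (st_mul (st_cst _ _) (st_add (st_mul t_term (st_pow (-1) H_term (fun z _ => H_gt0 (base_s z)))) (st_cst _ _))).
Qed.

Let rad_term : smooth_term U polar_rad.
Proof.
apply: st_pow; first exact: (st_mul (st_cst _ _) act_term).
by move=> z Uz; rewrite mulr_gt0// act_gt0.
Qed.

Lemma polar_embed_smooth : smooth_on U polar_embed.
Proof.
apply: (smooth_term_on U_open) => -[j [|]].
  have [jj|jj] := eqVneq j j0.
    apply: st_ext (st_mul rad_term (st_sin ang_term)) _ => z _.
    by rewrite /pc /polar_embed /= mxE jj eqxx.
  apply: st_ext (row_term (row j C) true) _ => z _.
  rewrite /pc /polar_embed /= mxE (negPf jj) mxE.
  by apply: eq_bigr => i _; rewrite mxE.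
have [jj|jj] := eqVneq j j0.
  apply: st_ext (st_mul rad_term (st_cos ang_term)) _ => z _.
  by rewrite /pc /polar_embed /= mxE jj eqxx.
apply: st_ext (row_term (row j A) false) _ => z _.
rewrite /pc /polar_embed /= mxE (negPf jj) mxE.
by apply: eq_bigr => i _; rewrite mxE.
Qed.

Let dotc_AC x y : dotc (A *m x) (C *m y) = dotc x y.
Proof. by rewrite dotc_mulmx mulmxA AC mul1mx. Qed.

Let rad_sq z : U z -> 0 < polar_rad z /\ polar_rad z ^+ 2 = 2 * polar_act z.
Proof.
move=> Uz; have a1 : 0 < 2 * polar_act z by rewrite mulr_gt0// act_gt0.
split; first exact: powR_gt0.
by rewrite -powR_mulrn ?powR_ge0// -powRrM mulVf// powRr1// ltW.
Qed.

(** The radius, and the angle in (0, 2 pi), are recovered from the plane coordinates; then s, as the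
    primitive of H is strictly increasing, and t. Invertibility of A and C gives the rest. *)
Lemma polar_embed_inj : set_inj U polar_embed.
Proof.
move=> z w; rewrite !inE => Uz Uw zw.
have [rz rz2] := rad_sq Uz; have [rw rw2] := rad_sq Uw.
have ex : polar_x z = polar_x w.
  by have := congr1 (fun y : P => y.1 j0 0) zw; rewrite !mxE eqxx.
have ey : polar_y z = polar_y w.
  by have := congr1 (fun y : P => y.2 j0 0) zw; rewrite !mxE eqxx.
have sq y : polar_x y ^+ 2 + polar_y y ^+ 2 = polar_rad y ^+ 2.
  rewrite /polar_x /polar_y !exprMn -mulrDr cos2Dsin2; exact: mulr1.
have r2 : polar_rad z ^+ 2 = polar_rad w ^+ 2 by rewrite -!sq ex ey.
have er : polar_rad z = polar_rad w.
  by apply/eqP; rewrite -(eqrXn2 (n := 2)) ?ltW// r2.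
have ea : polar_act z = polar_act w by move: r2; rewrite rz2 rw2; lra.
have ec : cos (polar_ang z) = cos (polar_ang w).
  by apply: (mulfI (lt0r_neq0 rz)); rewrite {2}er; exact: ex.
have es : sin (polar_ang z) = sin (polar_ang w).
  by apply: (mulfI (lt0r_neq0 rz)); rewrite {2}er; exact: ey.
have eang : polar_ang z = polar_ang w.
  apply/eqP; rewrite -subr_eq0; apply/eqP; apply: cos_eq1.
    have /andP[a1 a2] := ang_in Uz; have /andP[b1 b2] := ang_in Uw.
    by rewrite ltr_norml; apply/andP; split; lra.
  by rewrite cosB ec es -!expr2 cos2Dsin2.
have es' : base_s z = base_s w.
  have eW : prim H (base_s z) = prim H (base_s w).
    by apply: (@addIr _ a0); apply: (mulfI (_ : pi^-1 != 0)); [rewrite invr_neq0|exact: ea].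
  have lt_neq (x y : R) : x < y -> prim H x != prim H y.
    move=> xy; have [c _ e] := MVT_is_derive (ltW xy) (prim_derive H_cont).
    by rewrite eq_sym -subr_eq0 e mulf_neq0 ?lt0r_neq0// subr_gt0.
  apply/eqP; apply/negPn/negP; rewrite neq_lt => /orP[/lt_neq|/lt_neq]; rewrite eW eqxx//.
have et' : base_t z = base_t w.
  have := mulfI pi_neq0 eang => /addIr; rewrite es'.
  by apply: mulIf; rewrite powR_inv1 ?ltW// invr_neq0// lt0r_neq0.
have CA : C *m A^T = 1%:M by exact: mulmx1C AC.
have ACt : A *m C^T = 1%:M by have := congr1 trmx CA; rewrite trmx_mul trmxK trmx1.
have CtA : C^T *m A = 1%:M by exact: mulmx1C ACt.
have Ae : A *m z.1 = A *m w.1.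
  apply/colP => j; have [->|jj] := eqVneq j j0; first by rewrite !A_j0 -!/(base_s _) es'.
  by have := congr1 (fun y : P => y.1 j 0) zw; rewrite mxE [X in _ = X]mxE (negPf jj).
have Ce : C *m z.2 = C *m w.2.
  apply/colP => j; have [->|jj] := eqVneq j j0; first by rewrite !C_j0 -!/(base_t _) et'.
  by have := congr1 (fun y : P => y.2 j 0) zw; rewrite mxE [X in _ = X]mxE (negPf jj).
rewrite [z]surjective_pairing [w]surjective_pairing; congr (_, _).
  by rewrite -[z.1]mul1mx -CtA -mulmxA Ae mulmxA CtA mul1mx.
by rewrite -[z.2]mul1mx -(mulmx1C CA) -mulmxA Ce mulmxA (mulmx1C CA) mul1mx.
Qed.

Lemma polar_embed_cylinder z r : U z -> 2 * polar_act z < r ^+ 2 ->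
  cylinder n_gt0 r (polar_embed z).
Proof.
move=> Uz; have [_ <-] := rad_sq Uz.
rewrite /cylinder /= !mxE eqxx /polar_x /polar_y !exprMn -mulrDr cos2Dsin2.
by move=> h; rewrite mulr1.
Qed.

Let row_derive (c : 'rV[R]_n) b z u :
  'D_u (fun z : P => \sum_i c 0 i * pc (i, b) z) z = \sum_i c 0 i * pc (i, b) u.
Proof.
pose g (z : P) := \sum_i c 0 i * pc (i, b) z.
have dg : is_derive (0 : R) (1 : R) (fun s : R => g (z + s *: u)) (g u).
  apply: is_derive_sum_fin => i; apply: is_derive_scale.
  exact: is_derive_pc (is_derive_line z u 0).
have [_ e] := dg; apply: etrans e.
have ef : (fun h : R => h^-1 *: ((g \o shift z) (h *: u) - g z : R^o)) =
    (fun h => h^-1 *: (((fun s => g (z + s *: u)) \o shift 0) (h *: 1) - g (z + 0 *: u) : R^o)).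
  apply/funext => h /=; have -> : h *: (1 : R) = h by exact: mulr1.
  by rewrite scale0r !addr0 [z + _]addrC.
exact: (congr1 (fun k : R -> R => lim (k @ 0^')) ef).
Qed.

Let diff_s z : U z -> differentiable base_s z /\ forall u, 'D_u base_s z = base_s u.
Proof.
move=> Uz; split; first by have [d _] := smooth_term_derive U_open base_s_term; exact: d.
have e : base_s = (fun z : P => \sum_i u0^T 0 i * pc (i, false) z).
  by apply/funext => y; rewrite /base_s dotc_sum; apply: eq_bigr => i _; rewrite mxE.
by move=> u; rewrite {1 2}e row_derive.
Qed.

Let diff_t z : U z -> differentiable base_t z /\ forall u, 'D_u base_t z = base_t u.
Proof.
move=> Uz; split; first by have [d _] := smooth_term_derive U_open t_term; exact: d.
have e : base_t = (fun z : P => \sum_i v0^T 0 i * pc (i, true) z).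
  by apply/funext => y; rewrite /base_t dotc_sum; apply: eq_bigr => i _; rewrite mxE.
by move=> u; rewrite {1 2}e row_derive.
Qed.

Let diff_act z : U z -> differentiable polar_act z /\
  forall u, 'D_u polar_act z = pi^-1 * (H (base_s z) * base_s u).
Proof.
move=> Uz; have [ds Ds] := diff_s Uz.
split; first by have [d _] := smooth_term_derive U_open act_term; exact: d.
have dh : is_derive (base_s z) (1 : R) (fun s => pi^-1 * (prim H s + a0)) (pi^-1 * H (base_s z)).
  have := is_derive_scale pi^-1 (is_deriveD (prim_derive H_cont (base_s z)) (is_derive_cst a0 (base_s z) (1 : R))).
  by rewrite addr0.
by move=> u; have [_ ->] := is_derive_chain u ds dh; rewrite Ds mulrA.
Qed.

(** The coefficient [q] may stay unspecified because it cancels in [polar_area]. *)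
Let diff_ang z : U z -> differentiable polar_ang z /\ exists q,
  forall u, 'D_u polar_ang z = pi * (base_t u * (H (base_s z))^-1 + q * base_s u).
Proof.
move=> Uz; have [ds Ds] := diff_s Uz; have [dt Dt] := diff_t Uz.
split; first by have [d _] := smooth_term_derive U_open ang_term; exact: d.
have dH : is_derive (base_s z) (1 : R) H ('D_1 H (base_s z)) by apply: DeriveDef => //; exact: H_derivable.
have dh := @is_derive1_comp R (fun s => s `^ (-1)) H (base_s z) _ _
  (is_derive_powR_pos (-1) (H_gt0 (base_s z))) dH.
set q0 := _ * _ in dh.
exists (base_t z * q0) => u.
have [d1 D1] := is_derive_chain u ds dh.
have der_t : derivable base_t z u by exact: diff_derivable.
have der_i : derivable (fun y => H (base_s y) `^ (-1)) z u by exact: diff_derivable.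
have D2 := deriveM der_t der_i.
have der_m : derivable (base_t * (fun y => H (base_s y) `^ (-1))) z u by exact: derivableM.
have D3 := deriveD der_m (derivable_cst (1 : R) z u).
have D4 := deriveZ pi (derivableD der_m (derivable_cst (1 : R) z u)).
rewrite -[LHS]/('D_u (pi \*: (base_t * (fun y => H (base_s y) `^ (-1)) + cst (1 : R))) z).
apply: (etrans D4); rewrite D3 D2 derive_cst addr0 Dt D1 Ds !scaleRE.
rewrite powR_inv1 ?(ltW (H_gt0 _))//; congr (_ * _); ring.
Qed.

Let diff_rad z : U z -> differentiable polar_rad z /\
  forall u, 'D_u polar_rad z = (polar_rad z)^-1 * 'D_u polar_act z.
Proof.
move=> Uz; have [da Da] := diff_act Uz; have a1 := act_gt0 Uz.
have a2 : 0 < 2 * polar_act z by rewrite mulr_gt0.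
split; first by have [d _] := smooth_term_derive U_open rad_term; exact: d.
have d2 : is_derive (polar_act z) (1 : R) (fun s : R => 2 * s) (2 : R).
  by have := is_derive_scale 2 (is_derive_id (polar_act z) (1 : R)); rewrite mulr1.
have dh := @is_derive1_comp R (fun s => s `^ 2^-1) (fun s => 2 * s) (polar_act z) _ _
  (is_derive_powR_pos 2^-1 a2) d2.
move=> u; have [_ ->] := is_derive_chain u da dh; congr (_ * _).
have -> : (2^-1 - 1 : R) = - 2^-1 by field.
rewrite powRN /polar_rad mulrAC mulVf ?mul1r//.
Qed.

Let diff_polar (z u : P) : U z ->
  'D_u polar_x z = 'D_u polar_rad z * cos (polar_ang z) - polar_y z * 'D_u polar_ang z /\
  'D_u polar_y z = 'D_u polar_rad z * sin (polar_ang z) + polar_x z * 'D_u polar_ang z.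
Proof.
move=> Uz; have [dr _] := diff_rad Uz; have [da _] := diff_ang Uz.
have [dc Dc] := is_derive_chain u da (is_derive_cos (polar_ang z)).
have [dsn Ds] := is_derive_chain u da (is_derive_sin (polar_ang z)).
have der_r : derivable polar_rad z u by exact: diff_derivable.
have der_c : derivable (fun y => cos (polar_ang y)) z u by exact: diff_derivable.
have der_s : derivable (fun y => sin (polar_ang y)) z u by exact: diff_derivable.
split.
  apply: (etrans (deriveM der_r der_c)); rewrite Dc !scaleRE /polar_y; ring.
apply: (etrans (deriveM der_r der_s)); rewrite Ds !scaleRE /polar_x; ring.
Qed.

Lemma polar_area (z u v : P) : U z ->
  'D_u polar_x z * 'D_v polar_y z - 'D_u polar_y z * 'D_v polar_x z =
  base_s u * base_t v - base_t u * base_s v.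
Proof.
move=> Uz; have [xu yu] := diff_polar u Uz; have [xv yv] := diff_polar v Uz.
have [_ Dr] := diff_rad Uz; have [_ Da] := diff_act Uz; have [_ [q Dg]] := diff_ang Uz.
have [r0 _] := rad_sq Uz; have r_neq0 := lt0r_neq0 r0.
have H_neq0 := lt0r_neq0 (H_gt0 (base_s z)).
have area (a b g h : R) : (a * cos (polar_ang z) - polar_y z * g) * (b * sin (polar_ang z) + polar_x z * h) -
    (a * sin (polar_ang z) + polar_x z * g) * (b * cos (polar_ang z) - polar_y z * h) =
    polar_rad z * (a * h - b * g).
  have cs := cos2Dsin2 (polar_ang z).
  rewrite /polar_x /polar_y -[RHS]mulr1 -cs; ring.
rewrite xu yu xv yv area !Dr !Da !Dg.
move: (polar_rad z) (H (base_s z)) r_neq0 H_neq0 (base_s u) (base_s v) (base_t u) (base_t v).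
move: (pi : R) pi_neq0 => c c0 r h r_neq0 h_neq0 su sv tu tv; field.
by rewrite r_neq0 h_neq0 c0.
Qed.

Lemma polar_embed_symp (z u v : P) : U z ->
  omega ('d polar_embed z u) ('d polar_embed z v) = omega u v.
Proof.
move=> Uz.
have dphi : differentiable polar_embed z by exact: (polar_embed_smooth [::] Uz).
have coord k w : pc k ('d polar_embed z w) = 'D_w (fun y => pc k (polar_embed y)) z.
  have dk : differentiable (@pc R n k) (polar_embed z) by exact: pc_differentiable.
  rewrite -[RHS]/('D_w (pc k \o polar_embed) z) deriveE; last exact: differentiable_comp.
  by rewrite diff_comp//= -[RHS]deriveE// pc_derive.
have near_j (k : 'I_n * bool) w : k.1 != j0 ->
    pc k ('d polar_embed z w) = if k.2 then (C *m w.2) k.1 0 else (A *m w.1) k.1 0.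
  case: k => j [] /= jj; rewrite coord.
    have -> : (fun y => pc (j, true) (polar_embed y)) = (fun y : P => \sum_i row j C 0 i * pc (i, true) y).
      apply/funext => y; rewrite /pc /polar_embed /= mxE (negPf jj) mxE.
      by apply: eq_bigr => i _; rewrite mxE.
    by rewrite row_derive mxE; apply: eq_bigr => i _; rewrite mxE.
  have -> : (fun y => pc (j, false) (polar_embed y)) = (fun y : P => \sum_i row j A 0 i * pc (i, false) y).
    apply/funext => y; rewrite /pc /polar_embed /= mxE (negPf jj) mxE.
    by apply: eq_bigr => i _; rewrite mxE.
  by rewrite row_derive mxE; apply: eq_bigr => i _; rewrite mxE.
have at_x w : pc (j0, false) ('d polar_embed z w) = 'D_w polar_x z.
  by rewrite coord; congr ('D_w _ z); apply/funext => y; rewrite /pc /polar_embed /= mxE eqxx.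
have at_y w : pc (j0, true) ('d polar_embed z w) = 'D_w polar_y z.
  by rewrite coord; congr ('D_w _ z); apply/funext => y; rewrite /pc /polar_embed /= mxE eqxx.
have -> : omega u v = dotc (A *m u.1) (C *m v.2) - dotc (C *m u.2) (A *m v.1).
  rewrite dotc_AC (dotcC (C *m u.2)) dotc_AC (dotcC v.1) !dotc_sum -sumrB.
  by apply: eq_bigr => j _.
rewrite !dotc_sum -sumrB /omega (bigD1 j0)//= [RHS](bigD1 j0)//=; congr (_ + _).
  have := polar_area u v Uz; rewrite -!at_x -!at_y /pc /= => ->.
  rewrite !A_j0 !C_j0 -!/(base_s _) -!/(base_t _); field; exact: kap0.
apply: eq_bigr => j jj.
have := near_j (j, false) u jj; have := near_j (j, true) u jj.
have := near_j (j, false) v jj; have := near_j (j, true) v jj.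
by rewrite /pc /= => -> -> -> ->.
Qed.

Lemma polar_embedding : symplectic_embedding U polar_embed.
Proof.
split; [exact: polar_embed_smooth|exact: polar_embed_inj| |]; last first.
  by move=> z Uz u v; exact: polar_embed_symp.
(* The image of [V] is itself open, by [embed_open]. *)
move=> V V_open VU; exists (polar_embed @` V); last first.
  by rewrite setIidr//; exact: image_subset.
rewrite openE => _ [x Vx <-].
have [e e0 eV] : exists2 e, 0 < e & forall y, `|y - x| < e -> V y.
  have /nbhs_ballP[e /= e0 eV] : nbhs x V by exact: open_nbhs_nbhs.
  by exists e => // y yx; apply: eV; rewrite -ball_normE /= distrC.
have symp : forall z, U z -> forall u v, omega ('d polar_embed z u) ('d polar_embed z v) = omega u v.
  by move=> z Uz u v; exact: polar_embed_symp.
have [d d0 dP] := embed_open U_open polar_embed_smooth polar_embed_inj symp (VU _ Vx) e0.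
have sub : \forall y \near polar_embed x, (polar_embed @` V) y.
  by apply: (near_dist d0) => y /dP[y' [_ y'e <-]]; exists y' => //; exact: eV.
exact: sub.
Qed.

End PolarEmbedding.

Section BumpRegularity.
Variables (R : realType) (p M k eps dl : R).
Hypotheses (p_gt2 : 2 < p) (eps0 : 0 < eps) (dl0 : 0 < dl).
Local Notation H := (bump p M k eps dl).
Let p0 : 0 < p. Proof. by apply: lt_trans p_gt2. Qed.

Lemma bump_gt0 s : 0 < H s.
Proof. by rewrite ltr_wpDl// powR_ge0. Qed.

Lemma bumpN s : H (- s) = H s.
Proof. by rewrite /bump sqrrN. Qed.

Lemma bump_derivable s : 0 < k - `|M ^+ 2 * s ^+ 2 + eps| `^ (p / 2) -> derivable H s 1.
Proof.
move=> ks; have p2 : 1 < p / 2 by rewrite ltr_pdivlMr// mul1r.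
have ds : is_derive s (1 : R) (fun s => M ^+ 2 * s ^+ 2 + eps) (M ^+ 2 * (2 * s)).
  have d2 : is_derive s (1 : R) (fun s : R => s ^+ 2) (2 * s).
    have := is_deriveM (is_derive_id s (1 : R)) (is_derive_id s (1 : R)) => /is_derive_eq d2.
    by under eq_fun do rewrite expr2; apply: d2; rewrite scaleRE; ring.
  by have := is_deriveD (is_derive_scale (M ^+ 2) d2) (is_derive_cst eps s (1 : R)); rewrite addr0.
have d1 := @is_derive1_comp R (fun y => `|y| `^ (p / 2)) _ s _ _
  (is_derive_abs_powR p2 (M ^+ 2 * s ^+ 2 + eps)) ds.
have d2 := is_deriveB (is_derive_cst k s (1 : R)) d1.
have d3 := @is_derive1_comp R (fun y => y `^ p^-1) _ s _ _ (is_derive_powR_pos p^-1 ks) d2.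
have d4 := is_deriveD d3 (is_derive_cst dl s (1 : R)).
have inner_c : continuous (fun s : R => k - `|M ^+ 2 * s ^+ 2 + eps| `^ (p / 2)).
  apply: contB; first exact: cont_cst.
  apply: (@cont_comp R R R (fun s => `|s| `^ (p / 2))); last by apply: cont_powR; rewrite divr_gt0.
  apply: contD; last exact: cont_cst.
  by apply: contM; [exact: cont_cst|apply: contX => x; exact: cvg_id].
have eqn : {near s, (fun s : R => (k - `|M ^+ 2 * s ^+ 2 + eps| `^ (p / 2)) `^ p^-1 + dl) =1 H}.
  near=> y; have y0 : 0 < k - `|M ^+ 2 * y ^+ 2 + eps| `^ (p / 2).
    near: y; apply: (cvgr_gt (k - `|M ^+ 2 * s ^+ 2 + eps| `^ (p / 2))) => //.
    exact: inner_c.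
  by rewrite /bump (gtr0_norm y0).
by have [] := @near_eq_is_derive _ _ _ _ _ _ _ _ eqn d4.
Unshelve. all: by end_near. Qed.

(** On U the absolute values in [bump] are taken of positive numbers, so it agrees there with a
    composition of powers of positive terms. *)
Lemma bump_term n (U : set (phase_space R n)) (f : phase_space R n -> R) :
  smooth_term U f ->
  (forall z, U z -> 0 < k - `|M ^+ 2 * f z ^+ 2 + eps| `^ (p / 2)) ->
  smooth_term U (fun z => H (f z)).
Proof.
move=> sf Uk.
have pos z : 0 < M ^+ 2 * f z ^+ 2 + eps by rewrite ltr_wpDl// mulr_ge0// sqr_ge0.
have s1 : smooth_term U (fun z => M ^+ 2 * (f z * f z) + eps).
  exact: (st_add (st_mul (st_cst _ _) (st_mul sf sf)) (st_cst _ _)).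
have s2 : smooth_term U (fun z => (M ^+ 2 * (f z * f z) + eps) `^ (p / 2)).
  by apply: (st_pow _ s1) => z _; rewrite -expr2.
have s3 := st_add (st_cst U k) (st_opp s2).
have s4 : smooth_term U (fun z => (k - (M ^+ 2 * (f z * f z) + eps) `^ (p / 2)) `^ p^-1).
  by apply: (st_pow _ s3) => z /Uk; rewrite -expr2 gtr0_norm.
apply: st_ext (st_add s4 (st_cst U dl)) _ => z /Uk h.
by rewrite /bump (gtr0_norm h) (gtr0_norm (pos z)) expr2.
Qed.

End BumpRegularity.

(** * Embedding a neighbourhood of K into a cylinder *)

Section CapacityUpper.
Local Lemma between (R : realType) (w x y a : R) :
  0 <= x -> 0 <= y -> a + w = x -> w + y = a -> - a <= w <= a.
Proof. by move=> *; apply/andP; split; lra. Qed.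

Variables (R : realType) (n : nat) (p : R) (B D : 'M[R]_n) (M : R) (ea : 'cV[R]_n).
Hypotheses (p_gt2 : 2 < p) (n_gt0 : (0 < n)%N).
Hypotheses (orthB : orthogonal_mx B) (orthD : orthogonal_mx D).
Local Notation O := (B *m D^T).
Hypothesis ext : extremal p O M ea.
Local Notation P := (phase_space R n).
Local Notation GK := (energy p B D).
Local Notation q := (conj_exp p).
Let p1 : 1 < p. Proof. by apply: lt_trans p_gt2; rewrite ltr1n. Qed.
Let p0 := p_gt0 p1.
Let M0 : 0 < M. Proof. by case: ext. Qed.
Let M_neq0 := lt0r_neq0 M0.
Let eb := ext_b p O M ea.
Let u0 : 'cV[R]_n := M^-1 *: (B^T *m eb).
Let v0 : 'cV[R]_n := D^T *m ea.

Let dotc_uv : dotc u0 v0 = 1.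
Proof.
rewrite /u0 dotcZl dotc_mulmx trmxK /v0 mulmxA (ext_O p_gt2 ext) dotcC dotcZl mulKf//.
by rewrite dotcC dotc_spow ?q_gt1// (psum_ext_b p_gt2 ext).
Qed.

Let pairing_le (x y : 'cV[R]_n) : psum q y = 1 -> `|dotc y x| `^ p <= psum p x.
Proof.
move=> y1; have le1 (z : 'cV[R]_n) : dotc z y <= psum p z `^ p^-1.
  by have := hoelder_le p1 z y; rewrite y1 powR1 mulr1.
have h : `|dotc y x| <= psum p x `^ p^-1.
  rewrite dotcC ler_norml le1 andbT lerNl.
  have -> : - dotc x y = dotc (-1 *: x) y by rewrite dotcZl mulN1r.
  by apply: (le_trans (le1 _)); rewrite psumZ normrN1 powR1 mul1r.
have := powR_pos_mono (ltW p0) (normr_ge0 _) h.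
by rewrite powRKV ?psum_ge0// lt0r_neq0.
Qed.

(** Hoelder's inequality: M s and t are the pairings of B x and D y with unit vectors of l_q. *)
Let K_bound z : GK z <= 1 ->
  `|M * base_s u0 z| <= 1 /\ `|base_t v0 z| <= theta p (M * base_s u0 z).
Proof.
move=> z1.
have hs : `|M * base_s u0 z| `^ p <= psum p (B *m z.1).
  have -> : M * base_s u0 z = dotc eb (B *m z.1).
    by rewrite /base_s /u0 dotcZl mulVKf// dotc_mulmx trmxK.
  exact/pairing_le/(psum_ext_b p_gt2 ext).
have ht : `|base_t v0 z| `^ p <= psum p (D *m z.2).
  have -> : base_t v0 z = dotc ea (D *m z.2) by rewrite /base_t /v0 dotc_mulmx trmxK.
  by apply: pairing_le; case: ext.
have sum1 : `|M * base_s u0 z| `^ p + `|base_t v0 z| `^ p <= 1.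
  exact: le_trans (lerD hs ht) z1.
have t0 := powR_ge0 `|base_t v0 z| p; have s0 := powR_ge0 `|M * base_s u0 z| p.
split.
  rewrite leNgt; apply/negP => lt; have := powR_pos_ltr p0 ler01 lt; rewrite powR1; lra.
have s1 : 0 <= 1 - `|M * base_s u0 z| `^ p by lra.
rewrite leNgt; apply/negP => lt; have := powR_pos_ltr p0 (theta_ge0 _ _) lt.
rewrite /theta (max_idPl _)// powRKV ?normr_ge0 ?lt0r_neq0// ger0_norm//; lra.
Qed.

Theorem capacity_upper r : 0 < r -> 4 * theta_int p / M < pi * r ^+ 2 ->
  embeds_in_cylinder n_gt0 (Kp p B D) r.
Proof.
move=> r0 cr; have pi0 : 0 < (pi : R) by exact: pi_gt0.
pose e := pi * r ^+ 2 - 4 * theta_int p / M.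
have e0 : 0 < e by rewrite subr_gt0.
have e2 : 0 < e / 2 by rewrite divr_gt0.
have [k [eps [dl [eps0 dl0 kpos thH Hint]]]] := bump_exists p_gt2 M0 e2.
pose H := bump p M k eps dl.
have Hc : continuous H by exact: cont_bump.
have H0 s : 0 < H s by exact: bump_gt0.
have HN s : H (- s) = H s by exact: bumpN.
pose A := itg 0 M^-1 H; pose d := e / 8.
have d0 : 0 < d by rewrite divr_gt0.
(* With this constant pi times the action variable is [itg 0 s H + A + d], which lies between d and
   2 A + d on K; twice the upper bound is still below pi r^2. *)
pose a0 := A + d - prim H 0.
have AN : itg (- M^-1) 0 H = A.
  have dN (t : R) : is_derive t (1 : R) (fun s => - prim H (- s)) (H t).
    have d1 := @is_derive1_comp R (prim H) -%R t _ _ (prim_derive Hc (- t)) (is_deriveN (is_derive_id t (1 : R))).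
    have := is_deriveN d1 => /is_derive_eq; apply.
    by rewrite HN mulrN1 opprK.
  rewrite (prim_unique (- M^-1) 0 Hc dN) oppr0 !opprK /A /itg; ring.
have W_bound s : `|M * s| <= 1 -> - A <= itg 0 s H <= A.
  rewrite normrM (gtr0_norm M0) -ler_pdivlMl// mulr1 ler_norml => /andP[s1 s2].
  have pos x y : x <= y -> 0 <= itg x y H by move=> xy; apply: itg_ge0 => // t _; exact: ltW.
  have c1 := pos _ _ s1; have c2 := pos _ _ s2.
  have e1 := itg_cat H (- M^-1) 0 s; have e3 := itg_cat H 0 s M^-1.
  by rewrite AN in e1; exact: between c1 c2 e1 e3.
pose sf := base_s u0 : P -> R; pose tf := base_t v0 : P -> R.
have sfc : continuous sf.
  by apply: cont_dotc; [move=> z; exact: cvg_cst|apply: cont_fst => z; exact: cvg_id].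
have tfc : continuous tf.
  by apply: cont_dotc; [move=> z; exact: cvg_cst|apply: cont_snd => z; exact: cvg_id].
pose act := polar_act u0 H a0 : P -> R; pose ang := polar_ang u0 v0 H : P -> R.
have actc : continuous act.
  apply: contM; first exact: cont_cst.
  apply: contD; last exact: cont_cst.
  by apply: (@cont_comp _ _ _ (prim H) sf) => //; exact: is_derive_continuous (prim_derive Hc).
have angc : continuous ang.
  apply: contM; first exact: cont_cst.
  apply: contD; last exact: cont_cst.
  apply: contM => //.
  have -> : (fun z => H (base_s u0 z) `^ (-1)) = (fun z => (H (sf z))^-1).
    by apply/funext => z; rewrite powR_inv1// ltW.
  apply: cont_inv => [z|]; first exact: lt0r_neq0.
  exact: (@cont_comp _ _ _ H sf).
pose kf (z : P) := k - `|M ^+ 2 * sf z ^+ 2 + eps| `^ (p / 2).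
have kfc : continuous kf.
  apply: contB; first exact: cont_cst.
  apply: (@cont_comp _ _ _ (fun s => `|s| `^ (p / 2)) (fun z => M ^+ 2 * sf z ^+ 2 + eps)); last first.
    by apply: cont_powR; rewrite divr_gt0.
  apply: contD; last exact: cont_cst.
  by apply: contM; [exact: cont_cst|exact: contX].
pose U := [set z : P | 0 < kf z] `&` [set z | 0 < act z] `&` [set z | act z < r ^+ 2 / 2]
  `&` [set z | 0 < ang z] `&` [set z | ang z < 2 * pi].
have opengt (f : P -> R) c : continuous f -> open [set z | c < f z].
  by move=> fc; apply: (@open_comp _ _ f [set x | c < x]); [move=> z _; exact: fc|exact: open_gt].
have openlt (f : P -> R) c : continuous f -> open [set z | f z < c].
  by move=> fc; apply: (@open_comp _ _ f [set x | x < c]); [move=> z _; exact: fc|exact: open_lt].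
have U_open : open U.
  by do ![apply: openI]; [exact: opengt|exact: opengt|exact: openlt|exact: opengt|exact: openlt].
have KU : Kp p B D `<=` U.
  rewrite KpE// => z /= z1; have [s1 t1] := K_bound z1.
  have /andP[w1 w2] := W_bound _ s1.
  have tH := le_lt_trans t1 (thH _ s1).
  have actE : act z = pi^-1 * (itg 0 (sf z) H + A + d).
    by rewrite /act /polar_act /itg /a0; congr (_ * _); rewrite -/sf; ring.
  have [y1 y2] : -1 < tf z * H (sf z) `^ (-1) /\ tf z * H (sf z) `^ (-1) < 1.
    rewrite powR_inv1 ?(ltW (H0 _))//; move: tH; rewrite ltr_norml => /andP[h1 h2].
    by rewrite ltr_pdivlMr// ltr_pdivrMr// mulN1r mul1r.
  split; [split; [split; [split|]|]|] => /=.
  - exact: kpos.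
  - rewrite actE mulr_gt0 ?invr_gt0//; lra.
  - have fin : 2 * A + d < pi * (r ^+ 2 / 2).
      by move: Hint d0; rewrite -/H -/A /d /e; lra.
    rewrite actE ltr_pdivrMl//; apply: le_lt_trans fin; lra.
  - rewrite /ang /polar_ang mulr_gt0//; have := y1; rewrite /tf /sf; lra.
  - rewrite /ang /polar_ang (mulrC 2) ltr_pM2l//; have := y2; rewrite /tf /sf; lra.
have [mA [mC [kap kap0 [AC Aj Cj]]]] := symplectic_completion (Ordinal n_gt0) dotc_uv.
have Uk z : U z -> 0 < kf z by move=> [[[[]]]].
have Uact z : U z -> 0 < act z by move=> [[[[]]]].
have Uang z : U z -> 0 < ang z < 2 * pi by move=> [[_ /= h1] /= h2]; rewrite h1.
have dH z : U z -> derivable H (sf z) 1 by move=> /Uk; exact: bump_derivable.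
have H_term : smooth_term U (fun z => H (sf z)).
  by apply: bump_term => //; exact: base_s_term.
exists U, (polar_embed n_gt0 u0 v0 mA mC H a0); split => //.
  exact: (polar_embedding kap0 AC Aj Cj Hc H0 U_open dH H_term Uact Uang).
move=> _ [z Uz <-].
apply: (polar_embed_cylinder n_gt0 v0 mA mC Uact Uz).
by move: Uz => [[[_ /= h] _] _]; move: h; rewrite /act; lra.
Qed.

End CapacityUpper.

(** * The capacities of K_p(B, D) *)

(** It is one eighth of the integral of the positive function [curve_speed]. *)
Lemma theta_int_gt0 (R : realType) (p : R) : 1 < p -> 0 < theta_int p.
Proof.
move=> p1; have sc : continuous (curve_speed p) by exact: (cont_polar_pow p1).
have pi2 : 0 < 2 * pi :> R by rewrite mulr_gt0 ?pi_gt0.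
have [c _ e] := MVT_is_derive (ltW pi2) (prim_derive sc).
have : 0 < 8 * theta_int p.
  rewrite -(curve_speed_int p1) /itg e mulr_gt0 ?(curve_speed_gt0 p1)//.
  by rewrite subr0.
by rewrite pmulr_rgt0.
Qed.

Section Capacity.
Variables (R : realType) (n : nat) (p : R) (B D : 'M[R]_n) (M : R) (ea : 'cV[R]_n).
Hypotheses (p_gt2 : 2 < p) (n_gt0 : (0 < n)%N).
Hypotheses (orthB : orthogonal_mx B) (orthD : orthogonal_mx D).
Local Notation O := (B *m D^T).
Hypothesis ext : extremal p O M ea.
Let p1 : 1 < p. Proof. by apply: lt_trans p_gt2; rewrite ltr1n. Qed.
Let p0 := p_gt0 p1.
Let M0 : 0 < M. Proof. by case: ext. Qed.

Lemma Kp_cEHZ : is_cEHZ (Kp p B D) (4 * theta_int p / M).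
Proof.
split; last by move=> _ [T [g [cc ->]]]; exact: (action_lower p_gt2 n_gt0 orthB orthD ext).
exists (2 * pi); eexists; split.
  exact: (min_curve_characteristic p_gt2 ext).
by rewrite (min_curve_action p_gt2 ext).
Qed.

Lemma Kp_cZ : cZ n_gt0 (Kp p B D) = (4 * theta_int p / M)%:E.
Proof.
have c0 : 0 < 4 * theta_int p / M by rewrite divr_gt0// mulr_gt0// theta_int_gt0.
apply/eqP; rewrite eq_le; apply/andP; split; last first.
  apply: le_ereal_inf_tmp => _ [r [r0 emb] <-]; rewrite lee_fin.
  exact: (capacity_lower p_gt2 orthB orthD ext r0 emb).
apply/lee_addgt0Pr => e e0; set c := 4 * _ / _ in c0 *.
pose r := Num.sqrt ((c + e) / pi).
have q0 : 0 < (c + e) / pi by apply: divr_gt0; [exact: addr_gt0|exact: pi_gt0].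
have r0 : 0 < r by rewrite sqrtr_gt0.
have r2 : pi * r ^+ 2 = c + e.
  by rewrite sqr_sqrtr ?(ltW q0)// mulrC divfK// lt0r_neq0// pi_gt0.
rewrite -EFinD -r2; apply: ereal_inf_lbound; exists r => //; split => //.
apply: (capacity_upper p_gt2 n_gt0 ext r0).
by rewrite r2 ltrDl.
Qed.

Let K := n%:R `^ (2^-1 - p^-1) : R.
Let n0 : 0 < n%:R :> R. Proof. by rewrite ltr0n. Qed.
Let K0 : 0 < K. Proof. exact: powR_gt0. Qed.
Let orthO : orthogonal_mx O.
Proof.
by rewrite /orthogonal_mx trmx_mul trmxK mulmxA -(mulmxA B) (mulmx1C orthD) mulmx1.
Qed.

(** Taking p-th powers turns the comparison of M with 1/K into that of M^p with n^(1 - p/2), the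
    form in which the norm was estimated. *)
Let pow_MK : (M * K) `^ p = M `^ p * (n%:R `^ (1 - p / 2))^-1.
Proof.
rewrite powRM ?(ltW M0) ?(ltW K0)// /K -powRrM -powRN; congr (_ * _ `^ _).
by field; exact: lt0r_neq0.
Qed.

Lemma MK_ge1 : 1 <= M * K.
Proof.
rewrite leNgt; apply/negP => lt1.
have := powR_pos_ltr p0 (mulr_ge0 (ltW M0) (ltW K0)) lt1; rewrite powR1 pow_MK.
rewrite ltr_pdivrMr ?powR_gt0// mul1r ltNge => /negP; apply.
exact: (opnorm_ge p_gt2 n_gt0 orthO ext).
Qed.

Lemma MK_eq1 : M * K = 1 <-> normalized_hadamard O.
Proof.
split=> [e|Oh].
  apply: (opnorm_min_hadamard p_gt2 n_gt0 orthO ext).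
  have := pow_MK; rewrite e powR1 => /esym/eqP.
  by rewrite -subr_eq0 -[X in _ - X](mulfV (lt0r_neq0 (powR_gt0 (1 - p / 2) n0))) -mulrBl mulf_eq0 invr_eq0
    [X in _ || X]gt_eqF ?powR_gt0// orbF subr_eq0 => /eqP ->.
apply/eqP; rewrite eq_le MK_ge1 andbT leNgt; apply/negP => gt1.
have := powR_pos_ltr p0 ler01 gt1; rewrite powR1 pow_MK.
rewrite ltr_pdivlMr ?powR_gt0// mul1r ltNge => /negP; apply.
(* Enough doublings, since 2^k > k > 1/(p - 2). *)
pose k := Num.bound (p - 2)^-1.
apply: (hadamard_opnorm (k := k) n_gt0 p_gt2 _ Oh ext).
have p20 : 0 < p - 2 by rewrite subr_gt0.
rewrite -ler_pdivrMr// div1r; apply: (@le_trans _ _ k%:R).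
  by apply: ltW; apply: archi_boundP; rewrite invr_ge0 ltW.
by rewrite -natrX ler_nat; apply: ltnW; exact: ltn_expl.
Qed.

End Capacity.

Theorem theorem6 (R : realType) (n : nat) (n_gt0 : (0 < n)%N) (p : R)
    (p_gt2 : 2 < p) (B D : 'M[R]_n)
    (orthB : orthogonal_mx B) (orthD : orthogonal_mx D) :
  exists2 c : R, is_cEHZ (Kp p B D) c &
    [/\ (c0 p <= c%:E)%E,
        c%:E = cZ n_gt0 (Kp p B D),
        (cZ n_gt0 (Kp p B D) <= c0 p * (n%:R `^ (2^-1 - p^-1))%:E)%E
      & cZ n_gt0 (Kp p B D) = (c0 p * (n%:R `^ (2^-1 - p^-1))%:E)%E <->
        normalized_hadamard (B *m D^T)].
Proof.
have p1 : 1 < p by apply: lt_trans p_gt2; rewrite ltr1n.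
have orthO : orthogonal_mx (B *m D^T).
  by rewrite /orthogonal_mx trmx_mul trmxK mulmxA -(mulmxA B) (mulmx1C orthD) mulmx1.
have [M [a ext]] := extremal_exists p_gt2 n_gt0 orthO.
have M0 : 0 < M by case: ext.
have I0 : 0 < 4 * theta_int p by rewrite mulr_gt0// theta_int_gt0.
exists (4 * theta_int p / M); first exact: (Kp_cEHZ p_gt2 n_gt0 orthB orthD ext).
rewrite (Kp_cZ p_gt2 n_gt0 orthB orthD ext) (c0_theta p1) -EFinM.
have MK1 := MK_ge1 p_gt2 n_gt0 orthB orthD ext; have MKH := MK_eq1 p_gt2 n_gt0 orthB orthD ext.
move: MK1 MKH; set K := n%:R `^ _ => MK1 MKH.
split => //.
- by rewrite lee_fin ler_pdivlMr// ler_piMr ?(ltW I0)// (opnorm_le1 p_gt2 orthO ext).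
- rewrite lee_fin ler_pdivrMr// -mulrA ler_peMr ?(ltW I0)//.
  by rewrite mulrC.
- apply: (iff_trans _ MKH); split => [[/eqP]|MK].
    rewrite -subr_eq0 -mulrBr mulf_eq0 gt_eqF//= subr_eq0 => /eqP e.
    by rewrite -e mulfV// gt_eqF.
  suff -> : K = M^-1 by [].
  by apply: (mulfI (lt0r_neq0 M0)); rewrite MK mulfV// lt0r_neq0.
Qed.
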